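(* Let $(X,g(\cdot))$ be a Ricci flow solution on a connected manifold $X$, defined for $t\in[0,T]$, with uniformly bounded curvature and complete time slices. Let $x_0\in X$ be a basepoint and let $d_0$ be the time-zero distance. For some $\alpha>0$, suppose that as $x\to\infty$, $|\mathrm{Rm}(x,0)|=O\big(d_0(x,x_0)^{-2\alpha}\big)$. Suppose that the time-zero distance-like function $\phi$ (see the context) can be chosen to satisfy, for some $B_0\in\mathbb R$, $$\phi^{-1}\,\mathrm{Hess}_{g(0)}(\phi)\ge B_0\,g(0).$$ Then $|\mathrm{Rm}(x,t)|=O\big(d_0(x,x_0)^{-2\alpha}\big)$ uniformly in $t\in[0,T]$.
   Context: Ricci flow: $\partial_tg=-2\mathrm{Ric}(g)$. A time-zero distance-like function is a function $\phi\in C^\infty(X)$ for which there is $C<\infty$ such that, with respect to $g(0)$: $C^{-1}(d_0(x,x_0)+1)\le\phi(x)\le C(d_0(x,x_0)+1)$, $|d\phi|_{g(0)}\le C$, and $\mathrm{Hess}_{g(0)}(\phi)\le C\,g(0)$. (Such $\phi$ always exists for a complete metric of bounded curvature; the additional hypothesis is the lower Hessian bound.) *)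

(* Defs.v *)
From HB Require Import structures.
From mathcomp Require Import all_boot all_order all_algebra.
From mathcomp Require Import all_classical all_reals all_analysis.
Set Implicit Arguments.
Unset Strict Implicit.
Unset Printing Implicit Defensive.
Import Order.TTheory GRing.Theory Num.Theory.
Import numFieldNormedType.Exports.
Local Open Scope classical_set_scope.
Local Open Scope ring_scope.

(* Meant for an open set U: every derivative below is two-sided. *)
Fixpoint Ck (R : realType) (V W : normedModType R) (k : nat)
    (U : set V) (f : V -> W) : Prop :=
  (forall x, U x -> {for x, continuous f}) /\
  (if k is k'.+1 then
     forall v, (forall x, U x -> derivable f x v) /\ Ck k' U (fun x => 'D_v f x)
   else True).

(* Smoothness on an arbitrary subset A: local smooth extendability.  On an open
   set this is C^oo; on a closed interval, or on [0, T] x U with U open, it is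
   smoothness up to the boundary. *)
Definition smooth_on (R : realType) (V W : normedModType R)
    (A : set V) (f : V -> W) : Prop :=
  forall p, A p -> exists (O : set V) (F : V -> W),
    [/\ open O, O p, forall k, Ck k O F & forall q, A q -> O q -> f q = F q].

(* An n-manifold given by a (not necessarily maximal) smooth atlas.  [param i]
   is the inverse of [chart i] on [coords i]; the values of [chart i] off
   [dom i] and of [param i] off [coords i] are junk.  [chart_at] is only a
   choice of a chart around each point, used to evaluate chart-independent
   quantities at a point. *)
Record smooth_manifold (R : realType) (n : nat) := SmoothManifold {
  manifold_sort :> topologicalType;
  atlas : Type;
  dom : atlas -> set manifold_sort;
  chart : atlas -> manifold_sort -> 'rV[R]_n;
  param : atlas -> 'rV[R]_n -> manifold_sort;
  chart_at : manifold_sort -> atlas;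
  coords := fun i => chart i @` dom i;
  manifold_hausdorff : hausdorff_space manifold_sort;
  manifold_second_countable : @second_countable manifold_sort;
  dom_chart_at : forall x, dom (chart_at x) x;
  open_dom : forall i, open (dom i);
  open_coords : forall i, open (coords i);
  chartK : forall i x, dom i x -> param i (chart i x) = x;
  chart_continuous : forall i x, dom i x -> {for x, continuous (chart i)};
  param_continuous : forall i y, coords i y -> {for y, continuous (param i)};
  transition_smooth : forall i j,
    smooth_on (chart i @` (dom i `&` dom j)) (chart j \o param i)
}.

Definition smooth_fun (R : realType) (n : nat) (M : smooth_manifold R n)
    (f : M -> R) : Prop :=
  forall i : atlas M, smooth_on (coords i) (f \o param i).

(* In this section G is the matrix of a metric in a coordinate system. *)

Section Local.
Variables (R : realType) (n : nat).
Implicit Types (G : 'rV[R]_n -> 'M[R]_n) (f : 'rV[R]_n -> R) (x : 'rV[R]_n).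

Definition qform (A : 'M[R]_n) (v : 'rV[R]_n) : R := (v *m A *m v^T) ord0 ord0.

Definition partial (a : 'I_n) f x : R := 'D_(delta_mx ord0 a) f x.

(* Gamma^k_{ij} *)
Definition christoffel G (k i j : 'I_n) x : R :=
  2^-1 * \sum_l invmx (G x) k l *
    (partial i (fun y => G y j l) x + partial j (fun y => G y i l) x
     - partial l (fun y => G y i j) x).

(* R^l_{ijk}, the l-th component of R(d_i, d_j) d_k, where
   R(X, Y) Z = D_X D_Y Z - D_Y D_X Z - D_[X, Y] Z *)
Definition riemann G (l i j k : 'I_n) x : R :=
  partial i (christoffel G l j k) x - partial j (christoffel G l i k) x
  + \sum_m (christoffel G l i m x * christoffel G m j k x
            - christoffel G l j m x * christoffel G m i k x).

(* Ric(Y, Z) = trace of X |-> R(X, Y) Z *)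
Definition ricci G x : 'M[R]_n := \matrix_(j, k) \sum_i riemann G i i j k x.

Definition riemann_norm G x : R :=
  Num.sqrt (\sum_l \sum_l' \sum_i \sum_i' \sum_j \sum_j' \sum_k \sum_k'
    G x l l' * invmx (G x) i i' * invmx (G x) j j' * invmx (G x) k k'
    * riemann G l i j k x * riemann G l' i' j' k' x).

Definition hessian G f x : 'M[R]_n :=
  \matrix_(i, j) (partial i (partial j f) x
                  - \sum_k christoffel G k i j x * partial k f x).

Definition differential_norm G f x : R :=
  Num.sqrt (qform (invmx (G x)) (\row_i partial i f x)).

End Local.

Section Metric.
Variables (R : realType) (n : nat) (M : smooth_manifold R n).

(* A covariant 2-tensor field, as the family of its component matrices in the
   charts; [g i] is relevant on [coords i] only. *)
Definition tensor2 := atlas M -> 'rV[R]_n -> 'M[R]_n.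
Implicit Type g : tensor2.

(* 'J acts on row vectors from the right, whence the form of the
   transformation law. *)
Definition riemannian_metric g : Prop :=
  [/\ forall i a b, smooth_on (coords i) (fun y => g i y a b),
      forall i y, coords i y -> (g i y)^T = g i y,
      forall i y v, coords i y -> v != 0 -> 0 < qform (g i y) v
    & forall i j x, dom i x -> dom j x ->
        let J := 'J (chart j \o param i) (chart i x) in
        g i (chart i x) = J *m g j (chart j x) *m J^T].

Definition Rm_norm g (x : M) : R :=
  let i := chart_at x in riemann_norm (g i) (chart i x).

Definition d_norm g (f : M -> R) (x : M) : R :=
  let i := chart_at x in
  differential_norm (g i) (f \o param i) (chart i x).

(* The matrices of the metric and of Hess_g f at x, both in the chart
   [chart_at x]. *)
Definition metric_at g (x : M) : 'M[R]_n :=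
  let i := chart_at x in g i (chart i x).

Definition hess_at g (f : M -> R) (x : M) : 'M[R]_n :=
  let i := chart_at x in hessian (g i) (f \o param i) (chart i x).

Definition smooth_curve (A : set R) (c : R -> M) : Prop :=
  forall i : atlas M, smooth_on (A `&` c @^-1` dom i) (chart i \o c).

(* Curves are parametrised by [0, 1]; s lists the break points. *)
Definition piecewise_smooth (c : R -> M) : Prop :=
  {within `[0, 1], continuous c} /\
  exists s : seq R, forall a b : R, 0 <= a -> a <= b -> b <= 1 ->
    (forall r, r \in s -> ~~ (a < r < b)) -> smooth_curve `[a, b] c.

(* Junk at the break points and at 0 and 1, a null set for the length. *)
Definition speed g (c : R -> M) (s : R) : R :=
  let i := chart_at (c s) in
  Num.sqrt (qform (g i (chart i (c s))) (derive1 (chart i \o c) s)).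

Definition curve_length g (c : R -> M) : R :=
  Rintegral lebesgue_measure `[0, 1] (speed g c).

Definition dist g (x y : M) : R :=
  inf [set curve_length g c | c in
        [set c | [/\ piecewise_smooth c, c 0 = x & c 1 = y]]].

Definition complete_metric g : Prop :=
  forall u : nat -> M,
    (forall e : R, 0 < e -> exists N, forall p q,
       (N <= p)%N -> (N <= q)%N -> dist g (u p) (u q) < e) ->
    exists x, dist g (u p) x @[p --> \oo] --> 0.

(* The time derivative at t is the limit of difference quotients with s in
   [0, T], hence one-sided at the two ends. *)
Definition ricci_flow (T : R) (g : R -> tensor2) : Prop :=
  [/\ forall t : R, 0 <= t <= T -> riemannian_metric (g t),
      forall i a b,
        smooth_on (`[0, T]%classic `*` coords i)
                  (fun p : R * 'rV[R]_n => g p.1 i p.2 a b)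
    & forall (t : R) i y a b, 0 <= t <= T -> coords i y ->
        (g s i y a b - g t i y a b) / (s - t) @[s --> within `[0, T] t^']
          --> - 2 * ricci (g t i) y a b].

Definition distance_like g (x0 : M) (phi : M -> R) : Prop :=
  smooth_fun phi /\
  exists2 C : R, 0 < C & forall x,
    [/\ C^-1 * (dist g x x0 + 1) <= phi x,
        phi x <= C * (dist g x x0 + 1),
        d_norm g phi x <= C
      & forall v, qform (hess_at g phi x) v <= C * qform (metric_at g x) v].

End Metric.

(* Main.v *)
(** On the orthonormal frame bundle the covariant derivatives of a tensor are
    derivatives of its component functions along the horizontal vector fields
    [D e], and a time derivative [Dt] that preserves orthonormality of the
    frames turns the Ricci flow into an identity between derivations.  There the
    commutation rules of [D] and [Dt] give Bochner-type inequalities for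
    [|Rm|^2] and [|D Rm|^2] by pure algebra.

    Let [phi] be the distance-like function.  Its sublevel sets are compact by
    the Hopf-Rinow theorem, so that the localised quantity
    [t (1 - phi / r)^2 (a + |Rm|^2) |D Rm|^2] attains its maximum; Bernstein's
    trick then yields Shi's estimate [t |D Rm|^2 <= C].  The constant is
    independent of [r], because [|Hess phi|] at time [t] is controlled by
    [phi] at time 0 and by the values of [|D Rm|] before [t], whose bound
    [C / sqrt t] is integrable at [t = 0].  Hence [|d phi|] and
    [phi^-1 |Hess phi|] remain bounded along the flow, which is where the lower
    bound on the initial Hessian enters, and [phi^(4 alpha) |Rm|^2] is a
    subsolution of a linear heat inequality.  The maximum principle, with the
    barrier [e^(mu t) phi^(4 alpha + 1)] at infinity, bounds it by its initial
    values. *)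
Require Import Defs.
From HB Require Import structures.
From mathcomp Require Import all_boot all_order all_algebra ring lra.
From mathcomp Require Import all_classical all_reals all_analysis measurable_realfun.
Set Implicit Arguments.
Unset Strict Implicit.
Unset Printing Implicit Defensive.
Import Order.TTheory GRing.Theory Num.Theory.
Import numFieldNormedType.Exports.
Local Open Scope classical_set_scope.
Local Open Scope ring_scope.


(** * Derivations of the frame bundle and the evolution of curvature *)

(** The bundle is that of all linear frames: over a chart it is an open subset of a vector space, so
    that [D], [E] and [Dt] have explicit components, and orthonormal frames serve only as points of
    evaluation. [Dt] moves the frame by the Ricci endomorphism (Uhlenbeck's trick), which cancels
    the time derivative of the metric in all formulas. The obstacle is a circle: the cut-off in
    Shi's estimate needs a bound of Hess phi at positive times, and such a bound needs Shi's
    estimate. It is closed at the maximum itself. If the localised quantity has its maximum M at (t,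
    x), then, the cut-off being independent of time, |D Rm| at x and at any earlier time s is at
    most a multiple of sqrt (M / s). This bounds Hess phi at (t, x) linearly in sqrt M, and the
    inequality at the maximum takes the form M <= al + be sqrt M with constants independent of the
    radius. *)

Definition derivation (A : comPzRingType) (d : A -> A) :=
  (forall x y, d (x + y) = d x + d y) /\
  (forall x y, d (x * y) = d x * y + x * d y).

Section Derivation.
Variables (A : comPzRingType) (d : A -> A).
Hypothesis hd : derivation d.

Lemma derD x y : d (x + y) = d x + d y. Proof. exact: hd.1. Qed.
Lemma derM x y : d (x * y) = d x * y + x * d y. Proof. exact: hd.2. Qed.
Lemma der0 : d 0 = 0.
Proof. by apply: (addrI (d 0)); rewrite -derD !addr0. Qed.
Lemma derN x : d (- x) = - d x.
Proof. by apply: (addrI (d x)); rewrite -derD !subrr der0. Qed.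
Lemma derB x y : d (x - y) = d x - d y. Proof. by rewrite derD derN. Qed.
Lemma der1 : d 1 = 0.
Proof. by apply: (addrI (d 1)); rewrite addr0 -{3}(mulr1 1) derM mulr1 mul1r. Qed.
Lemma der_nat m : d m%:R = 0.
Proof. by elim: m => [|m IH]; rewrite ?der0 // -natr1 derD IH der1 addr0. Qed.
Lemma der_sum (I : Type) (s : seq I) (P : pred I) (F : I -> A) :
  d (\sum_(i <- s | P i) F i) = \sum_(i <- s | P i) d (F i).
Proof. by elim/big_rec2: _ => [|i x y _ <-]; rewrite ?der0 ?derD. Qed.
Lemma derMl x y : d x = 0 -> d (x * y) = x * d y.
Proof. by move=> h; rewrite derM h mul0r add0r. Qed.

End Derivation.

Lemma sum_delta (A : comPzRingType) (I : finType) (a : I) (F : I -> A) :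
  \sum_c (c == a)%:R * F c = F a.
Proof.
rewrite (bigD1 a) //= eqxx mul1r big1 ?addr0 // => c /negbTE ->.
by rewrite mul0r.
Qed.

Lemma sum_deltar (A : comPzRingType) (I : finType) (a : I) (F : I -> A) :
  \sum_c (a == c)%:R * F c = F a.
Proof. by rewrite -[RHS](sum_delta a F); apply: eq_bigr => c _; rewrite eq_sym. Qed.

(** [A] plays the ring of functions on the bundle of linear frames, [E d c] the vertical field that
    moves the c-th frame vector in the direction of the d-th, [G] and [Gi] the metric and its
    inverse in the frame, [Rm a b c d] the component g(R(e_a, e_b) e_c, e_d), and [s], up to sign,
    the vertical part of the bracket of [Dt] with [D a]. The symmetries of [Rm] and the Bianchi
    identities are not among the fields: they follow from the brackets by means of [fc_indep], the
    independence of the vector fields over [A]. *)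
Record frame_calculus (A : comPzRingType) (n : nat) (D : 'I_n -> A -> A)
    (E : 'I_n -> 'I_n -> A -> A) (Dt : A -> A) (G Gi : 'I_n -> 'I_n -> A)
    (Rm : 'I_n -> 'I_n -> 'I_n -> 'I_n -> A) (s : 'I_n -> 'I_n -> 'I_n -> A) := {
  fc_half : forall x : A, x + x = 0 -> x = 0;
  fc_D : forall a, derivation (D a);
  fc_E : forall d c, derivation (E d c);
  fc_Dt : derivation Dt;
  fc_Gsym : forall a b, G a b = G b a;
  fc_Gisym : forall a b, Gi a b = Gi b a;
  fc_GGi : forall a c, \sum_b G a b * Gi b c = (a == c)%:R;
  fc_DG : forall c a b, D c (G a b) = 0;
  fc_DtG : forall a b, Dt (G a b) = 0;
  fc_DGi : forall c a b, D c (Gi a b) = 0;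
  fc_DtGi : forall a b, Dt (Gi a b) = 0;
  fc_EG : forall d c a b,
    E d c (G a b) = (c == a)%:R * G d b + (c == b)%:R * G a d;
  fc_ED : forall d c a F, E d c (D a F) = D a (E d c F) + (c == a)%:R * D d F;
  fc_EDt : forall d c F, E d c (Dt F) = Dt (E d c F);
  fc_DD : forall a b F, D a (D b F) - D b (D a F) =
    - \sum_c \sum_d (\sum_e Rm a b c e * Gi e d) * E d c F;
  fc_ER : forall h g a b c d, E h g (Rm a b c d) =
    (g == a)%:R * Rm h b c d + (g == b)%:R * Rm a h c d
    + (g == c)%:R * Rm a b h d + (g == d)%:R * Rm a b c h;
  fc_indep : forall al be,
    (forall F, \sum_a al a * D a F + \sum_c \sum_d be c d * E d c F = 0) ->
    (forall a, al a = 0) /\ (forall c d, be c d = 0);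
  fc_DtD : let Ric b c := \sum_a \sum_d Gi a d * Rm a b c d in
    forall a F, Dt (D a F) - D a (Dt F) =
    \sum_h (\sum_e Ric a e * Gi e h) * D h F
    - \sum_c \sum_d (\sum_e s a c e * Gi e d) * E d c F;
  fc_s : let Ric b c := \sum_a \sum_d Gi a d * Rm a b c d in
    forall a d e, s a d e - s d a e = D a (Ric d e) - D d (Ric a e) }.

Section Frame.
Variables (A : comPzRingType) (n : nat) (D : 'I_n -> A -> A)
    (E : 'I_n -> 'I_n -> A -> A) (Dt : A -> A) (G Gi : 'I_n -> 'I_n -> A)
    (Rm : 'I_n -> 'I_n -> 'I_n -> 'I_n -> A) (s : 'I_n -> 'I_n -> 'I_n -> A).
Hypothesis fc : frame_calculus D E Dt G Gi Rm s.

Let hD := fc_D fc.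
Let hE := fc_E fc.
Let hDt := fc_Dt fc.

Definition frame_ric b c := \sum_a \sum_d Gi a d * Rm a b c d.
Definition frame_up a b c d := \sum_e Rm a b c e * Gi e d.
Definition frame_ricup a h := \sum_e frame_ric a e * Gi e h.
Definition frame_sup a c d := \sum_e s a c e * Gi e d.
Definition frame_lap F := \sum_e \sum_f Gi e f * D e (D f F).

Local Notation Ric := frame_ric.
Local Notation Rup := frame_up.
Local Notation Ru := frame_ricup.
Local Notation Su := frame_sup.
Local Notation Lap := frame_lap.

Lemma fc_GiG a c : \sum_b Gi a b * G b c = (a == c)%:R.
Proof.
rewrite eq_sym -(fc_GGi fc); apply: eq_bigr => b _.
by rewrite mulrC (fc_Gsym fc) (fc_Gisym fc).
Qed.

Lemma up_down (T : 'I_n -> A) h : \sum_d (\sum_e T e * Gi e d) * G d h = T h.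
Proof.
under eq_bigr do rewrite mulr_suml.
rewrite exchange_big /=; under eq_bigr => e _.
  under eq_bigr do rewrite -mulrA.
  rewrite -mulr_sumr fc_GiG mulrC; over.
exact: sum_delta.
Qed.

Lemma up_inj (T T' : 'I_n -> A) :
  (forall d, \sum_e T e * Gi e d = \sum_e T' e * Gi e d) -> T =1 T'.
Proof.
move=> h e; rewrite -(up_down T) -(up_down T'); apply: eq_bigr => d _.
by rewrite h.
Qed.

Lemma D_up a (T : 'I_n -> A) d :
  D a (\sum_e T e * Gi e d) = \sum_e D a (T e) * Gi e d.
Proof.
rewrite (der_sum (hD a)); apply: eq_bigr => e _.
by rewrite (derM (hD a)) (fc_DGi fc) mulr0 addr0.
Qed.

Lemma Dt_up (T : 'I_n -> A) d :
  Dt (\sum_e T e * Gi e d) = \sum_e Dt (T e) * Gi e d.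
Proof.
rewrite (der_sum hDt); apply: eq_bigr => e _.
by rewrite (derM hDt) (fc_DtGi fc) mulr0 addr0.
Qed.

(** The vertical field of the endomorphism [m]. The brackets [D a, D b] and [Dt, D a] have vertical
    parts of this form. *)
Definition E_act (m : 'I_n -> 'I_n -> A) (F : A) := \sum_c \sum_d m c d * E d c F.

Lemma E_actD m m' F : E_act (fun c d => m c d + m' c d) F = E_act m F + E_act m' F.
Proof.
rewrite /E_act -big_split; apply: eq_bigr => c _ /=.
by rewrite -big_split; apply: eq_bigr => d _ /=; rewrite mulrDl.
Qed.

Lemma E_actN m F : E_act (fun c d => - m c d) F = - E_act m F.
Proof.
rewrite /E_act -sumrN; apply: eq_bigr => c _.
by rewrite -sumrN; apply: eq_bigr => d _; rewrite mulNr.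
Qed.

Lemma E_act_ext m m' F : (forall c d, m c d = m' c d) -> E_act m F = E_act m' F.
Proof. by move=> h; apply: eq_bigr => c _; apply: eq_bigr => d _; rewrite h. Qed.

Lemma E_act_sum (al : 'I_n -> A) (m : 'I_n -> 'I_n -> 'I_n -> A) F :
  E_act (fun c d => \sum_h al h * m h c d) F = \sum_h al h * E_act (m h) F.
Proof.
rewrite /E_act; under [RHS]eq_bigr do rewrite mulr_sumr.
rewrite [RHS]exchange_big; apply: eq_bigr => c _ /=.
under [RHS]eq_bigr do rewrite mulr_sumr.
rewrite [RHS]exchange_big; apply: eq_bigr => d _ /=.
by rewrite mulr_suml; apply: eq_bigr => h _; rewrite mulrA.
Qed.

Lemma D_E_act a m F :
  D a (E_act m F) = E_act (fun c d => D a (m c d)) F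
    + \sum_c \sum_d m c d * D a (E d c F).
Proof.
rewrite (der_sum (hD a)) -big_split; apply: eq_bigr => c _ /=.
rewrite (der_sum (hD a)) -big_split; apply: eq_bigr => d _ /=.
by rewrite (derM (hD a)).
Qed.

Lemma E_act_D m a F :
  E_act m (D a F) = (\sum_c \sum_d m c d * D a (E d c F)) + \sum_d m a d * D d F.
Proof.
rewrite /E_act; under eq_bigr => c _.
  under eq_bigr do rewrite (fc_ED fc) mulrDr.
  rewrite big_split /=; under [X in _ + X]eq_bigr do rewrite mulrCA.
  rewrite -mulr_sumr; over.
by rewrite big_split /= sum_delta.
Qed.

Lemma D_E_act_comm a m F :
  D a (E_act m F) - E_act m (D a F) =
  E_act (fun c d => D a (m c d)) F - \sum_d m a d * D d F.
Proof. rewrite D_E_act E_act_D. set x := E_act _ _; set y := \sum_c _; set z := \sum_d _. ring. Qed.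

Lemma Dt_E_act_comm m F :
  Dt (E_act m F) - E_act m (Dt F) = E_act (fun c d => Dt (m c d)) F.
Proof.
rewrite /E_act (der_sum hDt) -sumrB; apply: eq_bigr => c _.
rewrite (der_sum hDt) -sumrB; apply: eq_bigr => d _.
by rewrite (derM hDt) (fc_EDt fc); ring.
Qed.

Lemma DD a b F : D a (D b F) - D b (D a F) = - E_act (Rup a b) F.
Proof. exact: (fc_DD fc). Qed.

Lemma DtD a F : Dt (D a F) - D a (Dt F) = \sum_h Ru a h * D h F - E_act (Su a) F.
Proof. exact: (fc_DtD fc). Qed.

Lemma indep al m : (forall F, \sum_a al a * D a F + E_act m F = 0) ->
  (forall a, al a = 0) /\ (forall c d, m c d = 0).
Proof. exact: (fc_indep fc). Qed.

Lemma indepE m : (forall F, E_act m F = 0) -> forall c d, m c d = 0.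
Proof.
move=> h; have [] // := @indep (fun=> 0) m => F.
by rewrite h addr0 big1 // => a _; rewrite mul0r.
Qed.

Lemma E_act_Rm m a b c d : E_act m (Rm a b c d) =
  \sum_h (m a h * Rm h b c d + m b h * Rm a h c d
          + m c h * Rm a b h d + m d h * Rm a b c h).
Proof.
rewrite /E_act exchange_big; apply: eq_bigr => h _ /=.
under eq_bigr do rewrite (fc_ER fc) !mulrDr ![m _ _ * (_%:R * _)]mulrCA.
by rewrite !big_split /= !sum_delta.
Qed.

Lemma E_act_G m a b :
  E_act m (G a b) = \sum_h m a h * G h b + \sum_h m b h * G h a.
Proof.
rewrite /E_act exchange_big -big_split; apply: eq_bigr => h _ /=.
under eq_bigr do rewrite (fc_EG fc) !mulrDr ![m _ _ * (_%:R * _)]mulrCA.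
by rewrite !big_split /= !sum_delta (fc_Gsym fc a).
Qed.

(** The bracket [D a, D b] is skew in a and b; independence of the vertical fields transfers this to
    its coefficients. *)
Lemma Rm_anti12 a b c d : Rm a b c d = - Rm b a c d.
Proof.
suff h c' : forall d', Rup a b c' d' = - Rup b a c' d'.
  apply: (@up_inj (Rm a b c) (fun e => - Rm b a c e)) => e.
  by rewrite [LHS]h -sumrN; apply: eq_bigr => i _; rewrite mulNr.
move=> d'; apply/eqP; rewrite -subr_eq0 opprK; apply/eqP.
apply: (@indepE (fun c d => Rup a b c d + Rup b a c d)) => F.
by rewrite E_actD -[E_act _ _]opprK -DD -[X in _ + X]opprK -DD; ring.
Qed.

(** The bracket [D a, D b] kills the functions [G c d], which are constant along horizontal fields,
    while its vertical part acts on them by the curvature endomorphism: that endomorphism is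
    skew. *)
Lemma Rm_anti34 a b c d : Rm a b c d = - Rm a b d c.
Proof.
have := DD a b (G c d); rewrite !(fc_DG fc) !(der0 (hD _)) subr0 E_act_G !up_down.
by move/eqP; rewrite eq_sym oppr_eq0 addr_eq0 => /eqP.
Qed.

(** Jacobi's identity for [D a], [D b], [D c]: its horizontal part is the first Bianchi identity,
    its vertical part the second. *)
Lemma bianchi_op a b c :
  (forall h, Rup b c a h + Rup c a b h + Rup a b c h = 0) /\
  (forall f g, D a (Rup b c f g) + D b (Rup c a f g) + D c (Rup a b f g) = 0).
Proof.
pose al h := Rup b c a h + Rup c a b h + Rup a b c h.
pose m f g := - (D a (Rup b c f g) + D b (Rup c a f g) + D c (Rup a b f g)).
have [|h1 h2] := @indep al m; last first.
  by split=> // f g; apply/eqP; rewrite -oppr_eq0; apply/eqP; exact: h2.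
move=> F; pose O x y K := D x (D y K) - D y (D x K).
have J x y z : D x (O y z F) - O y z (D x F) =
    E_act (fun f g => - D x (Rup y z f g)) F + \sum_d Rup y z x d * D d F.
  rewrite /O !DD (derN (hD _)) opprK E_actN.
  have := D_E_act_comm x (Rup y z) F.
  by move=> h; rewrite addrC -opprB h opprB addrC.
have -> : E_act m F = E_act (fun f g => - D a (Rup b c f g)) F
   + E_act (fun f g => - D b (Rup c a f g)) F
   + E_act (fun f g => - D c (Rup a b f g)) F.
  by rewrite -!E_actD; apply: E_act_ext => f g; rewrite /m; ring.
have -> : \sum_h al h * D h F = \sum_d Rup b c a d * D d F
   + \sum_d Rup c a b d * D d F + \sum_d Rup a b c d * D d F.
  by rewrite -!big_split; apply: eq_bigr => h _ /=; rewrite /al; ring.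
transitivity ((D a (O b c F) - O b c (D a F)) + (D b (O c a F) - O c a (D b F))
  + (D c (O a b F) - O a b (D c F))); first by rewrite !J; ring.
by rewrite /O !(derB (hD _)); ring.
Qed.

Lemma bianchi1 a b c d : Rm b c a d + Rm c a b d + Rm a b c d = 0.
Proof.
apply: (@up_inj (fun e => Rm b c a e + Rm c a b e + Rm a b c e) (fun=> 0)) => e.
rewrite [RHS]big1 => [|i _]; last by rewrite mul0r.
rewrite -[RHS]((bianchi_op a b c).1 e) -!big_split.
by apply: eq_bigr => i _ /=; rewrite !mulrDl.
Qed.

Lemma bianchi2 a b c d e : D a (Rm b c d e) + D b (Rm c a d e) + D c (Rm a b d e) = 0.
Proof.
apply: (@up_inj (fun e => D a (Rm b c d e) + D b (Rm c a d e) + D c (Rm a b d e))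
   (fun=> 0)) => f.
rewrite [RHS]big1 => [|i _]; last by rewrite mul0r.
rewrite -[RHS]((bianchi_op a b c).2 d f) /Rup !D_up -!big_split.
by apply: eq_bigr => i _ /=; rewrite !mulrDl.
Qed.

(** A signed sum of the four cyclic first Bianchi identities is twice the difference of the two
    sides. *)
Lemma Rm_pair a b c d : Rm a b c d = Rm c d a b.
Proof.
apply/eqP; rewrite -subr_eq0; apply/eqP; apply: (fc_half fc).
have h1 := bianchi1 a b c d; have h2 := bianchi1 b c d a.
have h3 := bianchi1 c d a b; have h4 := bianchi1 d a b c.
transitivity ((Rm b c a d + Rm c a b d + Rm a b c d) + (Rm c d b a + Rm d b c a + Rm b c d a)
  - (Rm d a c b + Rm a c d b + Rm c d a b) - (Rm a b d c + Rm b d a c + Rm d a b c));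
  last by rewrite h1 h2 h3 h4; ring.
rewrite (Rm_anti34 c d b a) (Rm_anti34 b c d a) (Rm_anti12 a c d b) (Rm_anti34 c a d b).
rewrite (Rm_anti34 d a c b) (Rm_anti34 a b d c) (Rm_anti12 b d a c) (Rm_anti34 d b a c).
ring.
Qed.

Lemma Ric_sym a b : Ric a b = Ric b a.
Proof.
rewrite /Ric exchange_big; apply: eq_bigr => c _; apply: eq_bigr => d _.
rewrite (fc_Gisym fc) Rm_pair Rm_anti12 Rm_anti34 opprK.
by [].
Qed.

Lemma D_Ric e b c : D e (Ric b c) = \sum_a \sum_d Gi a d * D e (Rm a b c d).
Proof.
rewrite (der_sum (hD e)); apply: eq_bigr => a _.
rewrite (der_sum (hD e)); apply: eq_bigr => d _.
by rewrite (derMl (hD e)) // (fc_DGi fc).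
Qed.

Definition frame_div b c d := \sum_e \sum_f Gi e f * D e (Rm b f c d).

(** The second Bianchi identity contracted once, after [Rm_pair] has moved the divergence index to
    the second pair. *)
Lemma div_Rm b c d : frame_div b c d = D c (Ric d b) - D d (Ric c b).
Proof.
rewrite /frame_div !D_Ric -sumrB; apply: eq_bigr => e _.
rewrite -sumrB; apply: eq_bigr => f _.
rewrite Rm_pair -mulrBr; congr (_ * _).
have := bianchi2 e c d b f.
rewrite (Rm_anti12 d e) (derN (hD _)).
by move/eqP; rewrite -addrA addr_eq0 opprD opprK => /eqP.
Qed.

(** The bracket [Dt, D a] annihilates [G d e], as in the proof that the curvature endomorphism is
    skew. *)
Lemma s_anti a d e : s a d e = - s a e d.
Proof.
have := DtD a (G d e).
rewrite !(fc_DG fc) (fc_DtG fc) (der0 hDt) (der0 (hD _)) subr0 E_act_G !up_down.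
rewrite big1 => [|h _]; last by rewrite (fc_DG fc) mulr0.
by move/eqP; rewrite sub0r eq_sym oppr_eq0 addr_eq0 => /eqP.
Qed.

(** The difference [u] of the two sides is skew in its last two indices and, by [fc_s], symmetric in
    its first two; exchanging indices around the three places gives u = - u. This is the argument
    for the uniqueness of the Levi-Civita connection. *)
Lemma sE a d e : s a d e = D e (Ric a d) - D d (Ric a e).
Proof.
pose u a d e := s a d e - (D e (Ric a d) - D d (Ric a e)).
apply/eqP; rewrite -subr_eq0 -/(u a d e); apply/eqP; apply: (fc_half fc).
have ua x y z : u x y z = - u x z y by rewrite /u (s_anti x y z); ring.
have us x y z : u x y z = u y x z.
  apply/eqP; rewrite -subr_eq0; apply/eqP.
  have := fc_s fc x y z; rewrite -/(Ric y z) -/(Ric x z) => h.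
  transitivity (s x y z - s y x z - (D x (Ric y z) - D y (Ric x z))).
    by rewrite /u (Ric_sym y x); ring.
  by rewrite h subrr.
by rewrite {2}(us a d e) (ua d a e) (us d e a) (ua e d a) opprK (us e a d) (ua a e d) subrr.
Qed.

(** The double bracket [[Dt, D a], D b], split into its horizontal and its vertical part. *)
Lemma Theta_D a b F :
  (Dt (D a (D b F)) - D a (Dt (D b F))) - D b (Dt (D a F) - D a (Dt F)) =
  \sum_h - (D b (Ru a h) + Su a b h) * D h F
  + E_act (fun c d => D b (Su a c d) - \sum_h Ru a h * Rup h b c d) F.
Proof.
rewrite !DtD (derB (hD _)) (der_sum (hD _)).
under [X in _ - (X - _) = _]eq_bigr do rewrite (derM (hD _)).
rewrite big_split /= E_actD E_actN E_act_sum.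
under [X in _ + (_ - X)]eq_bigr do rewrite -[E_act _ _]opprK -DD mulrN mulrBr.
rewrite sumrN sumrB.
under [X in _ = X + _]eq_bigr do rewrite opprD mulrDl !mulNr.
rewrite big_split /= !sumrN.
have := D_E_act_comm b (Su a) F; move/eqP; rewrite subr_eq => /eqP ->.
by rewrite /Su; ring.
Qed.

(** Jacobi's identity for [Dt], [D a] and [D b], from which independence extracts the vertical
    part. *)
Lemma Dt_Rm a b c d : Dt (Rm a b c d) =
  \sum_h Ru a h * Rm h b c d - \sum_h Ru b h * Rm h a c d
  + D a (s b c d) - D b (s a c d).
Proof.
pose T e := \sum_h Ru a h * Rm h b c e - \sum_h Ru b h * Rm h a c e
  + D a (s b c e) - D b (s a c e).
apply: (@up_inj (fun e => Dt (Rm a b c e)) T) => f.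
have TE : \sum_e T e * Gi e f = \sum_h Ru a h * Rup h b c f
    - \sum_h Ru b h * Rup h a c f + D a (Su b c f) - D b (Su a c f).
  have l (al : 'I_n -> A) x : \sum_h al h * Rup h x c f =
      \sum_e (\sum_h al h * Rm h x c e) * Gi e f.
    under [RHS]eq_bigr do rewrite mulr_suml.
    rewrite [RHS]exchange_big; apply: eq_bigr => h _ /=.
    by rewrite mulr_sumr; apply: eq_bigr => e _; rewrite mulrA.
  rewrite !l /Su !D_up -!sumrB -!big_split -!sumrB.
  by apply: eq_bigr => e _ /=; rewrite /T; ring.
rewrite TE -Dt_up -/(Rup a b c f).
pose m c f := Dt (Rup a b c f) - (\sum_h Ru a h * Rup h b c f
    - \sum_h Ru b h * Rup h a c f + D a (Su b c f) - D b (Su a c f)).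
apply/eqP; rewrite -subr_eq0 -/(m c f); apply/eqP.
pose al h := (D a (Ru b h) + Su b a h) - (D b (Ru a h) + Su a b h).
have [|_ h] := @indep (fun h => - al h) (fun c f => - m c f); last first.
  by apply/eqP; rewrite -oppr_eq0 h.
move=> {c f d T TE} F.
have hL : Dt (D a (D b F) - D b (D a F)) - (D a (D b (Dt F)) - D b (D a (Dt F)))
    = - E_act (fun c d => Dt (Rup a b c d)) F.
  by rewrite !DD (derN hDt) -Dt_E_act_comm; ring.
have hR : Dt (D a (D b F) - D b (D a F)) - (D a (D b (Dt F)) - D b (D a (Dt F)))
   = ((Dt (D a (D b F)) - D a (Dt (D b F))) - D b (Dt (D a F) - D a (Dt F)))
   - ((Dt (D b (D a F)) - D b (Dt (D a F))) - D a (Dt (D b F) - D b (Dt F))).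
  by rewrite (derB hDt) !(derB (hD _)); ring.
rewrite E_actN; have -> : E_act m F = E_act (fun c d => Dt (Rup a b c d)) F
   - E_act (fun c f => \sum_h Ru a h * Rup h b c f) F
   + E_act (fun c f => \sum_h Ru b h * Rup h a c f) F
   - E_act (fun c f => D a (Su b c f)) F + E_act (fun c f => D b (Su a c f)) F.
  by rewrite -!E_actN -!E_actD; apply: E_act_ext => c d; rewrite /m; ring.
move: hR; rewrite hL !Theta_D !E_actD !E_actN => hR.
rewrite !opprD hR !opprK.
have -> : \sum_h - al h * D h F = \sum_h - (D a (Ru b h) + Su b a h) * D h F
   - \sum_h - (D b (Ru a h) + Su a b h) * D h F.
  by rewrite -sumrB; apply: eq_bigr => h _; rewrite /al; ring.
ring.
Qed.

Lemma D_contract a (f : 'I_n -> 'I_n -> A) :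
  D a (\sum_x \sum_y Gi x y * f x y) = \sum_x \sum_y Gi x y * D a (f x y).
Proof.
rewrite (der_sum (hD a)); apply: eq_bigr => x _.
rewrite (der_sum (hD a)); apply: eq_bigr => y _.
by rewrite (derMl (hD a)) // (fc_DGi fc).
Qed.

(** The reaction term of the evolution equation of the curvature, quadratic in [Rm]. *)
Definition evolRm a b c d :=
  \sum_h Ru a h * Rm h b c d - \sum_h Ru b h * Rm h a c d
  - \sum_e \sum_f Gi e f * E_act (Rup e a) (Rm b f c d)
  + \sum_e \sum_f Gi e f * E_act (Rup e b) (Rm a f c d).

(** The second Bianchi identity moves the inner derivative to the first index pair. Commuting the
    outer one with [D a] and [D b] then produces derivatives of the divergence and quadratic
    terms. *)
Lemma Lap_Rm a b c d : Lap (Rm a b c d) =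
  - D a (frame_div b c d) + D b (frame_div a c d)
  + \sum_e \sum_f Gi e f * E_act (Rup e a) (Rm b f c d)
  - \sum_e \sum_f Gi e f * E_act (Rup e b) (Rm a f c d).
Proof.
rewrite /Lap /frame_div !D_contract -sumrN -!big_split -sumrB.
apply: eq_bigr => e _ /=; rewrite -sumrN -!big_split -sumrB.
apply: eq_bigr => f _ /=.
have -> : D f (Rm a b c d) = D b (Rm a f c d) - D a (Rm b f c d).
  have := bianchi2 f a b c d; rewrite (Rm_anti12 f a) (derN (hD _)).
  by move/eqP; rewrite -addrA addr_eq0 opprD opprK addrC => /eqP.
rewrite (derB (hD _)) -[E_act _ (Rm b _ _ _)]opprK -DD.
rewrite -[E_act _ (Rm a _ _ _)]opprK -DD; ring.
Qed.

(** [s x c d] is minus the divergence of [Rm], so that the second derivatives of the Ricci tensor in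
    [Dt_Rm] and in [Lap_Rm] cancel. *)
Lemma heat_Rm a b c d : Dt (Rm a b c d) - Lap (Rm a b c d) = evolRm a b c d.
Proof.
rewrite Dt_Rm Lap_Rm /evolRm.
have h x : s x c d = - frame_div x c d.
  by rewrite sE div_Rm opprB (Ric_sym d) (Ric_sym c).
by rewrite !h !(derN (hD _)); ring.
Qed.

(** The heat operator is commuted past [D e]: [Dt, D e] gives the terms in [Ru] and [Su], and the
    two brackets met inside the Laplacian give the last sum. *)
Lemma heat_D e F : Dt (D e F) - Lap (D e F) =
  D e (Dt F - Lap F) + \sum_h Ru e h * D h F - E_act (Su e) F
  + \sum_f \sum_g Gi f g * (D f (E_act (Rup g e) F) + E_act (Rup f e) (D g F)).
Proof.
rewrite -(addrA (D e _)) -DtD (derB (hD _)).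
have -> : \sum_f \sum_g Gi f g * (D f (E_act (Rup g e) F) + E_act (Rup f e) (D g F))
   = D e (Lap F) - Lap (D e F).
  rewrite /Lap D_contract -sumrB; apply: eq_bigr => f _.
  rewrite -sumrB; apply: eq_bigr => g _; rewrite -mulrBr; congr (_ * _).
  rewrite -[E_act _ F]opprK -DD -[E_act _ (D g F)]opprK -DD.
  by rewrite (derN (hD _)) (derB (hD _)); ring.
ring.
Qed.

(** Bochner's formula for a squared norm whose contraction coefficients [c] are killed by all the
    derivations; it serves |Rm|^2 and |D Rm|^2 alike. *)
Lemma heat_quadratic (K : finType) (c : K -> K -> A) (r : K -> A) :
  (forall i j, c i j = c j i) ->
  (forall e i j, D e (c i j) = 0) -> (forall i j, Dt (c i j) = 0) ->
  let N := \sum_i \sum_j c i j * (r i * r j) in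
  [/\ Dt N - Lap N = (\sum_i \sum_j c i j * (r i * (Dt (r j) - Lap (r j)))) *+ 2
      - (\sum_e \sum_f Gi e f * \sum_i \sum_j c i j * (D e (r i) * D f (r j))) *+ 2
    & forall e, D e N = (\sum_i \sum_j c i j * (r i * D e (r j))) *+ 2].
Proof.
move=> csym cD cDt N.
have sw (u v : K -> A) :
    \sum_i \sum_j c i j * (u i * v j) = \sum_i \sum_j c i j * (v i * u j).
  rewrite exchange_big; apply: eq_bigr => i _; apply: eq_bigr => j _ /=.
  by rewrite csym [u _ * _]mulrC.
have dN d : derivation d -> (forall i j, d (c i j) = 0) ->
    forall u v : K -> A, d (\sum_i \sum_j c i j * (u i * v j)) =
     \sum_i \sum_j c i j * (d (u i) * v j) + \sum_i \sum_j c i j * (u i * d (v j)).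
  move=> hd hc u v; rewrite (der_sum hd) -big_split; apply: eq_bigr => i _ /=.
  rewrite (der_sum hd) -big_split; apply: eq_bigr => j _ /=.
  by rewrite (derMl hd) // (derM hd) mulrDr.
have DN e : D e N = (\sum_i \sum_j c i j * (r i * D e (r j))) *+ 2.
  by rewrite /N (dN _ (hD e)) // sw mulr2n.
split=> //.
have -> : Dt N = (\sum_i \sum_j c i j * (r i * Dt (r j))) *+ 2.
  by rewrite /N (dN _ hDt) // sw mulr2n.
have -> : Lap N = (\sum_i \sum_j c i j * (r i * Lap (r j))) *+ 2 +
   (\sum_e \sum_f Gi e f * \sum_i \sum_j c i j * (D e (r i) * D f (r j))) *+ 2.
  have -> : \sum_i \sum_j c i j * (r i * Lap (r j)) =
     \sum_e \sum_f Gi e f * \sum_i \sum_j c i j * (r i * D e (D f (r j))).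
    rewrite /Lap.
    under [RHS]eq_bigr => e _ do under eq_bigr => f _ do
      (rewrite mulr_sumr; under eq_bigr => i _ do rewrite mulr_sumr).
    rewrite pair_big [RHS]pair_big /=.
    under [RHS]eq_bigr => p _ do rewrite pair_big.
    rewrite [RHS]exchange_big; apply: eq_bigr => -[i j] _ /=.
    rewrite [LHS]mulrA pair_big mulr_sumr; apply: eq_bigr => -[e f] _ /=; ring.
  rewrite /Lap -!mulrnDl -big_split -sumrMnl; apply: eq_bigr => e _ /=.
  rewrite -big_split -sumrMnl; apply: eq_bigr => f _ /=.
  rewrite DN !mulr2n (derD (hD _)) (dN _ (hD e)) //; ring.
have -> : \sum_i \sum_j c i j * (r i * (Dt (r j) - Lap (r j))) =
   \sum_i \sum_j c i j * (r i * Dt (r j)) - \sum_i \sum_j c i j * (r i * Lap (r j)).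
  rewrite -sumrB; apply: eq_bigr => i _; rewrite -sumrB; apply: eq_bigr => j _; ring.
by rewrite mulrnBl opprD addrA.
Qed.

End Frame.

(** * Pointwise bounds in an orthonormal frame *)

Lemma ler_norm_sumc (R : numDomainType) (I : finType) (F : I -> R) c :
  (forall i, `|F i| <= c) -> `|\sum_i F i| <= #|I|%:R * c.
Proof.
move=> h; apply: (le_trans (ler_norm_sum _ _ _)).
apply: (le_trans (ler_sum _ (fun i _ => h i))).
by rewrite sumr_const mulr_natl.
Qed.

Lemma ler_norm_sum_ord (R : numDomainType) n (F : 'I_n -> R) c :
  (forall i, `|F i| <= c) -> `|\sum_i F i| <= n%:R * c.
Proof. by move=> h; have := ler_norm_sumc h; rewrite card_ord. Qed.

Lemma ler_normM (R : numDomainType) (x y a b : R) :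
  `|x| <= a -> `|y| <= b -> `|x * y| <= a * b.
Proof. by move=> h1 h2; rewrite normrM ler_pM. Qed.

Lemma ler_normDD (R : numDomainType) (x y a b : R) :
  `|x| <= a -> `|y| <= b -> `|x + y| <= a + b.
Proof. by move=> h1 h2; apply: (le_trans (ler_normD _ _)); rewrite lerD. Qed.

Lemma ler_normBB (R : numDomainType) (x y a b : R) :
  `|x| <= a -> `|y| <= b -> `|x - y| <= a + b.
Proof. by move=> h1 h2; apply: ler_normDD => //; rewrite normrN. Qed.

Lemma ler_abs_sqrt_sumsq (R : rcfType) (I : finType) (f : I -> R) i :
  `|f i| <= Num.sqrt (\sum_j f j ^+ 2).
Proof.
rewrite -sqrtr_sqr ler_sqrt; last by apply: sumr_ge0 => j _; exact: sqr_ge0.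
by rewrite (bigD1 i) //= lerDl sumr_ge0 // => j _; exact: sqr_ge0.
Qed.

Section Bounds.
Variables (A : comPzRingType) (n : nat) (D : 'I_n -> A -> A)
    (E : 'I_n -> 'I_n -> A -> A) (Dt : A -> A) (G Gi : 'I_n -> 'I_n -> A)
    (Rm : 'I_n -> 'I_n -> 'I_n -> 'I_n -> A) (s : 'I_n -> 'I_n -> 'I_n -> A).
Hypothesis fc : frame_calculus D E Dt G Gi Rm s.
Variables (R : rcfType) (ev : {rmorphism A -> R}).
Hypothesis evGi : forall a b, ev (Gi a b) = (a == b)%:R.

Let hD := fc_D fc.
Local Notation Ric := (frame_ric Gi Rm).
Local Notation Rup := (frame_up Gi Rm).
Local Notation Ru := (frame_ricup Gi Rm).
Local Notation Su := (frame_sup Gi s).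
Local Notation Lap := (frame_lap D Gi).
Local Notation E_act := (E_act E).

Lemma ev_contract (F : 'I_n -> 'I_n -> A) :
  ev (\sum_e \sum_f Gi e f * F e f) = \sum_e ev (F e e).
Proof.
rewrite rmorph_sum; apply: eq_bigr => e _; rewrite rmorph_sum.
by under eq_bigr do rewrite rmorphM /= evGi; rewrite sum_deltar.
Qed.

Lemma ev_up (T : 'I_n -> A) d : ev (\sum_e T e * Gi e d) = ev (T d).
Proof.
rewrite rmorph_sum; under eq_bigr do rewrite rmorphM /= evGi mulrC.
by rewrite sum_delta.
Qed.

Variables k l : R.
Hypothesis hk : forall a b c d, `|ev (Rm a b c d)| <= k.
Hypothesis hl : forall e a b c d, `|ev (D e (Rm a b c d))| <= l.
Local Notation N := (n%:R : R).

Lemma ev_Rup_le a b c d : `|ev (Rup a b c d)| <= k.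
Proof. by rewrite ev_up. Qed.

Lemma ev_D_Rup_le e a b c d : `|ev (D e (Rup a b c d))| <= l.
Proof. by rewrite (D_up fc) ev_up. Qed.

Lemma ev_Ric_le a b : `|ev (Ric a b)| <= N * k.
Proof. by rewrite ev_contract; apply: ler_norm_sum_ord => e. Qed.

Lemma ev_D_Ric_le e a b : `|ev (D e (Ric a b))| <= N * l.
Proof. by rewrite (D_Ric fc) ev_contract; apply: ler_norm_sum_ord => i. Qed.

Lemma ev_Ru_le a b : `|ev (Ru a b)| <= N * k.
Proof. by rewrite ev_up ev_Ric_le. Qed.

Lemma ev_D_Ru_le e a b : `|ev (D e (Ru a b))| <= N * l.
Proof. by rewrite (D_up fc) ev_up ev_D_Ric_le. Qed.

Lemma ev_Su_le a b c : `|ev (Su a b c)| <= N * l + N * l.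
Proof. by rewrite ev_up (sE fc) rmorphB ler_normBB // ev_D_Ric_le. Qed.

(** The factor 4 counts the slots of [Rm] on which the endomorphism [m] acts. *)
Lemma ev_E_act_Rm_le m mu a b c d : (forall c d, `|ev (m c d)| <= mu) ->
  `|ev (E_act m (Rm a b c d))| <= N * (4 * (mu * k)).
Proof.
move=> h; rewrite (E_act_Rm fc) rmorph_sum; apply: ler_norm_sum_ord => i.
have -> : 4 * (mu * k) = mu * k + mu * k + mu * k + mu * k by ring.
by rewrite !rmorphD !rmorphM; do ?apply: ler_normDD; apply: ler_normM.
Qed.

Lemma ev_D_E_act_Rm_le m mu e a b c d : (forall c d, `|ev (m c d)| <= k) ->
  (forall c d, `|ev (D e (m c d))| <= mu) ->
  `|ev (D e (E_act m (Rm a b c d)))| <= N * (4 * (mu * k + k * l)).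
Proof.
move=> h1 h2; rewrite (E_act_Rm fc) (der_sum (hD e)) rmorph_sum.
apply: ler_norm_sum_ord => i.
set x := mu * k + k * l; have -> : 4 * x = x + x + x + x by ring.
rewrite !(derD (hD e)) !(derM (hD e)) !rmorphD !rmorphM /x.
by do 3!(apply: ler_normDD; last by apply: ler_normDD; apply: ler_normM);
   apply: ler_normDD; apply: ler_normM.
Qed.

(** The factor 5 counts the four slots of [Rm] and the index of the derivative. *)
Lemma ev_E_act_D_Rm_le m mu e a b c d : (forall c d, `|ev (m c d)| <= mu) ->
  `|ev (E_act m (D e (Rm a b c d)))| <= N * (5 * (mu * l)).
Proof.
move=> h; rewrite (E_act_D fc).
have -> : \sum_c0 \sum_d0 m c0 d0 * D e (E d0 c0 (Rm a b c d)) =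
  \sum_h (m a h * D e (Rm h b c d) + m b h * D e (Rm a h c d)
          + m c h * D e (Rm a b h d) + m d h * D e (Rm a b c h)).
  rewrite exchange_big; apply: eq_bigr => i _ /=.
  have t (g x : 'I_n) (F : A) : D e ((g == x)%:R * F) = (g == x)%:R * D e F.
    by rewrite (derMl (hD e)) // (der_nat (hD e)).
  under eq_bigr do
    rewrite (fc_ER fc) !(derD (hD e)) !t !mulrDr ![m _ _ * (_%:R * _)]mulrCA.
  by rewrite !big_split /= !sum_delta.
rewrite -big_split rmorph_sum; apply: ler_norm_sum_ord => i /=.
have -> : 5 * (mu * l) = mu * l + mu * l + mu * l + mu * l + mu * l by ring.
by rewrite !rmorphD !rmorphM; do ?apply: ler_normDD; apply: ler_normM.
Qed.

Lemma ev_evolRm_le a b c d : `|ev (evolRm E Gi Rm a b c d)| <= 10 * N ^+ 2 * k ^+ 2.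
Proof.
rewrite /evolRm rmorphD !rmorphB /= !rmorph_sum.
have -> : 10 * N ^+ 2 * k ^+ 2 = N * (N * k * k) + N * (N * k * k)
  + N * (N * (4 * (k * k))) + N * (N * (4 * (k * k))) by ring.
apply: ler_normDD; [apply: ler_normBB; [apply: ler_normBB|]|].
- by apply: ler_norm_sum_ord => h; rewrite rmorphM; apply: ler_normM; rewrite ?ev_Ru_le.
- by apply: ler_norm_sum_ord => h; rewrite rmorphM; apply: ler_normM; rewrite ?ev_Ru_le.
- rewrite -rmorph_sum ev_contract; apply: ler_norm_sum_ord => e.
  by apply: ev_E_act_Rm_le => *; exact: ev_Rup_le.
- rewrite -rmorph_sum ev_contract; apply: ler_norm_sum_ord => e.
  by apply: ev_E_act_Rm_le => *; exact: ev_Rup_le.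
Qed.

Lemma ev_D_evolRm_le e a b c d :
  `|ev (D e (evolRm E Gi Rm a b c d))| <= 20 * N ^+ 2 * (k * l).
Proof.
rewrite /evolRm (derD (hD e)) !(derB (hD e)) !(D_contract fc) !(der_sum (hD e)).
rewrite rmorphD !rmorphB /= !ev_contract !rmorph_sum /=.
have -> : 20 * N ^+ 2 * (k * l) = N * (N * l * k + N * k * l)
  + N * (N * l * k + N * k * l)
  + N * (N * (4 * (l * k + k * l))) + N * (N * (4 * (l * k + k * l))) by ring.
apply: ler_normDD; [apply: ler_normBB; [apply: ler_normBB|]|].
- apply: ler_norm_sum_ord => h; rewrite (derM (hD e)) rmorphD !rmorphM.
  by apply: ler_normDD; apply: ler_normM; rewrite ?ev_Ru_le ?ev_D_Ru_le.
- apply: ler_norm_sum_ord => h; rewrite (derM (hD e)) rmorphD !rmorphM.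
  by apply: ler_normDD; apply: ler_normM; rewrite ?ev_Ru_le ?ev_D_Ru_le.
- apply: ler_norm_sum_ord => f.
  by apply: ev_D_E_act_Rm_le => *; rewrite ?ev_Rup_le ?ev_D_Rup_le.
- apply: ler_norm_sum_ord => f.
  by apply: ev_D_E_act_Rm_le => *; rewrite ?ev_Rup_le ?ev_D_Rup_le.
Qed.

(** 42 = 20 + 1 + 8 + 13, in the order of [heat_D]: the derivative of the reaction term, the Ricci
    term, the term in [Su], and the brackets inside the Laplacian. *)
Lemma ev_heat_D_Rm_le e a b c d :
  `|ev (Dt (D e (Rm a b c d)) - Lap (D e (Rm a b c d)))| <= 42 * N ^+ 2 * (k * l).
Proof.
rewrite (heat_D fc) (heat_Rm fc) rmorphD rmorphB rmorphD ev_contract rmorph_sum /=.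
have -> : 42 * N ^+ 2 * (k * l) = 20 * N ^+ 2 * (k * l) + N * (N * k * l)
  + N * (4 * ((N * l + N * l) * k))
  + N * (N * (4 * (l * k + k * l)) + N * (5 * (k * l))) by ring.
apply: ler_normDD; [apply: ler_normBB; [apply: ler_normDD|]|].
- exact: ev_D_evolRm_le.
- by apply: ler_norm_sum_ord => h; rewrite rmorphM; apply: ler_normM; rewrite ?ev_Ru_le.
- by apply: ev_E_act_Rm_le => *; exact: ev_Su_le.
- apply: ler_norm_sum_ord => f; rewrite rmorphD; apply: ler_normDD.
    by apply: ev_D_E_act_Rm_le => *; rewrite ?ev_Rup_le ?ev_D_Rup_le.
  by apply: ev_E_act_D_Rm_le => *; rewrite ?ev_Rup_le.
Qed.

End Bounds.

(** * Heat inequalities for |Rm|^2 and |D Rm|^2 *)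

Definition idx4 (n : nat) := ('I_n * 'I_n * 'I_n * 'I_n)%type.
Definition idx5 (n : nat) := ('I_n * idx4 n)%type.

Lemma card_idx4 n : #|{: idx4 n}| = (n ^ 4)%N.
Proof. by rewrite !card_prod !card_ord !expnS expn0 muln1 !mulnA. Qed.

Lemma card_idx5 n : #|{: idx5 n}| = (n ^ 5)%N.
Proof. by rewrite card_prod card_idx4 card_ord expnS. Qed.

Section Norms.
Variables (A : comPzRingType) (n : nat) (D : 'I_n -> A -> A)
    (E : 'I_n -> 'I_n -> A -> A) (Dt : A -> A) (G Gi : 'I_n -> 'I_n -> A)
    (Rm : 'I_n -> 'I_n -> 'I_n -> 'I_n -> A) (s : 'I_n -> 'I_n -> 'I_n -> A).

Definition met4 (i j : idx4 n) :=
  Gi i.1.1.1 j.1.1.1 * Gi i.1.1.2 j.1.1.2 * Gi i.1.2 j.1.2 * Gi i.2 j.2.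
Definition met5 (i j : idx5 n) := Gi i.1 j.1 * met4 i.2 j.2.
Definition Rm4 (i : idx4 n) := Rm i.1.1.1 i.1.1.2 i.1.2 i.2.
Definition DRm5 (i : idx5 n) := D i.1 (Rm4 i.2).
Definition normRm := \sum_i \sum_j met4 i j * (Rm4 i * Rm4 j).
Definition normDRm := \sum_i \sum_j met5 i j * (DRm5 i * DRm5 j).

Hypothesis fc : frame_calculus D E Dt G Gi Rm s.
Let hD := fc_D fc.
Let hDt := fc_Dt fc.

Lemma met4C i j : met4 i j = met4 j i.
Proof. by rewrite /met4 !(fc_Gisym fc _ (i.2)) !(fc_Gisym fc i.1.1.1)
  (fc_Gisym fc i.1.1.2) (fc_Gisym fc i.1.2) (fc_Gisym fc i.2). Qed.

Lemma met5C i j : met5 i j = met5 j i.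
Proof. by rewrite /met5 met4C (fc_Gisym fc). Qed.

Lemma D_met4 e i j : D e (met4 i j) = 0.
Proof. by rewrite /met4 !(derM (hD e)) !(fc_DGi fc) !(mul0r, mulr0, addr0). Qed.
Lemma D_met5 e i j : D e (met5 i j) = 0.
Proof. by rewrite /met5 (derM (hD e)) D_met4 (fc_DGi fc) !(mul0r, mulr0, addr0). Qed.
Lemma Dt_met4 i j : Dt (met4 i j) = 0.
Proof. by rewrite /met4 !(derM hDt) !(fc_DtGi fc) !(mul0r, mulr0, addr0). Qed.
Lemma Dt_met5 i j : Dt (met5 i j) = 0.
Proof. by rewrite /met5 (derM hDt) Dt_met4 (fc_DtGi fc) !(mul0r, mulr0, addr0). Qed.

Variables (R : rcfType) (ev : {rmorphism A -> R}).
Hypothesis evGi : forall a b, ev (Gi a b) = (a == b)%:R.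
Local Notation Lap := (frame_lap D Gi).
Local Notation N := (n%:R : R).

Lemma ev_met4 i j : ev (met4 i j) = (i == j)%:R.
Proof.
case: i j => [[[a b] c] d] [[[a' b'] c'] d']; rewrite /met4 !rmorphM /= !evGi.
by rewrite !xpair_eqE -!natrM !mulnb.
Qed.

Lemma ev_met5 i j : ev (met5 i j) = (i == j)%:R.
Proof.
case: i j => [a i] [b j]; rewrite /met5 rmorphM /= evGi ev_met4.
by rewrite xpair_eqE -natrM mulnb.
Qed.

Lemma ev_quad (K : finType) (c : K -> K -> A) (F : K -> K -> A) :
  (forall i j, ev (c i j) = (i == j)%:R) ->
  ev (\sum_i \sum_j c i j * F i j) = \sum_i ev (F i i).
Proof.
move=> h; rewrite rmorph_sum; apply: eq_bigr => i _; rewrite rmorph_sum.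
by under eq_bigr do rewrite rmorphM /= h; rewrite sum_deltar.
Qed.

(** The squared norm of D D Rm at the frame of evaluation, the good term in the evolution of |D
    Rm|^2. *)
Definition ev_hess := \sum_e \sum_i ev (D e (DRm5 i)) ^+ 2.

Lemma ev_normRm : ev normRm = \sum_i ev (Rm4 i) ^+ 2.
Proof. by rewrite (ev_quad _ ev_met4); apply: eq_bigr => i _; rewrite rmorphM. Qed.

Lemma ev_normDRm : ev normDRm = \sum_i ev (DRm5 i) ^+ 2.
Proof. by rewrite (ev_quad _ ev_met5); apply: eq_bigr => i _; rewrite rmorphM. Qed.

Lemma ev_normRm_ge0 : 0 <= ev normRm.
Proof. by rewrite ev_normRm sumr_ge0 // => i _; exact: sqr_ge0. Qed.
Lemma ev_normDRm_ge0 : 0 <= ev normDRm.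
Proof. by rewrite ev_normDRm sumr_ge0 // => i _; exact: sqr_ge0. Qed.
Lemma ev_hess_ge0 : 0 <= ev_hess.
Proof. by rewrite sumr_ge0 // => e _; rewrite sumr_ge0 // => i _; exact: sqr_ge0. Qed.

Let u := Num.sqrt (ev normRm).
Let v := Num.sqrt (ev normDRm).
Let w := Num.sqrt ev_hess.

Lemma ev_Rm_le i : `|ev (Rm4 i)| <= u.
Proof. by rewrite /u ev_normRm; exact: (ler_abs_sqrt_sumsq (fun i => ev (Rm4 i))). Qed.

Lemma ev_DRm_le i : `|ev (DRm5 i)| <= v.
Proof. by rewrite /v ev_normDRm; exact: (ler_abs_sqrt_sumsq (fun i => ev (DRm5 i))). Qed.

Lemma ev_DDRm_le e i : `|ev (D e (DRm5 i))| <= w.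
Proof.
rewrite /w /ev_hess pair_big.
exact: (ler_abs_sqrt_sumsq (fun p : 'I_n * idx5 n => ev (D p.1 (DRm5 p.2))) (e, i)).
Qed.

Let hk a b c d : `|ev (Rm a b c d)| <= u. Proof. exact: (ev_Rm_le (a, b, c, d)). Qed.
Let hl e a b c d : `|ev (D e (Rm a b c d))| <= v.
Proof. exact: (ev_DRm_le (e, (a, b, c, d))). Qed.

(** Bochner's formula yields the term in [normDRm]. The reaction term costs a factor 2 for the
    square, [n ^ 4] for the number of components and 10 N^2 for [evolRm]. *)
Lemma heat_normRm :
  ev (Dt normRm - Lap normRm) <= - 2 * ev normDRm + 20 * N ^+ 6 * u ^+ 3.
Proof.
have [-> _] := heat_quadratic fc Rm4 met4C D_met4 Dt_met4.
rewrite rmorphB !rmorphMn /= (ev_quad _ ev_met4) (ev_contract evGi).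
have -> : \sum_e ev (\sum_i \sum_j met4 i j * (D e (Rm4 i) * D e (Rm4 j))) = ev normDRm.
  rewrite ev_normDRm; transitivity (\sum_e \sum_i ev (D e (Rm4 i)) ^+ 2);
    last by rewrite pair_big; apply: eq_bigr => -[].
  apply: eq_bigr => e _; rewrite (ev_quad _ ev_met4).
  by apply: eq_bigr => i _; rewrite rmorphM.
have e2 (x y : R) : x *+ 2 - y *+ 2 = - 2 * y + 2 * x by ring.
rewrite e2 lerD2l.
have -> : 20 * N ^+ 6 * u ^+ 3 = 2 * ((n ^ 4)%:R * (u * (10 * N ^+ 2 * u ^+ 2))).
  by rewrite natrX; ring.
rewrite ler_pM2l // (le_trans (ler_norm _)) // -card_idx4.
apply: ler_norm_sumc => -[[[a b] c] d]; rewrite rmorphM; apply: ler_normM.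
  exact: ev_Rm_le.
by rewrite /Rm4 /= (heat_Rm fc); apply: (ev_evolRm_le fc).
Qed.

Lemma heat_normDRm :
  ev (Dt normDRm - Lap normDRm) <= - 2 * ev_hess + 84 * N ^+ 7 * u * v ^+ 2.
Proof.
have [-> _] := heat_quadratic fc DRm5 met5C D_met5 Dt_met5.
rewrite rmorphB !rmorphMn /= (ev_quad _ ev_met5) (ev_contract evGi).
have -> : \sum_e ev (\sum_i \sum_j met5 i j * (D e (DRm5 i) * D e (DRm5 j))) = ev_hess.
  apply: eq_bigr => e _; rewrite (ev_quad _ ev_met5).
  by apply: eq_bigr => i _; rewrite rmorphM.
have e2 (x y : R) : x *+ 2 - y *+ 2 = - 2 * y + 2 * x by ring.
rewrite e2 lerD2l.
have -> : 84 * N ^+ 7 * u * v ^+ 2 = 2 * ((n ^ 5)%:R * (v * (42 * N ^+ 2 * (u * v)))).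
  by rewrite natrX; ring.
rewrite ler_pM2l // (le_trans (ler_norm _)) // -card_idx5.
apply: ler_norm_sumc => -[e [[[a b] c] d]]; rewrite rmorphM; apply: ler_normM.
  exact: ev_DRm_le.
by rewrite /DRm5 /Rm4 /=; apply: (ev_heat_D_Rm_le fc).
Qed.

Lemma grad_normRm e : `|ev (D e normRm)| <= 2 * N ^+ 4 * (u * v).
Proof.
have [_ ->] := heat_quadratic fc Rm4 met4C D_met4 Dt_met4.
rewrite rmorphMn /= (ev_quad _ ev_met4) -mulr_natl normrM ger0_norm //.
rewrite -mulrA ler_pM2l // -natrX -card_idx4.
apply: ler_norm_sumc => i; rewrite rmorphM; apply: ler_normM; first exact: ev_Rm_le.
exact: (ev_DRm_le (e, i)).
Qed.

Lemma grad_normDRm e : `|ev (D e normDRm)| <= 2 * N ^+ 5 * (v * w).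
Proof.
have [_ ->] := heat_quadratic fc DRm5 met5C D_met5 Dt_met5.
rewrite rmorphMn /= (ev_quad _ ev_met5) -mulr_natl normrM ger0_norm //.
rewrite -mulrA ler_pM2l // -natrX -card_idx5.
apply: ler_norm_sumc => i; rewrite rmorphM; apply: ler_normM; first exact: ev_DRm_le.
exact: ev_DDRm_le.
Qed.

End Norms.

(** * The Levi-Civita connection as vector fields on the frame bundle *)

Section VectorField.
Variables (A : comPzRingType) (I : finType) (pd : I -> A -> A).
Hypothesis pd_der : forall i, derivation (pd i).
Hypothesis pd_comm : forall i j F, pd i (pd j F) = pd j (pd i F).

Definition vf (v : I -> A) (F : A) := \sum_i v i * pd i F.

Lemma vf_der v : derivation (vf v).
Proof.
split=> x y; rewrite /vf.
  by rewrite -big_split; apply: eq_bigr => i _ /=; rewrite (derD (pd_der i)) mulrDr.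
rewrite mulr_suml mulr_sumr -big_split; apply: eq_bigr => i _ /=.
by rewrite (derM (pd_der i)); ring.
Qed.

(** The second-order terms cancel because the partial derivations commute, so that a bracket of
    vector fields is again a vector field. *)
Lemma vf_comm v w F :
  vf v (vf w F) - vf w (vf v F) = vf (fun i => vf v (w i) - vf w (v i)) F.
Proof.
have h (v' w' : I -> A) : vf v' (vf w' F) =
    \sum_i vf v' (w' i) * pd i F + \sum_i \sum_j v' i * w' j * pd i (pd j F).
  rewrite {1}/vf; under eq_bigr => i _.
    rewrite (der_sum (pd_der i)) mulr_sumr.
    under eq_bigr do rewrite (derM (pd_der i)) mulrDr.
    rewrite big_split /=; over.
  rewrite big_split /=; congr (_ + _).
    rewrite exchange_big; apply: eq_bigr => i _ /=.
    by rewrite /vf mulr_suml; apply: eq_bigr => j _; rewrite mulrA.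
  by apply: eq_bigr => i _; apply: eq_bigr => j _; rewrite mulrA.
rewrite !h opprD addrACA -sumrB [X in _ - X]exchange_big /=.
under [X in _ + (_ - X)]eq_bigr do under eq_bigr do rewrite pd_comm [_ * v _]mulrC.
by rewrite subrr addr0; apply: eq_bigr => i _; rewrite mulrBl.
Qed.

Lemma vf_ext v w F : (forall i, v i = w i) -> vf v F = vf w F.
Proof. by move=> h; apply: eq_bigr => i _; rewrite h. Qed.

Lemma vf_lin (J : finType) (al : J -> A) (v : J -> I -> A) F :
  \sum_h al h * vf (v h) F = vf (fun i => \sum_h al h * v h i) F.
Proof.
rewrite /vf; under eq_bigr do rewrite mulr_sumr.
rewrite exchange_big; apply: eq_bigr => i _ /=.
by rewrite mulr_suml; apply: eq_bigr => h _; rewrite mulrA.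
Qed.

Lemma vfN v F : - vf v F = vf (fun i => - v i) F.
Proof. by rewrite /vf -sumrN; apply: eq_bigr => i _; rewrite mulNr. Qed.

Lemma vfD v w F : vf v F + vf w F = vf (fun i => v i + w i) F.
Proof. by rewrite /vf -big_split; apply: eq_bigr => i _ /=; rewrite mulrDl. Qed.

Lemma vfZ c v F : c * vf v F = vf (fun i => c * v i) F.
Proof. by rewrite /vf mulr_sumr; apply: eq_bigr => i _ /=; rewrite mulrA. Qed.

End VectorField.

(* [None] is the time, [Some (inl k)] the k-th coordinate of the base point and
   [Some (inr (c, k))] the k-th component of the c-th vector of the frame. *)
Definition fidx (n : nat) := option ('I_n + 'I_n * 'I_n)%type.
Definition iT {n} : fidx n := None.
Definition iX {n} (k : 'I_n) : fidx n := Some (inl k).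
Definition iY {n} (c k : 'I_n) : fidx n := Some (inr (c, k)).

Lemma sum_fidx (V : nmodType) n (F : fidx n -> V) :
  \sum_i F i = F iT + \sum_k F (iX k) + \sum_c \sum_k F (iY c k).
Proof.
rewrite -addrA (bigD1 iT) //=; congr (_ + _).
rewrite (reindex_omap (fun i => Some i) id) /=; last by case.
rewrite (eq_bigl xpredT) => [|i]; last by rewrite eqxx.
by rewrite big_sumType /= pair_big; congr (_ + _); apply: eq_bigr => -[].
Qed.

(** * Horizontal, vertical and time fields in coordinates of the frame bundle *)

Section FrameBundle.
Variables (A : comPzRingType) (n : nat).
Variables (pd : fidx n -> A -> A) (z : fidx n -> A).
Variables (g gi yi : 'M[A]_n) (Gam : 'I_n -> 'I_n -> 'I_n -> A).

Local Notation px k := (pd (iX k)).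
Local Notation py c k := (pd (iY c k)).
Definition fy := \matrix_(c, k) z (iY c k).
Local Notation y := fy.

Definition fL (a : 'I_n) (f : 'I_n -> A) := \sum_i y a i * f i.
Definition fGy a b k := fL a (fun i => fL b (fun j => Gam k i j)).
Definition fR l i j k := px i (Gam l j k) - px j (Gam l i k)
  + \sum_m (Gam l i m * Gam m j k - Gam l j m * Gam m i k).
Definition fric j k := \sum_i fR i i j k.
Definition fric_mx := \matrix_(j, k) fric j k.
Definition frho (c k : 'I_n) := (y *m fric_mx *m gi) c k.
Definition fRl i j k l := \sum_m fR m i j k * g m l.

(** The horizontal lift of the a-th frame vector: the base point moves along it and the whole frame
    is carried by parallel transport. *)
Definition VD a (i : fidx n) : A := match i with
  | None => 0 | Some (inl k) => y a k | Some (inr (b, k)) => - fGy a b k end.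
Definition VE d c (i : fidx n) : A := match i with
  | None => 0 | Some (inl _) => 0 | Some (inr (b, k)) => (c == b)%:R * y d k end.
(** Uhlenbeck's trick: each frame vector moves by the Ricci endomorphism, which compensates the
    change of the metric under the flow. *)
Definition VT (i : fidx n) : A := match i with
  | None => 1 | Some (inl _) => 0 | Some (inr (b, k)) => frho b k end.

Definition fD a := vf pd (VD a).
Definition fE d c := vf pd (VE d c).
Definition fDt := vf pd VT.
Definition fG := y *m g *m y^T.
Definition fGi := yi^T *m gi *m yi.
Definition fRm a b c d :=
  fL a (fun i => fL b (fun j => fL c (fun k => fL d (fun l => fRl i j k l)))).
Definition fflat (w : 'I_n -> A) e := \sum_m \sum_l w m * g m l * y e l.
Definition fnabla a (w : 'I_n -> A) k := fD a (w k) + fL a (fun i => \sum_j Gam k i j * w j).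
(** The time derivative of the Christoffel symbols plus the covariant derivative of the Ricci
    endomorphism: up to sign, the vertical component of [Dt, D a] before its index is lowered. *)
Definition fsig a d k := fL a (fun i => fL d (fun j => pd iT (Gam k i j))) + fnabla a (frho d) k.
Definition fs a d e := fflat (fsig a d) e.

Hypothesis half : forall x : A, x + x = 0 -> x = 0.
Hypothesis pd_der : forall i, derivation (pd i).
Hypothesis pd_comm : forall i j F, pd i (pd j F) = pd j (pd i F).
Hypothesis pd_z : forall i j, pd i (z j) = (i == j)%:R.
Hypothesis yyi : y *m yi = 1%:M.
Hypothesis yiy : yi *m y = 1%:M.
Hypothesis ggi : g *m gi = 1%:M.
Hypothesis gig : gi *m g = 1%:M.
Hypothesis g_sym : g^T = g.
Hypothesis g_base : forall c k i j, py c k (g i j) = 0.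
Hypothesis gi_base : forall c k i j, py c k (gi i j) = 0.
Hypothesis Gam_base : forall c k l i j, py c k (Gam l i j) = 0.
Hypothesis Gam_sym : forall k i j, Gam k i j = Gam k j i.
Hypothesis Gam_compat : forall m k l,
  px m (g k l) = \sum_p Gam p m k * g p l + \sum_p Gam p m l * g k p.
Hypothesis flow : forall i j, pd iT (g i j) = - (fric i j + fric i j).

Let dD a : derivation (fD a). Proof. exact: vf_der. Qed.
Let dE d c : derivation (fE d c). Proof. exact: vf_der. Qed.
Let dDt : derivation fDt. Proof. exact: vf_der. Qed.

Lemma vf_z v i : vf pd v (z i) = v i.
Proof.
by rewrite /vf; under eq_bigr do rewrite pd_z mulrC; rewrite sum_delta.
Qed.

Lemma vf_y v c k : vf pd v (y c k) = v (iY c k).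
Proof. by rewrite mxE vf_z. Qed.

Lemma fD_y a c k : fD a (y c k) = - fGy a c k. Proof. exact: vf_y. Qed.
Lemma fE_y d c a k : fE d c (y a k) = (c == a)%:R * y d k. Proof. exact: vf_y. Qed.
Lemma fDt_y c k : fDt (y c k) = frho c k. Proof. exact: vf_y. Qed.

(** Functions of time and base point only, that is, pulled back from space-time. *)
Definition fbase F := forall c k, py c k F = 0.

Lemma fbase_px k F : fbase F -> fbase (px k F).
Proof. by move=> h c l; rewrite pd_comm h (der0 (pd_der _)). Qed.

Lemma fbaseD F F' : fbase F -> fbase F' -> fbase (F + F').
Proof. by move=> h h' c l; rewrite (derD (pd_der _)) h h' addr0. Qed.
Lemma fbaseB F F' : fbase F -> fbase F' -> fbase (F - F').
Proof. by move=> h h' c l; rewrite (derB (pd_der _)) h h' subr0. Qed.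
Lemma fbaseM F F' : fbase F -> fbase F' -> fbase (F * F').
Proof. by move=> h h' c l; rewrite (derM (pd_der _)) h h' mulr0 mul0r addr0. Qed.
Lemma fbase_sum (J : finType) (F : J -> A) : (forall i, fbase (F i)) -> fbase (\sum_i F i).
Proof. by move=> h c l; rewrite (der_sum (pd_der _)) big1 // => i _; exact: h. Qed.

Lemma fbase_R l i j k : fbase (fR l i j k).
Proof.
apply: fbaseD; last by apply: fbase_sum => m; apply: fbaseB; apply: fbaseM.
by apply: fbaseB; apply: fbase_px.
Qed.

Lemma fbase_ric j k : fbase (fric j k).
Proof. by apply: fbase_sum => i; exact: fbase_R. Qed.

Lemma fbase_Rl i j k l : fbase (fRl i j k l).
Proof. by apply: fbase_sum => m; apply: fbaseM => //; exact: fbase_R. Qed.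

Lemma vf_base v F : fbase F -> vf pd v F = v iT * pd iT F + \sum_k v (iX k) * px k F.
Proof.
move=> h; rewrite /vf sum_fidx [X in _ + X]big1 ?addr0 // => c _.
by rewrite big1 // => k _; rewrite h mulr0.
Qed.

Lemma fD_base a F : fbase F -> fD a F = fL a (fun i => px i F).
Proof. by move=> h; rewrite /fD (vf_base _ h) /= mul0r add0r. Qed.
Lemma fE_base d c F : fbase F -> fE d c F = 0.
Proof.
by move=> h; rewrite /fE (vf_base _ h) /= mul0r add0r big1 // => k _; rewrite mul0r.
Qed.
Lemma fDt_base F : fbase F -> fDt F = pd iT F.
Proof.
by move=> h; rewrite /fDt (vf_base _ h) /= mul1r big1 ?addr0 // => k _; rewrite mul0r.
Qed.

Lemma fL_ext a f f' : (forall i, f i = f' i) -> fL a f = fL a f'.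
Proof. by move=> h; apply: eq_bigr => i _; rewrite h. Qed.
Lemma fLD a f f' : fL a (fun i => f i + f' i) = fL a f + fL a f'.
Proof. by rewrite /fL -big_split; apply: eq_bigr => i _ /=; rewrite mulrDr. Qed.
Lemma fLN a f : fL a (fun i => - f i) = - fL a f.
Proof. by rewrite /fL -sumrN; apply: eq_bigr => i _ /=; rewrite mulrN. Qed.
Lemma fL0 a : fL a (fun=> 0) = 0.
Proof. by rewrite /fL big1 // => i _; rewrite mulr0. Qed.
Lemma fL_sum (J : finType) a f : fL a (fun i => \sum_(j : J) f j i) = \sum_j fL a (f j).
Proof.
rewrite /fL exchange_big; apply: eq_bigr => i _ /=.
by rewrite mulr_sumr.
Qed.
Lemma fLC a b f : fL a (fun i => fL b (fun j => f i j)) = fL b (fun j => fL a (fun i => f i j)).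
Proof.
rewrite /fL; under eq_bigr do rewrite mulr_sumr.
rewrite exchange_big; apply: eq_bigr => j _ /=; rewrite mulr_sumr.
by apply: eq_bigr => i _; rewrite mulrCA.
Qed.
Lemma fLMr a f c : fL a f * c = fL a (fun i => f i * c).
Proof. by rewrite /fL mulr_suml; apply: eq_bigr => i _; rewrite mulrA. Qed.
Lemma fLMl a f c : c * fL a f = fL a (fun i => c * f i).
Proof. by rewrite /fL mulr_sumr; apply: eq_bigr => i _; rewrite mulrCA. Qed.

Lemma fD_L c a f : fD c (fL a f) = fL a (fun i => fD c (f i)) - \sum_i fGy c a i * f i.
Proof.
rewrite (der_sum (dD c)) /fL -sumrB; apply: eq_bigr => i _.
by rewrite (derM (dD c)) fD_y; ring.
Qed.

Lemma fE_L d c a f :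
  fE d c (fL a f) = fL a (fun i => fE d c (f i)) + (c == a)%:R * fL d f.
Proof.
rewrite (der_sum (dE d c)) /fL mulr_sumr -big_split; apply: eq_bigr => i _ /=.
by rewrite (derM (dE d c)) fE_y; ring.
Qed.

Lemma fDt_L a f : fDt (fL a f) = fL a (fun i => fDt (f i)) + \sum_i frho a i * f i.
Proof.
rewrite (der_sum dDt) /fL -big_split; apply: eq_bigr => i _ /=.
by rewrite (derM dDt) fDt_y; ring.
Qed.

Lemma fGyC a b k : fGy a b k = fGy b a k.
Proof.
rewrite /fGy fLC; apply: fL_ext => i; apply: fL_ext => j; exact: Gam_sym.
Qed.

Lemma fGE a b : fG a b = fL a (fun k => fL b (fun l => g k l)).
Proof.
rewrite !mxE /fL; under eq_bigr => l _ do rewrite !mxE mulr_suml.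
rewrite exchange_big; apply: eq_bigr => k _ /=; rewrite mulr_sumr.
by apply: eq_bigr => l _; rewrite !mxE; ring.
Qed.

Lemma fflatE w e : fflat w e = \sum_m w m * fL e (fun l => g m l).
Proof.
apply: eq_bigr => m _; rewrite /fL mulr_sumr; apply: eq_bigr => l _; ring.
Qed.

Lemma fflat_mx w e : fflat w e = (\row_m w m *m g *m y^T) ord0 e.
Proof.
rewrite !mxE /fflat exchange_big; apply: eq_bigr => l _ /=.
by rewrite !mxE mulr_suml; apply: eq_bigr => m _; rewrite !mxE.
Qed.

Lemma fGiG : fGi *m fG = 1%:M.
Proof.
rewrite /fGi /fG !mulmxA -(mulmxA _ yi y) yiy mulmx1 -(mulmxA _ gi g) gig mulmx1.
by rewrite -trmx_mul yyi trmx1.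
Qed.

Lemma fGGi : fG *m fGi = 1%:M.
Proof.
rewrite /fGi /fG !mulmxA -(mulmxA _ y^T) -trmx_mul yiy trmx1 mulmx1.
by rewrite -(mulmxA _ g gi) ggi mulmx1 yyi.
Qed.

Lemma fsharp w d : \sum_e fflat w e * fGi e d = \sum_m w m * yi m d.
Proof.
transitivity ((\row_m w m *m g *m y^T *m fGi) ord0 d).
  by rewrite [RHS]mxE; apply: eq_bigr => e _; rewrite -fflat_mx.
rewrite /fGi !mulmxA -(mulmxA _ y^T) -trmx_mul yiy trmx1 mulmx1.
rewrite -(mulmxA _ g gi) ggi mulmx1 mxE.
by apply: eq_bigr => m _; rewrite mxE.
Qed.

Lemma fflat_sharp w k : \sum_d (\sum_e fflat w e * fGi e d) * y d k = w k.
Proof.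
under eq_bigr do rewrite fsharp.
transitivity ((\row_m w m *m yi *m y) ord0 k).
  rewrite mxE; apply: eq_bigr => d _; congr (_ * _).
  by rewrite mxE; apply: eq_bigr => m _; rewrite mxE.
by rewrite -mulmxA yiy mulmx1 mxE.
Qed.

(** Compatibility of the connection with [g]: the two Christoffel terms in the derivative of [g] are
    what the parallel transport of the two frame vectors takes away. *)
Lemma fD_G c a b : fD c (fG a b) = 0.
Proof.
rewrite fGE fD_L.
under fL_ext => k do rewrite fD_L.
rewrite fLD fLN.
under [in X in X - _]fL_ext => k do under fL_ext => l do
  rewrite (fD_base _ (fun c k => g_base _ _ _ _)).
under [in X in X - _]fL_ext => k do under fL_ext => l do
  (under fL_ext => m do rewrite Gam_compat; rewrite fLD).
under [in X in X - _]fL_ext => k do rewrite fLD.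
rewrite fLD.
set X := \sum_i _; set T := fL a _; set S := fL a _; set Z := fL a _.
suff [-> ->] : T = X /\ S = Z by ring.
split.
  transitivity (fL c (fun m => fL a (fun k => fL b (fun l => \sum_p Gam p m k * g p l)))).
    by rewrite [RHS]fLC; apply: fL_ext => k; rewrite [LHS]fLC.
  rewrite /X /fGy; under eq_bigr => p _ do rewrite fLMr.
  rewrite -fL_sum; apply: fL_ext => m; under eq_bigr => p _ do rewrite fLMr.
  rewrite -fL_sum; apply: fL_ext => k; under eq_bigr => p _ do rewrite fLMl.
  by rewrite -fL_sum.
apply: fL_ext => k; rewrite /fGy; under [RHS]eq_bigr => p _ do rewrite fLMr.
rewrite -fL_sum fLC; apply: fL_ext => m; under eq_bigr => p _ do rewrite fLMr.
by rewrite -fL_sum.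
Qed.

(** The symmetry of the Ricci tensor is read off from the flow equation, the other side of which is
    symmetric. *)
Lemma fric_sym i j : fric i j = fric j i.
Proof.
apply/eqP; rewrite -subr_eq0; apply/eqP; apply: half.
have := flow j i; have -> : g j i = g i j by rewrite -{1}g_sym mxE.
by rewrite flow => /eqP; rewrite eqr_opp -subr_eq0 => /eqP h; rewrite -[RHS]h; ring.
Qed.

Lemma frho_flat c e : fflat (frho c) e = fL c (fun j => fL e (fun l => fric j l)).
Proof.
rewrite fflat_mx; have -> : \row_m frho c m = row c (y *m fric_mx *m gi).
  by apply/rowP => m; rewrite !mxE.
rewrite -row_mul -mulmxA gig mulmx1 -row_mul !mxE /fL.
under eq_bigr => l _ do rewrite !mxE mulr_suml.
rewrite exchange_big; apply: eq_bigr => j _ /=; rewrite mulr_sumr.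
by apply: eq_bigr => l _; rewrite !mxE; ring.
Qed.

Lemma fric_frame b c :
  \sum_a \sum_d fGi a d * fRm a b c d = fL b (fun j => fL c (fun k => fric j k)).
Proof.
have e a d : fRm a b c d = fL b (fun j => fL c (fun k =>
    fL a (fun i => fL d (fun l => fRl i j k l)))).
  by rewrite /fRm fLC; apply: fL_ext => j; rewrite fLC.
under eq_bigr => a _ do under eq_bigr => d _ do rewrite e fLMl.
under eq_bigr => a _ do rewrite -fL_sum.
rewrite -fL_sum; apply: fL_ext => j.
under eq_bigr => a _ do under eq_bigr => d _ do rewrite fLMl.
under eq_bigr => a _ do rewrite -fL_sum.
rewrite -fL_sum; apply: fL_ext => k.
pose M := \matrix_(i, l) fRl i j k l.
have -> : \sum_i \sum_i0 fGi i i0 * fL i (fun i1 => fL i0 (fun l => fRl i1 j k l))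
   = \tr (fGi^T *m (y *m M *m y^T)).
  rewrite /mxtrace [LHS]exchange_big; apply: eq_bigr => a _ /=.
  rewrite [RHS]mxE; apply: eq_bigr => d _; rewrite [fGi^T _ _]mxE; congr (_ * _).
  rewrite /fL [RHS]mxE; under [RHS]eq_bigr => l _ do rewrite !mxE mulr_suml.
  rewrite [RHS]exchange_big; apply: eq_bigr => i _ /=; rewrite mulr_sumr.
  by apply: eq_bigr => l _; rewrite !mxE; ring.
have -> : fGi^T = yi^T *m gi^T *m yi by rewrite /fGi !trmx_mul trmxK mulmxA.
rewrite !mulmxA mxtrace_mulC !mulmxA -trmx_mul yiy trmx1 mul1mx.
rewrite -(mulmxA _ yi) yiy mulmx1.
have -> : M = (\matrix_(i, m) fR m i j k) *m g.
  apply/matrixP => p q; rewrite !mxE /fRl; apply: eq_bigr => m _; by rewrite mxE.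
have -> : gi^T = gi.
  have : (g *m gi)^T = 1%:M by rewrite ggi trmx1.
  rewrite trmx_mul g_sym => h; rewrite -[LHS]mulmx1 -ggi mulmxA h mul1mx; exact: erefl.
rewrite mulmxA mxtrace_mulC mulmxA ggi mul1mx /mxtrace.
by apply: eq_bigr => i _; rewrite mxE.
Qed.

Lemma fD_flat a w e : fD a (fflat w e) = fflat (fnabla a w) e.
Proof.
have h m : fD a (fL e (fun l => g m l)) = fL a (fun i => \sum_p Gam p i m * fL e (fun l => g p l)).
  have gb k l : fbase (g k l) by move=> ? ?; exact: g_base.
  rewrite fD_L; under fL_ext => l do rewrite (fD_base _ (gb _ _)).
  under fL_ext => l do (under fL_ext => i do rewrite Gam_compat; rewrite fLD).
  rewrite fLD; set S := fL e _; set T := fL e _; set X := \sum_i _.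
  have -> : T = X.
    rewrite /T /X fLC /fGy; under [RHS]eq_bigr => p _ do rewrite fLMr.
    rewrite -fL_sum; apply: fL_ext => i; under [RHS]eq_bigr => p _ do rewrite fLMr.
    by rewrite -fL_sum.
  rewrite addrK /S fLC; apply: fL_ext => i; rewrite fL_sum; apply: eq_bigr => p _.
  by rewrite fLMl.
rewrite !fflatE (der_sum (dD a)).
under eq_bigr do rewrite (derM (dD a)) h.
under [RHS]eq_bigr do rewrite mulrDl.
rewrite !big_split /=; congr (_ + _).
under eq_bigr do rewrite fLMl.
under [RHS]eq_bigr do rewrite fLMr.
rewrite -!fL_sum; apply: fL_ext => i.
under eq_bigr do rewrite mulr_sumr.
rewrite exchange_big; apply: eq_bigr => p _ /=; rewrite mulr_suml.
by apply: eq_bigr => m _; ring.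
Qed.

Definition fom a b c m := fL a (fun i => fL b (fun j => fL c (fun k => fR m i j k))).

Lemma fRm_flat a b c d : fRm a b c d = fflat (fom a b c) d.
Proof.
rewrite fflatE /fRm /fom; under [RHS]eq_bigr do rewrite fLMr.
rewrite -fL_sum; apply: fL_ext => i; under [RHS]eq_bigr do rewrite fLMr.
rewrite -fL_sum; apply: fL_ext => j; under [RHS]eq_bigr do rewrite fLMr.
rewrite -fL_sum; apply: fL_ext => k; under [RHS]eq_bigr do rewrite fLMl.
by rewrite -fL_sum.
Qed.

(** The curvature arises as the vertical component of [D a, D b]; the terms that move the frame
    vectors e_a and e_b themselves cancel by the symmetry of the Christoffel symbols. *)
Lemma fD_Gy a b c k : fD a (fGy b c k) - fD b (fGy a c k) = fom a b c k.
Proof.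
have h a' b' : fD a' (fGy b' c k) =
    fL a' (fun i => fL b' (fun j => fL c (fun l => px i (Gam k j l))))
    - fL a' (fun i => fL b' (fun j => fL c (fun l => \sum_m Gam k j m * Gam m i l)))
    - \sum_i fGy a' b' i * fL c (fun j => Gam k i j).
  rewrite /fGy fD_L; congr (_ - _).
  under fL_ext => j do rewrite fD_L.
  rewrite fLD fLN; congr (_ - _).
    rewrite [RHS]fLC; apply: fL_ext => j; rewrite [RHS]fLC; apply: fL_ext => l.
    by rewrite fD_base // => ? ?; exact: Gam_base.
  rewrite [RHS]fLC; apply: fL_ext => j; rewrite /fGy.
  under eq_bigr do rewrite fLMr.
  rewrite -fL_sum; apply: fL_ext => i; under eq_bigr do rewrite fLMr.
  rewrite -fL_sum; apply: fL_ext => l; apply: eq_bigr => m _; exact: mulrC.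
have -> : fom a b c k = fL a (fun i => fL b (fun j => fL c (fun l => px i (Gam k j l))))
  - fL a (fun i => fL b (fun j => fL c (fun l => px j (Gam k i l))))
  + (fL a (fun i => fL b (fun j => fL c (fun l => \sum_m Gam k i m * Gam m j l)))
  - fL a (fun i => fL b (fun j => fL c (fun l => \sum_m Gam k j m * Gam m i l)))).
  rewrite -!fLN -!fLD; apply: fL_ext => i; rewrite -!fLN -!fLD; apply: fL_ext => j.
  rewrite -!fLN -!fLD; apply: fL_ext => l.
  by rewrite /fR -sumrB.
rewrite !h (fLC b a) (fLC b a).
under [X in _ - (_ - X)]eq_bigr do rewrite fGyC.
ring.
Qed.

Lemma fD_comm_base a b F : fbase F -> fD a (fD b F) = fD b (fD a F).
Proof.
move=> h.
have e x w : fD x (fD w F) = fL w (fun j => fL x (fun i => px i (px j F)))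
    - \sum_j fGy x w j * px j F.
  rewrite (fD_base w h) fD_L; congr (_ - _); apply: fL_ext => j.
  by apply: fD_base; exact: fbase_px.
rewrite !e [in RHS]fLC; congr (_ - _).
  by apply: fL_ext => j; apply: fL_ext => i; exact: pd_comm.
by apply: eq_bigr => j _; rewrite fGyC.
Qed.

Lemma fE_Gy d c a b k :
  fE d c (fGy a b k) = (c == a)%:R * fGy d b k + (c == b)%:R * fGy a d k.
Proof.
rewrite /fGy fE_L addrC; congr (_ + _).
rewrite fLMl; apply: fL_ext => i; rewrite fE_L.
rewrite (_ : fL b _ = 0) ?add0r //; rewrite -(fL0 b); apply: fL_ext => j.
by rewrite fE_base // => ? ?; exact: Gam_base.
Qed.

Lemma fE_rho d c b k : fE d c (frho b k) = (c == b)%:R * frho d k.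
Proof.
have e x : frho x k = fL x (fun j => (fric_mx *m gi) j k).
  by rewrite /frho -mulmxA mxE.
rewrite !e fE_L (_ : fL b _ = 0) ?add0r //; rewrite -(fL0 b); apply: fL_ext => j.
apply: fE_base => c' k'; rewrite mxE; apply: fbase_sum => l c1 k1.
by apply: fbaseM => ? ?; rewrite ?mxE ?gi_base //; exact: fbase_ric.
Qed.

Lemma fDt_Gy a b k : fDt (fGy a b k) = fL a (fun i => fL b (fun j => pd iT (Gam k i j)))
  + fL a (fun i => \sum_j Gam k i j * frho b j) + \sum_i frho a i * fL b (fun j => Gam k i j).
Proof.
rewrite /fGy fDt_L; congr (_ + _); rewrite -fLD; apply: fL_ext => i.
rewrite fDt_L; congr (_ + _); last by apply: eq_bigr => j _; exact: mulrC.
by apply: fL_ext => j; rewrite fDt_base // => ? ?; exact: Gam_base.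
Qed.

Lemma fE_sum_y (m : 'I_n -> 'I_n -> A) b k :
  \sum_c \sum_d m c d * VE d c (iY b k) = \sum_d m b d * y d k.
Proof.
rewrite exchange_big; apply: eq_bigr => d _ /=.
by under eq_bigr do rewrite mulrCA; rewrite sum_delta.
Qed.

Lemma fE_act (m : 'I_n -> 'I_n -> A) F :
  \sum_c \sum_d m c d * fE d c F = vf pd (fun i => \sum_c \sum_d m c d * VE d c i) F.
Proof.
rewrite pair_big (vf_lin _ (fun p : 'I_n * 'I_n => m p.1 p.2)
  (fun p => VE p.2 p.1)) /=.
by apply: vf_ext => i; rewrite pair_big.
Qed.

(** The two Ricci terms that come from the motion of the frame vectors cancel the - 2 Ric of the
    flow. *)
Lemma fDt_G a b : fDt (fG a b) = 0.
Proof.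
rewrite fGE fDt_L; under fL_ext => k do rewrite fDt_L.
rewrite fLD -fflatE frho_flat.
have -> : fL a (fun k => \sum_i frho b i * g k i) = fflat (frho b) a.
  rewrite fflatE fL_sum; apply: eq_bigr => m _; rewrite fLMl; apply: fL_ext => k.
  by rewrite -{1}g_sym mxE.
rewrite frho_flat (fLC b a).
under [in X in _ + X + _]fL_ext => j do under fL_ext => l do rewrite fric_sym.
rewrite -!fLD -[RHS](fL0 a); apply: fL_ext => j.
rewrite -!fLD -[RHS](fL0 b); apply: fL_ext => l.
rewrite fDt_base => [|? ?]; last exact: g_base.
by rewrite flow; ring.
Qed.

Lemma derGi d : derivation d -> (forall a b, d (fG a b) = 0) -> forall a b, d (fGi a b) = 0.
Proof.
move=> hd h a b.
have e x : \sum_c fG x c * d (fGi c b) = 0.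
  have -> : \sum_c fG x c * d (fGi c b) = d ((fG *m fGi) x b).
    rewrite mxE (der_sum hd); apply: eq_bigr => c _.
    by rewrite (derMl hd).
  by rewrite fGGi mxE; exact: der_nat.
transitivity ((fGi *m (fG *m \matrix_(c, b) d (fGi c b))) a b).
  by rewrite mulmxA fGiG mul1mx [RHS]mxE.
rewrite mxE big1 // => x _; rewrite [X in _ * X]mxE.
under eq_bigr do rewrite [X in _ * X]mxE.
by rewrite e mulr0.
Qed.

Let vf0 v : vf pd v 0 = 0. Proof. exact: (der0 (vf_der pd_der v)). Qed.
Let vf1 v : vf pd v 1 = 0. Proof. exact: (der1 (vf_der pd_der v)). Qed.
Let vf_opp v F : vf pd v (- F) = - vf pd v F. Proof. exact: (derN (vf_der pd_der v)). Qed.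

(** Both sides of a bracket relation are vector fields, so that it suffices to compare their
    components, by [vf_comm] and [vf_ext]. *)
Lemma frame_bundle_calculus :
  frame_calculus fD fE fDt (fun a b => fG a b) (fun a b => fGi a b) fRm fs.
Proof.
have e_ric a b : \sum_c \sum_d fGi c d * fRm c a b d = fflat (frho a) b.
  by rewrite fric_frame frho_flat.
split=> //=.
- by move=> a b; rewrite !fGE fLC; apply: fL_ext => l; apply: fL_ext => k; rewrite -{1}g_sym mxE.
- have gis : gi^T = gi.
    have : (g *m gi)^T = 1%:M by rewrite ggi trmx1.
    by rewrite trmx_mul g_sym => h; rewrite -[LHS]mulmx1 -ggi mulmxA h mul1mx.
  move=> a b; have {1}-> : fGi = fGi^T by rewrite /fGi !trmx_mul trmxK gis mulmxA.
  by rewrite mxE.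
- by move=> a c; have := congr1 (fun M : 'M[_]_n => M a c) fGGi; rewrite !mxE.
- exact: fD_G.
- exact: fDt_G.
- by move=> c a b; apply: (derGi (dD c)); exact: fD_G.
- by move=> a b; apply: (derGi dDt); exact: fDt_G.
- move=> d c a b; rewrite !fGE fE_L addrC; congr (_ + _).
  rewrite fLMl; apply: fL_ext => k; rewrite fE_L.
  rewrite (_ : fL b _ = 0) ?add0r //; rewrite -(fL0 b); apply: fL_ext => l.
  by apply: fE_base => ? ?; exact: g_base.
- move=> d c a F; apply/eqP; rewrite addrC -subr_eq; apply/eqP.
  rewrite vf_comm // vfZ; apply: vf_ext => -[[k|[b k]]|] /=.
  + by rewrite vf0 subr0 -[LHS]/(fE d c (y a k)) fE_y.
  + rewrite vf_opp -/(fE d c) -/(fD a) (derMl (dD a)) ?(der_nat (dD a)) //.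
    by rewrite fD_y fE_Gy; ring.
  + by rewrite vf0 vf0 subr0 mulr0.
- move=> d c F; apply/eqP; rewrite -subr_eq0; apply/eqP.
  rewrite vf_comm //; transitivity (vf pd (fun=> 0) F); last first.
    by rewrite /vf big1 // => i _; rewrite mul0r.
  apply: vf_ext => -[[k|[b k]]|] /=.
  + by rewrite vf0 vf0 subr0.
  + rewrite -/(fE d c) -/fDt (derMl dDt) ?(der_nat dDt) //.
    by rewrite fDt_y fE_rho subrr.
  + by rewrite vf1 vf0 subr0.
- move=> a b F; rewrite vf_comm // fE_act vfN; apply: vf_ext => -[[k|[c k]]|].
  + rewrite [VD b _]/= [VD a _]/= -/(fD a) -/(fD b) !fD_y fGyC opprK addrC subrr.
    by rewrite big1 ?oppr0 // => c _; rewrite big1 // => d _; rewrite mulr0.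
  + rewrite fE_sum_y; under eq_bigr do under eq_bigr do rewrite fRm_flat.
    rewrite fflat_sharp [VD b _]/= [VD a _]/= !vf_opp -/(fD a) -/(fD b).
    by rewrite -fD_Gy; ring.
  + rewrite vf0 vf0 subr0.
    by rewrite big1 ?oppr0 // => c _; rewrite big1 // => d _; rewrite mulr0.
- move=> h e a b c d; rewrite /fRm.
  have t x F : fL x (fun l => fE h e (F l)) = fL x (fun l => fE h e (F l)) by [].
  rewrite fE_L; under fL_ext => i do rewrite fE_L.
  under fL_ext => i do (under fL_ext => j do rewrite fE_L).
  under fL_ext => i do (under fL_ext => j do (under fL_ext => k do rewrite fE_L)).
  rewrite [LHS]addrC -!addrA; congr (_ + _).
  rewrite [LHS](fLD a) [LHS]addrC; congr (_ + _); first by rewrite -fLMl.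
  under fL_ext => i do rewrite fLD.
  rewrite [LHS](fLD a) [LHS]addrC; congr (_ + _).
    by rewrite fLMl; apply: fL_ext => i; rewrite fLMl.
  rewrite fLMl; apply: fL_ext => i; rewrite fLMl; apply: fL_ext => j.
  rewrite fLMl; apply: fL_ext => k.
  rewrite (_ : fL d _ = 0) ?add0r //; rewrite -(fL0 d); apply: fL_ext => l.
  by apply: fE_base; exact: fbase_Rl.
(* Independence: the relation is tested on the coordinates of the base point, then on those of the
   frame vectors, and the frame matrix is inverted. *)
- move=> al be h.
  have al0 a : al a = 0.
    have e l : \sum_a al a * y a l = 0.
      rewrite -[RHS](h (z (iX l))) fE_act vf_z.
      rewrite [X in _ + X]big1 ?addr0 => [|c _]; last first.
        by rewrite big1 // => d _; rewrite mulr0.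
      by apply: eq_bigr => b _; rewrite /fD vf_z.
    transitivity ((\row_a al a *m (y *m yi)) ord0 a); first by rewrite yyi mulmx1 mxE.
    rewrite mulmxA mxE big1 // => l _; rewrite mxE.
    by under eq_bigr do rewrite mxE; rewrite e mul0r.
  split=> // c d.
  have e l : \sum_d be c d * y d l = 0.
    rewrite -[RHS](h (y c l)) fE_act vf_y fE_sum_y.
    by rewrite [X in _ = X + _]big1 ?add0r // => a _; rewrite al0 mul0r.
  transitivity ((\row_d be c d *m (y *m yi)) ord0 d); first by rewrite yyi mulmx1 mxE.
  rewrite mulmxA mxE big1 // => l _; rewrite mxE.
  by under eq_bigr do rewrite mxE; rewrite e mul0r.
- move=> a F; under [X in _ = X - _]eq_bigr do under eq_bigr do rewrite e_ric.
  rewrite vf_comm // fE_act vf_lin vfN vfD; apply: vf_ext => -[[k|[b k]]|].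
  + rewrite fflat_sharp [X in _ = _ - X]big1 => [|c _]; last first.
      by rewrite big1 // => d _; rewrite mulr0.
    by rewrite [VT _]/= vf0 !subr0 -[LHS]/(fDt (y a k)) fDt_y.
  + rewrite fE_sum_y fflat_sharp [VT _]/= [VD _ _]/= vf_opp -/fDt fDt_Gy.
    have -> : \sum_h (\sum_e fflat (frho a) e * fGi e h) * VD h (iY b k) =
       - \sum_i frho a i * fL b (fun j => Gam k i j).
      under eq_bigr do rewrite [VD _ _]/= mulrN.
      rewrite sumrN; congr (- _).
      under [RHS]eq_bigr do rewrite -(fflat_sharp (frho a)) mulr_suml.
      rewrite exchange_big; apply: eq_bigr => h _ /=; rewrite mulr_sumr.
      by apply: eq_bigr => i _; rewrite mulrA.
    by rewrite /fsig /fnabla -/(fD a); ring.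
  + rewrite [VT _]/= [VD _ _]/= vf0 vf1 subr0.
    rewrite !big1 ?subr0 // => i _; first by rewrite big1 // => d _; rewrite mulr0.
    by rewrite mulr0.
(* The time derivative of the Christoffel symbols is symmetric in the lower indices and drops out of
   the difference. *)
- move=> a d e; rewrite !e_ric !fD_flat /fs !fflatE -!sumrB; apply: eq_bigr => m _.
  rewrite -!mulrBl; congr (_ * _); rewrite /fsig fLC.
  under [in X in X + _ - _]fL_ext => i do under fL_ext => j do rewrite Gam_sym.
  ring.
Qed.

Lemma frame_contract (f f' : 'I_n -> A) :
  \sum_a \sum_a' fGi a a' * (fL a f * fL a' f') = \sum_i \sum_j gi i j * (f i * f' j).
Proof.
have e (M : 'M[A]_n) (u v : 'I_n -> A) :
    \sum_i \sum_j M i j * (u i * v j) = (\row_i u i *m M *m (\row_j v j)^T) ord0 ord0.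
  rewrite mxE exchange_big; apply: eq_bigr => j _ /=.
  by rewrite !mxE mulr_suml; apply: eq_bigr => i _; rewrite !mxE; ring.
rewrite !e /fGi.
have E h : \row_i fL i h = \row_i h i *m y^T.
  by apply/rowP => i; rewrite !mxE; apply: eq_bigr => j _; rewrite !mxE mulrC.
rewrite !E trmx_mul trmxK !mulmxA -(mulmxA _ y^T) -trmx_mul yiy trmx1 mulmx1.
by rewrite -(mulmxA _ yi) yiy mulmx1.
Qed.

Lemma base_contract (u v : 'I_n -> A) :
  \sum_i \sum_j gi i j * ((\sum_m u m * g m i) * (\sum_m v m * g m j)) =
  \sum_m \sum_m' g m m' * (u m * v m').
Proof.
have e (M : 'M[A]_n) (u' v' : 'I_n -> A) :
    \sum_i \sum_j M i j * (u' i * v' j) = (\row_i u' i *m M *m (\row_j v' j)^T) ord0 ord0.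
  rewrite mxE exchange_big; apply: eq_bigr => j _ /=.
  by rewrite !mxE mulr_suml; apply: eq_bigr => i _; rewrite !mxE; ring.
rewrite !e.
have E h : \row_i (\sum_m h m * g m i) = \row_m h m *m g.
  by apply/rowP => i; rewrite !mxE; apply: eq_bigr => j _; rewrite !mxE.
by rewrite !E trmx_mul g_sym !mulmxA -(mulmxA _ g gi) ggi mulmx1.
Qed.

Lemma sum_pairs (K L : finType) (F : K * L -> K * L -> A) :
  \sum_i \sum_j F i j = \sum_i \sum_j \sum_k \sum_l F (i, k) (j, l).
Proof.
transitivity (\sum_i \sum_k \sum_j F (i, k) j).
  by rewrite [RHS]pair_bigA; apply: eq_bigr => -[i k] _.
apply: eq_bigr => i _; rewrite [RHS]exchange_big; apply: eq_bigr => k _ /=.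
by rewrite [RHS]pair_bigA; apply: eq_bigr => -[j l] _.
Qed.

(** Converts the last index pair of a full contraction from the frame to coordinates, where the
    frame matrix cancels; it is iterated over the slots of a tensor. *)
Lemma contract_step (K : finType) (c : K -> K -> A) (F F' : K -> 'I_n -> A) :
  \sum_(i : K * 'I_n) \sum_(j : K * 'I_n) c i.1 j.1 * fGi i.2 j.2
     * (fL i.2 (F i.1) * fL j.2 (F' j.1)) =
  \sum_(q : 'I_n * 'I_n) gi q.1 q.2 * \sum_i \sum_j c i j * (F i q.1 * F' j q.2).
Proof.
rewrite sum_pairs /=.
transitivity (\sum_i \sum_j c i j * \sum_(q : 'I_n * 'I_n) gi q.1 q.2 * (F i q.1 * F' j q.2)).
  apply: eq_bigr => i _; apply: eq_bigr => j _.
  rewrite -(pair_bigA _ (fun a b => gi a b * (F i a * F' j b))) /= -frame_contract.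
  rewrite mulr_sumr; apply: eq_bigr => k _; rewrite mulr_sumr; apply: eq_bigr => l _.
  by rewrite -mulrA.
under [LHS]eq_bigr => i _ do under eq_bigr => j _ do rewrite mulr_sumr.
under eq_bigr => i _ do rewrite exchange_big /=.
rewrite exchange_big; apply: eq_bigr => q _ /=.
rewrite mulr_sumr; apply: eq_bigr => i _; rewrite mulr_sumr; apply: eq_bigr => j _.
by rewrite mulrCA.
Qed.

Lemma fL_rev4 a b c d (F : 'I_n -> 'I_n -> 'I_n -> 'I_n -> A) :
  fL a (fun i => fL b (fun j => fL c (fun k => fL d (fun l => F i j k l)))) =
  fL d (fun l => fL c (fun k => fL b (fun j => fL a (fun i => F i j k l)))).
Proof.
transitivity (fL a (fun i => fL d (fun l => fL c (fun k => fL b (fun j => F i j k l))))).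
  apply: fL_ext => i; rewrite [LHS]fLC [RHS]fLC.
  by apply: fL_ext => k; rewrite [LHS]fLC.
rewrite [LHS]fLC; apply: fL_ext => l; rewrite [LHS]fLC; apply: fL_ext => k.
by rewrite [LHS]fLC.
Qed.

Lemma frame_normRm : normRm (fun a b => fGi a b) fRm =
  \sum_l \sum_l' \sum_i \sum_i' \sum_j \sum_j' \sum_k \sum_k'
    g l l' * gi i i' * gi j j' * gi k k' * fR l i j k * fR l' i' j' k'.
Proof.
have RmE a b c d := fL_rev4 a b c d fRl.
pose Q := ('I_n * 'I_n)%type.
pose H (qi qj qk ql : Q) := fRl qi.1 qj.1 qk.1 ql.1 * fRl qi.2 qj.2 qk.2 ql.2.
transitivity (\sum_(ql : Q) gi ql.1 ql.2 * \sum_(qk : Q) gi qk.1 qk.2 *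
   \sum_(qj : Q) gi qj.1 qj.2 * \sum_(qi : Q) gi qi.1 qi.2 * H qi qj qk ql).
  rewrite /normRm; under eq_bigr => i _ do under eq_bigr => j _ do rewrite /Rm4 /fRm !RmE.
  rewrite (contract_step (fun i j : 'I_n * 'I_n * 'I_n => fGi i.1.1 j.1.1 * fGi i.1.2 j.1.2 * fGi i.2 j.2)
    (fun i l => fL i.2 (fun k => fL i.1.2 (fun j => fL i.1.1 (fun i => fRl i j k l))))
    (fun i l => fL i.2 (fun k => fL i.1.2 (fun j => fL i.1.1 (fun i => fRl i j k l))))).
  apply: eq_bigr => ql _; congr (_ * _).
  rewrite (contract_step (fun i j : 'I_n * 'I_n => fGi i.1 j.1 * fGi i.2 j.2)
    (fun i k => fL i.2 (fun j => fL i.1 (fun i => fRl i j k ql.1)))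
    (fun i k => fL i.2 (fun j => fL i.1 (fun i => fRl i j k ql.2)))).
  apply: eq_bigr => qk _; congr (_ * _).
  rewrite (contract_step (fun i j : 'I_n => fGi i j)
    (fun i j => fL i (fun i => fRl i j qk.1 ql.1))
    (fun i j => fL i (fun i => fRl i j qk.2 ql.2))).
  apply: eq_bigr => qj _; congr (_ * _).
  by rewrite frame_contract pair_big.
pose K (qi qj qk ql : Q) := fR ql.1 qi.1 qj.1 qk.1 * fR ql.2 qi.2 qj.2 qk.2.
have HK qi qj qk : \sum_(ql : Q) gi ql.1 ql.2 * H qi qj qk ql =
    \sum_(ql : Q) g ql.1 ql.2 * K qi qj qk ql.
  rewrite -(pair_bigA _ (fun a b => gi a b * H qi qj qk (a, b))).
  rewrite -(pair_bigA _ (fun a b => g a b * K qi qj qk (a, b))) /=.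
  exact: (base_contract (fun m => fR m qi.1 qj.1 qk.1) (fun m => fR m qi.2 qj.2 qk.2)).
have ex (c d : Q -> A) (F : Q -> Q -> A) : \sum_(p : Q) c p * \sum_(q : Q) d q * F p q =
    \sum_(q : Q) d q * \sum_(p : Q) c p * F p q.
  under eq_bigr do rewrite mulr_sumr.
  rewrite exchange_big; apply: eq_bigr => q _ /=; rewrite mulr_sumr.
  by apply: eq_bigr => p _; rewrite mulrCA.
rewrite ex; under eq_bigr => qk _ do rewrite ex.
under eq_bigr => qk _ do under eq_bigr => qj _ do rewrite ex.
under eq_bigr => qk _ do under eq_bigr => qj _ do under eq_bigr => qi _ do rewrite HK.
under eq_bigr => qk _ do under eq_bigr => qj _ do rewrite ex.
under eq_bigr => qk _ do rewrite ex.
rewrite ex.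
transitivity (\sum_(ql : Q) \sum_(qi : Q) \sum_(qj : Q) \sum_(qk : Q)
   g ql.1 ql.2 * gi qi.1 qi.2 * gi qj.1 qj.2 * gi qk.1 qk.2 * fR ql.1 qi.1 qj.1 qk.1 * fR ql.2 qi.2 qj.2 qk.2).
  apply: eq_bigr => ql _; rewrite mulr_sumr.
  under eq_bigr => qk _ do rewrite !mulr_sumr.
  under eq_bigr => qk _ do under eq_bigr => qj _ do rewrite !mulr_sumr.
  under eq_bigr => qk _ do rewrite exchange_big.
  rewrite exchange_big; apply: eq_bigr => qi _ /=.
  rewrite exchange_big; apply: eq_bigr => qj _ /=; apply: eq_bigr => qk _.
  by rewrite /K; ring.
rewrite [RHS]pair_big; apply: eq_bigr => -[l l'] _ /=.
rewrite [RHS]pair_big; apply: eq_bigr => -[i i'] _ /=.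
rewrite [RHS]pair_big; apply: eq_bigr => -[j j'] _ /=.
by rewrite [RHS]pair_big; apply: eq_bigr => -[k k'] _ /=.
Qed.

(** Coordinate components of the covariant derivative of the curvature tensor with all indices
    lowered. *)
Definition fDR m i j k l := px m (fRl i j k l)
  - \sum_p Gam p m i * fRl p j k l - \sum_p Gam p m j * fRl i p k l
  - \sum_p Gam p m k * fRl i j p l - \sum_p Gam p m l * fRl i j k p.

Lemma fD_fRm e a b c d : fD e (fRm a b c d) =
  fL a (fun i => fL b (fun j => fL c (fun k => fL d (fun l => fL e (fun m => fDR m i j k l))))).
Proof.
have step x f : fD e (fL x f) =
    fL x (fun i => fD e (f i) - \sum_p fL e (fun m => Gam p m i) * f p).
  rewrite fD_L fLD fLN; congr (_ - _).
  rewrite fL_sum; apply: eq_bigr => p _; rewrite /fGy fLC fLMr.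
  by apply: fL_ext => i.
have push x (c' : 'I_n -> A) (F : 'I_n -> 'I_n -> A) :
    \sum_p c' p * fL x (F p) = fL x (fun i => \sum_p c' p * F p i).
  by rewrite fL_sum; apply: eq_bigr => p _; rewrite fLMl.
rewrite /fRm step; apply: fL_ext => i; rewrite step push -fLN -fLD; apply: fL_ext => j.
rewrite step !push -!fLN -!fLD; apply: fL_ext => k.
rewrite step !push -!fLN -!fLD; apply: fL_ext => l.
rewrite fD_base; last exact: fbase_Rl.
have pull (c' : 'I_n -> 'I_n -> A) (F : 'I_n -> A) :
    \sum_p fL e (fun m => c' p m) * F p = fL e (fun m => \sum_p c' p m * F p).
  by rewrite fL_sum; apply: eq_bigr => p _; rewrite fLMr.
rewrite !pull -!fLN -!fLD; apply: fL_ext => m; rewrite /fDR; ring.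
Qed.

Lemma frame_normDRm : normDRm fD (fun a b => fGi a b) fRm =
  \sum_(qm : 'I_n * 'I_n) gi qm.1 qm.2 * \sum_(ql : 'I_n * 'I_n) gi ql.1 ql.2 *
  \sum_(qk : 'I_n * 'I_n) gi qk.1 qk.2 * \sum_(qj : 'I_n * 'I_n) gi qj.1 qj.2 *
  \sum_(qi : 'I_n * 'I_n) gi qi.1 qi.2 *
   (fDR qm.1 qi.1 qj.1 qk.1 ql.1 * fDR qm.2 qi.2 qj.2 qk.2 ql.2).
Proof.
pose Q := ('I_n * 'I_n)%type.
have RmE e a b c d := fL_rev4 a b c d (fun i j k l => fL e (fun m => fDR m i j k l)).
pose H e f (qi qj qk ql : Q) := fL e (fun m => fDR m qi.1 qj.1 qk.1 ql.1)
   * fL f (fun m => fDR m qi.2 qj.2 qk.2 ql.2).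
transitivity (\sum_(r : Q) fGi r.1 r.2 * \sum_(ql : Q) gi ql.1 ql.2 * \sum_(qk : Q) gi qk.1 qk.2 *
   \sum_(qj : Q) gi qj.1 qj.2 * \sum_(qi : Q) gi qi.1 qi.2 * H r.1 r.2 qi qj qk ql).
  rewrite /normDRm.
  transitivity (\sum_e \sum_f fGi e f * \sum_(i : idx4 n) \sum_(j : idx4 n)
     met4 (fun a b => fGi a b) i j * (fD e (Rm4 fRm i) * fD f (Rm4 fRm j))).
    transitivity (\sum_e \sum_I \sum_j met5 (fun a b => fGi a b) (e, I) j *
       (DRm5 fD fRm (e, I) * DRm5 fD fRm j)).
      by rewrite [RHS]pair_bigA; apply: eq_bigr => -[e I] _.
    apply: eq_bigr => e _.
    under [RHS]eq_bigr do rewrite mulr_sumr.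
    rewrite [RHS]exchange_big; apply: eq_bigr => I _ /=.
    under [RHS]eq_bigr do rewrite mulr_sumr.
    rewrite [RHS]pair_bigA; apply: eq_bigr => -[f J] _ /=.
    by rewrite /met5 /DRm5 /= -mulrA.
  rewrite pair_big; apply: eq_bigr => -[e f] _ /=; congr (_ * _).
  under eq_bigr => i _ do under eq_bigr => j _ do rewrite /Rm4 !fD_fRm !RmE.
  rewrite (contract_step (fun i j : 'I_n * 'I_n * 'I_n => fGi i.1.1 j.1.1 * fGi i.1.2 j.1.2 * fGi i.2 j.2)
    (fun i l => fL i.2 (fun k => fL i.1.2 (fun j => fL i.1.1 (fun i => fL e (fun m => fDR m i j k l)))))
    (fun i l => fL i.2 (fun k => fL i.1.2 (fun j => fL i.1.1 (fun i => fL f (fun m => fDR m i j k l)))))).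
  apply: eq_bigr => ql _; congr (_ * _).
  rewrite (contract_step (fun i j : 'I_n * 'I_n => fGi i.1 j.1 * fGi i.2 j.2)
    (fun i k => fL i.2 (fun j => fL i.1 (fun i => fL e (fun m => fDR m i j k ql.1))))
    (fun i k => fL i.2 (fun j => fL i.1 (fun i => fL f (fun m => fDR m i j k ql.2))))).
  apply: eq_bigr => qk _; congr (_ * _).
  rewrite (contract_step (fun i j : 'I_n => fGi i j)
    (fun i j => fL i (fun i => fL e (fun m => fDR m i j qk.1 ql.1)))
    (fun i j => fL i (fun i => fL f (fun m => fDR m i j qk.2 ql.2)))).
  apply: eq_bigr => qj _; congr (_ * _).
  by rewrite frame_contract pair_big.
have ex (c d : Q -> A) (F : Q -> Q -> A) : \sum_(p : Q) c p * \sum_(q : Q) d q * F p q =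
    \sum_(q : Q) d q * \sum_(p : Q) c p * F p q.
  under eq_bigr do rewrite mulr_sumr.
  rewrite exchange_big; apply: eq_bigr => q _ /=; rewrite mulr_sumr.
  by apply: eq_bigr => p _; rewrite mulrCA.
rewrite ex [RHS]ex; apply: eq_bigr => ql _; congr (_ * _).
rewrite ex [RHS]ex; apply: eq_bigr => qk _; congr (_ * _).
rewrite ex [RHS]ex; apply: eq_bigr => qj _; congr (_ * _).
rewrite ex [RHS]ex; apply: eq_bigr => qi _; congr (_ * _).
rewrite -(pair_bigA _ (fun e f => fGi e f * H e f qi qj qk ql)) /= frame_contract.
by rewrite pair_big.
Qed.

End FrameBundle.

(** * Calculus of C^k functions *)

Section Ck.
Variables (R : realType) (V : normedModType R).
Implicit Types (U O : set V).

Lemma Ck_cont (W : normedModType R) k U (f : V -> W) x :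
  Ck k U f -> U x -> {for x, continuous f}.
Proof. by case: k => [|k] [h _]; exact: h. Qed.

Lemma Ck_derivable (W : normedModType R) k U (f : V -> W) (hf : Ck k.+1 U f) x v :
  U x -> derivable f x v.
Proof. by case: hf => _ h; exact: (h v).1. Qed.
Arguments Ck_derivable {W k U f} hf {x} v.

Lemma Ck_D (W : normedModType R) k U (f : V -> W) v :
  Ck k.+1 U f -> Ck k U (fun x => 'D_v f x).
Proof. by case=> _ h; exact: (h v).2. Qed.

Lemma CkW (W : normedModType R) k U (f : V -> W) : Ck k.+1 U f -> Ck k U f.
Proof.
elim: k f => [|k IH] f hf; first by split=> // x; exact: (Ck_cont hf).
split=> [x|v]; first exact: (Ck_cont hf).
by split=> [x|]; [exact: (Ck_derivable hf) | apply: IH; exact: Ck_D].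
Qed.

Lemma Ck_sub (W : normedModType R) k U O (f : V -> W) : O `<=` U -> Ck k U f -> Ck k O f.
Proof.
move=> s; elim: k f => [|k IH] f [h1 h2]; split=> //.
- by move=> x /s; exact: h1.
- by move=> x /s; exact: h1.
- by move=> v; have [a b] := h2 v; split=> [x /s|]; [exact: a|exact: IH].
Qed.

Lemma Ck_ext (W : normedModType R) k U (f h : V -> W) : open U ->
  (forall x, U x -> f x = h x) -> Ck k U f -> Ck k U h.
Proof.
move=> oU; elim: k f h => [|k IH] f h e [h1 h2].
  split=> // x Ux; have nU : nbhs x U by exact: open_nbhs_nbhs.
  have := h1 x Ux; rewrite /prop_for /continuous_at -(e _ Ux) => hc.
  by apply: cvg_trans hc; apply: near_eq_cvg; near=> y; apply: e; near: y.
have nf x : U x -> {near x, f =1 h}.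
  move=> Ux; have nU : nbhs x U by exact: open_nbhs_nbhs.
  by near=> y; apply: e; near: y.
split=> [x Ux|v].
  have nU : nbhs x U by exact: open_nbhs_nbhs.
  have := h1 x Ux; rewrite /prop_for /continuous_at -(e _ Ux) => hc.
  by apply: cvg_trans hc; apply: near_eq_cvg; near=> y; apply: e; near: y.
have [a b] := h2 v; split=> [x Ux|].
  by apply: near_eq_derivable (a x Ux); exact: nf.
by apply: IH b => x Ux; apply: near_eq_derive; exact: nf.
Unshelve. all: by end_near. Qed.

Lemma Ck_local (W : normedModType R) k U (f : V -> W) :
  (forall x, U x -> exists O, O x /\ Ck k O f) -> Ck k U f.
Proof.
elim: k f => [|k IH] f h.
  by split=> // x /h[B [Bx hB]]; exact: (Ck_cont hB).
split=> [x /h[B [Bx hB]]|v]; first exact: (Ck_cont hB).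
split=> [x /h[B [Bx hB]]|]; first exact: (Ck_derivable hB).
by apply: IH => x /h[B [Bx hB]]; exists B; split=> //; exact: Ck_D.
Qed.

Lemma Ck_cst (W : normedModType R) k U (c : W) : Ck k U (fun=> c).
Proof.
elim: k c => [|k IH] c; first by split=> // x _; exact: cvg_cst.
split=> [x _|v]; first exact: cvg_cst.
split=> [x _|]; first exact: derivable_cst.
have -> : (fun x : V => 'D_v (fun=> c) x) = (fun=> 0) => //.
by apply/funext => x; exact: derive_cst.
Qed.

Lemma CkD (W : normedModType R) k U (f h : V -> W) : open U -> Ck k U f -> Ck k U h ->
  Ck k U (fun x => f x + h x).
Proof.
move=> oU; elim: k f h => [|k IH] f h hf hh.
  by split=> // x Ux; apply: cvgD; [exact: (Ck_cont hf)|exact: (Ck_cont hh)].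
split=> [x Ux|v]; first by apply: cvgD; [exact: (Ck_cont hf)|exact: (Ck_cont hh)].
have df x (Ux : U x) := Ck_derivable hf v Ux.
have dh x (Ux : U x) := Ck_derivable hh v Ux.
split=> [x Ux|]; first by apply: derivableD; [exact: df|exact: dh].
apply: Ck_ext (IH _ _ (Ck_D v hf) (Ck_D v hh)) => // x Ux.
by rewrite -deriveD //; [exact: df|exact: dh].
Qed.

Lemma CkM k U (f h : V -> R) : open U -> Ck k U f -> Ck k U h ->
  Ck k U (fun x => f x * h x).
Proof.
move=> oU; elim: k f h => [|k IH] f h hf hh.
  by split=> // x Ux; apply: cvgM; [exact: (Ck_cont hf)|exact: (Ck_cont hh)].
split=> [x Ux|v]; first by apply: cvgM; [exact: (Ck_cont hf)|exact: (Ck_cont hh)].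
have df x (Ux : U x) := Ck_derivable hf v Ux.
have dh x (Ux : U x) := Ck_derivable hh v Ux.
split=> [x Ux|]; first by apply: derivableM; [exact: df|exact: dh].
apply: Ck_ext (CkD oU (IH _ _ (CkW hf) (Ck_D v hh)) (IH _ _ (CkW hh) (Ck_D v hf))) => //.
by move=> x Ux; symmetry; exact: (deriveM (df x Ux) (dh x Ux)).
Qed.

Lemma CkV k U (f : V -> R) : open U -> (forall x, U x -> f x != 0) -> Ck k U f ->
  Ck k U (fun x => (f x)^-1).
Proof.
move=> oU f0; elim: k => [|k IH] hf.
  by split=> // x Ux; apply: cvgV; [exact: f0|exact: (Ck_cont hf)].
split=> [x Ux|v]; first by apply: cvgV; [exact: f0|exact: (Ck_cont hf)].
have df x (Ux : U x) := Ck_derivable hf v Ux.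
split=> [x Ux|]; first by apply: derivableV; [exact: f0|exact: df].
have hV := IH (CkW hf).
have hD := CkM oU (Ck_cst k U (- 1 : R)) (CkM oU (CkM oU hV hV) (Ck_D v hf)).
apply: (Ck_ext oU _ hD) => x Ux; rewrite deriveV ?f0 //; last exact: df.
by rewrite [RHS]/GRing.scale /= -exprVn; ring.
Qed.

Lemma CkN k U (f : V -> R) : open U -> Ck k U f -> Ck k U (fun x => - f x).
Proof.
move=> oU hf; apply: (Ck_ext oU _ (CkM oU (Ck_cst k U (- 1 : R)) hf)) => x Ux.
by rewrite mulN1r.
Qed.

Lemma Ck_sum (I : Type) (s : seq I) k U (f : I -> V -> R) : open U ->
  (forall i, Ck k U (f i)) -> Ck k U (fun x => \sum_(i <- s) f i x).
Proof.
move=> oU h; elim: s => [|i s IH].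
  by apply: (Ck_ext oU _ (Ck_cst k U (0 : R))) => x _; rewrite big_nil.
by apply: Ck_ext (CkD oU (h i) IH) => // x _; rewrite big_cons.
Qed.

Lemma Ck_prod (I : Type) (s : seq I) k U (f : I -> V -> R) : open U ->
  (forall i, Ck k U (f i)) -> Ck k U (fun x => \prod_(i <- s) f i x).
Proof.
move=> oU h; elim: s => [|i s IH].
  by apply: (Ck_ext oU _ (Ck_cst k U (1 : R))) => x _; rewrite big_nil.
by apply: Ck_ext (CkM oU (h i) IH) => // x _; rewrite big_cons.
Qed.

End Ck.
Arguments Ck_derivable {R V W k U f} hf {x} v.

(** * Chain rules along affine maps and mean values along segments *)

Section Affine.
Variables (R : realType) (V V' W : normedModType R).
Variables (L : V' -> V) (l : V' -> V).
Hypothesis Lc : continuous L.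
Hypothesis Ll : forall x w (h : R), L (h *: w + x) = h *: l w + L x.

Lemma derive_affine (f : V -> W) x w : 'D_w (f \o L) x = 'D_(l w) f (L x).
Proof.
rewrite /derive.
have -> // : (fun h : R => h^-1 *: (((f \o L) \o shift x) (h *: w) - (f \o L) x))
  = (fun h => h^-1 *: ((f \o shift (L x)) (h *: l w) - f (L x))).
by apply/funext => h /=; rewrite Ll.
Qed.

Lemma derivable_affine (f : V -> W) x w :
  derivable f (L x) (l w) -> derivable (f \o L) x w.
Proof.
rewrite /derivable; set F := (X in cvg (X @ _)); set G := (X in _ -> cvg (X @ _)).
by rewrite (_ : F = G) //; apply/funext => h; rewrite /F /G /= Ll.
Qed.

Lemma is_derive_affine (f : V -> W) x w d :
  is_derive (L x) (l w) f d -> is_derive x w (f \o L) d.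
Proof.
by move=> h; split; [apply: derivable_affine; exact: ex_derive|rewrite derive_affine derive_val].
Qed.

Lemma Ck_affine k (U : set V) (f : V -> W) : Ck k U f -> Ck k (L @^-1` U) (f \o L).
Proof.
elim: k f => [|k IH] f hf.
  by split=> // x Ux; apply: continuous_comp; [exact: Lc|exact: (Ck_cont hf)].
split=> [x Ux|w].
  by apply: continuous_comp; [exact: Lc|exact: (Ck_cont hf)].
split=> [x Ux|]; first by apply: derivable_affine; exact: (Ck_derivable hf).
have -> : (fun x => 'D_w (f \o L) x) = (fun x => 'D_(l w) f x) \o L.
  by apply/funext => x; rewrite derive_affine.
exact: IH (Ck_D _ hf).
Qed.

End Affine.

Section Linear.
Variables (R : realType) (V : normedModType R) (l : V -> R).
Hypothesis lc : continuous l.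
Hypothesis ll : forall x w (h : R), l (h *: w + x) = h * l w + l x.

Lemma derive_lin x w : 'D_w l x = l w.
Proof.
have -> : l = (@id R) \o l by [].
by rewrite (@derive_affine _ _ _ _ l l) // derive_id.
Qed.

Lemma Ck_lin k (U : set V) : Ck k U l.
Proof.
case: k => [|k]; first by split=> // x _; exact: lc.
split=> [x _|w]; first exact: lc.
split=> [x _|].
  have -> : l = (@id R) \o l by [].
  by apply: (@derivable_affine _ _ _ _ l l) => //; exact: derivable_id.
have -> : (fun x : V => 'D_w l x) = (fun=> l w); last exact: Ck_cst.
by apply/funext => x; exact: derive_lin.
Qed.

End Linear.

Section MVT.
Variables (R : realType) (V : normedModType R).

Lemma is_derive_line (f : V -> R) x v (s : R) : derivable f (x + s *: v) v ->
  is_derive s 1 (fun s => f (x + s *: v)) ('D_v f (x + s *: v)).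
Proof.
move=> h.
have e : (fun s => f (x + s *: v)) = f \o (fun s : R => x + s *: v) by [].
have Ll (r w h' : R) : x + (h' *: w + r) *: v = h' *: (w *: v) + (x + r *: v).
  by rewrite scalerDl -scalerA addrCA.
rewrite e; split.
  apply: (@derivable_affine _ _ _ _ (fun s : R => x + s *: v) (fun w => w *: v) Ll f s 1).
  by rewrite scale1r.
by rewrite (@derive_affine _ _ _ _ (fun s : R => x + s *: v) (fun w => w *: v)) // scale1r.
Qed.

Lemma mvt_dir (f : V -> R) x v (h : R) : 0 < h ->
  (forall s, 0 <= s <= h -> derivable f (x + s *: v) v) ->
  exists2 c, 0 < c < h & f (x + h *: v) - f x = h * 'D_v f (x + c *: v).
Proof.
move=> h0 hd.
have d1 s : s \in `]0, h[ -> is_derive s 1 (fun s => f (x + s *: v)) ('D_v f (x + s *: v)).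
  rewrite in_itv /= => /andP[a b]; apply: is_derive_line.
  by apply: hd; rewrite !ltW.
have c1 : {within `[0, h], continuous (fun s => f (x + s *: v))}.
  apply: derivable_within_continuous => s; rewrite in_itv /= => hs.
  exact: (@ex_derive _ _ _ _ _ _ _ (is_derive_line (hd s hs))).
have [c] := MVT h0 d1 c1.
rewrite in_itv /= => hc; rewrite scale0r addr0 subr0 => e.
by exists c => //; rewrite e mulrC.
Qed.

Lemma derive_scale (W : normedModType R) (f : V -> W) x v (c : R) : derivable f x v ->
  derivable f x (c *: v) /\ 'D_(c *: v) f x = c *: 'D_v f x.
Proof.
move=> hd; have [->|c0] := eqVneq c 0.
  by rewrite !scale0r; split; [exact: derivable0|exact: derive0].
suff hc : h^-1 *: ((f \o shift x) (h *: (c *: v)) - f x) @[h --> 0^'] --> c *: 'D_v f x.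
  by split; [apply/cvg_ex; exists (c *: 'D_v f x)|exact/cvg_lim].
have -> : (fun h : R => h^-1 *: ((f \o shift x) (h *: (c *: v)) - f x)) =
    (fun h => c *: (h^-1 *: ((f \o shift x) (h *: v) - f x))) \o (fun h => h * c).
  apply/funext => h /=; rewrite !scalerA; congr (_ *: _).
  by rewrite invfM mulrCA mulfV // mulr1.
apply: (@cvg_comp _ _ _ _ _ _ (0 : R)^'); last by apply: cvgZl_tmp; exact: hd.
have := @continuous_injective_withinNx R R (fun h => h * c) 0; rewrite /= mul0r; apply.
  by apply: cvgM; [exact: cvg_id|exact: cvg_cst].
by move=> h /eqP; rewrite mulf_eq0 (negbTE c0) orbF => /eqP.
Qed.

End MVT.

(* A finite coordinate system with coordinate functionals of norm at most 1, as
   for the sup norm. *)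
Record coordinates (R : realType) (V : normedModType R) (I : finType)
    (e : I -> V) (l : I -> V -> R) := {
  coordD : forall i x w (h : R), l i (h *: w + x) = h * l i w + l i x;
  coord_le : forall i v, `|l i v| <= `|v|;
  coordE : forall v, v = \sum_i l i v *: e i }.

(** * Continuous partial derivatives and total differentiability *)

Section Frechet.
Variables (R : realType) (V : normedModType R) (I : finType).
Variables (e : I -> V) (l : I -> V -> R).
Hypothesis co : coordinates e l.

Lemma coord_cont i : continuous (l i).
Proof.
move=> x; apply/cvgrPdist_lt => eps eps0; near=> y.
have -> : l i x - l i y = l i (x - y).
  by have := coordD co i x y (-1); rewrite scaleN1r addrC => ->; rewrite mulN1r addrC.
apply: le_lt_trans (coord_le co i _) _; near: y.
by have := nbhsx_ballx x eps eps0; rewrite -ball_normE.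
Unshelve. all: by end_near. Qed.

Definition C1diff (f : V -> R) x h := \sum_i l i h * 'D_(e i) f x.

Lemma C1diff_linear f x : linear (C1diff f x).
Proof.
move=> c u v; rewrite /C1diff scaler_sumr -big_split; apply: eq_bigr => i _ /=.
by rewrite (coordD co) mulrDl -mulrA.
Qed.

Lemma C1diff_cont f x : continuous (C1diff f x).
Proof.
move=> h; rewrite /C1diff; apply: cvg_big => [|i _]; first exact: add_continuous.
by apply: cvgM; [exact: coord_cont|exact: cvg_cst].
Qed.

(** The point moves from x to x + h one coordinate at a time, with the mean value theorem on each
    step. *)
Lemma C1_telescope (f : V -> R) x (r eps : R) h (s : seq I) :
  (forall y i, `|y - x| < r -> derivable f y (e i)) ->
  (forall y i, `|y - x| < r -> `|'D_(e i) f y - 'D_(e i) f x| <= eps) ->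
  `|h| * \sum_(i <- s) `|e i| < r ->
  `|f (x + \sum_(i <- s) l i h *: e i) - f x - \sum_(i <- s) l i h * 'D_(e i) f x|
     <= (size s)%:R * (eps * `|h|).
Proof.
move=> hd hD; elim: s => [|i s IH].
  by rewrite !big_nil addr0 subrr subr0 normr0 mul0r.
rewrite !big_cons mulrDr => hr.
have hr' : `|h| * \sum_(i <- s) `|e i| < r.
  by apply: le_lt_trans hr; rewrite lerDr mulr_ge0.
set p := \sum_(j <- s) l j h *: e j in IH *; set c := l i h.
have pn : `|p| <= `|h| * \sum_(i <- s) `|e i|.
  apply: le_trans (ler_norm_sum _ _ _) _; rewrite mulr_sumr; apply: ler_sum => j _.
  by rewrite normrZ ler_wpM2r // (coord_le co).
have inb (t : R) : 0 <= t <= 1 -> `|x + p + t *: (c *: e i) - x| < r.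
  move=> /andP[t0 t1]; rewrite -(addrA x) [x + _]addrC addrK; apply: le_lt_trans hr.
  rewrite addrC; apply: le_trans (ler_normD _ _) _; apply: lerD => //.
  rewrite !normrZ mulrA ler_wpM2r // -[leRHS]mul1r ler_pM //; last exact: (coord_le co).
  by rewrite ger0_norm.
have [t t01] := @mvt_dir R V f (x + p) (c *: e i) 1 ltr01
  (fun t ht => (derive_scale c (hd _ i (inb t ht))).1).
have t01' : 0 <= t <= 1 by case/andP: t01 => *; rewrite !ltW.
rewrite scale1r mul1r (derive_scale c (hd _ i (inb t t01'))).2 => E.
have -> : f (x + (c *: e i + p)) = f (x + p) + c *: 'D_(e i) f (x + p + t *: (c *: e i)).
  by rewrite -E [c *: _ + p]addrC addrA [RHS]addrC subrK.
set d := 'D_(e i) f _; set d0 := 'D_(e i) f x; set S := \sum_(j <- s) _.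
have -> : f (x + p) + c *: d - f x - (c * d0 + S) = (f (x + p) - f x - S) + c * (d - d0).
  by rewrite /GRing.scale /=; ring.
apply: le_trans (ler_normD _ _) _.
rewrite /= -addn1 natrD mulrDl mul1r lerD ?IH // normrM [eps * _]mulrC ler_pM //.
  exact: (coord_le co).
by apply: hD; exact: inb.
Qed.

(** [Ck] speaks of directional derivatives only; this passage to a total derivative is what
    [chain_rule] rests on. *)
Lemma C1_differentiable (f : V -> R) U x : open U -> Ck 1 U f -> U x ->
  differentiable f x /\ (forall h, 'd f x h = C1diff f x h).
Proof.
move=> oU hf Ux.
pose L : {linear V -> R} := HB.pack (C1diff f x) (GRing.isLinear.Build _ _ _ _ _ (C1diff_linear f x)).
suff ho : f \o shift x = cst (f x) + L +o_ 0 id.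
  have dL : 'd f x = L :> (V -> R) by apply: diff_unique => //; exact: C1diff_cont.
  split; last by move=> h; rewrite dL.
  by apply/diff_locallyP; rewrite dL; split => //; exact: C1diff_cont.
apply/eqaddoP => eps eps0.
pose m := (#|I|%:R + 1 : R).
have m0 : 0 < m by rewrite ltr_wpDl.
have nD : \forall y \near x, forall i, U y /\ `|'D_(e i) f y - 'D_(e i) f x| <= eps / m.
  apply: filter_forall => i; apply: filterI; first exact: open_nbhs_nbhs.
  have := Ck_cont (Ck_D (e i) hf) Ux; move=> /cvgrPdist_le /(_ (eps / m)).
  rewrite divr_gt0 // => /(_ isT); apply: filterS => y; by rewrite distrC.
have nU : nbhs x U by exact: open_nbhs_nbhs.
have [r r0 hr] : exists2 r : R, 0 < r & forall y, `|y - x| < r ->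
    U y /\ forall i, `|'D_(e i) f y - 'D_(e i) f x| <= eps / m.
  have /nbhs_ballP[r r0 hr] : nbhs x [set y | U y /\ forall i, `|'D_(e i) f y - 'D_(e i) f x| <= eps / m].
    by apply: filterI => //; apply: filterS nD => y h i; exact: (h i).2.
  exists r => // y hy; apply: hr; rewrite -ball_normE /=; by rewrite distrC.
pose M := \sum_i `|e i| + 1.
have M0 : 0 < M by rewrite ltr_wpDl // sumr_ge0.
near=> h.
have hM : `|h| * \sum_i `|e i| < r.
  have : `|h| < r / M by near: h; apply: nbhs0_lt; rewrite divr_gt0.
  rewrite ltr_pdivlMr // => hh; apply: le_lt_trans hh.
  by rewrite ler_wpM2l // lerDl.
have := @C1_telescope f x r (eps / m) h (index_enum I) _ _ hM.
rewrite -(coordE co h) => H.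
have -> : (f \o shift x - (cst (f x) + L)) h = f (x + h) - f x - \sum_i l i h * 'D_(e i) f x.
  by rewrite /= !fctE /= opprD addrA [h + x]addrC.
apply: le_trans (H _ _) _.
- by move=> y i /hr[Uy _]; exact: (Ck_derivable hf).
- by move=> y i /hr[_]; exact.
rewrite mulrA ler_wpM2r // mulrCA ger_pMr // ler_pdivrMr // mul1r /m.
by rewrite -[index_enum I]enumT -cardT lerDl.
Unshelve. all: by end_near. Qed.

Lemma C1_deriveE (f : V -> R) U x v : open U -> Ck 1 U f -> U x ->
  'D_v f x = \sum_i l i v * 'D_(e i) f x.
Proof.
by move=> oU hf Ux; have [d h] := C1_differentiable oU hf Ux; rewrite deriveE // h.
Qed.

End Frechet.

(** * Symmetry of second derivatives *)

Section Schwarz.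
Variables (R : realType) (V : normedModType R).

Lemma cont_ball (f : V -> R) U x (eps : R) : open U -> U x -> {for x, continuous f} ->
  0 < eps -> exists2 r : R, 0 < r & forall y, `|y - x| < r -> U y /\ `|f y - f x| <= eps.
Proof.
move=> oU Ux hf eps0.
have /nbhs_ballP[r r0 hr] : nbhs x [set y | U y /\ `|f y - f x| <= eps].
  apply: filterI; first exact: open_nbhs_nbhs.
  by have := hf => /cvgrPdist_le /(_ eps eps0); apply: filterS => y; rewrite distrC.
by exists r => // y hy; apply: hr; rewrite -ball_normE /= distrC.
Qed.

(** The mean value theorem along v, applied to the increment of f by h w, and then along w, exhibits
    the quotient as a value of the mixed derivative at a point near x. *)
Lemma second_difference (f : V -> R) U x v w (eps : R) : open U -> Ck 2 U f -> U x ->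
  0 < eps -> \forall h \near 0^'+,
  `|(f (x + h *: v + h *: w) - f (x + h *: v) - f (x + h *: w) + f x) / h ^+ 2
    - 'D_w (fun y => 'D_v f y) x| <= eps.
Proof.
move=> oU hf Ux eps0; pose DD y := 'D_w (fun y => 'D_v f y) y.
have nU : nbhs x U by exact: open_nbhs_nbhs.
have hDD := Ck_cont (Ck_D w (Ck_D v hf)) Ux.
have [r r0 hr] : exists2 r : R, 0 < r & forall y, `|y - x| < r ->
    U y /\ `|DD y - DD x| <= eps.
  exact: cont_ball.
pose M := `|v| + `|w| + 1.
have M0 : 0 < M by rewrite ltr_wpDl // addr_ge0.
near=> h.
have h0 : 0 < h by [].
have hM : h * (`|v| + `|w|) < r.
  have : h < r / M by near: h; apply: nbhs_right_lt; rewrite divr_gt0.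
  rewrite ltr_pdivlMr // => hh; apply: le_lt_trans hh.
  by rewrite ler_wpM2l ?(ltW h0) // /M lerDl.
have inb (s t : R) : 0 <= s <= h -> 0 <= t <= h -> `|x + s *: v + t *: w - x| < r.
  move=> /andP[s0 s1] /andP[t0 t1]; rewrite -(addrA x) [x + _]addrC addrK.
  apply: le_lt_trans hM; apply: le_trans (ler_normD _ _) _.
  by rewrite !normrZ !ger0_norm // mulrDr lerD // ler_wpM2r.
have hf1 := CkW hf.
have dv y : U y -> derivable f y v by exact: (Ck_derivable hf1).
have h0h : 0 <= h <= h by rewrite (ltW h0) lexx.
have h00 : 0 <= (0 : R) <= h by rewrite lexx ltW.
pose F y := f (y + h *: w) - f y.
have dF s : 0 <= s <= h ->
    is_derive (x + s *: v) v F ('D_v f (x + s *: v + h *: w) - 'D_v f (x + s *: v)).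
  move=> hs; apply: is_deriveB.
    have Ll (y u : V) (k : R) : (k *: u + y) + h *: w = k *: u + (y + h *: w) by rewrite addrA.
    have d1 : derivable f (x + s *: v + h *: w) v.
      by apply: dv; exact: (hr _ (inb s h hs h0h)).1.
    exact: (@is_derive_affine _ _ _ _ (fun y => y + h *: w) id Ll f _ _ _ (derivableP d1)).
  apply: derivableP; apply: dv.
  by have := (hr _ (inb s 0 hs h00)).1; rewrite scale0r addr0.
have [s /andP[s0 sh]] := @mvt_dir R V F x v h h0 (fun s hs => @ex_derive _ _ _ _ _ _ _ (dF s hs)).
have hs : 0 <= s <= h by rewrite !ltW.
rewrite (@derive_val _ _ _ _ _ _ _ (dF s hs)) => E1.
have [t /andP[t0 th]] := @mvt_dir R V (fun y => 'D_v f y) (x + s *: v) w h h0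
  (fun t ht => Ck_derivable (Ck_D v hf) w (hr _ (inb s t hs ht)).1).
move=> E2; rewrite E2 in E1.
have -> : f (x + h *: v + h *: w) - f (x + h *: v) - f (x + h *: w) + f x =
   h ^+ 2 * DD (x + s *: v + t *: w).
  move: E1; rewrite /F expr2 -mulrA => <-; ring.
rewrite mulrC mulKf ?expf_neq0 ?gt_eqF //.
by apply: (hr _ (inb s t hs _)).2; rewrite !ltW.
Unshelve. all: by end_near. Qed.

Lemma ler_dist_half (q a b eps : R) :
  `|q - a| <= eps / 2 -> `|q - b| <= eps / 2 -> `|a - b| <= eps.
Proof.
move=> h1 h2; rewrite -(subrKA q) (splitr eps) (le_trans (ler_normD _ _)) // lerD //.
by rewrite distrC.
Qed.

(** The second difference is symmetric in v and w, and its quotient approximates both mixed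
    derivatives. *)
Lemma schwarz (f : V -> R) U x v w : open U -> Ck 2 U f -> U x ->
  'D_w (fun y => 'D_v f y) x = 'D_v (fun y => 'D_w f y) x.
Proof.
move=> oU hf Ux; apply/eqP; rewrite -subr_eq0 -normr_le0; apply/ler_addgt0Pr => eps eps0.
rewrite add0r; have e20 : 0 < eps / 2 by rewrite divr_gt0.
have H1 := second_difference v w oU hf Ux e20.
have H2 := second_difference w v oU hf Ux e20.
have [h [h1 h2]] := filter_ex (filterI H1 H2); move: h1 h2 => {H1 H2} /= h1 h2.
move: h1 h2; rewrite (addrAC x (h *: w)).
rewrite (_ : _ - f (x + h *: w) - f (x + h *: v) + f x =
  f (x + h *: v + h *: w) - f (x + h *: v) - f (x + h *: w) + f x); last by ring.
exact: ler_dist_half.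
Qed.

End Schwarz.

(** * Compactness of balls in a complete length space, after Cohn-Vossen *)

Lemma ultra_fmap (T U : Type) (f : T -> U) (F : set_system T) :
  UltraFilter F -> UltraFilter (f @ F).
Proof.
move=> FU; split; first by typeclasses eauto.
move=> H HP FH; apply/seteqP; split=> A //=; last exact: FH.
move=> HA; have [//|FnA] := in_ultra_setVsetC (f @^-1` A) FU.
have HnA : H (~` A) by apply: FH.
by have [x [Ax nAx]] := filter_ex (filterI HA HnA).
Qed.

Section CohnVossen.
Variables (R : realType) (X : topologicalType) (reach : X -> X -> R -> Prop).
Hypothesis rS : forall x y r, reach x y r -> reach y x r.
Hypothesis rT : forall x y z r s, reach x y r -> reach y z s -> reach x z (r + s).
Hypothesis rW : forall x y r s, reach x y r -> r <= s -> reach x y s.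
Hypothesis rnbhs : forall x r, 0 < r -> nbhs x [set y | reach x y r].
Hypothesis rloc : forall x N, nbhs x N -> exists2 e : R, 0 < e & forall y, reach x y e -> N y.
Hypothesis rcpt : forall x, exists2 e : R, 0 < e &
  exists2 K, compact K & forall y, reach x y e -> K y.
Hypothesis rsplit : forall x y r d, 0 < r -> 0 < d -> reach x y (r + d) ->
  exists z, reach x z r /\ reach z y (2 * d).
Hypothesis rcompl : forall u : nat -> X,
  (forall e : R, 0 < e -> exists N, forall p q, (N <= p)%N -> (N <= q)%N -> reach (u p) (u q) e) ->
  exists x, forall e : R, 0 < e -> exists N, forall p, (N <= p)%N -> reach (u p) x e.

(** [reach x y r] reads: x and y are joined by a curve shorter than r; [rsplit] says that such
    curves can be cut at a prescribed length, approximately. Relative compactness of [A] is meant: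
    the limit of an ultrafilter on [A] may lie outside [A]. *)
Definition ultra_precompact (A : set X) :=
  forall F : set_system X, UltraFilter F -> F A -> exists p : X, F --> p.
Local Notation ball' x r := [set y | reach x y r].

Lemma precompactS A B : A `<=` B -> ultra_precompact B -> ultra_precompact A.
Proof. by move=> AB hB F FU FA; apply: hB; apply: filterS FA. Qed.

Lemma compact_precompact K : compact K -> ultra_precompact K.
Proof. by rewrite compact_ultra => hK F FU /(hK F FU)[p [_ hp]]; exists p. Qed.

Lemma invS_small (e : R) : 0 < e -> \forall k \near \oo, (k.+1%:R)^-1 <= e.
Proof.
move=> e0; exists (Num.truncn e^-1) => // k /= hk.
have k0 : 0 < k.+1%:R :> R by rewrite ltr0n.
rewrite invf_ple ?posrE //; apply: ltW; apply: (lt_le_trans (truncnS_gt _)).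
by rewrite ler_nat ltnS.
Qed.

Variable x0 : X.

(** Otherwise there are centres [z k] in the ball whose balls of radius 1 / (k + 1) are not
    precompact. Along an ultrafilter they converge to a point p, and a compact set around p contains
    some of these balls. *)
Lemma uniform_radius r : ultra_precompact (ball' x0 r) ->
  exists2 d : R, 0 < d & forall z, reach x0 z r -> ultra_precompact (ball' z d).
Proof.
move=> hr; apply: contrapT => hn.
have /boolp.choice[z hz] : forall k : nat, exists z, reach x0 z r /\
    ~ ultra_precompact (ball' z (k.+1%:R)^-1).
  move=> k; apply: contrapT => hk; apply: hn; exists (k.+1%:R)^-1; first by rewrite invr_gt0 ltr0n.
  by move=> z hz; apply: contrapT => hz'; apply: hk; exists z.
have [H [HU Hoo]] := ultraFilterLemma (F := \oo : set_system nat) _.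
have [p hp] := hr (z @ H) (ultra_fmap z HU) (@filterE _ _ _ _ (fun k => (hz k).1)).
have [e e0 [K cK hK]] := rcpt p.
have e2 : 0 < e / 2 by rewrite divr_gt0.
have h1 : H [set k | reach p (z k) (e / 2)] by apply: (hp _ (rnbhs p e2)).
have h2 : H [set k | (k.+1%:R)^-1 <= e / 2] by apply: Hoo; exact: invS_small.
have [k [k1 k2]] := filter_ex (filterI h1 h2).
apply: (hz k).2; apply: (precompactS _ (compact_precompact cK)) => y hy.
apply: hK; apply: rW (rT k1 hy) _; rewrite /= in k2; move: (_^-1) k2 => w; lra.
Qed.

(** [rsplit] projects the larger ball to the smaller one with displacement below 2 d. The projected
    ultrafilter converges to some p, so that the original one lives within 3 d of p. *)
Lemma reach_step r d (F : set_system X) : 0 < r -> 0 < d ->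
  ultra_precompact (ball' x0 r) -> UltraFilter F -> F (ball' x0 (r + d)) ->
  exists2 p, (exists z, reach x0 z r /\ reach z p d) & F (ball' p (3 * d)).
Proof.
move=> r0 d0 hr FU hF.
have /boolp.choice[pi hpi] : forall y, exists z, reach x0 y (r + d) -> reach x0 z r /\ reach z y (2 * d).
  move=> y; have [h|h] := pselect (reach x0 y (r + d)); last by exists y.
  by have [z hz] := rsplit r0 d0 h; exists z.
have hF2 : F [set y | reach x0 (pi y) r] by apply: filterS hF => y /hpi[].
have [p hp] := hr _ (ultra_fmap pi FU) hF2.
have h1 : F [set y | reach p (pi y) d] by apply: (hp _ (rnbhs p d0)).
have h2 : F (ball' x0 (r + d) `&` [set y | reach p (pi y) d]) by apply: filterI.
exists p.
  by have [y [/hpi[y1 _] y2]] := filter_ex h2; exists (pi y); split=> //; exact: rS.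
apply: filterS h2 => y [/hpi[_ y1] y2]; apply: rW (rT y2 y1) _; lra.
Qed.

(** With d tending to 0, [reach_step] puts balls of radii tending to 0 into the ultrafilter. Any two
    of them meet, hence their centres form a Cauchy sequence, whose limit is that of the
    ultrafilter. *)
Lemma precompact_limit r : 0 < r -> (forall s, s < r -> ultra_precompact (ball' x0 s)) ->
  ultra_precompact (ball' x0 r).
Proof.
move=> r0 hs F FU hF.
have /boolp.choice[u hu] : forall k : nat, exists p, F (ball' p (3 * (k.+1%:R)^-1)).
  move=> k; pose d := Num.min (k.+1%:R)^-1 (r / 2).
  have k0 : 0 < (k.+1%:R)^-1 :> R by rewrite invr_gt0 ltr0n.
  have d0 : 0 < d by rewrite lt_min k0 divr_gt0.
  have dr : d <= r / 2 by rewrite ge_min lexx orbT.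
  have dk : d <= (k.+1%:R)^-1 by rewrite ge_min lexx.
  have hF' : F (ball' x0 (r - d + d)) by rewrite subrK.
  have rd : 0 < r - d by lra.
  have rd' : r - d < r by lra.
  have [p _ hp] := reach_step rd d0 (hs _ rd') FU hF'.
  exists p; apply: filterS hp => y h; apply: rW h _; move: (_^-1) dk => w; lra.
have small (e : R) : 0 < e -> exists N, forall k, (N <= k)%N -> 3 * (k.+1%:R)^-1 <= e.
  move=> e0; have e3 : 0 < e / 3 by rewrite divr_gt0.
  have [N _ hN] := invS_small e3; exists N => k /hN /=; move: (_^-1) => w; lra.
have [x hx] : exists x, forall e : R, 0 < e -> exists N, forall p, (N <= p)%N -> reach (u p) x e.
  apply: rcompl => e e0; have e2 : 0 < e / 2 by rewrite divr_gt0.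
  have [N hN] := small _ e2; exists N => p q Np Nq.
  have [y [y1 y2]] := filter_ex (filterI (hu p) (hu q)).
  by apply: rW (rT y1 (rS y2)) _; rewrite (splitr e); apply: lerD; exact: hN.
exists x => N /rloc[e e0 he]; have e2 : 0 < e / 2 by rewrite divr_gt0.
have [N1 h1] := small _ e2; have [N2 h2] := hx _ e2.
pose k := maxn N1 N2.
have k1 := h1 k (leq_maxl _ _); have k2 := h2 k (leq_maxr _ _).
apply: filterS (hu k) => y hy; apply: he; apply: rW (rT (rS k2) hy) _.
by move: (_^-1) k1 => w; lra.
Qed.

(** The radii of precompact balls have no finite supremum m: by [precompact_limit] the ball of
    radius m would be precompact, and by [uniform_radius] a larger one too. *)
Lemma precompact_ball r : ultra_precompact (ball' x0 r).
Proof.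
pose S := [set s : R | 0 < s /\ ultra_precompact (ball' x0 s)].
have down s t : ultra_precompact (ball' x0 t) -> s <= t -> ultra_precompact (ball' x0 s).
  by move=> h st; apply: precompactS h => y hy; apply: rW hy st.
have [h|hn] := pselect (exists2 t, S t & r <= t); first by case: h => t [_ ht] /(down _ _ ht).
have ubr : ubound S r.
  by move=> t St; rewrite leNgt; apply/negP => rt; apply: hn; exists t => //; exact: ltW.
have S0 : S !=set0.
  have [e e0 [K cK hK]] := rcpt x0; exists e; split=> //.
  by apply: (precompactS _ (compact_precompact cK)).
have hsup : has_sup S by split=> //; exists r.
have [s0 [s00 hs0]] := S0.
pose m := sup S.
have m0 : 0 < m by apply: (lt_le_trans s00); exact: (ub_le_sup hsup.2).
have hm : ultra_precompact (ball' x0 m).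
  apply: precompact_limit => // s sm.
  have sm' : 0 < m - s by rewrite subr_gt0.
  have [t [t0 ht] mt] := sup_adherent sm' hsup.
  by apply: (down _ _ ht); rewrite -/m in mt; lra.
have [d d0 hd] := uniform_radius hm.
(* The ultrafilter will live within 3 d / 4 of a point that is within d / 4 of some z in the ball of
   radius m, hence in the precompact ball of radius d around z. *)
have d4 : 0 < d / 4 by rewrite divr_gt0.
have : S (m + d / 4).
  split; first by rewrite addr_gt0.
  move=> F FU hF; have [p [z [z1 z2]] hp] := reach_step m0 d4 hm FU hF.
  apply: (hd z z1 F FU); apply: filterS hp => y hy; apply: rW (rT z2 hy) _; lra.
move/(ub_le_sup hsup.2); rewrite -/m; lra.
Qed.

End CohnVossen.

(** * Rings of smooth functions *)

Record osub (R : realType) (V : normedModType R) := OSub {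
  osub_set :> set V; osub_open : open osub_set }.
Definition osub_mem (R : realType) (V : normedModType R) (U : osub V) : V -> Prop := osub_set U.
Coercion osub_mem : osub >-> Funclass.

(* Smooth functions on U, normalised to vanish off U so that equality is
   equality on U. *)
Record smfun (R : realType) (V : normedModType R) (U : osub V) := SmFun {
  smf :> V -> R;
  smf_smooth : forall k, Ck k U smf;
  smf_off : forall x, ~ U x -> smf x = 0 }.

Section SmRing.
Variables (R : realType) (V : normedModType R) (U : osub V).
Local Notation S := (smfun U).

Lemma smfun_eq (f h : S) : (forall x, U x -> f x = h x) -> f = h.
Proof.
case: f h => [f f1 f2] [h h1 h2] /= e.
have E : f = h.
  apply/funext => x; have [Ux|nUx] := pselect (U x); first exact: e.
  by rewrite f2 // h2.
by subst h; congr SmFun; exact: Prop_irrelevance.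
Qed.

Definition smrestr (f : V -> R) x := if pselect (U x) then f x else 0.

Lemma smrestrE f x : U x -> smrestr f x = f x.
Proof. by rewrite /smrestr; case: pselect. Qed.

Lemma smrestr_off f x : ~ U x -> smrestr f x = 0.
Proof. by rewrite /smrestr; case: pselect. Qed.

Lemma smrestr_smooth f : (forall k, Ck k U f) -> forall k, Ck k U (smrestr f).
Proof.
by move=> h k; apply: (Ck_ext (osub_open U) _ (h k)) => x Ux; rewrite smrestrE.
Qed.

Definition smk f (h : forall k, Ck k U f) : S := SmFun (smrestr_smooth h) (@smrestr_off f).

Lemma smkE f h x : U x -> @smk f h x = f x.
Proof. exact: smrestrE. Qed.

Definition smcst c : S := smk (fun k => Ck_cst k U (c : R)).
Definition smadd (f h : S) : S :=
  smk (fun k => CkD (osub_open U) (smf_smooth f k) (smf_smooth h k)).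
Definition smopp (f : S) : S := smk (fun k => CkN (osub_open U) (smf_smooth f k)).
Definition smmul (f h : S) : S :=
  smk (fun k => CkM (osub_open U) (smf_smooth f k) (smf_smooth h k)).

HB.instance Definition _ := gen_eqMixin S.
HB.instance Definition _ := gen_choiceMixin S.

Lemma smaddA : associative smadd.
Proof. by move=> f g h; apply: smfun_eq => x Ux; rewrite !smkE // addrA. Qed.
Lemma smaddC : commutative smadd.
Proof. by move=> f g; apply: smfun_eq => x Ux; rewrite !smkE // addrC. Qed.
Lemma smadd0 : left_id (smcst 0) smadd.
Proof. by move=> f; apply: smfun_eq => x Ux; rewrite !smkE // add0r. Qed.
Lemma smaddN : left_inverse (smcst 0) smopp smadd.
Proof. by move=> f; apply: smfun_eq => x Ux; rewrite !smkE // addNr. Qed.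
HB.instance Definition _ := GRing.isZmodule.Build S smaddA smaddC smadd0 smaddN.

Lemma smmulA : associative smmul.
Proof. by move=> f g h; apply: smfun_eq => x Ux; rewrite !smkE // mulrA. Qed.
Lemma smmulC : commutative smmul.
Proof. by move=> f g; apply: smfun_eq => x Ux; rewrite !smkE // mulrC. Qed.
Lemma smmul1 : left_id (smcst 1) smmul.
Proof. by move=> f; apply: smfun_eq => x Ux; rewrite !smkE // mul1r. Qed.
Lemma smmulD : left_distributive smmul smadd.
Proof. by move=> f g h; apply: smfun_eq => x Ux; rewrite !smkE // mulrDl. Qed.
HB.instance Definition _ := GRing.Zmodule_isComPzRing.Build S smmulA smmulC smmul1 smmulD.

Lemma sm0E p : U p -> (0 : S) p = 0. Proof. exact: smkE. Qed.
Lemma sm1E p : U p -> (1 : S) p = 1. Proof. exact: smkE. Qed.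
Lemma smDDE (f h : S) p : U p -> (f + h) p = f p + h p. Proof. exact: smkE. Qed.
Lemma smNE (f : S) p : U p -> (- f) p = - f p. Proof. exact: smkE. Qed.
Lemma smME (f h : S) p : U p -> (f * h) p = f p * h p. Proof. exact: smkE. Qed.

(** Evaluation at a point of [U]: the ring morphism that turns algebraic identities into pointwise
    ones. *)
Definition smev p (hp : U p) (f : S) : R := f p.

Section Ev.
Variables (p : V) (hp : U p).
Lemma smev_zmod : zmod_morphism (smev hp).
Proof. by move=> f g; rewrite /smev smDDE ?smNE. Qed.
Lemma smev_monoid : monoid_morphism (smev hp).
Proof. by split=> [|f g]; rewrite /smev ?sm1E ?smME. Qed.
HB.instance Definition _ := GRing.isZmodMorphism.Build S R (smev hp) smev_zmod.
HB.instance Definition _ := GRing.isMonoidMorphism.Build S R (smev hp) smev_monoid.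
End Ev.

End SmRing.

HB.lock Definition smD (R : realType) (V : normedModType R) (U : osub V) (v : V)
  (f : smfun U) : smfun U := smk (fun k => Ck_D v (smf_smooth f k.+1)).

Section SmDerivation.
Variables (R : realType) (V : normedModType R) (U : osub V).
Local Notation S := (smfun U).

Lemma smDE v (f : S) p : U p -> smD v f p = 'D_v f p.
Proof. by move=> Up; rewrite smD.unlock smkE. Qed.

Lemma smnear (P : V -> Prop) p : U p -> (forall q, U q -> P q) -> \forall q \near p, P q.
Proof.
move=> Up h; have nU : nbhs p U by apply: open_nbhs_nbhs; split=> //; exact: osub_open.
by apply: filterS nU.
Qed.

Lemma smD_der v : derivation (@smD R V U v).
Proof.
split=> f g; apply: smfun_eq => p Up;
  have df := Ck_derivable (smf_smooth f 1) v Up;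
  have dg := Ck_derivable (smf_smooth g 1) v Up.
  rewrite smDDE // !smDE // -(deriveD df dg); apply: near_eq_derive.
  by apply: smnear Up _ => q Uq; rewrite smDDE.
rewrite smDDE // !smME // !smDE // [_ * g p]mulrC addrC.
transitivity ('D_v ((f : V -> R) * g) p); last exact: (deriveM df dg).
by apply: near_eq_derive; apply: smnear Up _ => q Uq; rewrite smME.
Qed.

Lemma smD_comm v w (f : S) : smD v (smD w f) = smD w (smD v f).
Proof.
apply: smfun_eq => p Up.
transitivity ('D_v (smD w f) p); first exact: smDE.
transitivity ('D_w (smD v f) p); last by symmetry; exact: smDE.
have e u : \forall q \near p, smD u f q = 'D_u f q.
  by apply: smnear Up _ => q Uq; rewrite smDE.
rewrite (near_eq_derive v (e w)) (near_eq_derive w (e v)).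
exact: (schwarz _ _ (osub_open U) (smf_smooth f 2) Up).
Qed.

Lemma sm_half (f : S) : f + f = 0 -> f = 0.
Proof.
move=> h; apply: smfun_eq => p Up; have := congr1 (fun f : S => f p) h.
rewrite smDDE // sm0E //; lra.
Qed.

Lemma smcstE c p : U p -> smcst U c p = c. Proof. by move=> Up; rewrite smkE. Qed.

Lemma smD_cst v c : smD v (smcst U c) = 0.
Proof.
apply: smfun_eq => p Up; rewrite smDE // sm0E // -[RHS](derive_cst c p v).
apply: near_eq_derive.
by apply: smnear Up _ => q Uq; rewrite smcstE.
Qed.

End SmDerivation.

(** * The frame bundle over a chart *)

Local Opaque derive.

Section Determinant.
Variables (R : realType) (V : normedModType R) (U : set V).
Hypothesis oU : open U.

Lemma Ck_det m k (M : V -> 'M[R]_m) : (forall i j, Ck k U (fun x => M x i j)) ->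
  Ck k U (fun x => \det (M x)).
Proof.
move=> h; rewrite /determinant; apply: Ck_sum => // s.
by apply: CkM => //; [exact: Ck_cst|apply: Ck_prod].
Qed.

Lemma Ck_invmx m k (M : V -> 'M[R]_m) : (forall i j, Ck k U (fun x => M x i j)) ->
  (forall x, U x -> M x \in unitmx) ->
  forall i j, Ck k U (fun x => invmx (M x) i j).
Proof.
move=> h u i j.
have hd : Ck k U (fun x => (\det (M x))^-1).
  apply: CkV => //; last exact: Ck_det.
  by move=> x /u; rewrite unitmxE unitfE.
have hc : Ck k U (fun x => cofactor (M x) j i).
  rewrite /cofactor; apply: CkM => //; first exact: Ck_cst.
  apply: Ck_det => a b; apply: (Ck_ext oU _ (h (lift j a) (lift i b))) => x Ux.
  by rewrite !mxE.
apply: (Ck_ext oU _ (CkM oU hd hc)) => x Ux.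
by rewrite /invmx (u x Ux) !mxE.
Qed.

End Determinant.

Section FrameSpace.
Variables (R : realType) (n : nat).

Definition fe (i : fidx n) : R * 'rV[R]_n * 'M[R]_n := match i with
  | None => ((1, 0), 0)
  | Some (inl k) => ((0, delta_mx ord0 k), 0)
  | Some (inr (c, k)) => ((0, 0), delta_mx c k) end.

Definition fl (i : fidx n) (p : R * 'rV[R]_n * 'M[R]_n) : R := match i with
  | None => p.1.1
  | Some (inl k) => p.1.2 ord0 k
  | Some (inr (c, k)) => p.2 c k end.

Lemma ler_entry_norm a b (M : 'M[R]_(a, b)) i j : `|M i j| <= `|M|.
Proof.
rewrite [leRHS]/Num.Def.normr /= mx_normrE.
exact: (le_bigmax _ (fun ij : 'I_a * 'I_b => `|M ij.1 ij.2|) (i, j)).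
Qed.

Lemma coordinates_frame : coordinates fe fl.
Proof.
split.
- by case=> [[k|[c k]]|] x w h /=; rewrite ?mxE.
- have l1 (A B : normedModType R) (x : A * B) : `|x.1| <= `|x| by rewrite prod_normE le_max lexx.
  have l2 (A B : normedModType R) (x : A * B) : `|x.2| <= `|x| by rewrite prod_normE le_max lexx orbT.
  case=> [[k|[c k]]|] [[t x] Y] /=.
  + apply: (le_trans (ler_entry_norm _ _ _)).
    exact: (le_trans (l2 _ _ (t, x)) (l1 _ _ ((t, x), Y))).
  + apply: (le_trans (ler_entry_norm _ _ _)); exact: (l2 _ _ ((t, x), Y)).
  + exact: (le_trans (l1 _ _ (t, x)) (l1 _ _ ((t, x), Y))).
- case=> [[t x] Y].
  have e1 (A B : normedModType R) (I : finType) (f : I -> A * B) : \sum_i f i = (\sum_i (f i).1, \sum_i (f i).2).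
    by rewrite [LHS]surjective_pairing; congr (_, _); [exact: (raddf_sum fst)|exact: (raddf_sum snd)].
  rewrite e1; congr (_, _); first rewrite e1; first congr (_, _).
  + rewrite sum_fidx big1 => [|k _]; last exact: mulr0.
    rewrite big1 => [|c _]; last by rewrite big1 // => k _; exact: mulr0.
    by rewrite !addr0 [RHS]mulr1.
  + rewrite sum_fidx /= scaler0 add0r [X in _ + X]big1 => [|c _]; last first.
      by rewrite big1 // => k _; rewrite scaler0.
    rewrite addr0; exact: row_sum_delta.
  + rewrite sum_fidx /= scaler0 add0r [X in X + _]big1 => [|k _]; last by rewrite scaler0.
    rewrite add0r; exact: matrix_sum_delta.
Qed.

Lemma fl_fe i j : fl j (fe i) = (i == j)%:R.
Proof.
case: i j => [[k|[c k]]|] [[l|[d l]]|] //=; rewrite ?mxE //.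
- by rewrite eqxx /= eq_sym.
- by rewrite [in RHS](_ : _ == _ = ((c, k) == (d, l))) // xpair_eqE [d == c]eq_sym [l == k]eq_sym.
Qed.

End FrameSpace.

Section Geometry.
Variables (R : realType) (n : nat).
Local Notation B := (R * 'rV[R]_n)%type.
Local Notation P := (R * 'rV[R]_n * 'M[R]_n)%type.
Variables (O : osub B) (G : B -> 'M[R]_n).
Hypothesis hG : forall i j k, Ck k O (fun q => G q i j).
Hypothesis uG : forall q, O q -> G q \in unitmx.

Lemma open_frames : open [set p : P | O p.1 /\ p.2 \in unitmx].
Proof.
have -> : [set p : P | O p.1 /\ p.2 \in unitmx] =
    (fst @^-1` O) `&` ((fun p => \det p.2) @^-1` [set x | x != 0]).
  by apply/seteqP; split=> p /= []; rewrite unitmxE unitfE.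
apply: openI; apply: open_comp.
- by move=> p _; exact: cvg_fst.
- exact: osub_open.
- move=> p _; apply: (@Ck_cont _ _ _ 0 setT _ p) => //.
  apply: Ck_det => [|c k]; first exact: openT.
  apply: (@Ck_lin _ _ (fl (iY c k))).
    by move=> q; exact: (coord_cont (coordinates_frame R n)).
  exact: (coordD (coordinates_frame R n) (iY c k)).
- exact: open_neq.
Qed.

Definition frames : osub P := OSub open_frames.
Local Notation A := (smfun frames).

Lemma Ck_fst f k : Ck k O f -> Ck k frames (f \o fst : P -> R).
Proof.
move=> h; apply: (@Ck_sub _ _ _ _ (fst @^-1` O)); first by move=> p [].
by apply: (@Ck_affine _ _ _ _ fst fst) h => // p; exact: cvg_fst.
Qed.

Definition bfun f (h : forall k, Ck k O f) : A := smk (fun k => Ck_fst (h k)).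

Lemma bfunE f h p : frames p -> @bfun f h p = f p.1.
Proof. by move=> Up; rewrite smkE. Qed.

Definition zf (i : fidx n) : A := smk (fun k =>
  Ck_lin (@coord_cont _ _ _ _ _ (coordinates_frame R n) i) (coordD (coordinates_frame R n) i) k frames).

Lemma zfE i p : frames p -> zf i p = fl i p.
Proof. by move=> Up; rewrite smkE. Qed.

Definition pdf (i : fidx n) : A -> A := smD (fe R i).

Definition mg : 'M[A]_n := \matrix_(i, j) bfun (hG i j).
Definition mgi : 'M[A]_n :=
  \matrix_(i, j) bfun (fun k => Ck_invmx (osub_open O) (fun i j => hG i j k) uG i j).

Lemma Ck_frame_inv k i j : Ck k frames (fun p : P => invmx p.2 i j).
Proof.
apply: Ck_invmx; first exact: osub_open; last by move=> p [].
move=> a b; exact: (Ck_lin (@coord_cont _ _ _ _ _ (coordinates_frame R n) (iY a b))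
  (coordD (coordinates_frame R n) (iY a b))).
Qed.
Definition myi : 'M[A]_n := \matrix_(i, j) smk (fun k => Ck_frame_inv k i j).

Definition mGam k i j : A := smcst frames 2^-1 * \sum_l mgi k l *
  (pdf (iX i) (mg j l) + pdf (iX j) (mg i l) - pdf (iX l) (mg i j)).

Lemma smf_sum (I : finType) (F : I -> A) p : frames p -> (\sum_i F i) p = \sum_i F i p.
Proof. by move=> Up; exact: (rmorph_sum (smev Up)). Qed.

(** The link between the algebra on frames and the coordinate formulas: on its domain the ring
    element [F] is the pullback of the function [f] of time and position. *)
Definition pulls (F : A) (f : B -> R) := forall p, frames p -> F p = f p.1.

Lemma pulls_mg i j : pulls (mg i j) (fun q => G q i j).
Proof. by move=> p Up; rewrite mxE bfunE. Qed.
Lemma pulls_mgi i j : pulls (mgi i j) (fun q => invmx (G q) i j).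
Proof. by move=> p Up; rewrite mxE bfunE. Qed.

Lemma derive_fst (f : B -> R) (p : P) v : 'D_v (f \o fst) p = 'D_(v.1) f p.1.
Proof. by rewrite (@derive_affine _ _ _ _ fst fst). Qed.

Lemma derive_slice (f : B -> R) (t : R) (x v : 'rV[R]_n) :
  'D_v (fun y => f (t, y)) x = 'D_(0, v) f (t, x).
Proof.
rewrite -[fun y => _]/(f \o (fun y => (t, y))).
rewrite (@derive_affine _ _ _ _ (fun y => (t, y)) (fun v => (0, v))) //.
by move=> y w h; rewrite -[RHS]/(h * 0 + t, h *: w + y) mulr0 add0r.
Qed.

Lemma pulls_pd F f i p : pulls F f -> frames p -> pdf i F p = 'D_((fe R i).1) f p.1.
Proof.
move=> h Up; rewrite /pdf (smDE _ _ Up) -derive_fst; apply: near_eq_derive.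
by apply: (smnear Up) => q Uq; rewrite h.
Qed.

Lemma pulls_px F f k p : pulls F f -> frames p ->
  pdf (iX k) F p = partial k (fun y => f (p.1.1, y)) p.1.2.
Proof.
by move=> h Up; rewrite (pulls_pd _ h Up) /partial derive_slice; case: p Up => [[]].
Qed.

Lemma pulls_pxp F f k : pulls F f ->
  pulls (pdf (iX k) F) (fun q => partial k (fun y => f (q.1, y)) q.2).
Proof. by move=> h p Up; exact: pulls_px. Qed.

Lemma pulls_py F f c k : pulls F f -> pdf (iY c k) F = 0.
Proof.
move=> h; apply: smfun_eq => p Up; rewrite (pulls_pd _ h Up) sm0E // /fe /=.
exact: derive0.
Qed.

Lemma pulls_Gam k i j : pulls (mGam k i j)
  (fun q => christoffel (fun y => G (q.1, y)) k i j q.2).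
Proof.
move=> p Up; rewrite /mGam smME // smcstE // smf_sum //; congr (_ * _).
apply: eq_bigr => l _; rewrite smME // smDDE // smNE // smDDE //.
rewrite (pulls_mgi _ _ Up) !(pulls_px _ (pulls_mg _ _) Up).
by case: p Up => [[]].
Qed.

Local Notation gR := (fR pdf mGam).

Lemma pulls_R l i j k : pulls (gR l i j k)
  (fun q => riemann (fun y => G (q.1, y)) l i j k q.2).
Proof.
move=> p Up; rewrite /fR /riemann !smDDE // !smNE // smf_sum //.
congr (_ - _ + _); [exact: (pulls_px _ (pulls_Gam _ _ _))|exact: (pulls_px _ (pulls_Gam _ _ _))|].
apply: eq_bigr => m _; rewrite smDDE // smNE // !(smME (mGam _ _ _) (mGam _ _ _)) //.
by rewrite !(pulls_Gam _ _ _ Up).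
Qed.

Lemma pulls_ric j k : pulls (fric pdf mGam j k)
  (fun q => ricci (fun y => G (q.1, y)) q.2 j k).
Proof.
by move=> p Up; rewrite /fric smf_sum // mxE; apply: eq_bigr => i _; rewrite (pulls_R _ _ _ _ Up).
Qed.

End Geometry.

(** * The Ricci flow on the frame bundle *)

(** Gram-Schmidt as block elimination: the Schur complement [C'] of the leading entry is positive
    definite and is normalised by the induction hypothesis. *)
Lemma orthonormal_frame (R : realType) (n : nat) (G : 'M[R]_n) : G^T = G ->
  (forall v, v != 0 -> 0 < qform G v) -> exists Y : 'M[R]_n, Y *m G *m Y^T = 1%:M.
Proof.
elim: n G => [|n IH] G Gs Gp.
  by exists 1%:M; apply/matrixP => -[].
pose G' : 'M[R]_(1 + n) := G.
pose a := ulsubmx G' ord0 ord0; pose b : 'rV[R]_n := ursubmx G'; pose C := drsubmx G'.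
have bT : dlsubmx G' = b^T by rewrite -[G']Gs trmx_ursub.
have CT : C^T = C by rewrite /C trmx_drsub [G'^T]Gs.
have GE : G' = block_mx a%:M b b^T C.
  by rewrite -[LHS]submxK bT [ulsubmx G']mx11_scalar.
have a0 : 0 < a.
  have := Gp (delta_mx ord0 ord0).
  have -> : qform G (delta_mx ord0 ord0) = a.
    rewrite /qform -rowE trmx_delta -colE /a !mxE; congr (G _ _); exact/val_inj.
  apply; apply/eqP => /rowP /(_ ord0); rewrite !mxE /= => /eqP; by rewrite oner_eq0.
pose C' := C - a^-1 *: (b^T *m b).
have [||Y' hY'] := IH C'.
- by rewrite /C' linearB /= CT linearZ /= trmx_mul trmxK.
(* [v] extends [w] by the first coordinate at which the form is least; the value there is the form
   of [C'] at [w]. *)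
- move=> w w0; pose v : 'rV[R]_(1 + n) := row_mx (- a^-1 *: (w *m b^T)) w.
  have := Gp v; have -> : qform G v = qform C' w.
    rewrite (_ : qform G v = (v *m G' *m v^T) ord0 ord0) // GE /v mul_row_block tr_row_mx mul_row_col.
    rewrite mul_mx_scalar scalerA mulrN mulfV ?gt_eqF // scaleN1r addNr mul0mx add0r.
    congr (fun_of_matrix _ _ _); rewrite /C' mulmxBr mulmxBl -!scalemxAr -!scalemxAl.
    by rewrite mulmxDl -!scalemxAl scaleNr addrC !mulmxA.
  apply; apply/eqP => /(congr1 (@rsubmx _ 1 1 n)); rewrite row_mxKr linear0 => e.
  by rewrite e eqxx in w0.
pose L : 'M[R]_(1 + n) := block_mx 1%:M 0 (- a^-1 *: b^T) 1%:M.
pose S : 'M[R]_(1 + n) := block_mx (Num.sqrt a)^-1%:M 0 0 Y'.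
have LGL : L *m G' *m L^T = block_mx a%:M 0 0 C'.
  rewrite GE /L tr_block_mx !mulmx_block !trmx1 trmx0 !mul1mx !mulmx1 !mul0mx !mulmx0 ?addr0 ?add0r.
  have e1 : - a^-1 *: b^T *m a%:M + b^T = 0.
    by rewrite mul_mx_scalar scalerA mulrN mulfV ?gt_eqF // scaleN1r addNr.
  rewrite e1 mul0mx add0r linearZ /= trmxK mul_scalar_mx scalerA mulrN mulfV ?gt_eqF //.
  rewrite scaleN1r addNr /C'; congr block_mx.
  by rewrite -scalemxAl scaleNr addrC.
exists (S *m L); suff : S *m L *m G' *m (S *m L)^T = 1%:M by [].
rewrite trmx_mul mulmxA -(mulmxA S) -(mulmxA S) LGL.
rewrite /S tr_block_mx !mulmx_block !trmx0 !mulmx0 !mul0mx !addr0 !add0r.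
rewrite hY' tr_scalar_mx -!scalar_mxM [RHS]scalar_mx_block; congr block_mx.
all: rewrite ?mul0mx //; congr (_%:M).
by rewrite mulrAC -expr2 exprVn sqr_sqrtr ?ltW // mulVf // gt_eqF.

Qed.

(** * The frame calculus of a Ricci flow in a chart *)

Section Flow.
Variables (R : realType) (n : nat).
Local Notation B := (R * 'rV[R]_n)%type.
Local Notation P := (R * 'rV[R]_n * 'M[R]_n)%type.
Variables (O : osub B) (G : B -> 'M[R]_n).
Hypothesis hG : forall i j k, Ck k O (fun q => G q i j).
Hypothesis uG : forall q, O q -> G q \in unitmx.
Hypothesis sG : forall q, O q -> (G q)^T = G q.

Local Notation U := (frames O).
Local Notation A := (smfun U).
Local Notation pd := (@pdf R n O).
Local Notation z := (@zf R n O).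
Local Notation g := (mg hG).
Local Notation gi := (mgi hG uG).
Local Notation yi := (@myi R n O).
Local Notation Gam := (mGam hG uG).

Lemma sm_mulmx (M N : 'M[A]_n) i j p : U p ->
  ((M *m N) i j) p = \sum_k M i k p * N k j p.
Proof.
by move=> Up; rewrite mxE smf_sum //; apply: eq_bigr => k _; rewrite smME.
Qed.

Lemma sm_nat m p : U p -> (m%:R : A) p = m%:R.
Proof. by move=> Up; exact: (rmorph_nat (smev Up)). Qed.

Lemma sm_mulmx1 (M N : 'M[A]_n) (M' N' : P -> 'M[R]_n) :
  (forall i j p, U p -> M i j p = M' p i j) -> (forall i j p, U p -> N i j p = N' p i j) ->
  (forall p, U p -> M' p *m N' p = 1%:M) -> M *m N = 1%:M.
Proof.
move=> hM hN h; apply/matrixP => i j; apply: smfun_eq => p Up.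
rewrite sm_mulmx // [in RHS]mxE sm_nat //.
have := congr1 (fun X : 'M[R]_n => X i j) (h p Up); rewrite !mxE => <-.
by apply: eq_bigr => k _; rewrite hM // hN.
Qed.

Let yE i j p : U p -> fy z i j p = p.2 i j.
Proof. by move=> Up; rewrite mxE zfE. Qed.
Let yiE i j p : U p -> yi i j p = invmx p.2 i j.
Proof. by move=> Up; rewrite mxE smkE. Qed.
Let gE i j p : U p -> g i j p = G p.1 i j.
Proof. by move=> Up; rewrite (pulls_mg hG i j Up). Qed.
Let giE i j p : U p -> gi i j p = invmx (G p.1) i j.
Proof. by move=> Up; rewrite (pulls_mgi hG uG i j Up). Qed.

Lemma geom_yyi : fy z *m yi = 1%:M.
Proof.
by apply: (sm_mulmx1 (M' := fun p => p.2) (N' := fun p => invmx p.2)) => // p [_]; exact: mulmxV.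
Qed.
Lemma geom_yiy : yi *m fy z = 1%:M.
Proof.
by apply: (sm_mulmx1 (N' := fun p => p.2) (M' := fun p => invmx p.2)) => // p [_]; exact: mulVmx.
Qed.
Lemma geom_ggi : g *m gi = 1%:M.
Proof.
apply: (sm_mulmx1 (M' := fun p => G p.1) (N' := fun p => invmx (G p.1))) => // p [Op _].
exact: mulmxV (uG Op).
Qed.
Lemma geom_gig : gi *m g = 1%:M.
Proof.
apply: (sm_mulmx1 (N' := fun p => G p.1) (M' := fun p => invmx (G p.1))) => // p [Op _].
exact: mulVmx (uG Op).
Qed.
Lemma geom_sym : g^T = g.
Proof.
apply/matrixP => i j; apply: smfun_eq => p Up; rewrite mxE !gE //.
by rewrite -{1}(sG Up.1) mxE.
Qed.

Lemma geom_pd_z i j : pd i (z j) = (i == j)%:R.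
Proof.
apply: smfun_eq => p Up; rewrite sm_nat // -(fl_fe R) /pdf smDE //.
rewrite -[RHS](@derive_lin _ _ (fl j) (@coordD _ _ _ _ _ (coordinates_frame R n) j) p).
by apply: near_eq_derive; apply: (smnear Up) => q Uq; rewrite zfE.
Qed.

Lemma geom_Gam_sym k i j : Gam k i j = Gam k j i.
Proof.
rewrite /mGam; congr (_ * _); apply: eq_bigr => l _; congr (_ * _).
have -> : g j i = g i j by rewrite -{1}geom_sym mxE.
by rewrite [X in X - _]addrC.
Qed.

(** Once [lower] has cancelled [g] against its inverse, the two Christoffel symbols add up: the
    derivative along m occurs twice with weight 1/2, and the others cancel. *)
Lemma geom_Gam_compat m k l : pd (iX m) (g k l) =
  \sum_p Gam p m k * g p l + \sum_p Gam p m l * g k p.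
Proof.
have dpd i : derivation (pd i) by exact: smD_der.
pose c : A := smcst U 2^-1.
have c2 : c + c = 1.
  by apply: smfun_eq => p Up; rewrite smDDE // sm1E // smcstE //; field.
have gis a b : gi a b = gi b a.
  have h : gi^T = gi.
    have : (g *m gi)^T = 1%:M by rewrite geom_ggi trmx1.
    rewrite trmx_mul geom_sym => h; rewrite -[LHS]mulmx1 -geom_ggi mulmxA h mul1mx.
    exact: erefl.
  by rewrite -{1}h mxE.
have gs a b : g a b = g b a by rewrite -{1}geom_sym mxE.
have lower (X : 'I_n -> A) l' : \sum_p (c * \sum_q gi p q * X q) * g p l' = c * X l'.
  transitivity (c * \sum_q (\sum_p gi q p * g p l') * X q).
    rewrite mulr_sumr.
    under [RHS]eq_bigr do rewrite mulr_suml mulr_sumr.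
    rewrite exchange_big; apply: eq_bigr => p _ /=.
    rewrite -mulrA mulr_suml mulr_sumr; apply: eq_bigr => q _.
    by rewrite (gis p q); ring.
  congr (_ * _).
  under eq_bigr => q _.
    have -> : \sum_p gi q p * g p l' = (q == l')%:R.
      by have := congr1 (fun M : 'M[A]_n => M q l') geom_gig; rewrite !mxE.
    over.
  exact: sum_delta.
rewrite /mGam -/c.
have -> : \sum_p c * (\sum_l0 gi p l0 * (pd (iX m) (g l l0) + pd (iX l) (g m l0)
    - pd (iX l0) (g m l))) * g k p = c * (pd (iX m) (g l k) + pd (iX l) (g m k) - pd (iX k) (g m l)).
  rewrite -(lower (fun q => pd (iX m) (g l q) + pd (iX l) (g m q) - pd (iX q) (g m l)) k).
  by apply: eq_bigr => p _; rewrite (gs k p).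
rewrite (lower (fun q => pd (iX m) (g k q) + pd (iX k) (g m q) - pd (iX q) (g m k)) l).
rewrite (gs l k); set X := pd _ _; set Y := pd _ _; set Z := pd _ _.
transitivity ((c + c) * X); first by rewrite c2 mul1r.
ring.
Qed.

Hypothesis flow : forall q a b, O q ->
  'D_((1, 0) : B) (fun q => G q a b) q = - 2 * ricci (fun y => G (q.1, y)) q.2 a b.

Definition gD := fD pd z Gam.
Definition gE_ := fE pd z.
Definition gDt := fDt pd z gi Gam.
Definition gGi a b := fGi gi yi a b.
Definition gRm := fRm pd z g Gam.

Lemma geom_calculus : frame_calculus gD gE_ gDt (fun a b => fG z g a b) gGi gRm
  (fs pd z g gi Gam).
Proof.
apply: frame_bundle_calculus.
- exact: sm_half.
- by move=> i; exact: smD_der.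
- by move=> i j F; exact: smD_comm.
- exact: geom_pd_z.
- exact: geom_yyi.
- exact: geom_yiy.
- exact: geom_ggi.
- exact: geom_gig.
- exact: geom_sym.
- by move=> c k i j; exact: (pulls_py _ _ (pulls_mg hG i j)).
- by move=> c k i j; exact: (pulls_py _ _ (pulls_mgi hG uG i j)).
- by move=> c k l i j; exact: (pulls_py _ _ (pulls_Gam hG uG l i j)).
- exact: geom_Gam_sym.
- exact: geom_Gam_compat.
- move=> i j; apply: smfun_eq => p Up; rewrite (pulls_pd _ (pulls_mg hG i j) Up).
  rewrite smNE // smDDE // (pulls_ric hG uG i j Up) flow; last exact: Up.1.
  ring.
Qed.

End Flow.

(** * Curvature norms in coordinates *)

Section Raw.
Variables (R : realType) (n : nat).
Implicit Types (Gs : 'rV[R]_n -> 'M[R]_n) (y : 'rV[R]_n).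

Definition raw_Rl Gs i j k l y := \sum_m riemann Gs m i j k y * Gs y m l.

Definition raw_DR Gs m i j k l y := partial m (raw_Rl Gs i j k l) y
  - \sum_p christoffel Gs p m i y * raw_Rl Gs p j k l y
  - \sum_p christoffel Gs p m j y * raw_Rl Gs i p k l y
  - \sum_p christoffel Gs p m k y * raw_Rl Gs i j p l y
  - \sum_p christoffel Gs p m l y * raw_Rl Gs i j k p y.

(** The radicand of [riemann_norm]. *)
Definition rm_sq Gs y := \sum_l \sum_l' \sum_i \sum_i' \sum_j \sum_j' \sum_k \sum_k'
    Gs y l l' * invmx (Gs y) i i' * invmx (Gs y) j j' * invmx (Gs y) k k'
    * riemann Gs l i j k y * riemann Gs l' i' j' k' y.

(* The squared norm of the covariant derivative of the curvature tensor. *)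
Definition drm_sq Gs y :=
  \sum_(qm : 'I_n * 'I_n) invmx (Gs y) qm.1 qm.2 * \sum_(ql : 'I_n * 'I_n) invmx (Gs y) ql.1 ql.2 *
  \sum_(qk : 'I_n * 'I_n) invmx (Gs y) qk.1 qk.2 * \sum_(qj : 'I_n * 'I_n) invmx (Gs y) qj.1 qj.2 *
  \sum_(qi : 'I_n * 'I_n) invmx (Gs y) qi.1 qi.2 *
   (raw_DR Gs qm.1 qi.1 qj.1 qk.1 ql.1 y * raw_DR Gs qm.2 qi.2 qj.2 qk.2 ql.2 y).

Section Local.
Variables (G1 G2 : 'rV[R]_n -> 'M[R]_n).

Lemma near_partial (f1 f2 : 'rV[R]_n -> R) y k : (\forall z \near y, f1 z = f2 z) ->
  \forall z \near y, partial k f1 z = partial k f2 z.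
Proof.
move/nbhs_interior; apply: filterS => z h; rewrite /partial.
exact: near_eq_derive.
Qed.

Lemma near_forall (I : finType) (f1 f2 : I -> 'rV[R]_n -> R) y :
  (forall i, \forall z \near y, f1 i z = f2 i z) ->
  \forall z \near y, forall i, f1 i z = f2 i z.
Proof.
move=> h.
exact: (@filter_forall _ I (fun i z => f1 i z = f2 i z) (nbhs y) (nbhs_filter y) h).
Qed.

Lemma near_christoffel y k i j : (\forall z \near y, G1 z = G2 z) ->
  \forall z \near y, christoffel G1 k i j z = christoffel G2 k i j z.
Proof.
move=> h.
have hp a b c : \forall z \near y, partial c (fun z => G1 z a b) z = partial c (fun z => G2 z a b) z.
  by apply: near_partial; apply: filterS h => z ->.
have h1 : \forall z \near y, forall l, partial i (fun z => G1 z j l) z = partial i (fun z => G2 z j l) z.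
  by apply: near_forall => l; exact: hp.
have h2 : \forall z \near y, forall l, partial j (fun z => G1 z i l) z = partial j (fun z => G2 z i l) z.
  by apply: near_forall => l; exact: hp.
have h3 : \forall z \near y, forall l, partial l (fun z => G1 z i j) z = partial l (fun z => G2 z i j) z.
  by apply: near_forall => l; exact: hp.
apply: filterS (filterI (filterI h h1) (filterI h2 h3)) => z [[e e1] [e2 e3]].
by rewrite /christoffel e; congr (_ * _); apply: eq_bigr => l _; rewrite e1 e2 e3.
Qed.

Lemma near_riemann y l i j k : (\forall z \near y, G1 z = G2 z) ->
  \forall z \near y, riemann G1 l i j k z = riemann G2 l i j k z.
Proof.
move=> h.
have h0 : \forall z \near y, forall q : 'I_n * 'I_n * 'I_n,
    christoffel G1 q.1.1 q.1.2 q.2 z = christoffel G2 q.1.1 q.1.2 q.2 z.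
  by apply: near_forall => q; exact: near_christoffel.
have h1 := near_partial i (near_christoffel l j k h).
have h2 := near_partial j (near_christoffel l i k h).
apply: filterS (filterI h0 (filterI h1 h2)) => z [e [e1 e2]].
by rewrite /riemann e1 e2; congr (_ + _); apply: eq_bigr => m _; rewrite (e (l, i, m)) (e (m, j, k)) (e (l, j, m)) (e (m, i, k)).
Qed.

Lemma near_Rl y i j k l : (\forall z \near y, G1 z = G2 z) ->
  \forall z \near y, raw_Rl G1 i j k l z = raw_Rl G2 i j k l z.
Proof.
move=> h.
have h0 : \forall z \near y, forall m, riemann G1 m i j k z = riemann G2 m i j k z.
  by apply: near_forall => ?; exact: near_riemann.
apply: filterS (filterI h0 h) => z [e1 e2].
by apply: eq_bigr => m _; rewrite e1 e2.
Qed.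

(** Only the germ of the metric matters, so that in each time slice of [0, T] the flow may be
    replaced by a smooth extension of it. *)
Lemma local_rm_sq y : (\forall z \near y, G1 z = G2 z) -> rm_sq G1 y = rm_sq G2 y.
Proof.
move=> h; have e l i j k := nbhs_singleton (near_riemann l i j k h).
rewrite /rm_sq (nbhs_singleton h).
do 8!(apply: eq_bigr => ? _); by rewrite !e.
Qed.

Lemma local_drm_sq y : (\forall z \near y, G1 z = G2 z) -> drm_sq G1 y = drm_sq G2 y.
Proof.
move=> h; have e i j k l := nbhs_singleton (near_Rl i j k l h).
have eG l i j := nbhs_singleton (near_christoffel l i j h).
have ep m i j k l := nbhs_singleton (near_partial m (near_Rl i j k l h)).
have eD m i j k l : raw_DR G1 m i j k l y = raw_DR G2 m i j k l y.
  by rewrite /raw_DR ep; congr (_ - _ - _ - _ - _); apply: eq_bigr => p _; rewrite eG e.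
rewrite /drm_sq (nbhs_singleton h).
do 5!(apply: eq_bigr => ? _; congr (_ * _)); by rewrite !eD.
Qed.

End Local.
End Raw.

(** * Frame norms as coordinate expressions *)

Section Values.
Variables (R : realType) (n : nat).
Local Notation B := (R * 'rV[R]_n)%type.
Local Notation P := (R * 'rV[R]_n * 'M[R]_n)%type.
Variables (O : osub B) (G : B -> 'M[R]_n).
Hypothesis hG : forall i j k, Ck k O (fun q => G q i j).
Hypothesis uG : forall q, O q -> G q \in unitmx.
Hypothesis sG : forall q, O q -> (G q)^T = G q.

Local Notation U := (frames O).
Local Notation A := (smfun U).
Local Notation pd := (@pdf R n O).
Local Notation z := (@zf R n O).
Local Notation g := (mg hG).
Local Notation gi := (mgi hG uG).
Local Notation yi := (@myi R n O).
Local Notation Gam := (mGam hG uG).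
Local Notation Gs p := (fun y => G (p.1.1, y)).

Lemma pulls_Rl i j k l : pulls (fRl pd g Gam i j k l)
  (fun q => raw_Rl (fun y => G (q.1, y)) i j k l q.2).
Proof.
move=> p Up; rewrite /fRl smf_sum // /raw_Rl; apply: eq_bigr => m _.
rewrite smME // (pulls_R hG uG _ _ _ _ Up) (pulls_mg hG _ _ Up).
by case: p Up => [[]].
Qed.

Lemma pulls_DR m i j k l : pulls (fDR pd g Gam m i j k l)
  (fun q => raw_DR (fun y => G (q.1, y)) m i j k l q.2).
Proof.
have ps (F : 'I_n -> A) (f : 'I_n -> B -> R) : (forall a, pulls (F a) (f a)) ->
    pulls (\sum_a F a) (fun q => \sum_a f a q).
  by move=> h p Up; rewrite smf_sum //; apply: eq_bigr => a _; rewrite h.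
have pm (F F' : A) f f' : pulls F f -> pulls F' f' -> pulls (F * F') (fun q => f q * f' q).
  by move=> h h' p Up; rewrite smME // h // h'.
have pb (F F' : A) f f' : pulls F f -> pulls F' f' -> pulls (F - F') (fun q => f q - f' q).
  by move=> h h' p Up; rewrite smDDE // smNE // h // h'.
rewrite /fDR /raw_DR.
apply: (pb); last by apply: ps => a; apply: pm; [exact: pulls_Gam|exact: pulls_Rl].
apply: (pb); last by apply: ps => a; apply: pm; [exact: pulls_Gam|exact: pulls_Rl].
apply: (pb); last by apply: ps => a; apply: pm; [exact: pulls_Gam|exact: pulls_Rl].
apply: (pb); last by apply: ps => a; apply: pm; [exact: pulls_Gam|exact: pulls_Rl].
exact: (pulls_pxp _ (pulls_Rl _ _ _ _)).
Qed.

Lemma normRm_value p : U p -> normRm (gGi hG uG) (gRm hG uG) p = rm_sq (Gs p) p.1.2.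
Proof.
case: p => [[t x] Y] Up.
rewrite (frame_normRm _ _ (geom_yiy O) (geom_ggi hG uG) (geom_sym hG sG)).
pose e := rmorph_sum (smev Up).
do 8!(rewrite [LHS]e; apply: eq_bigr => ? _).
rewrite !(rmorphM (smev Up)).
congr (_ * _ * _ * _ * _ * _).
- exact: (pulls_mg hG _ _ Up).
- exact: (pulls_mgi hG uG _ _ Up).
- exact: (pulls_mgi hG uG _ _ Up).
- exact: (pulls_mgi hG uG _ _ Up).
- exact: (pulls_R hG uG _ _ _ _ Up).
- exact: (pulls_R hG uG _ _ _ _ Up).
Qed.

Lemma normDRm_value p : U p ->
  normDRm (gD hG uG) (gGi hG uG) (gRm hG uG) p = drm_sq (Gs p) p.1.2.
Proof.
case: p => [[t x] Y] Up; rewrite /gD /gRm.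
rewrite (frame_normDRm gi (fun i => smD_der U (fe R i) : derivation (pd i)) (fun i j F => smD_comm (fe R i) (fe R j) F)
  (@geom_pd_z R n O) (geom_yiy O)
  (fun c k i j => pulls_py c k (pulls_mg hG i j))
  (fun c k l i j => pulls_py c k (pulls_Gam hG uG l i j))).
pose e := rmorph_sum (smev Up).
do 5!(rewrite [LHS]e; apply: eq_bigr => ? _; rewrite [LHS]smME //; congr (_ * _);
  first exact: (pulls_mgi hG uG _ _ Up)).
rewrite [LHS]smME //; congr (_ * _); exact: (pulls_DR _ _ _ _ _ Up).
Qed.

Lemma frame_unit t x Y : O (t, x) -> Y *m G (t, x) *m Y^T = 1%:M -> U ((t, x), Y).
Proof.
move=> Oq h; split=> //=; have := unitmx1 R n; rewrite -h !unitmx_mul.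
by case/andP => /andP[].
Qed.

(** At an orthonormal frame the metric is the identity matrix, and so is its inverse; this is the
    hypothesis under which the pointwise bounds were stated. *)
Lemma gGi_orthonormal p (Up : U p) : p.2 *m G p.1 *m p.2^T = 1%:M ->
  forall a b, smev Up (gGi hG uG a b) = (a == b)%:R.
Proof.
move=> h a b.
have e : map_mx (smev Up) (fG z g) = 1%:M.
  rewrite /fG !map_mxM /= -h; congr (_ *m _ *m _); apply/matrixP => i j; rewrite !mxE /smev.
  - by rewrite zfE.
  - by rewrite bfunE.
  - by rewrite zfE.
have := congr1 (map_mx (smev Up)) (fGGi (geom_yyi O) (geom_yiy O) (geom_ggi hG uG)).
rewrite map_mxM map_mx1 e mul1mx => /matrixP /(_ a b).
by rewrite [LHS]mxE [RHS]mxE.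
Qed.

End Values.

(** * Invariance under changes of charts *)

Section ChainRule.
Variables (R : realType) (V W : normedModType R) (I : finType).
Variables (e : I -> W) (l : I -> W -> R).
Hypothesis co : coordinates e l.

(** [Psi] is differentiated in the single direction v: on the line through p it is a differentiable
    curve, to which the total derivative of [f] is applied. *)
Lemma chain_rule (f : W -> R) (N : set W) (Psi : V -> W) p v : open N -> Ck 1 N f ->
  N (Psi p) -> (forall k, derivable (l k \o Psi) p v) ->
  derivable (f \o Psi) p v /\
  'D_v (f \o Psi) p = \sum_k 'D_v (l k \o Psi) p * 'D_(e k) f (Psi p).
Proof.
move=> oN hf Np hd.
pose L (s : R) := p + s *: v.
have Ll (x w h : R) : L (h *: w + x) = h *: (w *: v) + L x.
  by rewrite /L scalerDl -scalerA addrCA.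
have L0 : L 0 = p by rewrite /L scale0r addr0.
pose ga := Psi \o L.
have dk k : is_derive (0 : R) 1 (fun s => l k (ga s) *: e k) ('D_v (l k \o Psi) p *: e k).
  have h1 : is_derive (0 : R) 1 ((l k \o Psi) \o L) ('D_v (l k \o Psi) p).
    apply: (is_derive_affine Ll); rewrite scale1r L0; exact: derivableP.
  have df : differentiable ((l k \o Psi) \o L) (0 : R) by apply/derivable1_diffP; exact: ex_derive.
  have dz := differentiableZl (e k) df.
  split; first by apply/derivable1_diffP.
  rewrite deriveE // (diffZl _ df) /= -deriveE //.
  by rewrite derive_val.
have gaE : ga = \sum_k (fun s => l k (ga s) *: e k).
  apply/funext => s; rewrite fct_sumE; exact: (coordE co).
have dga : is_derive (0 : R) 1 ga (\sum_k 'D_v (l k \o Psi) p *: e k).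
  rewrite [X in is_derive _ _ X _]gaE.
  elim/big_ind2: _ => [|x1 x2 y1 y2 h1 h2|k _]; [exact: is_derive_cst| |exact: dk].
  exact: is_deriveD.
have Nga : N (ga 0) by rewrite /ga /= L0.
have [df dfE] := C1_differentiable co oN hf Nga.
have dg : differentiable ga (0 : R) by apply/derivable1_diffP; exact: ex_derive.
have dc : differentiable (f \o ga) (0 : R) by apply: differentiable_comp.
have h0 : is_derive (0 : R) 1 (f \o ga) (\sum_k 'D_v (l k \o Psi) p * 'D_(e k) f (Psi p)).
  split; first exact: diff_derivable.
  rewrite deriveE // diff_comp //= -(deriveE _ dg) derive_val linear_sum.
  by apply: eq_bigr => k _; rewrite linearZ -deriveE // /ga /= L0.
split.
  apply/derivable1P; have := @ex_derive _ _ _ _ _ _ _ h0.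
  rewrite (_ : f \o ga = fun h : R => (f \o Psi) (h *: v + p)) //.
  by apply/funext => s; rewrite /ga /L /= addrC.
have := @derive_val _ _ _ _ _ _ _ h0.
rewrite -[f \o ga]/((f \o Psi) \o L) (derive_affine Ll) scale1r L0.
exact.
Qed.

End ChainRule.

Section Coordinates.
Variables (R : realType) (n : nat).

Lemma coordinates_rV : coordinates (fun k => delta_mx ord0 k : 'rV[R]_n)
  (fun k (v : 'rV[R]_n) => v ord0 k).
Proof.
split.
- by move=> i x w h; rewrite !mxE.
- by move=> i v; exact: ler_entry_norm.
- by move=> v; exact: row_sum_delta.
Qed.

Lemma Ck_entry (V : normedModType R) k (U : set V) (f : V -> 'rV[R]_n) l :
  open U -> Ck k U f -> Ck k U (fun x => f x ord0 l).
Proof.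
move=> oU; elim: k f => [|k IH] f hf.
  split=> // x Ux; apply: (@continuous_comp _ _ _ f (fun w : 'rV[R]_n => w ord0 l)).
    exact: (Ck_cont hf).
  exact: (@coord_cont _ _ _ _ _ coordinates_rV l).
split=> [x Ux|v].
  apply: (@continuous_comp _ _ _ f (fun w : 'rV[R]_n => w ord0 l)).
    exact: (Ck_cont hf).
  exact: (@coord_cont _ _ _ _ _ coordinates_rV l).
split=> [x Ux|].
  exact: ((derivable_mxP _ _ _).1 (Ck_derivable hf v Ux)).
apply: (Ck_ext oU _ (IH _ (Ck_D v hf))) => x Ux.
by rewrite (derive_mx (Ck_derivable hf v Ux)) mxE.
Qed.

Lemma C1_differentiable_rV (f : 'rV[R]_n -> 'rV[R]_n) U x : open U ->
  (forall l, Ck 1 U (fun y => f y ord0 l)) -> U x -> differentiable f x.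
Proof.
move=> oU hf Ux.
have -> : f = \sum_(l < n) (fun y => f y ord0 l *: (delta_mx ord0 l : 'rV[R]_n)).
  by apply/funext => y; rewrite fct_sumE; exact: row_sum_delta.
apply: differentiable_sum => l; apply: differentiableZl.
by have [] := C1_differentiable coordinates_rV oU (hf l) Ux.
Qed.

Lemma jacobian_entries (f : 'rV[R]_n -> 'rV[R]_n) U x : open U ->
  (forall l, Ck 1 U (fun y => f y ord0 l)) -> U x ->
  'J f x = \matrix_(k, l) partial k (fun y => f y ord0 l) x.
Proof.
move=> oU hf Ux; have d := C1_differentiable_rV oU hf Ux.
apply/matrixP => k l; rewrite [RHS]mxE /partial.
have e := deriveEjacobian (delta_mx ord0 k) d.
have := congr1 (fun v : 'rV[R]_n => v ord0 l) e.
rewrite -rowE [X in _ = X]mxE => <-.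
by rewrite derive_mx ?mxE //; exact: diff_derivable.
Qed.

End Coordinates.

(** * Transformation of the Christoffel symbols *)

Section Invariance.
Variables (R : realType) (n : nat).
Local Notation V := 'rV[R]_n.
Variables (N1 N2 : osub V) (h1 h2 : V -> 'M[R]_n) (tau : V -> V).
Hypothesis hh1 : forall i j k, Ck k N1 (fun y => h1 y i j).
Hypothesis hh2 : forall i j k, Ck k N2 (fun y => h2 y i j).
Hypothesis u1 : forall y, N1 y -> h1 y \in unitmx.
Hypothesis u2 : forall y, N2 y -> h2 y \in unitmx.
Hypothesis s1 : forall y, N1 y -> (h1 y)^T = h1 y.
Hypothesis s2 : forall y, N2 y -> (h2 y)^T = h2 y.
Hypothesis tauN : forall y, N1 y -> N2 (tau y).
Hypothesis htau : forall l k, Ck k N1 (fun y => tau y ord0 l).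
Definition inv_J (y : V) : 'M[R]_n := \matrix_(k, l) partial k (fun y => tau y ord0 l) y.
Hypothesis hJ : forall y, N1 y -> h1 y = inv_J y *m h2 (tau y) *m (inv_J y)^T.

Lemma open_static (N : osub V) : open [set q : R * V | N q.2].
Proof. by apply: open_comp; [move=> q _; exact: cvg_snd|exact: osub_open]. Qed.
Definition static (N : osub V) : osub (R * V)%type := OSub (@open_static N).

Lemma Ck_static (N : osub V) (f : V -> R) k : Ck k N f -> Ck k (static N) (fun q : R * V => f q.2).
Proof.
move=> h; apply: (@Ck_affine _ _ _ _ snd snd) h => // q; exact: cvg_snd.
Qed.

Let O1 := static N1.
Let O2 := static N2.
Let G1 (q : R * V) := h1 q.2.
Let G2 (q : R * V) := h2 q.2.
Let hG1 i j k : Ck k O1 (fun q => G1 q i j). Proof. exact: (Ck_static (hh1 i j k)). Qed.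
Let hG2 i j k : Ck k O2 (fun q => G2 q i j). Proof. exact: (Ck_static (hh2 i j k)). Qed.
Let uG1 q : O1 q -> G1 q \in unitmx. Proof. exact: u1. Qed.
Let uG2 q : O2 q -> G2 q \in unitmx. Proof. exact: u2. Qed.
Let sG1 q : O1 q -> (G1 q)^T = G1 q. Proof. exact: s1. Qed.
Let sG2 q : O2 q -> (G2 q)^T = G2 q. Proof. exact: s2. Qed.

Lemma inv_J_unit y : N1 y -> inv_J y \in unitmx.
Proof.
by move=> Ny; have := u1 Ny; rewrite (hJ Ny) !unitmx_mul => /andP[/andP[]].
Qed.

Lemma Ck_J r l k : Ck k N1 (fun y => inv_J y r l).
Proof.
apply: (Ck_ext (osub_open N1) _ (Ck_D (delta_mx ord0 r) (htau l k.+1))) => y Ny.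
by rewrite mxE.
Qed.

(** A single metric is a family constant in time; the identity on the frame bundle is evaluated at
    the identity frame. *)
Lemma static_compat (N : osub V) (h : V -> 'M[R]_n)
    (hh : forall i j k, Ck k N (fun y => h y i j)) (u : forall y, N y -> h y \in unitmx)
    (s : forall y, N y -> (h y)^T = h y) y m k l : N y ->
  partial m (fun y => h y k l) y = \sum_p christoffel h p m k y * h y p l
    + \sum_p christoffel h p m l y * h y k p.
Proof.
move=> Ny; pose G (q : R * V) := h q.2.
have hG i j k' : Ck k' (static N) (fun q => G q i j) := Ck_static (hh i j k').
have uG q : static N q -> G q \in unitmx := @u q.2.
have sG q : static N q -> (G q)^T = G q := @s q.2.
have Up : frames (static N) ((0, y), 1%:M) by split=> //=; exact: unitmx1.
have := congr1 (smev Up) (geom_Gam_compat hG uG sG m k l).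
rewrite rmorphD !rmorph_sum => e.
transitivity (smev Up (pdf (iX m) (mg hG k l))).
  symmetry; exact: (pulls_px _ (pulls_mg hG _ _) Up).
rewrite e; congr (_ + _); apply: eq_bigr => p _; rewrite rmorphM; congr (_ * _).
- exact: (pulls_Gam hG uG _ _ _ Up).
- exact: (pulls_mg hG _ _ Up).
- exact: (pulls_Gam hG uG _ _ _ Up).
- exact: (pulls_mg hG _ _ Up).
Qed.

Lemma static_sym (N : osub V) (h : V -> 'M[R]_n) (s : forall y, N y -> (h y)^T = h y)
  y k i j : N y -> christoffel h k i j y = christoffel h k j i y.
Proof.
move=> Ny; rewrite /christoffel; congr (_ * _); apply: eq_bigr => l _; congr (_ * _).
have -> : partial l (fun y => h y i j) y = partial l (fun y => h y j i) y.
  apply: near_eq_derive.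
  have nN : nbhs y N by apply: open_nbhs_nbhs; split=> //; exact: osub_open.
  by apply: filterS nN => w Nw; rewrite -{1}(s w Nw) mxE.
by congr (_ - _); exact: addrC.
Qed.

(** The transformation law, solved for the pulled back matrix, expresses it by [h1] and the inverse
    Jacobian. *)
Lemma Ck_h2tau l u k : Ck k N1 (fun y => h2 (tau y) l u).
Proof.
have iJ a b : Ck k N1 (fun y => invmx (inv_J y) a b).
  apply: (Ck_invmx (osub_open N1)); [by move=> *; exact: Ck_J|exact: inv_J_unit].
have oN := osub_open N1.
have h : Ck k N1 (fun y => \sum_b (\sum_a invmx (inv_J y) l a * h1 y a b) * invmx (inv_J y) u b).
  apply: Ck_sum => // b; apply: CkM => //; apply: Ck_sum => // a.
  by apply: CkM.
apply: (Ck_ext oN _ h) => y Ny.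
transitivity ((invmx (inv_J y) *m h1 y *m (invmx (inv_J y))^T) l u).
  by rewrite mxE; apply: eq_bigr => b _; rewrite !mxE.
rewrite (hJ Ny) !mulmxA mulVmx ?inv_J_unit // mul1mx -mulmxA -trmx_mul.
by rewrite mulVmx ?inv_J_unit // trmx1 mulmx1.
Qed.

Lemma der_mulmx (A : comPzRingType) (d : A -> A) (M N : 'M[A]_n) : derivation d ->
  map_mx d (M *m N) = map_mx d M *m N + M *m map_mx d N.
Proof.
move=> hd; apply/matrixP => i j; rewrite !mxE (der_sum hd) -big_split.
by apply: eq_bigr => k _; rewrite /= (derM hd) !mxE.
Qed.

Lemma near_N1 (P : V -> Prop) y : N1 y -> (forall w, N1 w -> P w) -> \forall w \near y, P w.
Proof. exact: smnear. Qed.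

Lemma derive_h2tau y k l u : N1 y -> partial k (fun y => h2 (tau y) l u) y =
  \sum_p inv_J y k p * partial p (fun w => h2 w l u) (tau y).
Proof.
move=> Ny; rewrite /partial.
have [_ ->] := @chain_rule R V V _ _ _ (coordinates_rV R n) (fun w => h2 w l u) N2 tau y
  (delta_mx ord0 k) (osub_open N2) (hh2 l u 1) (tauN Ny)
  (fun p => Ck_derivable (htau p 1) _ Ny).
by apply: eq_bigr => p _; rewrite mxE.
Qed.

(** The defect of the law, with its last index lowered, is [X k]. It is skew in its last two indices
    because both connections are metric, and symmetric in its first two because both are
    torsion-free and second derivatives of [tau] commute; hence it vanishes. *)
Lemma christoffel_transform y k r l : N1 y ->
  \sum_m christoffel h1 m k r y * inv_J y m l = partial k (fun y => inv_J y r l) y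
   + \sum_q inv_J y r q * \sum_p inv_J y k p * christoffel h2 l p q (tau y).
Proof.
move=> Ny; have N2y := tauN Ny.
pose J := inv_J y; pose H := h2 (tau y).
pose Ga k := \matrix_(r, m) christoffel h1 m k r y.
pose Gb p := \matrix_(q, l) christoffel h2 l p q (tau y).
pose C k := \sum_p J k p *: Gb p.
pose dJ k := \matrix_(r, l) partial k (fun y => inv_J y r l) y.
pose dH k := \matrix_(a, b) partial k (fun y => h2 (tau y) a b) y.
pose dh k := \matrix_(a, b) partial k (fun y => h1 y a b) y.
pose T k := dJ k + J *m C k.
have Hs : H^T = H by exact: s2.
have dHE k' : dH k' = C k' *m H + H *m (C k')^T.
  apply/matrixP => a b; rewrite [LHS]mxE derive_h2tau //.
  under eq_bigr => p _ do rewrite (static_compat hh2 u2 s2 _ _ _ N2y) mulrDr.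
  rewrite big_split [RHS]mxE /C linear_sum /= mulmx_suml mulmx_sumr !summxE; congr (_ + _).
    apply: eq_bigr => p _; rewrite -scalemxAl !mxE; congr (_ * _).
    by apply: eq_bigr => v _; rewrite !mxE.
  apply: eq_bigr => p _; rewrite linearZ /= -scalemxAr !mxE; congr (_ * _).
  by apply: eq_bigr => v _; rewrite !mxE mulrC.
have dhE k' : dh k' = dJ k' *m H *m J^T + J *m dH k' *m J^T + J *m H *m (dJ k')^T.
  (* Leibniz' rule is applied to matrices over the ring of smooth functions on [N1] and then
     evaluated at [y]. *)
  pose JM : 'M[smfun N1]_n := \matrix_(a, b) smk (fun k => Ck_J a b k).
  pose HM : 'M[smfun N1]_n := \matrix_(a, b) smk (fun k => Ck_h2tau a b k).
  pose hM : 'M[smfun N1]_n := \matrix_(a, b) smk (fun k => hh1 a b k).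
  have ev (M : 'M[smfun N1]_n) (f : V -> 'M[R]_n) :
      (forall a b w, N1 w -> M a b w = f w a b) ->
      map_mx (smev Ny) M = f y /\
      map_mx (smev Ny) (map_mx (smD (delta_mx ord0 k' : V)) M) =
        \matrix_(a, b) partial k' (fun w => f w a b) y.
    move=> h; split; apply/matrixP => a b; rewrite !mxE; first exact: h.
    rewrite /smev (smDE _ _ Ny) /partial; apply: near_eq_derive.
    by apply: near_N1 Ny _ => w Nw; rewrite h.
  have [eJ edJ] := ev JM inv_J (fun a b w Nw => ltac:(by rewrite mxE smkE)).
  have [eH edH] := ev HM (fun w => h2 (tau w)) (fun a b w Nw => ltac:(by rewrite mxE smkE)).
  have [eh edh] := ev hM h1 (fun a b w Nw => ltac:(by rewrite mxE smkE)).
  have E : hM = JM *m HM *m JM^T.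
    apply/matrixP => a b; apply: smfun_eq => w Nw; rewrite mxE smkE // (hJ Nw).
    transitivity (map_mx (smev Nw) (JM *m HM *m JM^T) a b); last by rewrite mxE.
    have e1 : map_mx (smev Nw) JM = inv_J w.
      by apply/matrixP => c d; rewrite !mxE /smev smkE // mxE.
    have e2 : map_mx (smev Nw) HM = h2 (tau w).
      by apply/matrixP => c d; rewrite !mxE /smev smkE.
    by rewrite !map_mxM -map_trmx e1 e2.
  rewrite /dh -edh E !(der_mulmx _ _ (smD_der _ _)) mulmxDl !map_mxD !map_mxM.
  by rewrite edJ edH eJ eH -!map_trmx edJ eJ.
have Gac k' : dh k' = Ga k' *m h1 y + (Ga k' *m h1 y)^T.
  apply/matrixP => a b; rewrite [LHS]mxE (static_compat hh1 u1 s1 _ _ _ Ny).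
  rewrite !mxE; congr (_ + _); apply: eq_bigr => p _; rewrite !mxE //.
  by rewrite -[in LHS](s1 Ny) mxE.
pose X k' := (Ga k' *m J - T k') *m H *m J^T.
have h1E : h1 y = J *m H *m J^T by exact: hJ.
have Xa k' : X k' + (X k')^T = 0.
  have : dh k' = T k' *m H *m J^T + (T k' *m H *m J^T)^T.
    have -> : (T k' *m H *m J^T)^T = J *m H *m (T k')^T.
      by rewrite !trmx_mul trmxK Hs mulmxA.
    have -> : (T k')^T = (dJ k')^T + (C k')^T *m J^T by rewrite [LHS]linearD /= trmx_mul.
    rewrite dhE dHE /T !(mulmxDl, mulmxDr) !mulmxA -!addrA.
    by congr (_ + (_ + _)); rewrite addrC.
  rewrite Gac h1E /X !mulmxBl !mulmxA => /eqP; rewrite -subr_eq0 => /eqP E.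
  by rewrite linearB /= -[RHS]E opprD addrACA.
have Xs k' r' s' : X k' r' s' = X r' k' s'.
  have sy a b c : (Ga a *m J - T a) b c = (Ga b *m J - T b) a c.
    rewrite !mxE; congr (_ - (_ + _)).
    - by apply: eq_bigr => m _; rewrite !mxE (static_sym s1 _ _ _ Ny).
    - have e : forall b', partial a (fun y => inv_J y b' c) y =
          partial a (fun y => partial b' (fun y => tau y ord0 c) y) y.
        by move=> b'; apply: near_eq_derive; apply: near_N1 Ny _ => w Nw; rewrite mxE.
      have e' : forall a', partial b (fun y => inv_J y a' c) y =
          partial b (fun y => partial a' (fun y => tau y ord0 c) y) y.
        by move=> a'; apply: near_eq_derive; apply: near_N1 Ny _ => w Nw; rewrite mxE.
      rewrite e e' /partial; exact: (schwarz _ _ (osub_open N1) (htau c 2) Ny).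
    - under eq_bigr => q _ do rewrite summxE mulr_sumr.
      rewrite exchange_big; apply: eq_bigr => p _ /=; rewrite summxE mulr_sumr.
      apply: eq_bigr => q _; rewrite !mxE (static_sym s2 _ _ _ N2y).
      by rewrite mulrCA.
  rewrite /X -!mulmxA mxE [RHS]mxE; apply: eq_bigr => c _; congr (_ * _).
  exact: sy.
have X0 k' : X k' = 0.
  apply/matrixP => r' s'; rewrite [RHS]mxE.
  have A' a b c : X a b c = - X a c b.
    have := congr1 (fun M : 'M[R]_n => M b c) (Xa a); rewrite !mxE => /eqP.
    by rewrite addr_eq0 => /eqP.
  have : X k' r' s' = - X k' r' s'.
    by rewrite {1}Xs A' Xs A' opprK Xs A'.
  lra.
have JHu : H *m J^T \in unitmx.
  by rewrite unitmx_mul unitmx_tr inv_J_unit // andbT; exact: u2.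
have : Ga k *m J = T k.
  apply/eqP; rewrite -subr_eq0; apply/eqP.
  by rewrite -[LHS](mulmxK JHu) mulmxA -/(X k) X0 mul0mx.
move=> /(congr1 (fun M : 'M[R]_n => M r l)) E.
transitivity ((Ga k *m J) r l).
  by rewrite [RHS]mxE; apply: eq_bigr => m _; congr (_ * _); rewrite [RHS]mxE.
rewrite E [LHS]mxE; congr (_ + _); first by rewrite [LHS]mxE.
rewrite [LHS]mxE; apply: eq_bigr => q _; congr (_ * _).
by rewrite summxE; apply: eq_bigr => p _; rewrite [LHS]mxE [X in _ * X = _]mxE.
Qed.

End Invariance.

(** * Horizontal fields and curvature under a change of charts *)

Lemma der_comm_sum (A : comPzRingType) (I : finType) (d d' : A -> A) (u v : I -> A) :
  derivation d -> derivation d' -> (forall i, d (d' (v i)) = d' (d (v i))) ->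
  d (d' (\sum_i u i * v i)) - d' (d (\sum_i u i * v i)) =
  \sum_i (d (d' (u i)) - d' (d (u i))) * v i.
Proof.
move=> hd hd' h; rewrite !(der_sum hd) !(der_sum hd') !(der_sum hd) -sumrB.
apply: eq_bigr => i _.
by rewrite !(derM hd) !(derM hd') !(derD hd) !(derD hd') !(derM hd) !(derM hd') h; ring.
Qed.

Section Naturality.
Variables (R : realType) (n : nat).
Local Notation V := 'rV[R]_n.
Variables (N1 N2 : osub V) (h1 h2 : V -> 'M[R]_n) (tau : V -> V).
Hypothesis hh1 : forall i j k, Ck k N1 (fun y => h1 y i j).
Hypothesis hh2 : forall i j k, Ck k N2 (fun y => h2 y i j).
Hypothesis u1 : forall y, N1 y -> h1 y \in unitmx.
Hypothesis u2 : forall y, N2 y -> h2 y \in unitmx.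
Hypothesis s1 : forall y, N1 y -> (h1 y)^T = h1 y.
Hypothesis s2 : forall y, N2 y -> (h2 y)^T = h2 y.
Hypothesis tauN : forall y, N1 y -> N2 (tau y).
Hypothesis htau : forall l k, Ck k N1 (fun y => tau y ord0 l).
Local Notation inv_J := (inv_J tau).
Hypothesis hJ : forall y, N1 y -> h1 y = inv_J y *m h2 (tau y) *m (inv_J y)^T.

Let O1 := static N1.
Let O2 := static N2.
Let G1 (q : R * V) := h1 q.2.
Let G2 (q : R * V) := h2 q.2.
Let hG1 i j k : Ck k O1 (fun q => G1 q i j). Proof. exact: (Ck_static (hh1 i j k)). Qed.
Let hG2 i j k : Ck k O2 (fun q => G2 q i j). Proof. exact: (Ck_static (hh2 i j k)). Qed.
Let uG1 q : O1 q -> G1 q \in unitmx. Proof. exact: u1. Qed.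
Let uG2 q : O2 q -> G2 q \in unitmx. Proof. exact: u2. Qed.
Let sG1 q : O1 q -> (G1 q)^T = G1 q. Proof. exact: s1. Qed.
Let sG2 q : O2 q -> (G2 q)^T = G2 q. Proof. exact: s2. Qed.

Local Notation P := (R * 'rV[R]_n * 'M[R]_n)%type.
Let U1 := frames O1.
Let U2 := frames O2.
Let A1 := smfun U1.
Let A2 := smfun U2.
Let D1 := gD hG1 uG1.
Let D2 := gD hG2 uG2.

(** The map of frame bundles induced by [tau]: its differential acts on the frame vectors, which are
    rows, from the right. *)
Definition inv_Psi (p : P) : P := ((p.1.1, tau p.1.2), p.2 *m inv_J p.1.2).

Lemma inv_PsiU p : U1 p -> U2 (inv_Psi p).
Proof.
move=> [h1' h2']; split; first exact: tauN.
by rewrite unitmx_mul h2' (inv_J_unit u1 hJ).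
Qed.

Let Jf m l : A1 := bfun (fun k => Ck_static (Ck_J htau m l k)).
Let psi (k : fidx n) : A1 := match k with
  | None => zf O1 None
  | Some (inl l) => bfun (fun k => Ck_static (htau l k))
  | Some (inr (c, l)) => \sum_m zf O1 (iY c m) * Jf m l end.

Let JfE m l p : U1 p -> Jf m l p = inv_J p.1.2 m l.
Proof. by move=> Up; rewrite bfunE. Qed.

Let psiE k p : U1 p -> psi k p = fl k (inv_Psi p).
Proof.
move=> Up; case: k => [[l|[c l]]|].
- exact: (bfunE (fun k => Ck_static (htau l k)) Up).
- transitivity ((\sum_m zf O1 (iY c m) * Jf m l) p); first by [].
  rewrite smf_sum // [RHS]mxE; apply: eq_bigr => m _.
  by rewrite smME // JfE // zfE.
- exact: (zfE None Up).
Qed.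

Let d1 i : derivation (@pdf R n O1 i). Proof. exact: smD_der. Qed.
Let d2 i : derivation (@pdf R n O2 i). Proof. exact: smD_der. Qed.

Lemma fGy_value (N : osub V) (h : V -> 'M[R]_n)
    (hG : forall i j k, Ck k (static N) (fun q : R * V => h q.2 i j))
    (uG : forall q, static N q -> h q.2 \in unitmx) a c m p : frames (static N) p ->
  fGy (@zf R n (static N)) (mGam hG uG) a c m p =
  \sum_i p.2 a i * \sum_j p.2 c j * christoffel h m i j p.1.2.
Proof.
move=> Up; rewrite /fGy /fL smf_sum //; apply: eq_bigr => i _; rewrite smME // mxE zfE //.
congr (_ * _); rewrite smf_sum //; apply: eq_bigr => j _; rewrite smME // mxE zfE //.
by congr (_ * _); exact: (pulls_Gam hG uG _ _ _ Up).
Qed.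

(** The horizontal fields of the two charts are related by [inv_Psi]. On the fibre coordinates this
    is [christoffel_transform] contracted with two frame vectors. *)
Lemma D1_psi a k p : U1 p ->
  D1 a (psi k) p = VD (@zf R n O2) (mGam hG2 uG2) a k (inv_Psi p).
Proof.
move=> Up; have Up2 := inv_PsiU Up; have Ny : N1 p.1.2 := Up.1.
case: k => [[l|[c l]]|]; rewrite /D1 /gD.
- have pl : pulls (psi (iX l)) (fun q => tau q.2 ord0 l) by move=> q Uq; rewrite psiE.
  rewrite fD_base => [|c' k']; last exact: (pulls_py c' k' pl).
  rewrite /fL smf_sum //.
  transitivity (fy (@zf R n O2) a l (inv_Psi p)); last by [].
  rewrite [fy _ a l]mxE zfE // [RHS]mxE; apply: eq_bigr => i _.
  rewrite smME // mxE zfE // (pulls_px _ pl Up).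
  by rewrite [inv_J _ i l]mxE.
- have dD := vf_der d1 (VD (@zf R n O1) (mGam hG1 uG1) a).
  rewrite -/(fD _ _ _ a) in dD *.
  transitivity ((- fGy (@zf R n O2) (mGam hG2 uG2) a c l) (inv_Psi p)); last by [].
  rewrite smNE // fGy_value //.
  transitivity (fD (@pdf R n O1) (@zf R n O1) (mGam hG1 uG1) a
     (\sum_m zf O1 (iY c m) * Jf m l) p); first by [].
  rewrite (der_sum dD) smf_sum //.
  have e m : fD (@pdf R n O1) (@zf R n O1) (mGam hG1 uG1) a (zf O1 (iY c m) * Jf m l) p =
      - (\sum_i p.2 a i * \sum_j p.2 c j * christoffel h1 m i j p.1.2) * inv_J p.1.2 m l
      + p.2 c m * \sum_i p.2 a i * partial i (fun y => inv_J y m l) p.1.2.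
    rewrite (derM dD) smDDE // !smME // JfE // zfE //; congr (_ * _ + _ * _).
      rewrite /fD vf_z; last exact: geom_pd_z.
      transitivity ((- fGy (@zf R n O1) (mGam hG1 uG1) a c m) p); first by [].
      by rewrite smNE // fGy_value.
    have pl : pulls (Jf m l) (fun q => inv_J q.2 m l) by move=> q Uq; rewrite JfE.
    rewrite fD_base => [|c' k']; last exact: (pulls_py c' k' pl).
  rewrite /fL smf_sum //.
    apply: eq_bigr => i _; rewrite smME // mxE zfE //; congr (_ * _).
    exact: (pulls_px _ pl Up).
  under eq_bigr => m _ do rewrite e.
  rewrite big_split /=.
  pose Y := p.2; pose J := inv_J p.1.2.
  have -> : \sum_m - (\sum_i Y a i * \sum_j Y c j * christoffel h1 m i j p.1.2) * J m l =
     - \sum_i \sum_j Y a i * Y c j * \sum_m christoffel h1 m i j p.1.2 * J m l.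
    under eq_bigr do rewrite mulNr mulr_suml.
    rewrite sumrN exchange_big /=; congr (- _); apply: eq_bigr => i _.
    under eq_bigr do rewrite mulr_sumr mulr_suml.
    rewrite exchange_big; apply: eq_bigr => j _ /=; rewrite mulr_sumr.
    by apply: eq_bigr => m _; ring.
  have -> : \sum_i \sum_j Y a i * Y c j * (\sum_m christoffel h1 m i j p.1.2 * J m l) =
      \sum_i \sum_j Y a i * Y c j * partial i (fun y => inv_J y j l) p.1.2
      + \sum_i \sum_j Y a i * Y c j * (\sum_q J j q * \sum_r J i r * christoffel h2 l r q (tau p.1.2)).
    rewrite -big_split; apply: eq_bigr => i _; rewrite -big_split; apply: eq_bigr => j _ /=.
    rewrite -mulrDr; congr (_ * _).
    exact: (christoffel_transform hh1 hh2 u1 u2 s1 s2 tauN htau hJ _ _ _ Ny).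
  rewrite opprD.
  have -> : \sum_m Y c m * (\sum_i Y a i * partial i (fun y => inv_J y m l) p.1.2) =
      \sum_i \sum_j Y a i * Y c j * partial i (fun y => inv_J y j l) p.1.2.
    under eq_bigr do rewrite mulr_sumr.
    rewrite exchange_big; apply: eq_bigr => i _; apply: eq_bigr => j _ /=; ring.
  rewrite addrAC addNr add0r; congr (- _).
  transitivity (\sum_i \sum_j \sum_q \sum_r Y a i * Y c j * (J j q * (J i r * christoffel h2 l r q (tau p.1.2)))).
    apply: eq_bigr => i _; apply: eq_bigr => j _; rewrite mulr_sumr; apply: eq_bigr => q _.
    by rewrite !mulr_sumr.
  symmetry.
  transitivity (\sum_r \sum_q \sum_i \sum_j Y a i * Y c j * (J j q * (J i r * christoffel h2 l r q (tau p.1.2)))).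
    apply: eq_bigr => r _; rewrite mulr_sumr; apply: eq_bigr => q _.
    rewrite /= [X in X * _]mxE mulr_suml; apply: eq_bigr => i _.
    rewrite [X in _ * (X * _)]mxE !mulr_suml mulr_sumr; apply: eq_bigr => j _.
    by rewrite -/Y -/J; ring.
  rewrite exchange_big /=.
  under eq_bigr => q _ do rewrite exchange_big /=.
  rewrite exchange_big /=; apply: eq_bigr => i _.
  under eq_bigr => q _ do rewrite exchange_big /=.
  by rewrite exchange_big.
- transitivity (fD (@pdf R n O1) (@zf R n O1) (mGam hG1 uG1) a (zf O1 None) p); first by [].
  rewrite /fD vf_z; last exact: geom_pd_z.
  transitivity ((0 : A1) p); first by [].
  transitivity ((0 : A2) (inv_Psi p)); last by [].
  by rewrite !sm0E.
Qed.

(** [H] is the pullback of [F] under the map of frame bundles. *)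
Definition sim (H : A1) (F : A2) := forall p, U1 p -> H p = F (inv_Psi p).

Lemma sim_D a H F : sim H F -> sim (D1 a H) (D2 a F).
Proof.
move=> h p Up; have Up2 := inv_PsiU Up.
have nearU Q : (forall q, U1 q -> Q q) -> \forall q \near p, Q q := @smnear _ _ _ Q p Up.
have e i : pdf i H p = \sum_k pdf i (psi k) p * pdf k F (inv_Psi p).
  have ek k : \forall q \near p, psi k q = (fl k \o inv_Psi) q.
    by apply: nearU => q Uq; rewrite psiE.
  have [_ E] := @chain_rule R P P _ _ _ (coordinates_frame R n) F U2 inv_Psi p (fe R i)
    (osub_open U2) (smf_smooth F 1) Up2
    (fun k => near_eq_derivable (ek k) (Ck_derivable (smf_smooth (psi k) 1) _ Up)).
  transitivity ('D_(fe R i) ((F : P -> R) \o inv_Psi) p).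
    rewrite /pdf (smDE _ _ Up); apply: near_eq_derive.
    by apply: nearU => q Uq; rewrite /= h.
  rewrite E; apply: eq_bigr => k _; congr (_ * _).
    by rewrite /pdf (smDE _ _ Up); symmetry; apply: near_eq_derive; exact: ek.
  by rewrite /pdf (smDE _ _ Up2).
have eH : D1 a H p = \sum_i VD (@zf R n O1) (mGam hG1 uG1) a i p * pdf i H p.
  by rewrite /D1 /gD /fD /vf smf_sum //; apply: eq_bigr => i _; rewrite smME.
have eF : D2 a F (inv_Psi p) = \sum_k VD (@zf R n O2) (mGam hG2 uG2) a k (inv_Psi p) * pdf k F (inv_Psi p).
  by rewrite /D2 /gD /fD /vf smf_sum //; apply: eq_bigr => i _; rewrite smME.
rewrite eH eF.
under eq_bigr => i _ do rewrite e mulr_sumr.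
rewrite exchange_big; apply: eq_bigr => k _ /=; rewrite -D1_psi //.
rewrite /D1 /gD /fD /vf smf_sum // mulr_suml; apply: eq_bigr => i _.
by rewrite smME // mulrA.
Qed.

Lemma simDD H H' F F' : sim H F -> sim H' F' -> sim (H + H') (F + F').
Proof. by move=> h h' p Up; rewrite !smDDE ?h ?h' //; exact: inv_PsiU. Qed.
Lemma simN H F : sim H F -> sim (- H) (- F).
Proof. by move=> h p Up; rewrite !smNE ?h //; exact: inv_PsiU. Qed.
Lemma simM H H' F F' : sim H F -> sim H' F' -> sim (H * H') (F * F').
Proof. by move=> h h' p Up; rewrite !smME ?h ?h' //; exact: inv_PsiU. Qed.
Lemma sim_sum (I : finType) (H : I -> A1) (F : I -> A2) :
  (forall i, sim (H i) (F i)) -> sim (\sum_i H i) (\sum_i F i).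
Proof.
move=> h p Up; rewrite !smf_sum //; last exact: inv_PsiU.
by apply: eq_bigr => i _; exact: h.
Qed.

Lemma sim_Gi a b : sim (gGi hG1 uG1 a b) (gGi hG2 uG2 a b).
Proof.
move=> p Up; have Up2 := inv_PsiU Up; have Ny : N1 p.1.2 := Up.1.
have val (O : osub (R * V)%type) (G : R * V -> 'M[R]_n) (hG : forall i j k, Ck k O (fun q => G q i j))
    (uG : forall q, O q -> G q \in unitmx) q (Uq : frames O q) :
    gGi hG uG a b q = ((invmx q.2)^T *m invmx (G q.1) *m invmx q.2) a b.
  transitivity (map_mx (smev Uq) (fGi (mgi hG uG) (myi O)) a b); first by rewrite [RHS]mxE.
  rewrite /fGi !map_mxM -map_trmx.
  have -> : map_mx (smev Uq) (myi O) = invmx q.2.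
    by apply/matrixP => i j; rewrite !mxE /smev smkE.
  have -> // : map_mx (smev Uq) (mgi hG uG) = invmx (G q.1).
  by apply/matrixP => i j; rewrite mxE; exact: (pulls_mgi hG uG _ _ Uq).
rewrite (val _ _ hG1 uG1 p Up) (val _ _ hG2 uG2 _ Up2) /G1 /G2 /=.
have Ju := inv_J_unit u1 hJ Ny; have Yu : p.2 \in unitmx by exact: Up.2.
have Hu := u2 (tauN Ny).
have invM (M N : 'M[R]_n) : M \in unitmx -> N \in unitmx -> invmx (M *m N) = invmx N *m invmx M.
  move=> hM hN; have hMN : M *m N \in unitmx by rewrite unitmx_mul hM.
  apply: (can_inj (mulKmx hMN)); rewrite mulmxV // mulmxA -(mulmxA M) mulmxV // mulmx1.
  by rewrite mulmxV.
rewrite (hJ Ny) !invM ?unitmx_mul ?unitmx_tr ?Ju ?Hu //.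
by rewrite trmx_mul !trmx_inv !mulmxA.
Qed.

Lemma sim_psi k : sim (psi k) (zf O2 k).
Proof. by move=> p Up; rewrite psiE // zfE //; exact: inv_PsiU. Qed.

(** The commutator of two horizontal fields, applied to a fibre coordinate, is minus the curvature;
    relatedness of the fields carries it from one chart to the other. *)
Lemma sim_fom a b c k p : U1 p ->
  fom (@pdf R n O2) (@zf R n O2) (mGam hG2 uG2) a b c k (inv_Psi p) =
  \sum_m fom (@pdf R n O1) (@zf R n O1) (mGam hG1 uG1) a b c m p * inv_J p.1.2 m k.
Proof.
move=> Up; have Up2 := inv_PsiU Up.
have cy (N : osub V) (h : V -> 'M[R]_n)
    (hG : forall i j k, Ck k (static N) (fun q : R * V => h q.2 i j))
    (uG : forall q, static N q -> h q.2 \in unitmx) (sG : forall q, static N q -> (h q.2)^T = h q.2) m :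
    gD hG uG a (gD hG uG b (zf (static N) (iY c m))) - gD hG uG b (gD hG uG a (zf (static N) (iY c m)))
    = - fom (@pdf R n (static N)) (@zf R n (static N)) (mGam hG uG) a b c m.
  have dd i : derivation (@pdf R n (static N) i) by exact: smD_der.
  have dD x : derivation (gD hG uG x) by exact: vf_der.
  have e x : gD hG uG x (zf (static N) (iY c m)) = - fGy (@zf R n (static N)) (mGam hG uG) x c m.
    by rewrite /gD /fD vf_z; last exact: geom_pd_z.
  rewrite !e !(derN (dD _)) -opprD; congr (- _).
  apply: (fD_Gy dd (@geom_pd_z R n _)).
    by move=> c' k' l i j; exact: (pulls_py _ _ (pulls_Gam hG uG l i j)).
  exact: (geom_Gam_sym hG uG sG).
have S := simDD (sim_D a (sim_D b (sim_psi (iY c k)))) (simN (sim_D b (sim_D a (sim_psi (iY c k))))).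
have := S p Up; rewrite /D2 (cy N2 h2 hG2 uG2 sG2) smNE // => /eqP; rewrite -eqr_oppLR => /eqP <-.
have dD x : derivation (D1 x) by exact: (vf_der d1).
have -> : D1 a (D1 b (psi (iY c k))) - D1 b (D1 a (psi (iY c k))) =
    - \sum_m fom (@pdf R n O1) (@zf R n O1) (mGam hG1 uG1) a b c m * Jf m k.
  rewrite -[psi _]/(\sum_m zf O1 (iY c m) * Jf m k).
  rewrite (der_comm_sum _ (dD a) (dD b)); last first.
    move=> m; have pl : pulls (Jf m k) (fun q => inv_J q.2 m k) by move=> q Uq; rewrite JfE.
    apply: (fD_comm_base d1 (fun i j F => smD_comm (fe R i) (fe R j) F) (@geom_pd_z R n O1)
      (geom_Gam_sym hG1 uG1 sG1)).
    by move=> c' k'; exact: (pulls_py c' k' pl).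
  rewrite -sumrN; apply: eq_bigr => m _; rewrite -mulNr; congr (_ * _).
  exact: (cy N1 h1 hG1 uG1 sG1).
rewrite smNE // opprK smf_sum //; apply: eq_bigr => m _.
by rewrite smME // JfE.
Qed.

Lemma sim_Rm a b c d : sim (gRm hG1 uG1 a b c d) (gRm hG2 uG2 a b c d).
Proof.
move=> p Up; have Up2 := inv_PsiU Up; have Ny : N1 p.1.2 := Up.1.
have val (O : osub (R * V)%type) (G : R * V -> 'M[R]_n) (hG : forall i j k, Ck k O (fun q => G q i j))
    (uG : forall q, O q -> G q \in unitmx) q (Uq : frames O q) :
    gRm hG uG a b c d q = ((\row_m fom (@pdf R n O) (@zf R n O) (mGam hG uG) a b c m q)
      *m G q.1 *m q.2^T) ord0 d.
  rewrite /gRm fRm_flat fflat_mx.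
  transitivity (map_mx (smev Uq) (\row_m fom (@pdf R n O) (@zf R n O) (mGam hG uG) a b c m
     *m mg hG *m (fy (@zf R n O))^T) ord0 d); first by rewrite [RHS]mxE.
  rewrite !map_mxM -map_trmx; congr (fun_of_matrix (_ *m _ *m _^T) _ _).
  - by apply/matrixP => i j; rewrite [LHS]mxE [RHS]mxE [in LHS]mxE.
  - by apply/matrixP => i j; rewrite [LHS]mxE; exact: (pulls_mg hG _ _ Uq).
  - by apply/matrixP => i j; rewrite mxE [fy _ _ _]mxE; exact: (zfE (iY i j) Uq).
rewrite (val _ _ hG1 uG1 p Up) (val _ _ hG2 uG2 _ Up2) /G1 /G2.
transitivity ((\row_m fom (@pdf R n O2) (@zf R n O2) (mGam hG2 uG2) a b c m (inv_Psi p)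
   *m h2 (tau p.1.2) *m (p.2 *m inv_J p.1.2)^T) ord0 d); last by [].
have -> : \row_m fom (@pdf R n O2) (@zf R n O2) (mGam hG2 uG2) a b c m (inv_Psi p) =
   \row_m fom (@pdf R n O1) (@zf R n O1) (mGam hG1 uG1) a b c m p *m inv_J p.1.2.
  apply/rowP => k; rewrite [LHS]mxE [RHS]mxE sim_fom //.
  by apply: eq_bigr => m _; rewrite [X in _ = X * _]mxE.
by rewrite (hJ Ny) trmx_mul !mulmxA.
Qed.

Lemma sim_normRm : sim (normRm (gGi hG1 uG1) (gRm hG1 uG1)) (normRm (gGi hG2 uG2) (gRm hG2 uG2)).
Proof.
apply: sim_sum => i; apply: sim_sum => j; apply: simM; last by apply: simM; exact: sim_Rm.
by do 3!(apply: simM; last exact: sim_Gi); exact: sim_Gi.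
Qed.

Lemma sim_normDRm : sim (normDRm D1 (gGi hG1 uG1) (gRm hG1 uG1)) (normDRm D2 (gGi hG2 uG2) (gRm hG2 uG2)).
Proof.
apply: sim_sum => i; apply: sim_sum => j; apply: simM; last first.
  by apply: simM; apply: sim_D; exact: sim_Rm.
apply: simM; first exact: sim_Gi.
by do 3!(apply: simM; last exact: sim_Gi); exact: sim_Gi.
Qed.

(** The frame expressions of the norms are pullbacks of each other, and by [normRm_value] and
    [normDRm_value] their values do not depend on the frame: the identity frame is taken. *)
Lemma norms_invariant y : N1 y ->
  rm_sq h1 y = rm_sq h2 (tau y) /\ drm_sq h1 y = drm_sq h2 (tau y).
Proof.
move=> Ny.
have Up : U1 ((0, y), 1%:M) by split=> //=; exact: unitmx1.
split.
  have := sim_normRm Up; rewrite (normRm_value hG1 uG1 sG1 Up).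
  by rewrite (normRm_value hG2 uG2 sG2 (inv_PsiU Up)).
have := sim_normDRm Up; rewrite (normDRm_value hG1 uG1 Up).
by rewrite (normDRm_value hG2 uG2 (inv_PsiU Up)).
Qed.

End Naturality.

(** * Curvature norms on the manifold *)

Lemma smooth_on_Ck (R : realType) (V W : normedModType R) (U : set V) (f : V -> W) :
  open U -> smooth_on U f -> forall k, Ck k U f.
Proof.
move=> oU h k; apply: Ck_local => x Ux; have [B [F [oB Bx hF e]]] := h x Ux.
exists (U `&` B); split=> //; apply: (@Ck_ext _ _ _ _ _ F); first exact: openI.
  by move=> y [Uy By]; rewrite e.
by apply: Ck_sub (hF k) => y [].
Qed.

Lemma posdef_unit (R : realType) n (A : 'M[R]_n) :
  (forall v, v != 0 -> 0 < qform A v) -> A \in unitmx.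
Proof.
move=> h; rewrite -row_free_unit; apply: inj_row_free => v vA; apply/eqP.
apply: contraT => /h; by rewrite /qform vA mul0mx mxE ltxx.
Qed.

Lemma cont_pair (T U V : topologicalType) (f : T -> U) (h : T -> V) x :
  {for x, continuous f} -> {for x, continuous h} ->
  {for x, continuous (fun z => (f z, h z))}.
Proof.
move=> hf hh; exact: (@cvg_pair T U V (nbhs x) (nbhs (f x)) (nbhs (h x)) _ _ _ f h hf hh).
Qed.

Section Charts.
Variables (R : realType) (n : nat) (M : smooth_manifold R n).
Implicit Types (i j : atlas M) (x : M).

Definition overlap i j := chart i @` (dom i `&` dom j).

Lemma coords_chart i x : dom i x -> coords i (chart i x).
Proof. by move=> h; exists x. Qed.

Lemma paramK i y : coords i y -> dom i (param i y) /\ chart i (param i y) = y.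
Proof. by move=> [x dx <-]; rewrite chartK. Qed.

Lemma near_param (P : set M) i y : coords i y -> nbhs (param i y) P ->
  \forall z \near y, coords i z /\ P (param i z).
Proof.
move=> cy hP; have hc : nbhs y (coords i).
  by apply: open_nbhs_nbhs; split=> //; exact: open_coords.
apply: filterI => //; exact: (param_continuous cy hP).
Qed.

Lemma near_dom i x : dom i x -> nbhs x (dom i).
Proof. by move=> dx; apply: open_nbhs_nbhs; split=> //; exact: open_dom. Qed.

Lemma near_chart (P : set 'rV[R]_n) i x : dom i x -> nbhs (chart i x) P ->
  \forall z \near x, dom i z /\ P (chart i z).
Proof.
by move=> dx hP; apply: filterI; [exact: near_dom|exact: (chart_continuous dx hP)].
Qed.

Lemma open_overlap i j : open (overlap i j).
Proof.
rewrite openE => y [x [dx1 dx2] <-].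
have hP : nbhs (param i (chart i x)) (dom j) by rewrite chartK //; exact: near_dom.
apply: filterS (near_param (coords_chart dx1) hP) => z [cz dz].
by have [d e] := paramK cz; exists (param i z).
Qed.

Lemma overlap_coords i j y : overlap i j y -> coords i y /\ coords j (chart j (param i y)).
Proof.
move=> [x [dx1 dx2] <-]; split; first exact: coords_chart.
by rewrite chartK //; exact: coords_chart.
Qed.

Lemma transition_Ck i j k : Ck k (overlap i j) (chart j \o param i).
Proof. by apply: smooth_on_Ck; [exact: open_overlap|exact: transition_smooth]. Qed.

Lemma transition_entry_Ck i j l k :
  Ck k (overlap i j) (fun y => (chart j \o param i) y ord0 l).
Proof. by apply: Ck_entry; [exact: open_overlap|exact: transition_Ck]. Qed.

Section Metric.
Variable (h : tensor2 M).
Hypothesis hm : riemannian_metric h.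

Lemma metric_Ck i a b k : Ck k (coords i) (fun y => h i y a b).
Proof. by case: hm => hs _ _ _; apply: (smooth_on_Ck _ (hs i a b)); exact: open_coords. Qed.

Lemma metric_sym i y : coords i y -> (h i y)^T = h i y.
Proof. by case: hm => _ hs _ _; exact: hs. Qed.

Lemma metric_pos i y : coords i y -> forall v, v != 0 -> 0 < qform (h i y) v.
Proof. by case: hm => _ _ hp _ cy v; exact: hp. Qed.

Lemma metric_unit i y : coords i y -> h i y \in unitmx.
Proof. by move=> cy; apply: posdef_unit; exact: metric_pos. Qed.

Lemma metric_transform i j y : overlap i j y ->
  h i y = inv_J (chart j \o param i) y *m h j ((chart j \o param i) y)
          *m (inv_J (chart j \o param i) y)^T.
Proof.
move=> Ny; have e := jacobian_entries (@open_overlap i j) (fun l => @transition_entry_Ck i j l 1) Ny.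
case: Ny e => x [dx1 dx2] <- e; case: hm => _ _ _ /(_ i j x dx1 dx2).
by rewrite e /= chartK.
Qed.

Lemma norms_chart i j x : dom i x -> dom j x ->
  rm_sq (h i) (chart i x) = rm_sq (h j) (chart j x) /\
  drm_sq (h i) (chart i x) = drm_sq (h j) (chart j x).
Proof.
move=> di dj; pose N1 := OSub (@open_overlap i j); pose N2 := OSub (@open_coords R n M j).
have ov : overlap i j (chart i x) by exists x.
rewrite -{2 4}(chartK di).
apply: (@norms_invariant R n N1 N2 (h i) (h j) (chart j \o param i)) => //.
- move=> a b k; apply: Ck_sub (metric_Ck i a b k) => y; by case/overlap_coords.
- by move=> a b k; exact: metric_Ck.
- by move=> y /overlap_coords[cy _]; exact: metric_unit.
- by move=> y; exact: metric_unit.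
- by move=> y /overlap_coords[cy _]; exact: metric_sym.
- by move=> y; exact: metric_sym.
- by move=> y /overlap_coords[].
- by move=> l k; exact: transition_entry_Ck.
- exact: metric_transform.
Qed.

End Metric.

(** [NR] and [ND] are |Rm|^2 and |D Rm|^2 in the chosen chart; by [norms_chart] the choice is
    immaterial. *)
Definition NR (h : tensor2 M) x := rm_sq (h (chart_at x)) (chart (chart_at x) x).
Definition ND (h : tensor2 M) x := drm_sq (h (chart_at x)) (chart (chart_at x) x).

Lemma Rm_normE (h : tensor2 M) x : Rm_norm h x = Num.sqrt (NR h x).
Proof. by []. Qed.

Lemma NR_chart (h : tensor2 M) i x : riemannian_metric h -> dom i x ->
  NR h x = rm_sq (h i) (chart i x).
Proof. by move=> hm dx; exact: (norms_chart hm (dom_chart_at x) dx).1. Qed.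

Lemma ND_chart (h : tensor2 M) i x : riemannian_metric h -> dom i x ->
  ND h x = drm_sq (h i) (chart i x).
Proof. by move=> hm dx; exact: (norms_chart hm (dom_chart_at x) dx).2. Qed.

(** * Continuity in space-time up to the ends of the time interval *)

Section Flow.
Variables (T : R) (g : R -> tensor2 M).
Hypothesis gf : ricci_flow T g.
Local Notation B := (R * 'rV[R]_n)%type.

Lemma flow_metric t : 0 <= t <= T -> riemannian_metric (g t).
Proof. by case: gf => h _ _; exact: h. Qed.

Lemma nbhs_slice (P : set B) (t : R) (y : 'rV[R]_n) : nbhs (t, y) P -> \forall z \near y, P (t, z).
Proof.
move=> h; have c : {for y, continuous (fun z : 'rV[R]_n => (t, z) : B)}.
  by apply: cont_pair; [exact: cst_continuous|exact: cvg_id].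
exact: c h.
Qed.

(* The metric near a point of [0, T] x coords i is the restriction of a
   nondegenerate symmetric family that is smooth in an open set, also at the
   ends of the time interval. *)
Lemma local_extension i t0 y0 : 0 <= t0 <= T -> coords i y0 ->
  exists (W : osub B) (G : B -> 'M[R]_n),
  [/\ W (t0, y0), forall a b k, Ck k W (fun q => G q a b),
      forall q, W q -> G q \in unitmx, forall q, W q -> (G q)^T = G q &
      forall q, W q -> coords i q.2 /\ (0 <= q.1 <= T -> G q = g q.1 i q.2)].
Proof.
move=> t0T cy0; case: gf => hm hs _.
have : forall ab : 'I_n * 'I_n, exists F : set B * (B -> R),
    [/\ open F.1, F.1 (t0, y0), forall k, Ck k F.1 F.2 &
     forall q, (`[0, T]%classic `*` coords i) q -> F.1 q -> g q.1 i q.2 ab.1 ab.2 = F.2 q].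
  move=> [a b]; have p0 : (`[0, T]%classic `*` coords i) (t0, y0) by split; rewrite //= in_itv.
  by have [W [F [h1 h2 h3 h4]]] := hs i a b _ p0; exists (W, F).
case/boolp.choice => F hF.
pose S q := forall ab, (F ab).1 q.
have oS : open [set q | S q /\ coords i q.2].
  rewrite openE => q [Sq cq]; apply: filterI.
    apply: (@filter_forall _ _ (fun ab q => (F ab).1 q) (nbhs q) (nbhs_filter q)) => ab.
    by apply: open_nbhs_nbhs; split; [case: (hF ab)|exact: Sq].
  have : nbhs q.2 (coords i) by apply: open_nbhs_nbhs; split=> //; exact: open_coords.
  exact: (@cvg_snd _ _ (nbhs q.1) (nbhs q.2) _ (coords i)).
pose G q : 'M[R]_n := \matrix_(a, b) (2^-1 * ((F (a, b)).2 q + (F (b, a)).2 q)).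
have hG a b k : Ck k [set q | S q /\ coords i q.2] (fun q => G q a b).
  have s ab : Ck k [set q | S q /\ coords i q.2] (F ab).2.
    by case: (hF ab) => _ _ /(_ k) h _; apply: Ck_sub h => q [Sq _]; exact: Sq.
  apply: (@Ck_ext _ _ _ _ _ (fun q => 2^-1 * ((F (a, b)).2 q + (F (b, a)).2 q))) => //.
    by move=> q _; rewrite mxE.
  by apply: CkM => //; [exact: Ck_cst|apply: CkD].
pose W := [set q | (S q /\ coords i q.2) /\ \det (G q) != 0].
have oW : open W.
  rewrite openE => q [Sq dq]; apply: filterI; first by apply: open_nbhs_nbhs; split.
  have c : {for q, continuous (fun q => \det (G q))}.
    by apply: (Ck_cont (Ck_det oS (fun a b => hG a b 0)) Sq).
  have : nbhs (\det (G q)) [set x | x != 0] by apply: open_nbhs_nbhs; split=> //; exact: open_neq.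
  exact: c.
have eG q : S q /\ coords i q.2 -> 0 <= q.1 <= T -> G q = g q.1 i q.2.
  move=> [Sq cq] qT; have m := flow_metric qT.
  have pq : (`[0, T]%classic `*` coords i) q by split; rewrite //= in_itv.
  have e ab : (F ab).2 q = g q.1 i q.2 ab.1 ab.2.
    by case: (hF ab) => _ _ _ h; rewrite h //; exact: Sq.
  apply/matrixP => a b; rewrite mxE !e /=.
  have := congr1 (fun A : 'M[R]_n => A a b) (metric_sym m cq); rewrite mxE => ->; lra.
have S0 : S (t0, y0) /\ coords i y0 by split=> // ab; case: (hF ab).
exists (OSub oW), G; split.
- split=> //=; rewrite eG //= -unitfE -unitmxE; exact: (metric_unit (flow_metric t0T) cy0).
- by move=> a b k; apply: Ck_sub (hG a b k) => q [].
- by move=> q [_]; rewrite unitmxE unitfE.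
- by move=> q _; apply/matrixP => a b; rewrite !mxE [X in _ * X]addrC.
- by move=> q [Sq _]; split; [exact: Sq.2|exact: eG].
Qed.

(* Q stands for a scalar built from finitely many derivatives of the metric. *)
Definition local_scalar (S : set 'rV[R]_n) (Q : ('rV[R]_n -> 'M[R]_n) -> 'rV[R]_n -> R) :=
  (forall G1 G2 y, (\forall z \near y, G1 z = G2 z) -> Q G1 y = Q G2 y) /\
  (forall (W : osub B) (G : B -> 'M[R]_n), (forall a b k, Ck k W (fun q => G q a b)) ->
     (forall q, W q -> G q \in unitmx) -> (forall q, W q -> (G q)^T = G q) ->
     (forall q, W q -> S q.2) -> forall q, W q -> {for q, continuous (fun q => Q (fun y => G (q.1, y)) q.2)}).

(** Near the point the flow agrees on [0, T] with the smooth family of [local_extension], for which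
    the scalar is continuous in an open set. *)
Lemma local_scalar_cont Q i (t0 : R) y0 : local_scalar (coords i) Q -> 0 <= t0 <= T -> coords i y0 ->
  Q (g q.1 i) q.2 @[q --> within (`[0, T]%classic `*` setT) (nbhs ((t0, y0) : B))]
    --> Q (g t0 i) y0.
Proof.
move=> [Ql Qc] t0T cy0; have [W [G [W0 hG uG sG eG]]] := local_extension t0T cy0.
have E q : W q -> 0 <= q.1 <= T -> Q (fun y => G (q.1, y)) q.2 = Q (g q.1 i) q.2.
  move=> Wq qT; apply: Ql.
  have nW : nbhs (q.1, q.2) W.
    by rewrite -surjective_pairing; apply: open_nbhs_nbhs; split=> //; exact: osub_open.
  by apply: filterS (nbhs_slice nW) => z Wz; exact: (eG _ Wz).2.
have nW : nbhs ((t0, y0) : B) W by apply: open_nbhs_nbhs; split=> //; exact: osub_open.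
rewrite -(E (t0, y0)) //; move=> P /= /(Qc W G hG uG sG (fun q Wq => (eG q Wq).1) _ W0) hP.
apply: filterS (filterI nW hP) => q [Wq Pq] [qT _].
have qT' : 0 <= q.1 <= T by move: qT; rewrite /= in_itv.
by move: Pq; rewrite /preimage /= (E q Wq qT').
Qed.

Lemma smooth_scalar_cont (W : osub B) (F : smfun (frames W)) f q :
  pulls F f -> W q -> {for q, continuous f}.
Proof.
move=> pf Wq; have Up r : W r -> frames W (r, 1%:M) by move=> Wr; split=> //=; exact: unitmx1.
have c1 : {for q, continuous (fun r : B => (r, 1%:M : 'M[R]_n))}.
  by apply: cont_pair; [exact: cvg_id|exact: cst_continuous].
have c2 : {for (q, 1%:M), continuous (F : B * 'M[R]_n -> R)}.
  exact: (Ck_cont (smf_smooth F 0) (Up q Wq)).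
have c3 := @continuous_comp _ _ _ (fun r : B => (r, 1%:M : 'M[R]_n)) F _ c1 c2.
have nW : nbhs q W by apply: open_nbhs_nbhs; split=> //; exact: osub_open.
move=> P /=; rewrite -[f q]/(f (q, 1%:M : 'M[R]_n).1) -(pf _ (Up q Wq)) => /c3 hP.
by apply: filterS (filterI nW hP) => r [Wr] /=; rewrite /preimage /= (pf _ (Up r Wr)).
Qed.

Lemma local_scalar_rm S : local_scalar S (@rm_sq R n).
Proof.
split; first by move=> G1 G2 y; exact: local_rm_sq.
move=> W G hG uG sG _ q Wq.
apply: (@smooth_scalar_cont W (normRm (gGi hG uG) (gRm hG uG)) _ _ _ Wq) => p Up.
by rewrite (normRm_value hG uG sG Up).
Qed.

Lemma local_scalar_drm S : local_scalar S (@drm_sq R n).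
Proof.
split; first by move=> G1 G2 y; exact: local_drm_sq.
move=> W G hG uG sG _ q Wq.
apply: (@smooth_scalar_cont W (normDRm (gD hG uG) (gGi hG uG) (gRm hG uG)) _ _ _ Wq) => p Up.
by rewrite (normDRm_value hG uG Up).
Qed.

Lemma manifold_scalar_cont (Q : ('rV[R]_n -> 'M[R]_n) -> 'rV[R]_n -> R) (N : tensor2 M -> M -> R) :
  (forall S, local_scalar S Q) -> (forall h i x, riemannian_metric h -> dom i x -> N h x = Q (h i) (chart i x)) ->
  forall (t0 : R) (x0 : M), 0 <= t0 <= T ->
  N (g q.1) q.2 @[q --> within (`[0, T]%classic `*` setT) (nbhs ((t0, x0) : R * M))]
    --> N (g t0) x0.
Proof.
move=> hQ hN t0 x0 t0T; set i := chart_at x0; have d0 : dom i x0 by exact: dom_chart_at.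
rewrite (hN _ i) //; last exact: flow_metric.
move=> P /= /(local_scalar_cont (hQ _) t0T (coords_chart d0)) hP.
have c : {for (t0, x0), continuous (fun q : R * M => (q.1, chart i q.2) : B)}.
  apply: cont_pair; first exact: cvg_fst.
  apply: (@continuous_comp _ _ _ (@snd R M) (chart i)); first exact: cvg_snd.
  exact: chart_continuous.
have nd : \forall q \near ((t0, x0) : R * M), dom i q.2.
  exact: (@cvg_snd _ _ (nbhs t0) (nbhs x0) _ (dom i) (near_dom d0)).
have hc : nbhs ((t0, x0) : R * M)
    [set q : R * M | q.1 \in `[0, T] /\ True -> P (Q (g q.1 i) (chart i q.2))] by exact: (c _ hP).
have nd' : nbhs ((t0, x0) : R * M) [set q : R * M | dom i q.2] by exact: nd.
apply: filterS (filterI hc nd') => -[t x] [/= hq dq] [qT _].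
have m : riemannian_metric (g t) by apply: flow_metric; move: qT; rewrite /= in_itv.
suff: P (N (g t) x) by [].
by rewrite (hN _ i _ m dq); exact: (hq (conj qT I)).
Qed.

Lemma NR_cont (t0 : R) (x0 : M) : 0 <= t0 <= T ->
  NR (g q.1) q.2 @[q --> within (`[0, T]%classic `*` setT) (nbhs ((t0, x0) : R * M))]
    --> NR (g t0) x0.
Proof.
apply: (manifold_scalar_cont local_scalar_rm); exact: NR_chart.
Qed.

Lemma ND_cont (t0 : R) (x0 : M) : 0 <= t0 <= T ->
  ND (g q.1) q.2 @[q --> within (`[0, T]%classic `*` setT) (nbhs ((t0, x0) : R * M))]
    --> ND (g t0) x0.
Proof.
apply: (manifold_scalar_cont local_scalar_drm); exact: ND_chart.
Qed.

(** * The flow equation at interior times *)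

Section Interior.
Variable i : atlas M.

Lemma open_cylinder : open [set q : B | 0 < q.1 < T /\ coords i q.2].
Proof.
rewrite openE => q [q1 q2]; apply: filterI.
  have : nbhs q.1 [set t | 0 < t < T].
    have -> : [set t : R | 0 < t < T] = `]0, T[%classic by apply/seteqP; split=> t /=; rewrite in_itv.
    by apply: open_nbhs_nbhs; split; [exact: interval_open|rewrite /= in_itv].
  exact: (@cvg_fst _ _ (nbhs q.1) (nbhs q.2) _ [set t | 0 < t < T]).
have : nbhs q.2 (coords i) by apply: open_nbhs_nbhs; split=> //; exact: open_coords.
exact: (@cvg_snd _ _ (nbhs q.1) (nbhs q.2) _ (coords i)).
Qed.

Definition cylinder : osub B := OSub open_cylinder.
Definition flow_mx (q : B) := g q.1 i q.2.

Lemma cylinderT q : cylinder q -> 0 <= q.1 <= T.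
Proof. by move=> [/andP[a b] _]; rewrite !ltW. Qed.

Lemma flow_Ck a b k : Ck k cylinder (fun q => flow_mx q a b).
Proof.
apply: smooth_on_Ck; first exact: osub_open.
case: gf => _ hs _ q [q1 q2].
have pq r : cylinder r -> (`[0, T]%classic `*` coords i) r.
  by move=> hr; split; [rewrite /= in_itv; exact: cylinderT|exact: hr.2].
have [W [F [h1 h2 h3 h4]]] := hs i a b q (pq q (conj q1 q2)).
by exists W, F; split=> // r hr; exact: h4 (pq r hr).
Qed.

Lemma flow_unit q : cylinder q -> flow_mx q \in unitmx.
Proof. by move=> hq; have [_ c] := hq; exact: (metric_unit (flow_metric (cylinderT hq)) c). Qed.

Lemma flow_sym q : cylinder q -> (flow_mx q)^T = flow_mx q.
Proof. by move=> hq; have [_ c] := hq; exact: (metric_sym (flow_metric (cylinderT hq)) c). Qed.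

(** For 0 < t < T all small shifts of t stay in [0, T], so that the limit within [0, T] is a
    two-sided derivative. *)
Lemma flow_eq q a b : cylinder q -> 'D_((1, 0) : B) (fun q => flow_mx q a b) q
  = - 2 * ricci (fun y => flow_mx (q.1, y)) q.2 a b.
Proof.
case: q => t y hq; have tT := cylinderT hq; case: gf => _ _ /(_ t i y a b tT hq.2) L.
have d := Ck_derivable (@flow_Ck a b 1) ((1, 0) : B) hq.
have t0 : 0 < t < T by exact: hq.1.
have sh : (h + t) @[h --> (0 : R)^'] --> within `[0, T]%classic t^'.
  move=> P hP; rewrite /= in hP.
  have hP' : \forall s \near t, s != t -> s \in `[0, T] -> P s.
    have h0 : nbhs t [set s | s != t -> s \in `[0, T] -> P s] by exact: hP.
    exact: h0.
  have c : {for (0 : R), continuous (fun h : R => h + t)}.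
    by apply: cvgD; [exact: cvg_id|exact: cvg_cst].
  have n2 : \forall s \near t, s \in `[0, T].
    have : nbhs t `]0, T[%classic.
      by apply: open_nbhs_nbhs; split; [exact: interval_open|rewrite /= in_itv].
    by apply: filterS => s /=; rewrite !in_itv /= => /andP[u v]; rewrite !ltW.
  have n3 : nbhs (0 + t) [set s | (s != t -> s \in `[0, T] -> P s) /\ s \in `[0, T]].
    by rewrite add0r; apply: filterI.
  have n4 : nbhs (0 : R) [set h | (h + t != t -> h + t \in `[0, T] -> P (h + t)) /\ h + t \in `[0, T]].
    exact: (c _ n3).
  apply: filterS n4 => h [/= h1 h2] h0.
  by apply: h1 => //; rewrite -subr_eq0 addrK.
have L' := cvg_comp _ _ sh L.
have e : 'D_((1, 0) : B) (fun q => flow_mx q a b) (t, y) =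
    lim (h^-1 *: (flow_mx (h *: ((1, 0) : B) + (t, y)) a b - flow_mx (t, y) a b) @[h --> (0 : R)^']) by [].
rewrite e; apply: cvg_lim => //; apply: cvg_trans L'; apply: near_eq_cvg.
near=> h; rewrite /flow_mx /= scaler0 add0r.
rewrite -[h *: 1]/(h * 1) mulr1 addrK; exact: mulrC.
Unshelve. all: by end_near.
Qed.

End Interior.
End Flow.
End Charts.

(** * Lengths of curves *)

Section Breaks.
Variable R : realType.

(** A break point splits the interval into two parts on which only the remaining ones count. This
    reduces claims on piecewise smooth curves to smooth pieces and to adjoining intervals. *)
Lemma break_ind (P : R -> R -> Prop) (s : seq R) :
  (forall a b, a < b -> (forall r, r \in s -> ~~ (a < r < b)) -> P a b) ->
  (forall a m b, a < m -> m < b -> P a m -> P m b -> P a b) ->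
  forall a b, a < b -> P a b.
Proof.
elim: s => [|r s IH] hb hs a b ab; first by apply: hb.
apply: IH => // {ab}a {}b ab nb.
have nb' p q r' : a <= p -> q <= b -> r' \in s -> ~~ (p < r' < q).
  move=> ap qb /nb; apply: contra => /andP[h1 h2].
  by rewrite (le_lt_trans ap h1) (lt_le_trans h2 qb).
have [/andP[ar rb]|nr] := boolP (a < r < b); last first.
  by apply: hb => // r'; rewrite inE => /orP[/eqP->|/nb].
apply: (hs a r b) => //; apply: hb => // r'; rewrite inE => /orP[/eqP->|h].
- by rewrite ltxx andbF.
- by apply: nb' => //; exact: ltW.
- by rewrite ltxx.
- by apply: nb' => //; exact: ltW.
Qed.

Lemma gap (s : seq R) (u : R) :
  exists2 e : R, 0 < e & forall r, r \in s -> r != u -> e <= `|r - u|.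
Proof.
elim: s => [|r s [e e0 he]]; first by exists 1.
have [->|ru] := eqVneq r u.
  exists e => // r'; rewrite inE => /orP[/eqP->|/he]; [by rewrite eqxx|exact].
exists (Num.min e `|r - u|); first by rewrite lt_min e0 normr_gt0 subr_eq0.
move=> r'; rewrite inE => /orP[/eqP-> _|/he h /h h']; first by rewrite ge_min lexx orbT.
by rewrite ge_min h'.
Qed.

(** The tool of the length estimates: they compare derivatives off the break points instead of
    integrals. *)
Lemma mono_off (f df : R -> R) (s : seq R) a b : a <= b -> {within `[a, b], continuous f} ->
  (forall u, a < u < b -> u \notin s -> is_derive u 1 f (df u) /\ 0 <= df u) -> f a <= f b.
Proof.
rewrite le_eqVlt => /orP[/eqP->//|ab] cf hd.
have := @break_ind (fun p q => a <= p -> q <= b -> f p <= f q) s _ _ a b ab (lexx _) (lexx _).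
apply.
- move=> p q pq nb ap qb.
  have cpq : {within `[p, q], continuous f}.
    apply: continuous_subspaceW cf => z /=; rewrite !in_itv /= => /andP[h1 h2].
    by rewrite (le_trans ap h1) (le_trans h2 qb).
  have d z : z \in `]p, q[ -> is_derive z 1 f (df z) /\ 0 <= df z.
    rewrite in_itv /= => /andP[z1 z2]; apply: hd.
      by rewrite (le_lt_trans ap z1) (lt_le_trans z2 qb).
    by apply/negP => /nb; rewrite z1 z2.
  apply: (@ger0_derive1_le_cc R f p q) => //; rewrite ?in_itv /= ?lexx ?ltW //.
  + by move=> z /d[h _]; exact: (@ex_derive _ _ _ _ _ _ _ h).
  + by move=> z /d[h h0]; rewrite derive1E (@derive_val _ _ _ _ _ _ _ h).
- move=> p m q pm mq h1 h2 ap qb; apply: (le_trans (h1 ap _) (h2 _ qb)).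
    exact: le_trans (ltW mq) qb.
  exact: le_trans ap (ltW pm).
Qed.

Lemma nbhs_itvoo (a b u : R) : a < u < b -> nbhs u `]a, b[%classic.
Proof. by move=> h; apply: open_nbhs_nbhs; split; [exact: interval_open|rewrite /= in_itv]. Qed.

Lemma within_cont (T : topologicalType) (a b u : R) (c : R -> T) :
  {within `[a, b], continuous c} -> a < u < b -> {for u, continuous c}.
Proof.
move=> cc uab N hN.
have uI : `[a, b]%classic u by move: uab => /andP[h1 h2]; rewrite /= in_itv /= !ltW.
have h : nbhs u [set z | `[a, b]%classic z -> N (c z)].
  exact: ((@subspace_continuousP _ _ _ c).1 cc u uI N hN).
apply: filterS (filterI h (nbhs_itvoo uab)) => z [h1 /=]; rewrite in_itv /= => /andP[h2 h3].
by apply: h1; rewrite /= in_itv /= !ltW.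
Qed.

Lemma near_within (T : topologicalType) (a b u : R) (c : R -> T) (N : set T) :
  {within `[a, b], continuous c} -> a <= u <= b -> nbhs (c u) N ->
  \forall z \near u, a <= z <= b -> N (c z).
Proof.
move=> cc uab hN; have uI : `[a, b]%classic u by rewrite /= in_itv.
have h : nbhs u [set z | `[a, b]%classic z -> N (c z)].
  exact: ((@subspace_continuousP _ _ _ c).1 cc u uI N hN).
by apply: filterS h => z h1 h2; apply: h1; rewrite /= in_itv.
Qed.

End Breaks.

(** * Bounds of quadratic forms *)

Section QForm.
Variables (R : realType) (n : nat).

Lemma qformE (A : 'M[R]_n) v : qform A v = \sum_b \sum_a v ord0 a * A a b * v ord0 b.
Proof.
rewrite /qform mxE; apply: eq_bigr => b _; rewrite mxE mulr_suml.
by apply: eq_bigr => a _; rewrite mxE.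
Qed.

Lemma qformZ (A : 'M[R]_n) (k : R) v : qform A (k *: v) = k ^+ 2 * qform A v.
Proof.
rewrite !qformE mulr_sumr; apply: eq_bigr => b _; rewrite mulr_sumr.
by apply: eq_bigr => a _; rewrite !mxE; ring.
Qed.

Lemma qformB (A B : 'M[R]_n) v : qform (A - B) v = qform A v - qform B v.
Proof.
rewrite !qformE -sumrB; apply: eq_bigr => b _; rewrite -sumrB.
by apply: eq_bigr => a _; rewrite !mxE; ring.
Qed.

Lemma qform_norm_le (A : 'M[R]_n) (e : R) v : (forall a b, `|A a b| <= e) ->
  `|qform A v| <= n%:R ^+ 2 * e * `|v| ^+ 2.
Proof.
move=> h; rewrite qformE.
have -> : n%:R ^+ 2 * e * `|v| ^+ 2 = n%:R * (n%:R * (`|v| * e * `|v|)) by ring.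
apply: ler_norm_sum_ord => b; apply: ler_norm_sum_ord => a.
by apply: ler_normM; [apply: ler_normM|]; rewrite ?ler_entry_norm.
Qed.

Lemma norm_rV_le (v : 'rV[R]_n) c : 0 <= c -> (forall k, `|v ord0 k| <= c) -> `|v| <= c.
Proof.
move=> c0 h; rewrite [leLHS]/Num.Def.normr /= mx_normrE; apply: bigmax_le => // -[i k] _ /=.
by rewrite (ord1 i).
Qed.

(** In an orthonormal frame [Y] the form is a sum of squares and controls each coordinate there;
    returning to the original coordinates costs a factor of at most n |Y|. *)
Lemma posdef_lower (A : 'M[R]_n) : A^T = A -> (forall v, v != 0 -> 0 < qform A v) ->
  exists2 m : R, 0 < m & forall v, m * `|v| ^+ 2 <= qform A v.
Proof.
move=> sA pA; have [Y hY] := orthonormal_frame sA pA.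
have uY : Y \in unitmx.
  by have := unitmx1 R n; rewrite -hY !unitmx_mul => /andP[/andP[]].
pose K : R := n%:R * `|Y| + 1.
have K0 : 0 < K by rewrite ltr_wpDl // mulr_ge0.
exists (K ^+ 2)^-1; first by rewrite invr_gt0 exprn_gt0.
move=> v; pose w := v *m invmx Y.
have vE : v = w *m Y by rewrite /w -mulmxA mulVmx // mulmx1.
have qE : qform A v = \sum_k w ord0 k ^+ 2.
  rewrite vE /qform trmx_mul !mulmxA -(mulmxA w) -(mulmxA w) hY mulmx1 mxE.
  by apply: eq_bigr => k _; rewrite [X in _ * X]mxE.
have q0 : 0 <= qform A v by rewrite qE sumr_ge0 // => k _; exact: sqr_ge0.
have wk k : `|w ord0 k| <= Num.sqrt (qform A v).
  by rewrite qE; exact: (ler_abs_sqrt_sumsq (fun k => w ord0 k)).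
have hv : `|v| <= K * Num.sqrt (qform A v).
  apply: norm_rV_le; first by rewrite mulr_ge0 ?sqrtr_ge0 // ltW.
  move=> j; rewrite {1}vE mxE; apply: (@le_trans _ _ (n%:R * (Num.sqrt (qform A v) * `|Y|))).
    by apply: ler_norm_sum_ord => k; apply: ler_normM => //; exact: ler_entry_norm.
  rewrite mulrCA [leRHS]mulrC ler_wpM2l ?sqrtr_ge0 // /K; lra.
rewrite mulrC ler_pdivrMr ?exprn_gt0 //.
have : `|v| ^+ 2 <= (K * Num.sqrt (qform A v)) ^+ 2.
  by rewrite lerXn2r // nnegrE // mulr_ge0 ?sqrtr_ge0 // ltW.
by rewrite exprMn sqr_sqrtr // mulrC.
Qed.

End QForm.

(** * Speed and arc length of piecewise smooth curves *)

Section Curves.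
Variables (R : realType) (n : nat) (M : smooth_manifold R n) (g : tensor2 M).
Hypothesis hm : riemannian_metric g.
Implicit Types (c : R -> M) (i j : atlas M).

Lemma metric_near i y0 e : coords i y0 -> 0 < e ->
  \forall y \near y0, coords i y /\ forall a b, `|g i y a b - g i y0 a b| <= e.
Proof.
move=> cy e0; apply: filterI; first by apply: open_nbhs_nbhs; split=> //; exact: open_coords.
have h (q : 'I_n * 'I_n) : \forall y \near y0, `|g i y q.1 q.2 - g i y0 q.1 q.2| <= e.
  have /cvgrPdist_le/(_ e e0) := Ck_cont (metric_Ck hm i q.1 q.2 0) cy.
  by apply: filterS => y; rewrite distrC.
have := @filter_forall _ _ (fun q y => `|g i y q.1 q.2 - g i y0 q.1 q.2| <= e) (nbhs y0) (nbhs_filter y0) h.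
by apply: filterS => y h1 a b; exact: (h1 (a, b)).
Qed.

Lemma metric_upper i y0 : coords i y0 -> exists2 K : R, 0 < K &
  \forall y \near y0, coords i y /\ forall v, qform (g i y) v <= (K * `|v|) ^+ 2.
Proof.
move=> cy; pose K : R := n%:R * (`|g i y0| + 1) + 1; have K0 : 0 < K.
  by rewrite ltr_wpDl // mulr_ge0 // addr_ge0.
exists K => //; apply: filterS (metric_near cy ltr01) => y [cy' h]; split=> // v.
apply: (le_trans (ler_norm _)).
apply: (le_trans (qform_norm_le (e := `|g i y0| + 1) v _)) => [a b|].
  have -> : g i y a b = g i y0 a b + (g i y a b - g i y0 a b) by rewrite addrC subrK.
  by apply: (le_trans (ler_normD _ _)); rewrite lerD // ler_entry_norm.
rewrite exprMn ler_wpM2r ?sqr_ge0 // /K.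
have n0 : 0 <= n%:R :> R by []. have g0 : 0 <= `|g i y0| by [].
move: (n%:R) n0 (`|g i y0|) g0 => N n0 G g0; nra.
Qed.

Lemma metric_lower i y0 : coords i y0 -> exists2 m : R, 0 < m &
  \forall y \near y0, coords i y /\ forall v, (m * `|v|) ^+ 2 <= qform (g i y) v.
Proof.
move=> cy; have [m m0 hmm] := posdef_lower (metric_sym hm cy) (metric_pos hm cy).
(* Entries within [e] of those at y0 change the form by at most n^2 e |v|^2, which is at most half
   of the lower bound m |v|^2. *)
pose e := m / (2 * (n%:R ^+ 2 + 1)).
have n0 : 0 <= n%:R ^+ 2 :> R by rewrite exprn_ge0.
have e0 : 0 < e by rewrite divr_gt0 // mulr_gt0 // ltr_wpDl.
exists (Num.sqrt (m / 2)); first by rewrite sqrtr_gt0 divr_gt0.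
apply: filterS (metric_near cy e0) => y [cy' h]; split=> // v.
rewrite exprMn sqr_sqrtr; last by rewrite divr_ge0 // ltW.
have E : qform (g i y) v = qform (g i y0) v + qform (g i y - g i y0) v.
  by rewrite qformB addrC subrK.
have h2 : `|qform (g i y - g i y0) v| <= n%:R ^+ 2 * e * `|v| ^+ 2.
  by apply: qform_norm_le => a b; rewrite !mxE.
have h3 : n%:R ^+ 2 * e <= m / 2.
  rewrite /e; have -> : n%:R ^+ 2 * (m / (2 * (n%:R ^+ 2 + 1))) = (m / 2) * (n%:R ^+ 2 / (n%:R ^+ 2 + 1)).
    by field; rewrite gt_eqF // ltr_wpDl.
  apply: ler_piMr; first by rewrite divr_ge0 // ltW.
  by rewrite ler_pdivrMr ?ltr_wpDl // mul1r lerDl.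
have h4 := ler_wpM2r (sqr_ge0 `|v|) h3; have h5 := hmm v.
move: h2; rewrite ler_norml => /andP[h2 _]; rewrite E; lra.
Qed.

Definition curve_breaks c (s : seq R) := {within `[0, 1], continuous c} /\
  forall a b : R, 0 <= a -> a <= b -> b <= 1 ->
    (forall r, r \in s -> ~~ (a < r < b)) -> smooth_curve `[a, b] c.

(** [speed] uses the chart chosen at [c w]; the transformation law of the metric and the chain rule
    give the same value in any chart, from a smooth local expression [F] of the curve. *)
Lemma speed_chart c i w F (W : set R) : open W -> W w -> (forall k, Ck k W F) ->
  (\forall z \near w, dom i (c z) /\ chart i (c z) = F z) ->
  [/\ derivable (chart i \o c) w 1, 'D_1 (chart i \o c) w = 'D_1 F w &
      speed g c w = Num.sqrt (qform (g i (F w)) ('D_1 F w))].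
Proof.
move=> oW Ww hF hc; have [dw eF] := nbhs_singleton hc.
have dF := Ck_derivable (hF 1) (1 : R) Ww.
have ne : \forall z \near w, (chart i \o c) z = F z by apply: filterS hc => z [].
have ne' : \forall z \near w, F z = (chart i \o c) z by apply: filterS ne => z ->.
split; [exact: (near_eq_derivable ne' dF)|exact: near_eq_derive|].
pose j := chart_at (c w); have dj : dom j (c w) by exact: dom_chart_at.
have ov : overlap i j (F w) by exists (c w).
have cF : {for w, continuous F} by exact: (Ck_cont (hF 0) Ww).
have hov : \forall z \near w, overlap i j (F z).
  by apply: cF; apply: open_nbhs_nbhs; split=> //; exact: open_overlap.
have nj : \forall z \near w, (chart j \o c) z = ((chart j \o param i) \o F) z.
  by apply: filterS hc => z [dz ez] /=; rewrite -ez chartK.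
have hd k : derivable ((fun v : 'rV[R]_n => v ord0 k) \o F) w 1.
  exact: ((derivable_mxP _ _ _).1 dF).
have cr l := chain_rule (coordinates_rV R n) (@open_overlap _ _ M i j)
  (@transition_entry_Ck _ _ M i j l 1) ov hd.
have dT : derivable ((chart j \o param i) \o F) w 1.
  apply/derivable_mxP => a l; rewrite (ord1 a); exact: (cr l).1.
have eD : derive1 (chart j \o c) w = 'D_1 F w *m inv_J (chart j \o param i) (F w).
  rewrite derive1E (near_eq_derive (1 : R) nj) (derive_mx dT); apply/rowP => l; rewrite [LHS]mxE [RHS]mxE.
  rewrite (cr l).2; apply: eq_bigr => k _; congr (_ * _).
    by rewrite (derive_mx dF) mxE.
  by rewrite /inv_J mxE.
rewrite /speed -/j eD (metric_transform hm ov) /qform trmx_mul !mulmxA.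
have -> // : (chart j \o param i) (F w) = chart j (c w) by rewrite /= -eF chartK.
Qed.

Section Pieces.
Variables (c : R -> M) (s : seq R).
Hypothesis hc : curve_breaks c s.

(** Up to the ends of an interval without breaks, the curve in a chart is the restriction of some
    [F] that is smooth on both sides of [u0]. [Q] collects interior parameters near which the two
    agree, so that speeds can be computed from [F]. *)
Lemma piece a b u0 i : 0 <= a -> a < b -> b <= 1 -> (forall r, r \in s -> ~~ (a < r < b)) ->
  a <= u0 <= b -> dom i (c u0) ->
  exists (F : R -> 'rV[R]_n) (W Q : set R),
  [/\ open W, W u0, forall k, Ck k W F & F u0 = chart i (c u0)] /\
  [/\ forall w, Q w -> W w, forall w, Q w -> \forall z \near w, dom i (c z) /\ chart i (c z) = F z &
      \forall w \near u0, a < w < b -> Q w].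
Proof.
move=> a0 ab b1 nb uab du; case: hc => cc sc.
have pu : (`[a, b]%classic `&` c @^-1` dom i) u0 by split=> //; rewrite /= in_itv.
have [W [F [oW Wu hF e]]] := sc a b a0 (ltW ab) b1 nb i u0 pu.
pose Q := [set w | (a < w < b) /\ W w /\ dom i (c w)].
exists F, W, Q; split; first by split=> //; rewrite -e.
split.
- by move=> w [_ []].
- move=> w [wab [Ww dw]].
  have w01 : 0 < w < 1 by case/andP: wab => h1 h2; rewrite (le_lt_trans a0 h1) (lt_le_trans h2 b1).
  have n1 : \forall z \near w, dom i (c z) by exact: (within_cont cc w01 (near_dom dw)).
  have n2 : nbhs w W by apply: open_nbhs_nbhs.
  apply: filterS (filterI (filterI n1 n2) (nbhs_itvoo wab)) => z [[dz Wz]] /=.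
  rewrite in_itv /= => /andP[z1 z2]; split=> //; rewrite -e //.
  by split=> //; rewrite /= in_itv /= !ltW.
- have u01 : 0 <= u0 <= 1 by case/andP: uab => h1 h2; rewrite (le_trans a0 h1) (le_trans h2 b1).
  have n1 := near_within cc u01 (near_dom du).
  have n2 : nbhs u0 W by apply: open_nbhs_nbhs.
  apply: filterS (filterI n1 n2) => w [h1 h2] wab; split=> //; split=> //.
  by apply: h1; case/andP: wab => h3 h4; rewrite (le_trans a0 (ltW h3)) (le_trans (ltW h4) b1).
Qed.

Lemma piece_speed a b u0 : 0 <= a -> a < b -> b <= 1 -> (forall r, r \in s -> ~~ (a < r < b)) ->
  a <= u0 <= b -> exists2 sg : R -> R, {for u0, continuous sg} &
  \forall w \near u0, a < w < b -> speed g c w = sg w.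
Proof.
move=> a0 ab b1 nb uab; have du := dom_chart_at (c u0); set i := chart_at (c u0) in du.
have [F [W [Q [[oW Wu hF eF] [QW Qn nQ]]]]] := piece a0 ab b1 nb uab du.
exists (fun w => Num.sqrt (qform (g i (F w)) ('D_1 F w))); last first.
  by apply: filterS nQ => w h /h Qw; have [_ _ ->] := speed_chart oW (QW _ Qw) hF (Qn _ Qw).
have cF : {for u0, continuous F} by exact: (Ck_cont (hF 0) Wu).
apply: (@continuous_comp _ _ _ (fun w => qform (g i (F w)) ('D_1 F w)) Num.sqrt); last exact: sqrt_continuous.
have -> : (fun w => qform (g i (F w)) ('D_1 F w)) =
   (fun w => \sum_b \sum_a 'D_1 F w ord0 a * g i (F w) a b * 'D_1 F w ord0 b).
  by apply/funext => w; rewrite qformE.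
have cG p q : {for u0, continuous (fun w => g i (F w) p q)}.
  apply: (@continuous_comp _ _ _ F (fun y => g i y p q)) => //.
  by apply: (Ck_cont (metric_Ck hm i p q 0)); rewrite eF; exact: coords_chart.
have cD p : {for u0, continuous (fun w => 'D_1 F w ord0 p)}.
  have h := Ck_entry p oW (Ck_D (1 : R) (hF 1)); exact: (Ck_cont h Wu).
have csum (f : 'I_n -> R -> R) : (forall k, {for u0, continuous (f k)}) ->
    {for u0, continuous (fun w => \sum_k f k w)}.
  move=> h; have -> : (fun w => \sum_k f k w) = \sum_k f k by apply/funext => w; rewrite fct_sumE.
  elim/big_ind: _ => [|x y hx hy|k _]; [exact: cst_continuous|exact: cvgD|exact: h].
apply: (csum) => q; apply: (csum) => p; apply: cvgM; last exact: cD.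
by apply: cvgM; [exact: cD|exact: cG].
Qed.

Lemma gap01 u : 0 < u < 1 -> u \notin s ->
  exists a b, [/\ 0 <= a, a < u < b, b <= 1 & forall r, r \in s -> ~~ (a < r < b)].
Proof.
move=> /andP[u0 u1] us; have [e e0 he] := gap s u.
exists (Num.max 0 (u - e)), (Num.min 1 (u + e)); split.
- by rewrite le_max lexx.
- by rewrite gt_max u0 lt_min u1 gtrBl ltrDl e0.
- by rewrite ge_min lexx.
move=> r rs; apply/negP; rewrite gt_max lt_min => /andP[/andP[_ h1] /andP[_ h2]].
have ru : r != u by apply: contraNneq us => <-.
by have := he r rs ru; rewrite leNgt ltr_norml; apply/negP/negPn; lra.
Qed.

Lemma regular_speed u i : 0 < u < 1 -> u \notin s -> dom i (c u) ->
  derivable (chart i \o c) u 1 /\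
  speed g c u = Num.sqrt (qform (g i (chart i (c u))) ('D_1 (chart i \o c) u)).
Proof.
move=> u01 us du; have [a [b [a0 uab b1 nb]]] := gap01 u01 us.
have ab : a < b by case/andP: uab; exact: lt_trans.
have uab' : a <= u <= b by case/andP: uab => *; rewrite !ltW.
have [F [W [Q [[oW Wu hF eF] [QW Qn nQ]]]]] := piece a0 ab b1 nb uab' du.
have Qu : Q u by apply: (nbhs_singleton nQ).
have [h1 -> ->] := speed_chart oW (QW _ Qu) hF (Qn _ Qu).
by rewrite -eF.
Qed.

Lemma regular_speed_cont u : 0 < u < 1 -> u \notin s -> {for u, continuous (speed g c)}.
Proof.
move=> u01 us; have [a [b [a0 uab b1 nb]]] := gap01 u01 us.
have ab : a < b by case/andP: uab; exact: lt_trans.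
have uab' : a <= u <= b by case/andP: uab => *; rewrite !ltW.
have [sg csg nsg] := piece_speed a0 ab b1 nb uab'.
have e : \forall w \near u, speed g c w = sg w.
  apply: filterS (filterI nsg (nbhs_itvoo uab)) => w [h /=]; rewrite in_itv; exact: h.
move=> N; rewrite (nbhs_singleton e) => /csg hN.
by apply: filterS (filterI e hN) => w [ew Nw]; rewrite /preimage /= ew.
Qed.

Lemma speed_ge0 u : 0 <= speed g c u.
Proof. exact: sqrtr_ge0. Qed.

(** The smooth extensions bound the speed on either side of u; the value at u itself, arbitrary at a
    break point, is adjoined as a third bound. *)
Lemma speed_locally_bounded (u : R) : 0 <= u <= 1 ->
  exists K : R, \forall w \near u, 0 <= w <= 1 -> speed g c w <= K.
Proof.
move=> /andP[u0 u1]; have [e e0 he] := gap s u.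
have bd (sg : R -> R) : {for u, continuous sg} -> \forall w \near u, sg w <= `|sg u| + 1.
  move=> /cvgrPdist_le/(_ 1 ltr01); apply: filterS => w.
  rewrite distrC ler_norml => /andP[_ h]; have := ler_norm (sg u); lra.
have left : exists K : R, \forall w \near u, 0 <= w -> w < u -> speed g c w <= K.
  move: u0; rewrite le_eqVlt => /orP[/eqP u0|u0].
    by exists 0; apply: filterS (@filterT _ (nbhs u) _) => w _; rewrite -u0 => h1 h2; have := le_lt_trans h1 h2; rewrite ltxx.
  have a0 : 0 <= Num.max 0 (u - e) by rewrite le_max lexx.
  have au : Num.max 0 (u - e) < u by rewrite gt_max u0 gtrBl.
  have nb r : r \in s -> ~~ (Num.max 0 (u - e) < r < u).
    move=> rs; apply/negP; rewrite gt_max => /andP[/andP[_ h1] h2].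
    have := he r rs (negbT (lt_eqF h2)); rewrite ltr0_norm ?subr_lt0 //; lra.
  have uab : Num.max 0 (u - e) <= u <= u by rewrite lexx ltW.
  have [sg csg nsg] := piece_speed a0 au u1 nb uab.
  exists (`|sg u| + 1).
  have n3 : nbhs u `]Num.max 0 (u - e), u + 1[%classic by apply: nbhs_itvoo; rewrite au ltrDl ltr01.
  apply: filterS (filterI (filterI nsg (bd _ csg)) n3) => w [[h1 h2]] /=.
  by rewrite in_itv /= => /andP[h3 _] _ h4; rewrite h1 // h3.
have right : exists K : R, \forall w \near u, w <= 1 -> u < w -> speed g c w <= K.
  move: u1; rewrite le_eqVlt => /orP[/eqP u1|u1].
    by exists 0; apply: filterS (@filterT _ (nbhs u) _) => w _; rewrite u1 => h1 h2; have := le_lt_trans h1 h2; rewrite ltxx.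
  have b1 : Num.min 1 (u + e) <= 1 by rewrite ge_min lexx.
  have ub : u < Num.min 1 (u + e) by rewrite lt_min u1 ltrDl.
  have nb r : r \in s -> ~~ (u < r < Num.min 1 (u + e)).
    move=> rs; apply/negP; rewrite lt_min => /andP[h1 /andP[_ h2]].
    have := he r rs (negbT (gt_eqF h1)); rewrite gtr0_norm ?subr_gt0 //; lra.
  have uab : u <= u <= Num.min 1 (u + e) by rewrite lexx ltW.
  have [sg csg nsg] := piece_speed u0 ub b1 nb uab.
  exists (`|sg u| + 1).
  have n3 : nbhs u `]u - 1, Num.min 1 (u + e)[%classic by apply: nbhs_itvoo; rewrite ub gtrBl ltr01.
  apply: filterS (filterI (filterI nsg (bd _ csg)) n3) => w [[h1 h2]] /=.
  by rewrite in_itv /= => /andP[_ h3] _ h4; rewrite h1 // h3 h4.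
have [K1 h1] := left; have [K2 h2] := right.
exists (Num.max (Num.max K1 K2) (speed g c u)).
apply: filterS (filterI h1 h2) => w [g1 g2] /andP[w0 w1]; rewrite !le_max.
case: (ltgtP w u) => [wu|uw|->].
- rewrite (g1 w0 wu); exact: isT.
- rewrite (g2 w1 uw) orbT; exact: isT.
- rewrite (lexx (speed g c u)) !orbT; exact: isT.
Qed.

Lemma speed_bounded : exists K : R, forall u, 0 <= u <= 1 -> speed g c u <= K.
Proof.
have /compact_near_coveringP cov := @segment_compact R 0 1.
have := cov R (pinfty_nbhs R) (fun K w => 0 <= w <= 1 -> speed g c w <= K) _.
case=> [u|K [_ hK]].
  rewrite /= in_itv /= => u01; have [K hK] := speed_locally_bounded u01.
  exists ([set w | 0 <= w <= 1 -> speed g c w <= K], [set K' | K <= K']) => /=.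
    by split=> //; apply: nbhs_pinfty_ge; exact: num_real.
  by move=> [w K'] /= [h1 h2] h3; exact: le_trans (h1 h3) h2.
by exists (K + 1) => u u01; apply: hK => //; rewrite ltrDl.
Qed.

Lemma speed_measurable : measurable_fun (`[(0 : R), 1]%classic : set R) (speed g c).
Proof.
have := @break_ind R (fun p q => 0 <= p -> q <= 1 -> measurable_fun (`[p, q]%classic : set R) (speed g c)) s _ _ 0 1 ltr01 (lexx _) (lexx _).
apply.
- move=> p q pq nb p0 q1; apply: (@measurable_fun_itv_cc _ p q false true).
  apply: open_continuous_measurable_fun; first exact: interval_open.
  move=> u; rewrite inE /= in_itv /= => /andP[h1 h2]; apply: regular_speed_cont.
    by rewrite (le_lt_trans p0 h1) (lt_le_trans h2 q1).
  by apply/negP => /nb; rewrite h1 h2.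
- move=> p m q pm mq h1 h2 p0 q1.
  have -> : `[p, q]%classic = `[p, m] `|` `[m, q] :> set R.
    apply/seteqP; split=> u /=; rewrite !in_itv /=.
      by move=> /andP[g1 g2]; have [um|mu] := leP u m; [left; rewrite g1|right; rewrite ltW].
    case=> /andP[g1 g2]; first by rewrite g1 (le_trans g2 (ltW mq)).
    by rewrite g2 (le_trans (ltW pm) g1).
  apply/measurable_funU => //; split; first by apply: h1 => //; exact: le_trans (ltW mq) q1.
  by apply: h2 => //; exact: le_trans p0 (ltW pm).
Qed.

Lemma speed_integrable : (@lebesgue_measure R).-integrable (`[(0 : R), 1]%classic : set R) (EFin \o speed g c).
Proof.
apply: measurable_bounded_integrable => //.
- by have := @lebesgue_measure_itv R `[0, 1]; rewrite /= lte_fin ltr01 => ->; rewrite -EFinB ltry.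
- exact: speed_measurable.
- have [K hK] := speed_bounded; exists K; split; first exact: num_real.
  move=> K' hK' u /=; rewrite in_itv /= => /hK h.
  by rewrite ger0_norm ?speed_ge0 // (le_trans h) // ltW.
Qed.

(** The arc length function. Lengths are used below through these properties, which suit
    [mono_off]. *)
Lemma curve_antiderivative : exists l : R -> R,
  [/\ {within `[0, 1], continuous l}, l 0 = 0, l 1 = curve_length g c &
      forall u, 0 < u < 1 -> u \notin s -> is_derive u 1 l (speed g c u)].
Proof.
exists (fun x => parameterized_integral (@lebesgue_measure R) 0 x (speed g c)); split.
- exact: (parameterized_integral_continuous ler01 speed_integrable).
- by rewrite /parameterized_integral set_itv1 Rintegral_set1.
- by [].
move=> u u01 us; have /andP[u0 u1] := u01.
have [h1 h2] := continuous_FTC1_closed u1 speed_integrable u0 (regular_speed_cont u01 us).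
by split; [exact: h1|rewrite -derive1E; exact: h2].
Qed.

End Pieces.
End Curves.

(** * The Hopf-Rinow theorem *)

Section AffineReparametrisation.
Variables (R : realType) (a k : R).

Lemma affineL (h w x : R) : a + k * (h *: w + x) = h *: (k *: w) + (a + k * x).
Proof. by rewrite /GRing.scale /=; ring. Qed.

Lemma affine_cont : continuous (fun u : R => a + k * u).
Proof.
move=> u; apply: cvgD; first exact: cvg_cst.
by apply: cvgM; [exact: cvg_cst|exact: cvg_id].
Qed.

Lemma is_derive_aff (l : R -> R) u d : is_derive (a + k * u) 1 l d ->
  is_derive u 1 (fun u => l (a + k * u)) (k * d).
Proof.
move=> h; have [h1 h2] := derive_scale k (@ex_derive _ _ _ _ _ _ _ h).
apply: (@is_derive_affine _ _ _ _ (fun u => a + k * u) (fun w => k *: w)).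
  by move=> x w c; exact: affineL.
by split=> //; rewrite h2 (@derive_val _ _ _ _ _ _ _ h).
Qed.

Lemma within_pull (T : topologicalType) (c : R -> T) u (N : set T) :
  {within `[0, 1], continuous c} -> 0 <= a + k * u <= 1 -> nbhs (c (a + k * u)) N ->
  \forall z \near u, 0 <= a + k * z <= 1 -> N (c (a + k * z)).
Proof. by move=> cc u01 hN; exact: (@affine_cont u _ (near_within cc u01 hN)). Qed.

End AffineReparametrisation.

Section Reach.
Variables (R : realType) (n : nat) (M : smooth_manifold R n) (g : tensor2 M).
Hypothesis hm : riemannian_metric g.
Implicit Types (c : R -> M) (i j : atlas M) (x y : M).

Lemma smooth_pull (A A' : set R) c c' i (a k : R) :
  smooth_on (A `&` c @^-1` dom i) (chart i \o c) ->
  (forall z, A' z -> A (a + k * z) /\ c' z = c (a + k * z)) ->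
  smooth_on (A' `&` c' @^-1` dom i) (chart i \o c').
Proof.
move=> hs hA u [Au du]; have [Au' eu] := hA u Au.
have pu : (A `&` c @^-1` dom i) (a + k * u) by split=> //; rewrite /preimage /= -eu.
have [W [F [oW Wu hF e]]] := hs _ pu.
exists ((fun u => a + k * u) @^-1` W), (F \o (fun u => a + k * u)); split=> //.
- by apply: open_comp => // z _; exact: affine_cont.
- move=> m; apply: (@Ck_affine _ _ _ _ (fun u => a + k * u) (fun w => k *: w)) => //.
    exact: affine_cont.
  by move=> x w h; exact: affineL.
- move=> z [Az dz] Wz; have [Az' ez] := hA z Az.
  by rewrite /= ez -e //; split=> //; rewrite /preimage /= -ez.
Qed.

Lemma speed_germ c c' u : (\forall z \near u, c z = c' z) -> speed g c u = speed g c' u.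
Proof.
move=> h; rewrite /speed (nbhs_singleton h); set j := chart_at _.
have e : \forall z \near u, (chart j \o c) z = (chart j \o c') z by apply: filterS h => z /= ->.
by rewrite !derive1E (near_eq_derive (1 : R) e).
Qed.

Lemma speed_affine c s a k u : curve_breaks c s -> 0 < a + k * u < 1 -> a + k * u \notin s ->
  speed g (fun u => c (a + k * u)) u = `|k| * speed g c (a + k * u).
Proof.
move=> hc u01 us; set j := chart_at (c (a + k * u)).
have [dj _] := regular_speed hm hc u01 us (dom_chart_at (c (a + k * u))).
have [_ e2] := derive_scale k dj.
rewrite /speed -/j !derive1E.
rewrite -[chart j \o (fun u => c (a + k * u))]/((chart j \o c) \o (fun u => a + k * u)).
rewrite (@derive_affine _ _ _ _ (fun u => a + k * u) (fun w => k *: w)); last first.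
  by move=> x w h; exact: affineL.
by rewrite e2 qformZ sqrtrM ?sqr_ge0 // sqrtr_sqr.
Qed.

(** Unlike a bound on [dist], this fails for points that no curve joins; the strict inequality
    avoids asking whether an infimum of lengths is attained. *)
Definition reach x y (r : R) :=
  exists c s, [/\ curve_breaks c s, c 0 = x, c 1 = y & curve_length g c < r].

Lemma reachW x y r s : reach x y r -> r <= s -> reach x y s.
Proof. by move=> [c [b [h1 h2 h3 h4]]] rs; exists c, b; split=> //; exact: lt_le_trans rs. Qed.

Lemma length_le c s (f df : R -> R) : curve_breaks c s ->
  {within `[0, 1], continuous f} ->
  (forall u, 0 < u < 1 -> u \notin s -> is_derive u 1 f (df u) /\ speed g c u <= df u) ->
  curve_length g c <= f 1 - f 0.
Proof.
move=> hc cf hf; have [l [cl l0 l1 hl]] := curve_antiderivative hm hc.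
have := @mono_off R (fun u => f u - l u) (fun u => df u - speed g c u) s 0 1 ler01.
rewrite l0 l1 => h; have : f 0 - 0 <= f 1 - curve_length g c; last by lra.
apply: h => [|u u01 us].
  by move=> u; apply: cvgB; [exact: cf|exact: cl].
have [h1 h2] := hf u u01 us; have h3 := hl u u01 us.
by split; [exact: is_deriveB|rewrite subr_ge0].
Qed.

Lemma length_ge0 c s : curve_breaks c s -> 0 <= curve_length g c.
Proof.
move=> hc; have [l [cl l0 l1 hl]] := curve_antiderivative hm hc.
rewrite -l1 -l0; apply: (@mono_off R l (speed g c) s) => //= u u01 us.
by split; [exact: hl|exact: speed_ge0].
Qed.

Lemma reparam_breaks c s a b : curve_breaks c s -> 0 <= a <= 1 -> 0 <= b <= 1 -> a != b ->
  curve_breaks (fun u => c (a + (b - a) * u)) [seq (r - a) / (b - a) | r <- s].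
Proof.
move=> [cc sc] /andP[a0 a1] /andP[b0 b1] ab.
have k0 : b - a != 0 by rewrite subr_eq0 eq_sym.
have L01 z : 0 <= z <= 1 -> 0 <= a + (b - a) * z <= 1.
  by move=> /andP[z0 z1]; apply/andP; split; nra.
split.
  apply/subspace_continuousP => u; rewrite /= in_itv /= => u01 N hN.
  have := within_pull cc (L01 u u01) hN; apply: filterS => z h zI; apply: h; apply: L01.
  by move: zI; rewrite /= in_itv.
move=> p q p0 pq q1 nb i.
have rE r : a + (b - a) * ((r - a) / (b - a)) = r by field.
have [kp|kn] := ltP 0 (b - a).
  have hs := sc (a + (b - a) * p) (a + (b - a) * q).
  apply: (@smooth_pull `[a + (b - a) * p, a + (b - a) * q]%classic `[p, q]%classic c _ i a (b - a)).
    apply: hs; [by nra|by nra|by nra|].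
    move=> r rs; have := nb _ (map_f (fun r => (r - a) / (b - a)) rs); apply: contra.
    move=> /andP[h1 h2]; apply/andP.
    by split; rewrite -(ltr_pM2l kp) -(ltrD2l a) rE.
  move=> z; rewrite /= !in_itv /= => /andP[z1 z2]; split=> //.
  by rewrite !lerD2l !ler_pM2l // z1 z2.
have {}kn : b - a < 0 by rewrite lt_neqAle k0.
have hs := sc (a + (b - a) * q) (a + (b - a) * p).
apply: (@smooth_pull `[a + (b - a) * q, a + (b - a) * p]%classic `[p, q]%classic c _ i a (b - a)).
  apply: hs; [by nra|by nra|by nra|].
  move=> r rs; have := nb _ (map_f (fun r => (r - a) / (b - a)) rs); apply: contra.
  move=> /andP[h1 h2]; apply/andP.
  by split; rewrite -(ltr_nM2l kn) -(ltrD2l a) rE.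
move=> z; rewrite /= !in_itv /= => /andP[z1 z2]; split=> //.
by rewrite !lerD2l !ler_nM2l // z1 z2.
Qed.

(** The sign accounts for a > b, where the curve is run backwards; symmetry of [reach] is the case a
    = 1, b = 0. *)
Lemma reparam_length c s a b (l : R -> R) : curve_breaks c s -> 0 <= a <= 1 -> 0 <= b <= 1 -> a != b ->
  {within `[0, 1], continuous l} ->
  (forall u, 0 < u < 1 -> u \notin s -> is_derive u 1 l (speed g c u)) ->
  curve_length g (fun u => c (a + (b - a) * u)) <= Num.sg (b - a) * (l b - l a).
Proof.
move=> hc ha hb ab cl hl; have hc' := reparam_breaks hc ha hb ab.
have k0 : b - a != 0 by rewrite subr_eq0 eq_sym.
have := @length_le _ _ (fun u => Num.sg (b - a) * l (a + (b - a) * u))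
  (fun u => Num.sg (b - a) * ((b - a) * speed g c (a + (b - a) * u))) hc'.
rewrite mulr1 mulr0 addr0 (addrC a) subrK -mulrBr; apply.
  apply/subspace_continuousP => u; rewrite /= in_itv /= => u01.
  apply: cvgM; first exact: cvg_cst.
  have L01 z : 0 <= z <= 1 -> 0 <= a + (b - a) * z <= 1.
    by move: ha hb => /andP[? ?] /andP[? ?] /andP[z0 z1]; apply/andP; split; nra.
  move=> N hN; have := within_pull cl (L01 u u01) hN; apply: filterS => z h zI; apply: h; apply: L01.
  by move: zI; rewrite /= in_itv.
move=> u /andP[u0 u1] us.
have Lu : 0 < a + (b - a) * u < 1.
  move: ha hb k0 => /andP[? ?] /andP[? ?]; rewrite neq_lt => /orP[h|h]; apply/andP; split; nra.
have Ls : a + (b - a) * u \notin s.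
  apply: contra us => h; apply/mapP; exists (a + (b - a) * u) => //; by field.
split.
  apply: is_deriveZ; apply: is_derive_aff; exact: hl.
rewrite (speed_affine hc Lu Ls) mulrA normrEsg; exact: lexx.
Qed.

Lemma reach_sub c s a b (l : R -> R) r : curve_breaks c s -> 0 <= a <= 1 -> 0 <= b <= 1 -> a != b ->
  {within `[0, 1], continuous l} ->
  (forall u, 0 < u < 1 -> u \notin s -> is_derive u 1 l (speed g c u)) ->
  Num.sg (b - a) * (l b - l a) < r -> reach (c a) (c b) r.
Proof.
move=> hc ha hb ab cl hl h.
exists (fun u => c (a + (b - a) * u)), [seq (r - a) / (b - a) | r <- s]; split.
- exact: (reparam_breaks hc ha hb ab).
- by rewrite mulr0 addr0.
- by rewrite mulr1 addrC subrK.
- exact: (le_lt_trans (reparam_length hc ha hb ab cl hl)).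
Qed.

Lemma reach_sym x y r : reach x y r -> reach y x r.
Proof.
move=> [c [s [hc <- <- hr]]]; have [l [cl l0 l1 hl]] := curve_antiderivative hm hc.
apply: (reach_sub hc _ _ _ cl hl); rewrite ?lexx ?ler01 ?oner_neq0 // sub0r sgrN sgr1 l0 l1.
by rewrite sub0r mulN1r opprK.
Qed.

Lemma double_left (u : R) : 0 <= u <= 2^-1 -> 0 <= 0 + 2 * u <= 1.
Proof. by move=> /andP[? ?]; apply/andP; split; lra. Qed.
Lemma double_left_lt (u : R) : 0 < u < 2^-1 -> 0 < 0 + 2 * u < 1.
Proof. by move=> /andP[? ?]; apply/andP; split; lra. Qed.
Lemma double_right (u : R) : 2^-1 <= u <= 1 -> 0 <= -1 + 2 * u <= 1.
Proof. by move=> /andP[? ?]; apply/andP; split; lra. Qed.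
Lemma double_right_lt (u : R) : 2^-1 < u < 1 -> 0 < -1 + 2 * u < 1.
Proof. by move=> /andP[? ?]; apply/andP; split; lra. Qed.
Lemma half_double_left (u : R) : u = (0 + 2 * u) / 2.
Proof. lra. Qed.
Lemma half_double_right (u : R) : u = (-1 + 2 * u + 1) / 2.
Proof. lra. Qed.
Lemma ler_sub_swap (x y z : R) : - x <= z - y -> y - x <= z. Proof. lra. Qed.
Lemma two_gt0 : 0 < 2 :> R. Proof. exact: ltr0n. Qed.
Lemma half_lt (d : R) : 0 < d -> d / 2 < d. Proof. lra. Qed.
Lemma left_ball (b z r : R) : b - r / 2 <= z -> 0 < r -> b - z < r. Proof. lra. Qed.
Lemma right_ball (b z r : R) : z <= b + r / 2 -> 0 < r -> z - b < r. Proof. lra. Qed.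
Lemma split_left (q d r : R) : q < r + d -> 0 < d -> q - 3 / 2 * d < r. Proof. lra. Qed.
Lemma split_right (q d t : R) : q - 3 / 2 * d <= t -> 0 < d -> q - t < 2 * d. Proof. lra. Qed.
Lemma exit_bound (p q r d : R) : 0 - q <= r - p -> r <= d -> p - q <= d. Proof. lra. Qed.
Lemma le_sqrt_of_sq (x y : R) : x ^+ 2 <= y -> x <= Num.sqrt y.
Proof. by move=> h; apply: (le_trans (ler_norm x)); rewrite -sqrtr_sqr ler_wsqrtr. Qed.
Lemma half_le1 : 2^-1 <= 1 :> R. Proof. lra. Qed.
Lemma half_gt0 : 0 < 2^-1 :> R. Proof. lra. Qed.
Lemma double_right1 : -1 + 2 * 1 = 1 :> R. Proof. lra. Qed.
Lemma double_right_half : -1 + 2 * 2^-1 = 0 :> R. Proof. lra. Qed.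

(** * Concatenation of curves *)

Section Concatenation.
Variables (c1 c2 : R -> M) (s1 s2 : seq R).
Hypothesis h1 : curve_breaks c1 s1.
Hypothesis h2 : curve_breaks c2 s2.
Hypothesis h12 : c1 1 = c2 0.

Definition concat u := if u <= 2^-1 then c1 (0 + 2 * u) else c2 (-1 + 2 * u).
Definition concat_breaks := 2^-1 :: [seq r / 2 | r <- s1] ++ [seq (r + 1) / 2 | r <- s2].

Lemma concat_right u : 2^-1 <= u -> concat u = c2 (-1 + 2 * u).
Proof.
rewrite /concat le_eqVlt => /orP[/eqP<-|hu]; last by rewrite leNgt hu.
by rewrite lexx add0r mulfV ?pnatr_eq0 // h12; congr c2; lra.
Qed.

Lemma concat_curve : curve_breaks concat concat_breaks.
Proof.
case: (h1) (h2) => [cc1 sc1] [cc2 sc2]; split.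
  apply/subspace_continuousP => u; rewrite /= in_itv /= => /andP[u0 u1] N hN0.
  have hN : nbhs (concat u) N by exact: hN0.
  have nl : \forall z \near u, 0 <= z -> z <= 2^-1 -> N (c1 (0 + 2 * z)).
    have [hu|hu] := leP u 2^-1.
      have u01 : 0 <= 0 + 2 * u <= 1 by apply/andP; split; lra.
      have hN' : nbhs (c1 (0 + 2 * u)) N by move: hN; rewrite /concat hu.
      by apply: filterS (within_pull cc1 u01 hN') => z h z0 z1; apply: h; apply/andP; split; lra.
    have hu' : 2^-1 < u < u + 1 by rewrite hu ltrDl ltr01.
    apply: filterS (nbhs_itvoo hu') => z /=; rewrite in_itv /= => /andP[z1 _] _ z2.
    by have := lt_le_trans z1 z2; rewrite ltxx.
  have nr : \forall z \near u, 2^-1 <= z -> z <= 1 -> N (c2 (-1 + 2 * z)).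
    have [hu|hu] := leP 2^-1 u.
      have u01 : 0 <= -1 + 2 * u <= 1 by apply/andP; split; lra.
      have hN' : nbhs (c2 (-1 + 2 * u)) N by rewrite -concat_right.
      by apply: filterS (within_pull cc2 u01 hN') => z h z0 z1; apply: h; apply/andP; split; lra.
    have hu' : u - 1 < u < 2^-1 by rewrite hu gtrBl ltr01.
    apply: filterS (nbhs_itvoo hu') => z /=; rewrite in_itv /= => /andP[_ z1] z2 _.
    by have := lt_le_trans z1 z2; rewrite ltxx.
  apply: filterS (filterI nl nr) => z [g1 g2]; rewrite /= in_itv /= => /andP[z0 z1].
  suff: N (concat z) by [].
  have [hz|hz] := leP z 2^-1; first by rewrite /concat hz; exact: g1.
  by rewrite (concat_right (ltW hz)); exact: g2 (ltW hz) z1.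
move=> p q p0 pq q1 nb i.
have [hq|hq] := leP q 2^-1.
  apply: (@smooth_pull `[0 + 2 * p, 0 + 2 * q]%classic `[p, q]%classic c1 _ i 0 2).
    apply: sc1; [lra|lra|lra|] => r rs.
    have hr : r / 2 \in concat_breaks by rewrite inE mem_cat (map_f (fun r => r / 2) rs) !orbT.
    have := nb _ hr; apply: contra => /andP[g1 g2]; apply/andP; split; lra.
  move=> z; rewrite /= !in_itv /= => /andP[z1 z2]; split; first by apply/andP; split; lra.
  by rewrite /concat (le_trans z2 hq).
have hp : 2^-1 <= p.
  have hr : 2^-1 \in concat_breaks by rewrite inE eqxx.
  by have := nb _ hr; rewrite hq andbT -leNgt.
apply: (@smooth_pull `[-1 + 2 * p, -1 + 2 * q]%classic `[p, q]%classic c2 _ i (-1) 2).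
  apply: sc2; [lra|lra|lra|] => r rs.
  have hr : (r + 1) / 2 \in concat_breaks.
    by rewrite inE mem_cat (map_f (fun r => (r + 1) / 2) rs) !orbT.
  have := nb _ hr; apply: contra => /andP[g1 g2]; apply/andP; split; lra.
move=> z; rewrite /= !in_itv /= => /andP[z1 z2]; split; first by apply/andP; split; lra.
by rewrite concat_right // (le_trans hp z1).
Qed.

(** On each half, the arc length of the concatenation is compared with that of the corresponding
    curve run at double speed. *)
Lemma concat_length : curve_length g concat <= curve_length g c1 + curve_length g c2.
Proof.
have hc := concat_curve; have [l [cl l0 l1 hl]] := curve_antiderivative hm hc.
have [m1 [cm1 m10 m11 hm1]] := curve_antiderivative hm h1.
have [m2 [cm2 m20 m21 hm2]] := curve_antiderivative hm h2.
have sub p q : 0 <= p -> q <= 1 -> {within `[p, q], continuous l}.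
  move=> p0 q1; apply: continuous_subspaceW cl => z /=; rewrite !in_itv /= => /andP[g1 g2].
  by rewrite (le_trans p0 g1) (le_trans g2 q1).
have half1 := half_le1.
have half0 := ltW half_gt0.
have i1 : l 2^-1 <= curve_length g c1.
  have := @mono_off R (fun u => m1 (0 + 2 * u) - l u) (fun u => 2 * speed g c1 (0 + 2 * u) - speed g concat u)
    concat_breaks 0 2^-1 half0.
  rewrite mulr0 addr0 add0r mulfV ?pnatr_eq0 // m10 m11 l0 subr0 subr_ge0; apply.
    move=> u; apply: cvgB; last exact: (sub 0 2^-1).
    apply/subspace_continuousP: u => u; rewrite /= in_itv /= => /andP[u0 u1] N hN.
    have u01 : 0 <= 0 + 2 * u <= 1 by apply: double_left; rewrite u0.
    apply: filterS (within_pull cm1 u01 hN) => z h; rewrite /= in_itv /= => /andP[z0 z1].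
    by apply: h; apply: double_left; rewrite z0.
  move=> u /andP[u0 u1] us.
  have u01 : 0 < 0 + 2 * u < 1 by apply: double_left_lt; rewrite u0.
  have us1 : 0 + 2 * u \notin s1.
    apply: contra us => h; rewrite inE mem_cat; apply/orP; right; apply/orP; left.
    by apply/mapP; exists (0 + 2 * u) => //; exact: half_double_left.
  have e : speed g concat u = 2 * speed g c1 (0 + 2 * u).
    have e0 := speed_affine h1 u01 us1; rewrite (gtr0_norm two_gt0) in e0; rewrite -e0.
    apply: speed_germ.
    have hu' : 0 < u < 2^-1 by rewrite u0.
    apply: filterS (nbhs_itvoo hu') => z /=; rewrite in_itv /= => /andP[_ z1].
    by rewrite /concat ltW.
  split; last by rewrite e subrr.
  apply: is_deriveB; first by apply: is_derive_aff; exact: hm1.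
  by apply: hl => //; rewrite u0 (lt_le_trans u1 half1).
have i2 : l 1 - l 2^-1 <= curve_length g c2.
  have := @mono_off R (fun u => m2 (-1 + 2 * u) - l u) (fun u => 2 * speed g c2 (-1 + 2 * u) - speed g concat u)
    concat_breaks 2^-1 1 half1.
  rewrite double_right1 double_right_half.
  rewrite m20 m21 sub0r => h; apply: ler_sub_swap.
  apply: h.
    move=> u; apply: cvgB; last exact: (sub 2^-1 1).
    apply/subspace_continuousP: u => u; rewrite /= in_itv /= => /andP[u0 u1] N hN.
    have u01 : 0 <= -1 + 2 * u <= 1 by apply: double_right; rewrite u0.
    apply: filterS (within_pull cm2 u01 hN) => z h; rewrite /= in_itv /= => /andP[z0 z1].
    by apply: h; apply: double_right; rewrite z0.
  move=> u /andP[u0 u1] us.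
  have u01 : 0 < -1 + 2 * u < 1 by apply: double_right_lt; rewrite u0.
  have us1 : -1 + 2 * u \notin s2.
    apply: contra us => h; rewrite inE mem_cat; apply/orP; right; apply/orP; right.
    by apply/mapP; exists (-1 + 2 * u) => //; exact: half_double_right.
  have e : speed g concat u = 2 * speed g c2 (-1 + 2 * u).
    have e0 := speed_affine h2 u01 us1; rewrite (gtr0_norm two_gt0) in e0; rewrite -e0.
    apply: speed_germ.
    have hu' : 2^-1 < u < 1 by rewrite u0.
    apply: filterS (nbhs_itvoo hu') => z /=; rewrite in_itv /= => /andP[z1 _].
    by rewrite concat_right // ltW.
  split; last by rewrite e subrr.
  apply: is_deriveB; first by apply: is_derive_aff; exact: hm2.
  by apply: hl => //; rewrite u1 (lt_trans half_gt0 u0).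
rewrite -l1 -[l 1](subrK (l 2^-1)) addrC; exact: (lerD i1 i2).
Qed.

End Concatenation.

Lemma reach_trans x y z r s : reach x y r -> reach y z s -> reach x z (r + s).
Proof.
move=> [c1 [s1 [h1 e1 e2 l1]]] [c2 [s2 [h2 e3 e4 l2]]].
have e : c1 1 = c2 0 by rewrite e2 e3.
exists (concat c1 c2), (concat_breaks s1 s2); split.
- exact: concat_curve.
- by rewrite /concat invr_ge0 ler0n mulr0 addr0.
- rewrite concat_right //; first by rewrite double_right1.
  exact: half_le1.
- exact: le_lt_trans (concat_length h1 h2 e) (ltrD l1 l2).
Qed.

(** The intermediate value theorem for the arc length cuts the curve at length [tau]. *)
Lemma reach_split x y r d : 0 < r -> 0 < d -> (forall z e, 0 < e -> reach z z e) ->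
  reach x y (r + d) -> exists z, reach x z r /\ reach z y (2 * d).
Proof.
move=> r0 d0 refl [c [s [hc <- <- hl]]]; have [l [cl l0 l1 dl]] := curve_antiderivative hm hc.
have L0 := length_ge0 hc.
(* The length is below r + d. Cutting off 3/2 d, a factor strictly between 1 and 2, makes both
   pieces satisfy strict bounds; the maximum with 0 covers short curves. *)
pose tau := Num.max 0 (curve_length g c - 3 / 2 * d).
have t0 : 0 <= tau by rewrite le_max lexx.
have tL : tau <= curve_length g c.
  by rewrite ge_max L0 gerBl mulr_ge0 // ltW.
have tr : tau < r by rewrite gt_max r0 /=; exact: split_left.
have tL2 : curve_length g c - tau < 2 * d.
  have : curve_length g c - 3 / 2 * d <= tau by rewrite le_max lexx orbT.
  by move=> h; exact: split_right.
have [u] : exists2 u, u \in `[0, 1] & l u = tau.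
  apply: IVT => //; rewrite l0 l1; apply/andP; split; first by rewrite ge_min t0.
  by rewrite le_max tL orbT.
rewrite in_itv /= => u01 lu; exists (c u); have /andP[u0 u1] := u01.
have h0 : 0 <= (0 : R) <= 1 by rewrite lexx ler01.
have h1 : 0 <= (1 : R) <= 1 by rewrite lexx ler01.
have d2 : 0 < 2 * d by rewrite mulr_gt0.
split.
  have [u00|u0'] := eqVneq u 0; first by rewrite u00; exact: refl.
  apply: (reach_sub hc h0 u01 _ cl dl); first by rewrite eq_sym.
  by rewrite subr0 gtr0_sg ?mul1r ?lu ?l0 ?subr0 // lt_neqAle eq_sym u0'.
have [u11|u1'] := eqVneq u 1; first by rewrite u11; exact: refl.
apply: (reach_sub hc u01 h1 u1' cl dl).
by rewrite gtr0_sg ?mul1r ?lu ?l1 // subr_gt0 lt_neqAle u1'.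
Qed.

(** * Straight segments in a chart *)

Section Segment.
Variables (i : atlas M) (y1 v : 'rV[R]_n) (K : R).
Hypothesis K0 : 0 <= K.
Hypothesis seg : forall u : R, 0 <= u <= 1 -> coords i (y1 + u *: v) /\
  forall w, qform (g i (y1 + u *: v)) w <= (K * `|w|) ^+ 2.

Let line (u : R) := y1 + u *: v.
Let lineL (x w h : R) : line (h *: w + x) = h *: (w *: v) + line x.
Proof. by rewrite /line scalerDl -scalerA addrCA. Qed.

Lemma line_cont : continuous line.
Proof.
move=> u; apply: cvgD; first exact: cvg_cst.
by apply: cvgZ; [exact: cvg_id|exact: cvg_cst].
Qed.

Lemma line_Ck k : Ck k setT line.
Proof.
have := @Ck_affine R _ _ _ line (fun w : R => w *: v) line_cont lineL k setT id.
by apply; elim: k => [|k IH]; [split=> // x _; exact: cvg_id|split=> [x _|w];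
  [exact: cvg_id|split=> [x _|]; [exact: derivable_id|
   apply: (@Ck_ext _ _ _ _ _ (cst w)); [exact: openT|move=> x _; rewrite derive_id|exact: Ck_cst]]]].
Qed.

Lemma segment_curve : curve_breaks (param i \o line) [::].
Proof.
split.
  apply/subspace_continuousP => u; rewrite /= in_itv /= => u01.
  apply: cvg_within_filter.
  apply: (@continuous_comp _ _ _ line (param i)); first exact: line_cont.
  exact: param_continuous (seg u01).1.
move=> a b a0 ab b1 _ j u [uab du].
exists (line @^-1` overlap i j), ((chart j \o param i) \o line).
have ov z : `[a, b]%classic z -> dom j ((param i \o line) z) -> overlap i j (line z).
  rewrite /= in_itv /= => /andP[z1 z2] dz.
  have z01 : 0 <= z <= 1 by rewrite (le_trans a0 z1) (le_trans z2 b1).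
  have [d e] := paramK (seg z01).1; exists (param i (line z)) => //.
split.
- by apply: open_comp => [z _|]; [exact: line_cont|exact: open_overlap].
- exact: ov.
- move=> k; apply: (@Ck_affine R _ _ _ line (fun w : R => w *: v) line_cont lineL k _ _ (@transition_Ck _ _ M i j k)).
- by [].
Qed.

Lemma segment_length : curve_length g (param i \o line) <= K * `|v|.
Proof.
have := @length_le _ _ (fun u => K * `|v| * u) (fun u => K * `|v|) segment_curve.
rewrite mulr1 mulr0 subr0; apply.
  by apply: continuous_subspaceT => u; apply: cvgM; [exact: cvg_cst|exact: cvg_id].
move=> u u01 _; have u01' : 0 <= u <= 1 by case/andP: u01 => *; rewrite !ltW.
split.
  have := is_deriveZ (K * `|v|) (is_derive_id u (1 : R)); rewrite /GRing.scale /= mulr1; exact.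
have hn : \forall z \near u, dom i ((param i \o line) z) /\ chart i ((param i \o line) z) = line z.
  apply: filterS (nbhs_itvoo u01) => z /=; rewrite in_itv /= => /andP[z1 z2].
  by apply: paramK; apply: (seg _).1; rewrite !ltW.
have [_ _ ->] := speed_chart hm openT (I : setT u) line_Ck hn.
have -> : 'D_1 line u = v.
  have := @derive_affine R _ _ _ line (fun w : R => w *: v) lineL id u 1.
  rewrite -[id \o line]/line => ->; rewrite scale1r derive_id; exact: erefl.
have -> : K * `|v| = Num.sqrt ((K * `|v|) ^+ 2) by rewrite sqrtr_sqr ger0_norm // mulr_ge0.
rewrite ler_sqrt; first exact: ((seg u01').2 v).
exact: sqr_ge0.
Qed.

End Segment.

(** In a chart ball on which the metric is at most K^2 times the square of the sup norm, short
    straight segments have length below r. *)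
Lemma reach_nbhs x r : 0 < r -> nbhs x [set y | reach x y r].
Proof.
move=> r0; set i := chart_at x; have dx : dom i x by exact: dom_chart_at.
set y0 := chart i x; have cy0 : coords i y0 by exact: coords_chart.
have [K K0 hK] := metric_upper hm cy0; have /nbhs_ballP[e e0 he] := hK.
pose d := Num.min e (r / K); have d0 : 0 < d by rewrite lt_min e0 divr_gt0.
have hb : nbhs y0 (ball y0 d) by exact: nbhsx_ballx.
apply: filterS (near_chart dx hb) => y [dy]; rewrite -ball_normE /= => hy.
have vd : `|chart i y - y0| < d by rewrite distrC.
have seg (u : R) : 0 <= u <= 1 -> coords i (y0 + u *: (chart i y - y0)) /\
    forall w, qform (g i (y0 + u *: (chart i y - y0))) w <= (K * `|w|) ^+ 2.
  move=> /andP[u0 u1]; apply: he; rewrite -ball_normE /= opprD addrA subrr sub0r normrN normrZ ger0_norm //.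
  apply: (@le_lt_trans _ _ `|chart i y - y0|); first by rewrite ler_piMl.
  by apply: (lt_le_trans vd); rewrite ge_min lexx.
exists (param i \o (fun u : R => y0 + u *: (chart i y - y0))), [::]; split.
- exact: (segment_curve seg).
- by rewrite /= scale0r addr0 chartK.
- by rewrite /= scale1r addrC subrK chartK.
- apply: (le_lt_trans (segment_length (ltW K0) seg)).
  rewrite mulrC -ltr_pdivlMr //; apply: (lt_le_trans vd); by rewrite ge_min lexx orbT.
Qed.

Lemma reach_refl x r : 0 < r -> reach x x r.
Proof. by move=> /(reach_nbhs x)/nbhs_singleton. Qed.

(* A curve issued from x that is shorter than m d stays in the chart ball of
   radius d around x: it is followed up to the first exit time. *)
Lemma reach_chart x : exists2 m : R, 0 < m & exists2 d0 : R, 0 < d0 &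
  forall d, 0 < d -> d < d0 ->
    [set z | `|z - chart (chart_at x) x| <= d] `<=` coords (chart_at x) /\
    forall y, reach x y (m * d) ->
      (param (chart_at x) @` [set z | `|z - chart (chart_at x) x| <= d]) y.
Proof.
set i := chart_at x; have dx : dom i x by exact: dom_chart_at.
set y0 := chart i x; have cy0 : coords i y0 by exact: coords_chart.
have [m m0 hmm] := metric_lower hm cy0; have /nbhs_ballP[e e0 he] := hmm.
exists m => //; exists e => // d dp de.
have sub z : `|z - y0| <= d -> coords i z /\ forall v, (m * `|v|) ^+ 2 <= qform (g i z) v.
  by move=> hz; apply: he; rewrite -ball_normE /= distrC (le_lt_trans hz).
split; first by move=> z /sub[].
move=> y [c [s [hc c0 <- hl]]]; have [l [cl l0 l1 dl]] := curve_antiderivative hm hc.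
have [cc _] := hc.
pose B := [set z : 'rV[R]_n | `|z - y0| <= d].
have clB : closed B.
  have -> : B = closed_ball_ Num.Def.normr y0 d by apply/seteqP; split=> z; rewrite /B /closed_ball_ /= distrC.
  exact: closed_closed_ball_.
have cpB : compact B.
  apply: bounded_closed_compact => //; exists (`|y0| + d); split; first exact: num_real.
  move=> r hr z hz; rewrite -(subrK y0 z); apply: (le_trans (ler_normD _ _)).
  by apply: ltW; apply: le_lt_trans hr; rewrite addrC lerD2l.
have cpK : compact (param i @` B).
  apply: continuous_compact => //; apply: continuous_in_subspaceT => z; rewrite inE => hz.
  exact: param_continuous (sub z hz).1.
have clK : closed (param i @` B) by apply: compact_closed => //; exact: manifold_hausdorff.
pose P u := dom i (c u) /\ `|chart i (c u) - y0| < e.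
(* [S] collects the times up to which the curve has stayed in the open chart ball of radius [e],
   where the metric is bounded below. Its supremum [b] turns out to be 1. *)
pose S := [set u : R | 0 <= u <= 1 /\ forall w, 0 <= w <= u -> P w].
have P0 : P 0 by split; rewrite c0 // subrr normr0.
have S0 : S 0.
  split; first by rewrite lexx ler01.
  by move=> w; rewrite -eq_le eq_sym => /eqP->.
have hS : has_sup S by split; [exists 0|exists 1 => u [/andP[]]].
pose b := sup S; have b0 : 0 <= b by exact: ub_le_sup hS.2 _ S0.
have b1 : b <= 1 by apply: ge_sup; [exists 0|move=> u [/andP[]]].
have Pb w : 0 <= w -> w < b -> P w.
  move=> w0 wb; have wb' : 0 < b - w by rewrite subr_gt0.
  have [u [u01 hu] hub] := sup_adherent wb' hS; apply: hu; rewrite w0 /=; apply: ltW.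
  by apply: le_lt_trans hub; rewrite -/b subKr.
have dist w : 0 <= w -> w < b -> (param i @` B) (c w).
  move=> w0 wb; have [dw hw] := Pb w w0 wb; exists (chart i (c w)); last by rewrite chartK.
  have w1 : w <= 1 by apply: (le_trans (ltW wb)).
  (* No coordinate changes faster than the speed divided by m; [sg] takes the values 1 and -1, for
     the two halves of an absolute value. *)
  have bound (sg : R) k : `|sg| = 1 -> sg * (chart i (c w) ord0 k - y0 ord0 k) <= d.
    move=> hsg.
    have cg : {within `[0, w], continuous (fun u => chart i (c u) ord0 k)}.
      apply/subspace_continuousP => u; rewrite /= in_itv /= => /andP[u0 uw].
      have [du _] := Pb u u0 (le_lt_trans uw wb).
      have cu : {for c u, continuous (fun z => chart i z ord0 k)}.
        apply: (@continuous_comp _ _ _ (chart i) (fun z : 'rV[R]_n => z ord0 k)).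
          exact: chart_continuous.
        exact: (@coord_cont _ _ _ _ _ (coordinates_rV R n) k).
      have u01 : 0 <= u <= 1 by rewrite u0 (le_trans uw w1).
      move=> N hN; apply: filterS (near_within cc u01 (cu N hN)) => z h.
      by rewrite /= in_itv /= => /andP[z0 zw]; apply: h; rewrite z0 (le_trans zw w1).
    have clw : {within `[0, w], continuous l}.
      apply: continuous_subspaceW cl => z /=; rewrite !in_itv /= => /andP[z0 zw].
      by rewrite z0 (le_trans zw w1).
    have := @mono_off R (fun u => m^-1 * l u - sg * chart i (c u) ord0 k)
      (fun u => m^-1 * speed g c u - sg * 'D_1 (fun u => chart i (c u) ord0 k) u) s 0 w w0.
    rewrite l0 mulr0 c0 -/y0 => h.
    have lw : l w <= curve_length g c.
      rewrite -l1; apply: (@mono_off R l (speed g c) s w 1 w1).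
        apply: continuous_subspaceW cl => z /=; rewrite !in_itv /= => /andP[z0 zw].
        by rewrite (le_trans w0 z0).
      move=> u /andP[u0 u1] us; split; last exact: speed_ge0.
      by apply: dl => //; rewrite u1 (le_lt_trans w0 u0).
    have md : m^-1 * l w <= d.
      by rewrite mulrC ler_pdivrMr // mulrC; apply: (le_trans lw); exact: ltW.
    suff h' : 0 - sg * y0 ord0 k <= m^-1 * l w - sg * chart i (c w) ord0 k.
      by rewrite mulrBr; exact: exit_bound h' md.
    apply: h.
      by move=> u; apply: cvgB; apply: cvgM; [exact: cvg_cst|exact: clw|exact: cvg_cst|exact: cg].
    move=> u /andP[u0 uw] us.
    have u01 : 0 < u < 1 by rewrite u0 (lt_le_trans uw w1).
    have [du hu] := Pb u (ltW u0) (lt_trans uw wb).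
    have [ddu es] := regular_speed hm hc u01 us du.
    have hk := (derivable_mxP _ _ _).1 ddu ord0 k.
    have dk : is_derive u (1 : R) (fun u => chart i (c u) ord0 k) ('D_1 (fun u => chart i (c u) ord0 k) u).
      exact: derivableP.
    split; first by apply: is_deriveB; apply: is_deriveZ; exact: dl.
    have ek : 'D_1 (fun u => chart i (c u) ord0 k) u = 'D_1 (chart i \o c) u ord0 k.
      by rewrite (derive_mx ddu) mxE.
    rewrite subr_ge0 ek; apply: (le_trans (ler_norm _)); rewrite normrM hsg mul1r.
    apply: (le_trans (ler_entry_norm _ _ _)); rewrite mulrC ler_pdivlMr //.
    have hz : ball y0 e (chart i (c u)) by rewrite -ball_normE /= distrC.
    have hq := (he _ hz).2 ('D_1 (chart i \o c) u).
    rewrite es mulrC; exact: le_sqrt_of_sq hq.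
  rewrite /B /=; apply: norm_rV_le; first exact: ltW.
  move=> k; rewrite !mxE ler_norml -[_ - _]mul1r.
  have h1 := bound 1 k (normr1 _); have hN1 : `|(-1) : R| = 1 by rewrite normrN1.
  have h2 := bound (-1) k hN1.
  rewrite h1 andbT lerNl -mulN1r mulrA mulr1 -[_ * (_ - _)]/(-1 * (chart i (c w) ord0 k - y0 ord0 k)); exact: h2.
(* Before time b the curve lies in the compact image of the closed ball of radius d, hence also at
   time b. *)
have Kb : (param i @` B) (c b).
  move: (b0); rewrite le_eqVlt => /orP[/eqP<-|bp].
    by rewrite c0; exists y0; [rewrite /B /= subrr normr0 ltW|exact: chartK].
  apply: contrapT => nK.
  have nb : nbhs (c b) (~` (param i @` B)) by apply: open_nbhs_nbhs; split=> //; exact: closed_openC.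
  have b01 : 0 <= b <= 1 by rewrite b0.
  have /nbhs_ballP[r rp hr] := near_within cc b01 nb.
  pose z := Num.max 0 (b - r / 2).
  have z0 : 0 <= z by rewrite le_max lexx.
  have zb : z < b by rewrite gt_max bp gtrBl divr_gt0.
  have bz : b - r / 2 <= z by rewrite le_max lexx orbT.
  have hz : ball b r z.
    rewrite -ball_normE /= gtr0_norm ?subr_gt0 //.
    exact: left_ball.
  have z01 : 0 <= z <= 1 by rewrite z0 (le_trans (ltW zb)).
  exact: (hr z hz z01 (dist z z0 zb)).
have [eb|b1'] := eqVneq b 1; first by rewrite -eb.
(* As d < e, the curve stays in the open ball for some time after b, against the choice of b. *)
exfalso; have {b1'}bl : b < 1 by rewrite lt_neqAle b1'.
have PbP : P b.
  case: Kb => z hz ez; have [cz _] := sub z hz; have [d1 d2] := paramK cz.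
  by rewrite /P -ez d2; split=> //; exact: le_lt_trans de.
have nP : nbhs (c b) [set z | dom i z /\ `|chart i z - y0| < e].
  apply: (near_chart PbP.1 (P := [set z | `|z - y0| < e])).
  have o : open (ball y0 e) by exact: ball_open.
  have -> : [set z | `|z - y0| < e] = ball y0 e.
    by apply/seteqP; split=> z; rewrite -ball_normE /= distrC.
  by apply: open_nbhs_nbhs; split=> //; rewrite -ball_normE /= distrC; exact: PbP.2.
have b01 : 0 <= b <= 1 by rewrite b0.
have /nbhs_ballP[r rp hr] := near_within cc b01 nP.
pose z := Num.min 1 (b + r / 2).
have zb : b < z by rewrite lt_min bl ltrDl divr_gt0.
have Sz : S z.
  split; first by rewrite (le_trans b0 (ltW zb)) ge_min lexx.
  move=> w /andP[w0 wz]; have [wb|bw] := ltP w b; first exact: Pb.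
  have hw : ball b r w.
    rewrite -ball_normE /= distrC ger0_norm ?subr_ge0 //.
    have : w <= b + r / 2 by apply: (le_trans wz); rewrite ge_min lexx orbT.
    by move=> h; exact: right_ball.
  by apply: (hr w hw); rewrite w0 (le_trans wz) // ge_min lexx.
by have := ub_le_sup hS.2 Sz; rewrite leNgt zb.
Qed.

Lemma reach_compact x : exists2 e : R, 0 < e &
  exists2 K, compact K & forall y, reach x y e -> K y.
Proof.
have [m m0 [d0 d0p h]] := reach_chart x.
have d2 : 0 < d0 / 2 by rewrite divr_gt0.
have d2' := half_lt d0p.
have [hs hr] := h _ d2 d2'.
exists (m * (d0 / 2)); first by rewrite mulr_gt0.
set B := [set z | _] in hs hr; exists (param (chart_at x) @` B) => //.
apply: continuous_compact; first by apply: continuous_in_subspaceT => z; rewrite inE => /hs; exact: param_continuous.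
apply: bounded_closed_compact.
  exists (`|chart (chart_at x) x| + d0 / 2); split; first exact: num_real.
  move=> r hr' z hz; rewrite -(subrK (chart (chart_at x) x) z); apply: (le_trans (ler_normD _ _)).
  by apply: ltW; apply: le_lt_trans hr'; rewrite addrC lerD2l.
have -> : B = closed_ball_ Num.Def.normr (chart (chart_at x) x) (d0 / 2).
  by apply/seteqP; split=> z; rewrite /B /closed_ball_ /= distrC.
exact: closed_closed_ball_.
Qed.

Lemma reach_local x N : nbhs x N -> exists2 e : R, 0 < e & forall y, reach x y e -> N y.
Proof.
move=> hN; have [m m0 [d0 d0p h]] := reach_chart x; set i := chart_at x in h.
have dx : dom i x by exact: dom_chart_at.
have hN' : nbhs (param i (chart i x)) N by rewrite chartK.
have /nbhs_ballP[e e0 he] := near_param (coords_chart dx) hN'.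
pose d := Num.min e d0 / 2.
have md : 0 < Num.min e d0 by rewrite lt_min e0.
have dp : 0 < d by rewrite divr_gt0.
have dm : d < Num.min e d0 by exact: half_lt.
have dd0 : Num.min e d0 <= d0 by rewrite ge_min lexx orbT.
have [_ hr] := h d dp (lt_le_trans dm dd0).
exists (m * d); first by rewrite mulr_gt0.
move=> y /hr[z hz <-]; apply: (he z _).2; rewrite -ball_normE /= distrC.
apply: (le_lt_trans hz); apply: (lt_le_trans dm); by rewrite ge_min lexx.
Qed.

Lemma reach_dist x y r : reach x y r -> dist g x y < r.
Proof.
move=> [c [s [hc c0 c1 hl]]]; apply: le_lt_trans hl; apply: ge_inf; last first.
  by exists c => //; split=> //; case: hc => h1 h2; split=> //; exists s.
exists 0 => _ [c' [[h1 [s' h2]] _ _] <-]; exact: (@length_ge0 c' s').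
Qed.

(** Reachability at some radius excludes the value 0 that [inf] takes on the empty set of
    lengths. *)
Lemma dist_reach x y r e : reach x y r -> dist g x y < e -> reach x y e.
Proof.
move=> [c [s [hc c0 c1 hl]]] he.
set E := [set curve_length g c | c in [set c | [/\ piecewise_smooth c, c 0 = x & c 1 = y]]].
have E0 : E !=set0.
  by exists (curve_length g c), c => //; split=> //; case: hc => h1 h2; split=> //; exists s.
have hE : has_inf E.
  by split=> //; exists 0 => _ [c' [[h1 [s' h2]] _ _] <-]; exact: (@length_ge0 c' s').
have de : 0 < e - dist g x y by rewrite subr_gt0.
have [_ [c' [[h1 [s' h2]] c0' c1'] <-]] := inf_adherent de hE.
by rewrite -/(dist g x y) addrC subrK => hlt; exists c', s'.
Qed.

(** Both the set of points reachable from x and its complement are open. *)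
Lemma reach_connected x y : connected [set: M] -> exists r, reach x y r.
Proof.
move=> hc; pose B := [set y | exists r, reach x y r].
have BT : B = setT.
  apply: hc.
  - by exists x, 1; exact: reach_refl.
  - exists B; last by rewrite setTI.
    rewrite openE => z [r hz]; apply: filterS (reach_nbhs z ltr01) => w hw.
    by exists (r + 1); exact: reach_trans hz hw.
  - exists B; last by rewrite setTI.
    rewrite -openC openE => z hz; apply: filterS (reach_nbhs z ltr01) => w hw [r hr].
    by apply: hz; exists (r + 1); apply: reach_trans hr _; exact: reach_sym.
by have : B y by rewrite BT.
Qed.

(** Connectedness turns the bound on [dist] into reachability at radius r + 1, so that [A] lies in a
    precompact ball; closedness keeps the limits in [A]. *)
Theorem hopf_rinow x0 r (A : set M) : connected [set: M] -> complete_metric g ->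
  closed A -> (forall y, A y -> dist g y x0 <= r) -> compact A.
Proof.
move=> hX hcm clA hA; rewrite compact_ultra => F FU FA.
have hp : ultra_precompact [set y | reach x0 y (r + 1)].
  apply: precompact_ball.
  - exact: reach_sym.
  - exact: reach_trans.
  - exact: reachW.
  - exact: reach_nbhs.
  - exact: reach_local.
  - exact: reach_compact.
  - by move=> x y r' d r0 d0; apply: reach_split => // z e; exact: reach_refl.
  - move=> u hu.
    have hu' (e : R) : 0 < e -> exists N, forall p q, (N <= p)%N -> (N <= q)%N -> dist g (u p) (u q) < e.
      by move=> e0; have [N hN] := hu e e0; exists N => p q Np Nq; exact: reach_dist (hN _ _ Np Nq).
    have [x hx] := hcm u hu'; exists x => e e0; have /cvgrPdist_lt/(_ e e0)[N _ hN] := hx; exists N => p Np.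
    have [r' hr'] := reach_connected (u p) x hX; apply: dist_reach hr' _.
    have := hN p Np; rewrite /= sub0r normrN; exact: le_lt_trans (ler_norm _).
have FB : F [set y | reach x0 y (r + 1)].
  apply: filterS FA => y /hA hy; have [r' hr'] := reach_connected y x0 hX.
  by apply: reach_sym; apply: dist_reach hr' _; apply: (le_lt_trans hy); rewrite ltrDl.
have [p hp'] := hp F FU FB; exists p; split=> //; apply: clA => N hN; have FN := hp' N hN.
by have [z [z1 z2]] := filter_ex (filterI FA FN); exists z.
Qed.

End Reach.

(** * Inequalities at a maximum *)

Section PhiAlgebra.
Variables (A : comPzRingType) (n : nat) (D : 'I_n -> A -> A)
    (E : 'I_n -> 'I_n -> A -> A) (Dt : A -> A) (G Gi : 'I_n -> 'I_n -> A)
    (Rm : 'I_n -> 'I_n -> 'I_n -> 'I_n -> A) (s : 'I_n -> 'I_n -> 'I_n -> A).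

Definition met2 (i j : 'I_n * 'I_n) := Gi i.1 j.1 * Gi i.2 j.2.
Definition gradsq (F : A) := \sum_a \sum_b Gi a b * (D a F * D b F).
Definition hesssq (F : A) :=
  \sum_(i : 'I_n * 'I_n) \sum_(j : 'I_n * 'I_n) met2 i j * (D i.1 (D i.2 F) * D j.1 (D j.2 F)).

Hypothesis fc : frame_calculus D E Dt G Gi Rm s.
Let hD := fc_D fc.
Let hDt := fc_Dt fc.
Local Notation Lap := (frame_lap D Gi).
Local Notation Ru := (frame_ricup Gi Rm).
Local Notation Su := (frame_sup Gi s).

Lemma Dt_quadratic (K : finType) (c : K -> K -> A) (r : K -> A) :
  (forall i j, c i j = c j i) -> (forall i j, Dt (c i j) = 0) ->
  Dt (\sum_i \sum_j c i j * (r i * r j)) = (\sum_i \sum_j c i j * (r i * Dt (r j))) *+ 2.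
Proof.
move=> csym cDt; rewrite mulr2n.
transitivity (\sum_i \sum_j (c i j * (Dt (r i) * r j) + c i j * (r i * Dt (r j)))).
  rewrite (der_sum hDt); apply: eq_bigr => i _; rewrite (der_sum hDt); apply: eq_bigr => j _.
  by rewrite (derMl hDt) // (derM hDt) mulrDr.
under eq_bigr do rewrite big_split; rewrite big_split /=; congr (_ + _).
rewrite exchange_big; apply: eq_bigr => i _; apply: eq_bigr => j _ /=.
by rewrite csym [Dt _ * _]mulrC.
Qed.

Lemma heatM x y : Dt (x * y) - Lap (x * y) = x * (Dt y - Lap y) + y * (Dt x - Lap x)
  - (\sum_e \sum_f Gi e f * (D e x * D f y)) *+ 2.
Proof.
have -> : Lap (x * y) = x * Lap y + y * Lap x + (\sum_e \sum_f Gi e f * (D e x * D f y)) *+ 2.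
  transitivity (\sum_e \sum_f (x * (Gi e f * D e (D f y)) + y * (Gi e f * D e (D f x)) +
     (Gi e f * (D e x * D f y) + Gi e f * (D f x * D e y)))).
    apply: eq_bigr => e _; apply: eq_bigr => f _.
    by rewrite (derM (hD f)) (derD (hD e)) !(derM (hD e)); ring.
  under eq_bigr do rewrite big_split /= big_split /= -!mulr_sumr.
  rewrite big_split /= big_split /= -!mulr_sumr; congr (_ + _).
  under eq_bigr do rewrite big_split /=.
  rewrite big_split /= mulr2n; congr (_ + _).
  rewrite exchange_big; apply: eq_bigr => e _; apply: eq_bigr => f _ /=.
  by rewrite (fc_Gisym fc).
by rewrite (derM hDt); ring.
Qed.

(** * Time derivatives of |d phi|^2 and |Hess phi|^2 *)

Section Base.
Variable F : A.
Hypothesis EF : forall d c, E d c F = 0.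
Hypothesis DtF : Dt F = 0.

Lemma E_act_base m : E_act E m F = 0.
Proof. by rewrite /E_act big1 // => c _; rewrite big1 // => d _; rewrite EF mulr0. Qed.

Lemma Dt_D_base a : Dt (D a F) = \sum_h Ru a h * D h F.
Proof.
have := DtD fc a F; rewrite DtF (der0 (hD a)) E_act_base !subr0 => ->; exact: erefl.
Qed.

(** As [F] depends neither on time nor on the frame, its Hessian changes only through the brackets
    of [Dt] with [D a] and [D b], which contain the curvature and its first derivatives. *)
Lemma Dt_DD_base a b : Dt (D a (D b F)) = \sum_h D a (Ru b h) * D h F
  + \sum_h Ru b h * D a (D h F) + \sum_h Ru a h * D h (D b F) - \sum_d Su a b d * D d F.
Proof.
have := DtD fc a (D b F); rewrite (E_act_D fc).
have -> : \sum_c \sum_d frame_sup Gi s a c d * D b (E d c F) = 0.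
  by rewrite big1 // => c _; rewrite big1 // => d _; rewrite EF (der0 (hD b)) mulr0.
rewrite add0r => /eqP; rewrite subr_eq => /eqP ->; rewrite Dt_D_base (der_sum (hD a)).
have -> : \sum_i D a (Ru b i * D i F) = \sum_h D a (Ru b h) * D h F + \sum_h Ru b h * D a (D h F).
  by rewrite -big_split; apply: eq_bigr => h _; rewrite (derM (hD a)).
ring.
Qed.

Variables (R : rcfType) (ev : {rmorphism A -> R}).
Hypothesis evGi : forall a b, ev (Gi a b) = (a == b)%:R.
Local Notation N := (n%:R : R).
Local Notation u := (Num.sqrt (ev (normRm Gi Rm))).
Local Notation v := (Num.sqrt (ev (normDRm D Gi Rm))).
Local Notation P := (ev (gradsq F)).
Local Notation H := (ev (hesssq F)).

Lemma ev_met2 i j : ev (met2 i j) = (i == j)%:R.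
Proof.
by case: i j => [a b] [c d]; rewrite /met2 rmorphM !evGi xpair_eqE -natrM mulnb.
Qed.

Lemma ev_gradsq : P = \sum_a ev (D a F) ^+ 2.
Proof. by rewrite (ev_quad _ evGi); apply: eq_bigr => a _; rewrite rmorphM. Qed.
Lemma ev_hesssq : H = \sum_(i : 'I_n * 'I_n) ev (D i.1 (D i.2 F)) ^+ 2.
Proof. by rewrite (ev_quad _ ev_met2); apply: eq_bigr => a _; rewrite rmorphM. Qed.
Lemma ev_gradsq_ge0 : 0 <= P.
Proof. by rewrite ev_gradsq sumr_ge0 // => a _; exact: sqr_ge0. Qed.
Lemma ev_hesssq_ge0 : 0 <= H.
Proof. by rewrite ev_hesssq sumr_ge0 // => a _; exact: sqr_ge0. Qed.
Lemma ev_D_le a : `|ev (D a F)| <= Num.sqrt P.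
Proof. by rewrite ev_gradsq; exact: (ler_abs_sqrt_sumsq (fun a => ev (D a F))). Qed.
Lemma ev_DD_le a b : `|ev (D a (D b F))| <= Num.sqrt H.
Proof.
by rewrite ev_hesssq; exact: (ler_abs_sqrt_sumsq (fun i => ev (D i.1 (D i.2 F))) (a, b)).
Qed.

Lemma ev_lap_le : `|ev (Lap F)| <= N * Num.sqrt H.
Proof.
by rewrite (ev_contract evGi); apply: ler_norm_sum_ord => e; exact: ev_DD_le.
Qed.

Let hk a b c d : `|ev (Rm a b c d)| <= u. Proof. exact: (ev_Rm_le Rm evGi (a, b, c, d)). Qed.
Let hl e a b c d : `|ev (D e (Rm a b c d))| <= v.
Proof. exact: (ev_DRm_le D Rm evGi (e, (a, b, c, d))). Qed.

Lemma ev_Dt_gradsq_le : `|ev (Dt (gradsq F))| <= 2 * N ^+ 3 * u * P.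
Proof.
rewrite /gradsq (Dt_quadratic _ (fc_Gisym fc) (fc_DtGi fc)) rmorphMn /= (ev_quad _ evGi).
rewrite -mulr_natl normrM ger0_norm //.
have -> : 2 * N ^+ 3 * u * P = 2 * (N * (Num.sqrt P * (N * (N * u * Num.sqrt P)))).
  by rewrite -{1}(sqr_sqrtr ev_gradsq_ge0); ring.
rewrite ler_pM2l //; apply: ler_norm_sum_ord => a; rewrite rmorphM; apply: ler_normM.
  exact: ev_D_le.
rewrite Dt_D_base rmorph_sum; apply: ler_norm_sum_ord => h; rewrite rmorphM; apply: ler_normM.
  exact: (ev_Ru_le evGi hk).
exact: ev_D_le.
Qed.

Lemma ev_Dt_DD_le a b : `|ev (Dt (D a (D b F)))| <=
  3 * N ^+ 2 * (v * Num.sqrt P) + 2 * N ^+ 2 * (u * Num.sqrt H).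
Proof.
rewrite Dt_DD_base rmorphB !rmorphD /=.
have -> : 3 * N ^+ 2 * (v * Num.sqrt P) + 2 * N ^+ 2 * (u * Num.sqrt H) =
  N * (N * v * Num.sqrt P) + N * (N * u * Num.sqrt H) + N * (N * u * Num.sqrt H)
  + N * ((N * v + N * v) * Num.sqrt P) by ring.
apply: ler_normBB; [apply: ler_normDD; [apply: ler_normDD|]|];
  rewrite rmorph_sum; apply: ler_norm_sum_ord => h; rewrite rmorphM; apply: ler_normM;
  try exact: ev_D_le; try exact: ev_DD_le.
- exact: (ev_D_Ru_le fc evGi hl).
- exact: (ev_Ru_le evGi hk).
- exact: (ev_Ru_le evGi hk).
- exact: (ev_Su_le fc evGi hl).
Qed.

(** Passing to the square root of the Hessian term divides by it: the first summand becomes a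
    multiple of |D Rm|, to be integrated in time, the second a linear term. *)
Lemma ev_Dt_hesssq_le : `|ev (Dt (hesssq F))| <=
  6 * N ^+ 4 * (v * Num.sqrt P * Num.sqrt H) + 4 * N ^+ 4 * u * H.
Proof.
have m2C i j : met2 i j = met2 j i by rewrite /met2 !(fc_Gisym fc i.1) !(fc_Gisym fc i.2).
have m2D i j : Dt (met2 i j) = 0.
  by rewrite /met2 (derM hDt) !(fc_DtGi fc) mulr0 mul0r addr0.
rewrite /hesssq (Dt_quadratic _ m2C m2D) rmorphMn /= (ev_quad _ ev_met2).
rewrite -mulr_natl normrM ger0_norm //.
have -> : 6 * N ^+ 4 * (v * Num.sqrt P * Num.sqrt H) + 4 * N ^+ 4 * u * H =
   2 * (N ^+ 2 * (Num.sqrt H * (3 * N ^+ 2 * (v * Num.sqrt P) + 2 * N ^+ 2 * (u * Num.sqrt H)))).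
  by have := sqr_sqrtr ev_hesssq_ge0; set h := Num.sqrt H => <-; ring.
rewrite ler_pM2l //.
have -> : N ^+ 2 = #|{: 'I_n * 'I_n}|%:R by rewrite card_prod card_ord natrM expr2.
apply: ler_norm_sumc => -[a b]; rewrite rmorphM; apply: ler_normM; first exact: ev_DD_le.
rewrite card_prod card_ord natrM -expr2; exact: ev_Dt_DD_le.
Qed.

End Base.

(** * Bernstein's trick and the weighted curvature *)

Section Stages.
Variables (R : rcfType) (ev : {rmorphism A -> R}).
Hypothesis evGi : forall a b, ev (Gi a b) = (a == b)%:R.
Local Notation N := (n%:R : R).
Local Notation NRe := (normRm Gi Rm).
Local Notation NDe := (normDRm D Gi Rm).
Local Notation u := (Num.sqrt (ev (normRm Gi Rm))).
Local Notation v := (Num.sqrt (ev (normDRm D Gi Rm))).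
Local Notation heat x := (ev (Dt x - Lap x)).

Lemma ev_heatM x y : heat (x * y) = ev x * heat y + ev y * heat x
  - 2 * \sum_e ev (D e x) * ev (D e y).
Proof.
rewrite heatM rmorphB rmorphD !rmorphM rmorphMn /= (ev_contract evGi) -mulr_natl.
by congr (_ - _ * _); apply: eq_bigr => e _; rewrite rmorphM.
Qed.

Variables (F : A) (k : R).
Hypothesis EF : forall d c, E d c F = 0.
Hypothesis DtF : Dt F = 0.
Hypothesis uk : u <= k.
Local Notation P := (ev (gradsq F)).
Local Notation H := (ev (hesssq F)).

(** The factor |Rm|^2 contributes - 2 |D Rm|^4. The cross term of the gradients is absorbed by half
    of this and by the good term - 2 a0 |D D Rm|^2, because a0 is large compared with k^2. *)
Lemma heat_shi (a0 : A) : (forall e, D e a0 = 0) -> Dt a0 = 0 -> 8 * N ^+ 20 * k ^+ 2 <= ev a0 ->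
  0 < ev a0 ->
  heat ((a0 + NRe) * NDe) <= - ev NDe ^+ 2
    + (20 * N ^+ 6 * k ^+ 3 + (ev a0 + k ^+ 2) * (84 * N ^+ 7 * k)) * ev NDe.
Proof.
move=> Da Dta ha a0p; rewrite ev_heatM.
have hN := heat_normRm fc evGi; have hS := heat_normDRm fc evGi.
have -> : heat (a0 + NRe) = heat NRe.
  congr (ev _); rewrite (derD hDt) Dta add0r; congr (_ - _).
  by apply: eq_bigr => e _; apply: eq_bigr => f _; rewrite (derD (hD f)) Da add0r.
have De e : D e (a0 + NRe) = D e NRe by rewrite (derD (hD e)) Da add0r.
have hc : `|\sum_e ev (D e (a0 + NRe)) * ev (D e NDe)| <=
    N * (2 * N ^+ 4 * (u * v) * (2 * N ^+ 5 * (v * Num.sqrt (ev_hess D Rm ev)))).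
  apply: ler_norm_sum_ord => e; rewrite De; apply: ler_normM.
    exact: (grad_normRm fc evGi).
  exact: (grad_normDRm fc evGi).
have N0 : 0 <= N by exact: ler0n.
have u0 : 0 <= u by exact: sqrtr_ge0.
have v0 : 0 <= v by exact: sqrtr_ge0.
have w0 : 0 <= Num.sqrt (ev_hess D Rm ev) by exact: sqrtr_ge0.
have uE : ev NRe = u ^+ 2 by rewrite sqr_sqrtr //; exact: ev_normRm_ge0.
have vE : ev NDe = v ^+ 2 by rewrite sqr_sqrtr //; exact: ev_normDRm_ge0.
have wE : ev_hess D Rm ev = Num.sqrt (ev_hess D Rm ev) ^+ 2.
  by rewrite sqr_sqrtr //; exact: ev_hess_ge0.
have k0 : 0 <= k by exact: le_trans uk.
have uk2 : u ^+ 2 <= k ^+ 2 by rewrite lerXn2r.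
have uk3 : u ^+ 3 <= k ^+ 3 by rewrite lerXn2r.
have UK := uk; rewrite rmorphD.
set U := Num.sqrt (ev NRe) in UK u0 uE uk2 uk3 hN hS hc *.
set V := Num.sqrt (ev NDe) in v0 vE hN hS hc *.
set w := Num.sqrt (ev_hess _ _ _) in w0 wE hN hS hc *.
move: hN hS hc; rewrite wE uE vE.
set LN := heat NRe; set LS := heat NDe; set X := \sum_e _.
move: LN LS X w U V UK u0 v0 w0 uk2 uk3 {uE vE wE} => LN LS X w U V UK U0 V0 w0 UK2 UK3 hN hS hc.
have h1 : V ^+ 2 * LN <= V ^+ 2 * (- 2 * V ^+ 2 + 20 * N ^+ 6 * k ^+ 3).
  rewrite ler_wpM2l ?sqr_ge0 //; apply: le_trans hN _.
  by rewrite lerD2l ler_wpM2l // mulr_ge0 // exprn_ge0.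
have aU : 0 <= ev a0 + U ^+ 2 by rewrite addr_ge0 ?sqr_ge0 // ltW.
have h2 : (ev a0 + U ^+ 2) * LS <= - 2 * ev a0 * w ^+ 2 + (ev a0 + k ^+ 2) * (84 * N ^+ 7 * k) * V ^+ 2.
  apply: (@le_trans _ _ ((ev a0 + U ^+ 2) * (- 2 * w ^+ 2 + 84 * N ^+ 7 * U * V ^+ 2))).
    by rewrite ler_wpM2l.
  rewrite mulrDr; apply: lerD.
    have := mulr_ge0 (sqr_ge0 U) (sqr_ge0 w); lra.
  rewrite [leRHS](_ : _ = (ev a0 + k ^+ 2) * (84 * N ^+ 7 * k * V ^+ 2)); last by ring.
  apply: ler_pM => //; first by rewrite !mulr_ge0 ?exprn_ge0 ?sqr_ge0.
    by rewrite lerD2l.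
  by rewrite ler_wpM2r ?sqr_ge0 // ler_wpM2l // mulr_ge0 // exprn_ge0.
have h3 : - (2 * X) <= 2 * ev a0 * w ^+ 2 + V ^+ 4.
  have hX : - X <= 4 * N ^+ 10 * (U * V ^+ 2 * w).
    have : - X <= `|X| by rewrite -normrN; exact: ler_norm.
    move=> hx; apply: (le_trans hx); apply: (le_trans hc); rewrite le_eqVlt; apply/orP; left.
    by apply/eqP; ring.
  suff h : 8 * N ^+ 10 * (U * V ^+ 2 * w) <= 2 * ev a0 * w ^+ 2 + V ^+ 4 by lra.
  (* AM-GM with weight a0, using 8 N^20 U^2 <= a0 *)
  have hA : (8 * N ^+ 20 * U ^+ 2) * V ^+ 4 <= ev a0 * V ^+ 4.
    rewrite ler_wpM2r ?exprn_ge0 //; apply: le_trans ha.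
    by apply: ler_wpM2l => //; rewrite mulr_ge0 // exprn_ge0.
  have sq := sqr_ge0 (2 * ev a0 * w - 4 * N ^+ 10 * U * V ^+ 2).
  rewrite -(ler_pM2l a0p).
  have := sq; have := hA; rewrite !expr2; nra.
have h4 : V ^+ 4 = (V ^+ 2) ^+ 2 by rewrite -exprM.
rewrite -h4; move: h1 h2 h3; rewrite (_ : V ^+ 2 * (- 2 * V ^+ 2 + 20 * N ^+ 6 * k ^+ 3) =
  - 2 * V ^+ 4 + 20 * N ^+ 6 * k ^+ 3 * V ^+ 2); last by rewrite h4; ring.
rewrite [(_ + _) * V ^+ 2]mulrDl; lra.
Qed.

(* The inequality that Bernstein's trick yields at a maximum of
   (1 - c F)^2 t (a0 + |Rm|^2) |D Rm|^2. *)
Lemma shi_max (t c a0 : A) (Tm : R) :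
  (forall e, D e t = 0) -> Dt t = 1 -> (forall e, D e c = 0) -> Dt c = 0 ->
  (forall e, D e a0 = 0) -> Dt a0 = 0 ->
  8 * N ^+ 20 * k ^+ 2 <= ev a0 -> 0 < ev a0 -> 0 <= ev t <= Tm -> 0 <= ev c ->
  0 <= 1 - ev c * ev F <= 1 ->
  let eta := 1 - c * F in let Z := (a0 + NRe) * NDe in
  let q := t * (eta * eta) * Z in let y := 1 - ev c * ev F in
  0 <= ev (Dt q) -> (forall e, ev (D e q) = 0) -> ev (Lap q) <= 0 ->
  (ev t * y ^+ 2 * ev NDe) ^+ 2 <=
    (20 * N ^+ 6 * k ^+ 3 + (ev a0 + k ^+ 2) * (84 * N ^+ 7 * k)) * Tm * (ev t * y ^+ 2 * ev NDe)
    + ev q * (1 + 2 * Tm * N * ev c * (y * Num.sqrt H) + 8 * Tm * ev c ^+ 2 * P).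
Proof.
move=> Dt0 Dtt Dc Dtc Da Dta ha a0p /andP[t0 tT] c0 /andP[y0 y1] eta Z q y q1 q2 q3.
pose W := t * (eta * eta).
have De e : D e eta = - (c * D e F).
  by rewrite /eta (derB (hD e)) (der1 (hD e)) (derM (hD e)) Dc; ring.
have eeta : ev eta = y by rewrite /eta rmorphB rmorph1 rmorphM.
have Leta : heat eta = ev c * ev (Lap F).
  have -> : Dt eta = 0 by rewrite /eta (derB hDt) (der1 hDt) (derM hDt) Dtc DtF; ring.
  have -> : Lap eta = - (c * Lap F).
    rewrite /frame_lap mulr_sumr -sumrN; apply: eq_bigr => e _.
    rewrite mulr_sumr -sumrN; apply: eq_bigr => f _.
    by rewrite De (derN (hD e)) (derM (hD e)) Dc; ring.
  by rewrite sub0r opprK rmorphM.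
have Lt : heat t = 1.
  rewrite Dtt /frame_lap big1 ?subr0 ?rmorph1 // => e _; rewrite big1 // => f _.
  by rewrite Dt0 (der0 (hD e)) mulr0.
have sP : \sum_e ev (D e eta) * ev (D e eta) = ev c ^+ 2 * P.
  rewrite (ev_gradsq _ evGi) mulr_sumr; apply: eq_bigr => e _.
  by rewrite De rmorphN rmorphM /=; ring.
have LW : heat W = ev t * (2 * (y * (ev c * ev (Lap F))) - 2 * (ev c ^+ 2 * P)) + y ^+ 2.
  rewrite /W ev_heatM Lt (ev_heatM eta eta) Leta sP.
  rewrite [X in _ - 2 * X]big1 => [|e _]; last by rewrite Dt0 rmorph0 mul0r.
  by rewrite rmorphM /= eeta; ring.
have DW e : ev (D e W) = - (2 * ev t * y * (ev c * ev (D e F))).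
  rewrite /W (derM (hD e)) Dt0 mul0r add0r (derM (hD e)) De.
  by rewrite rmorphM rmorphD !rmorphM !rmorphN !rmorphM /= eeta; ring.
have LZ := heat_shi Da Dta ha a0p.
have evW : ev W = ev t * y ^+ 2 by rewrite /W !rmorphM /= eeta expr2.
have W0 : 0 <= ev W by rewrite evW mulr_ge0 // sqr_ge0.
have S0 : 0 <= ev NDe by exact: ev_normDRm_ge0.
have R0 : 0 <= ev NRe by exact: ev_normRm_ge0.
have Z0 : 0 <= ev Z by rewrite /Z rmorphM rmorphD mulr_ge0 // addr_ge0 // ltW.
(* The gradient of the product W Z vanishes at the maximum, so that the gradient of [Z] is expressed
   by that of the weight. *)
have DZ e : ev W * ev (D e Z) = - (ev Z * ev (D e W)).
  have := q2 e; rewrite /q -/W (derM (hD e)) rmorphD !rmorphM /= => h.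
  by apply/eqP; rewrite -addr_eq0 -[X in _ == X]h; apply/eqP; ring.
have Lq : 0 <= ev W * heat Z + ev Z * heat W - 2 * \sum_e ev (D e W) * ev (D e Z).
  by rewrite -ev_heatM rmorphB subr_ge0 (le_trans q3).
have sW : ev W * (\sum_e ev (D e W) * ev (D e Z)) = - (ev Z * (4 * ev t ^+ 2 * y ^+ 2 * ev c ^+ 2 * P)).
  rewrite (ev_gradsq _ evGi) !mulr_sumr -sumrN; apply: eq_bigr => e _.
  by rewrite mulrCA DZ DW; ring.
have N0 : 0 <= N by exact: ler0n.
have P0 : 0 <= P by exact: ev_gradsq_ge0.
have lapb : ev (Lap F) <= N * Num.sqrt H by rewrite (le_trans (ler_norm _)) // ev_lap_le.
have LWb : heat W <= y ^+ 2 + 2 * ev t * y * ev c * (N * Num.sqrt H).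
  rewrite LW.
  have h1 : ev t * y * ev c * ev (Lap F) <= ev t * y * ev c * (N * Num.sqrt H).
    by rewrite ler_wpM2l // !mulr_ge0.
  have h2 : 0 <= ev t * ev c ^+ 2 * P by rewrite !mulr_ge0 // sqr_ge0.
  lra.
(* A further factor W brings the cross term into the form of [sW], a multiple of |d F|^2, and makes
   the main term the square of W |D Rm|^2. *)
have := mulr_ge0 W0 Lq; rewrite mulrBr mulrDr (mulrCA _ 2) sW => h.
have h1 : ev W * (ev W * heat Z) <= ev W * (ev W * (- ev NDe ^+ 2
    + (20 * N ^+ 6 * k ^+ 3 + (ev a0 + k ^+ 2) * (84 * N ^+ 7 * k)) * ev NDe)).
  by rewrite !ler_wpM2l.
have h2 : ev W * (ev Z * heat W) <= ev W * (ev Z * (y ^+ 2 + 2 * ev t * y * ev c * (N * Num.sqrt H))).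
  by rewrite !ler_wpM2l.
have -> : ev q = ev W * ev Z by rewrite /q rmorphM.
rewrite -evW.
set C3 := (20 * N ^+ 6 * k ^+ 3 + _) in h1 *.
have C30 : 0 <= C3.
  have k0 : 0 <= k by apply: le_trans uk; exact: sqrtr_ge0.
  by rewrite /C3 addr_ge0 // !mulr_ge0 // ?exprn_ge0 // addr_ge0 ?exprn_ge0 // ltW.
have y2 : y ^+ 2 <= 1 by rewrite exprn_ile1.
have WT : ev W <= Tm by rewrite evW; apply: le_trans tT; rewrite ler_piMr.
have g1 : C3 * (ev W * ev W * ev NDe) <= C3 * (Tm * (ev W * ev NDe)).
  by rewrite ler_wpM2l // -mulrA ler_wpM2r // mulr_ge0.
have g2 : ev W * ev Z * y ^+ 2 <= ev W * ev Z by rewrite ler_piMr // mulr_ge0.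
have sH : 0 <= Num.sqrt H by exact: sqrtr_ge0.
have g3 : ev W * ev Z * N * ev c * y * Num.sqrt H * ev t <= ev W * ev Z * N * ev c * y * Num.sqrt H * Tm.
  by rewrite ler_wpM2l // !mulr_ge0.
have g4 : ev W * ev Z * ev c ^+ 2 * P * ev t <= ev W * ev Z * ev c ^+ 2 * P * Tm.
  by rewrite ler_wpM2l // !mulr_ge0 // sqr_ge0.
have e1 : ev Z * (4 * ev t ^+ 2 * y ^+ 2 * ev c ^+ 2 * P) = 4 * (ev W * ev Z * ev c ^+ 2 * P * ev t).
  by rewrite evW; ring.
rewrite e1 in h.
move: h h1 h2 g1 g2 g3 g4; move: (heat Z) (heat W) => hz hw.
move: (ev W) (ev Z) (ev NDe) (ev c) (Num.sqrt H) (P) (ev t) => w z S c' sh p t'; nra.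
Qed.

(* kap stands for 1 / F and W for the power F ^ b. *)
Lemma power_weight (b : A) (W kap : A) : (forall e, D e b = 0) -> kap * F = 1 ->
  (forall e, D e W = b * (W * (kap * D e F))) ->
  Lap W = W * (b * (b - 1) * (kap * kap * gradsq F) + b * (kap * Lap F)).
Proof.
move=> Db kF DW.
have Dk e : D e kap = - (kap * kap * D e F).
  have h := congr1 (D e) kF; move: h; rewrite (derM (hD e)) (der1 (hD e)) => h.
  have := congr1 ( *%R kap) h; rewrite mulr0 mulrDr => h2.
  have e1 : kap * (D e kap * F) = D e kap by rewrite mulrCA kF mulr1.
  by apply/eqP; rewrite -addr_eq0 -[X in _ == X]h2 e1; apply/eqP; ring.
transitivity (\sum_e \sum_f (W * (b * (b - 1) * (kap * kap * (Gi e f * (D e F * D f F))))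
   + W * (b * (kap * (Gi e f * D e (D f F)))))).
  apply: eq_bigr => e _; apply: eq_bigr => f _; rewrite DW (derM (hD e)) Db !(derM (hD e)) DW Dk.
  ring.
under eq_bigr do rewrite big_split /= -!mulr_sumr.
by rewrite big_split /= -!mulr_sumr [RHS]mulrDr.
Qed.

(** The reaction term costs 20 N^6 k and the Laplacian of the weight the terms in p and h. The cross
    term is completed to a square against - 2 W |D Rm|^2, which costs 2 N^10 b^2 p^2. *)
Lemma decay_heat (b : A) (W kap : A) (C p h : R) : (forall e, D e b = 0) ->
  kap * F = 1 -> Dt W = 0 -> (forall e, D e W = b * (W * (kap * D e F))) ->
  0 <= ev W -> 0 <= ev b -> 0 <= ev kap -> ev kap * Num.sqrt P <= p -> ev kap * Num.sqrt H <= h ->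
  `|ev (Lap W)| <= ev W * (ev b * (ev b + 1) * p ^+ 2 + ev b * (N * h)) /\
  heat (W * NRe) <= (20 * N ^+ 6 * k + (ev b * (ev b + 1) * p ^+ 2 + ev b * (N * h))
     + 2 * N ^+ 10 * ev b ^+ 2 * p ^+ 2) * (ev W * ev NRe).
Proof.
move=> Db kF DtW DW W0 b0 k0 hp hh.
have P0 : 0 <= P by exact: ev_gradsq_ge0.
have N0 : 0 <= N by exact: ler0n.
have sP0 : 0 <= Num.sqrt P by exact: sqrtr_ge0.
have p0 : 0 <= p by apply: le_trans hp; exact: mulr_ge0.
have lapW : `|ev (Lap W)| <= ev W * (ev b * (ev b + 1) * p ^+ 2 + ev b * (N * h)).
  rewrite (power_weight Db kF DW) rmorphM normrM (ger0_norm W0) ler_wpM2l //.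
  rewrite rmorphD !rmorphM rmorphB rmorph1 /=; apply: ler_normDD.
    apply: ler_normM; last first.
      have -> : ev kap * ev kap * P = (ev kap * Num.sqrt P) ^+ 2.
        by rewrite exprMn sqr_sqrtr // expr2.
      by rewrite ger0_norm ?sqr_ge0 // lerXn2r // nnegrE mulr_ge0.
    apply: ler_normM; first by rewrite ger0_norm.
    by rewrite ler_norml; apply/andP; split; lra.
  apply: ler_normM; first by rewrite ger0_norm.
  rewrite normrM (ger0_norm k0).
  have h1 := ev_lap_le F evGi.
  apply: (@le_trans _ _ (ev kap * (N * Num.sqrt H))); first by rewrite ler_wpM2l.
  by rewrite mulrCA ler_wpM2l.
split=> //; rewrite ev_heatM.
have hN := heat_normRm fc evGi.
have hW : heat W = - ev (Lap W) by rewrite DtW sub0r rmorphN.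
have u0 : 0 <= u by exact: sqrtr_ge0.
have v0 : 0 <= v by exact: sqrtr_ge0.
have uE : ev NRe = u ^+ 2 by rewrite sqr_sqrtr //; exact: ev_normRm_ge0.
have vE : ev NDe = v ^+ 2 by rewrite sqr_sqrtr //; exact: ev_normDRm_ge0.
have hc : `|\sum_e ev (D e W) * ev (D e NRe)| <=
    N * (ev b * (ev W * p) * (2 * N ^+ 4 * (u * v))).
  apply: ler_norm_sum_ord => e; rewrite DW !rmorphM /=; apply: ler_normM; last exact: (grad_normRm fc evGi).
  apply: ler_normM; first by rewrite ger0_norm.
  apply: ler_normM; first by rewrite ger0_norm.
  rewrite normrM (ger0_norm k0); apply: le_trans hp; rewrite ler_wpM2l //; exact: ev_D_le.
have k0' : 0 <= k by exact: le_trans uk.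
have UK := uk; rewrite hW.
set U := Num.sqrt (ev NRe) in UK u0 uE hN hc *.
set V := Num.sqrt (ev NDe) in v0 vE hN hc *.
move: hN hc lapW; rewrite uE vE.
set Q := ev b * (ev b + 1) * _ + _; set X := \sum_e _; move: (heat NRe) (ev (Lap W)) X => LN LW X hN hc lapW.
move: U V UK u0 v0 hN hc {uE vE} => U V UK U0 V0 hN hc.
have g1 : ev W * LN <= ev W * (- 2 * V ^+ 2 + 20 * N ^+ 6 * k * U ^+ 2).
  rewrite ler_wpM2l //; apply: (le_trans hN); rewrite lerD2l exprS.
  have -> : 20 * N ^+ 6 * k * U ^+ 2 = 20 * N ^+ 6 * (k * U ^+ 2) by ring.
  by apply: ler_wpM2l; [rewrite mulr_ge0 // exprn_ge0|rewrite ler_wpM2r ?sqr_ge0].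
have g2 : U ^+ 2 * - LW <= U ^+ 2 * (ev W * Q).
  by rewrite ler_wpM2l ?sqr_ge0 //; apply: le_trans lapW; rewrite -normrN ler_norm.
have g3 : - (2 * X) <= ev W * (2 * V ^+ 2) + ev W * (2 * N ^+ 10 * ev b ^+ 2 * p ^+ 2) * U ^+ 2.
  have hX : - X <= ev W * (2 * (N ^+ 5 * ev b * p * U) * V).
    have : - X <= `|X| by rewrite -normrN; exact: ler_norm.
    move=> hx; apply: (le_trans hx); apply: (le_trans hc); rewrite le_eqVlt; apply/orP; left.
    by apply/eqP; ring.
  have sq := mulr_ge0 W0 (sqr_ge0 (V - N ^+ 5 * ev b * p * U)).
  have -> : ev W * (2 * N ^+ 10 * ev b ^+ 2 * p ^+ 2) * U ^+ 2 =
     2 * (ev W * (N ^+ 5 * ev b * p * U) ^+ 2) by ring.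
  move: hX sq; move: (N ^+ 5 * ev b * p * U) (ev W) => Y w; rewrite !expr2; nra.
move: g1 g2 g3; rewrite !mulrDr !mulrDl; nra.
Qed.

End Stages.
End PhiAlgebra.

(** * Powers and exponentials of smooth functions; derivatives at a maximum *)

Section Composition.
Variables (R : realType) (V : normedModType R).

Lemma is_derive_comp_dir (f : R -> R) (h : V -> R) x v d :
  is_derive (h x) 1 f d -> derivable h x v -> is_derive x v (f \o h) (d * 'D_v h x).
Proof.
move=> hf hh; pose L (s : R) := s *: v + x.
have Ll (r w c : R) : L (c *: w + r) = c *: (w *: v) + L r.
  by rewrite /L scalerDl -scalerA addrA.
have L0 : L 0 = x by rewrite /L scale0r add0r.
have dh : is_derive (0 : R) 1 (h \o L) ('D_v h x).
  apply: (is_derive_affine Ll); rewrite scale1r L0; exact: derivableP.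
have hf' : is_derive ((h \o L) 0) 1 f d by rewrite /= L0.
have dc := is_derive1_comp hf' dh.
split; first by apply/derivable1P; exact: (@ex_derive _ _ _ _ _ _ _ dc).
have := @derive_val _ _ _ _ _ _ _ dc.
by rewrite -[f \o (h \o L)]/((f \o h) \o L) (derive_affine Ll) scale1r L0 => ->.
Qed.

(** [f m] stands for the m-th derivative of one function. The whole sequence is carried along
    because differentiating the composite with [f m] produces the composite with the next one. *)
Lemma Ck_comp1 (U : set V) (S : set R) (f : nat -> R -> R) (h : V -> R) : open U ->
  (forall m x, S x -> is_derive x 1 (f m) (f m.+1 x)) ->
  (forall x, U x -> S (h x)) -> (forall k, Ck k U h) ->
  forall k m, Ck k U (f m \o h).
Proof.
move=> oU hf hS hh.
have c m x : U x -> {for x, continuous (f m \o h)}.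
  move=> Ux; apply: continuous_comp; first exact: (Ck_cont (hh 0)).
  apply/differentiable_continuous/derivable1_diffP.
  exact: (@ex_derive _ _ _ _ _ _ _ (hf m _ (hS _ Ux))).
have d m v x : U x -> is_derive x v (f m \o h) (f m.+1 (h x) * 'D_v h x).
  move=> Ux; apply: is_derive_comp_dir; [exact: hf (hS _ Ux)|exact: (Ck_derivable (hh 1))].
elim=> [|k IH] m; first by split=> // x; exact: c.
split=> [x|v]; first exact: c.
split=> [x Ux|]; first exact: (@ex_derive _ _ _ _ _ _ _ (d m v x Ux)).
apply: (@Ck_ext _ _ _ _ _ (fun x => (f m.+1 \o h) x * 'D_v h x)) => //.
  by move=> x Ux; symmetry; exact: (@derive_val _ _ _ _ _ _ _ (d m v x Ux)).
by apply: CkM => //; exact: (Ck_D v (hh k.+1)).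
Qed.

Lemma is_derive_powR_tower (b x : R) m : 0 < x ->
  is_derive x 1 (fun y => (\prod_(i < m) (b - i%:R)) * y `^ (b - m%:R))
    ((\prod_(i < m.+1) (b - i%:R)) * x `^ (b - m.+1%:R)).
Proof.
move=> x0; have h := is_derive1_powR (b - m%:R) x0.
have := is_deriveZ (\prod_(i < m) (b - i%:R)) h.
rewrite big_ord_recr /= /GRing.scale /= mulrA -natr1 opprD addrA; exact.
Qed.

Lemma Ck_powR (U : set V) (h : V -> R) b : open U -> (forall x, U x -> 0 < h x) ->
  (forall k, Ck k U h) -> forall k, Ck k U (fun x => h x `^ b).
Proof.
move=> oU h0 hh k.
have := @Ck_comp1 U [set x | 0 < x] (fun m y => (\prod_(i < m) (b - i%:R)) * y `^ (b - m%:R)) h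
  oU (fun m x => @is_derive_powR_tower b x m) h0 hh k 0.
by apply: Ck_ext => // x Ux /=; rewrite big_ord0 mul1r subr0.
Qed.

Lemma Ck_expR (U : set V) (h : V -> R) : open U ->
  (forall k, Ck k U h) -> forall k, Ck k U (fun x => expR (h x)).
Proof.
move=> oU hh k.
exact: (@Ck_comp1 U setT (fun _ => expR) h oU (fun _ x _ => is_derive_expR x) (fun _ _ => I) hh k 0).
Qed.

Section Extremum.
Variables (f : V -> R) (U : set V) (x v : V).
Hypothesis oU : open U.
Hypothesis Ux : U x.

(** A negative derivative at x would be negative nearby, and the mean value theorem would give a
    larger value at x - h v. The one-sided form is needed in the time direction, where only earlier
    points are compared. *)
Lemma left_max_derive : Ck 1 U f ->
  (\forall h \near (0 : R), 0 < h -> f (x - h *: v) <= f x) -> 0 <= 'D_v f x.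
Proof.
move=> hf hm; rewrite leNgt; apply/negP => d0.
have d2 : 0 < - 'D_v f x / 2 by rewrite divr_gt0 // oppr_gt0.
have [r r0 hr] := cont_ball oU Ux (Ck_cont (Ck_D v hf) Ux) d2.
have /nbhs_ballP[e e0 he] := hm.
pose h := Num.min (e / 2) (r / (2 * (`|v| + 1))).
have v1 : 0 < `|v| + 1 by rewrite ltr_wpDl.
have h0 : 0 < h by rewrite lt_min !divr_gt0 // mulr_gt0.
have he' : ball 0 e h.
  rewrite -ball_normE /= sub0r normrN gtr0_norm // (@le_lt_trans _ _ (e / 2)) ?ge_min ?lexx //.
  by rewrite ltr_pdivrMr // ltr_pMr // ltr1n.
have hv : h * `|v| < r.
  apply: (@le_lt_trans _ _ (r / (2 * (`|v| + 1)) * `|v|)).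
    by rewrite ler_wpM2r // ge_min lexx orbT.
  rewrite mulrAC ltr_pdivrMr ?mulr_gt0 // ltr_pM2l //; have := normr_ge0 v; lra.
have inb s : 0 <= s <= h -> `|x - h *: v + s *: v - x| < r.
  move=> /andP[s0 sh]; rewrite addrAC [x - _]addrC addrK addrC -scalerBl normrZ.
  apply: le_lt_trans hv; rewrite ler_wpM2r // ler0_norm; lra.
have [c /andP[c0 ch]] := @mvt_dir R V f (x - h *: v) v h h0
  (fun s hs => Ck_derivable hf v (hr _ (inb s hs)).1).
rewrite subrK => E; have hc : 0 <= c <= h by rewrite !ltW.
have := (hr _ (inb c hc)).2; set d := 'D_v f _ in E * => hd.
have dneg : d < 0 by move: hd; rewrite ler_norml => /andP[_]; lra.
have := he h he' h0; rewrite -subr_ge0 E pmulr_rge0 // leNgt dneg; exact.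
Qed.

(** Were the second derivative positive, two applications of the mean value theorem would make f
    increase from the critical point. *)
Lemma second_max_derive : Ck 2 U f -> 'D_v f x = 0 ->
  (\forall h \near (0 : R), 0 < h -> f (x + h *: v) <= f x) -> 'D_v (fun y => 'D_v f y) x <= 0.
Proof.
move=> hf d1 hm; rewrite leNgt; apply/negP => d0.
have d2 : 0 < 'D_v (fun y => 'D_v f y) x / 2 by rewrite divr_gt0.
have [r r0 hr] := cont_ball oU Ux (Ck_cont (Ck_D v (Ck_D v hf)) Ux) d2.
have /nbhs_ballP[e e0 he] := hm.
pose h := Num.min (e / 2) (r / (2 * (`|v| + 1))).
have v1 : 0 < `|v| + 1 by rewrite ltr_wpDl.
have h0 : 0 < h by rewrite lt_min !divr_gt0 // mulr_gt0.
have he' : ball 0 e h.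
  rewrite -ball_normE /= sub0r normrN gtr0_norm // (@le_lt_trans _ _ (e / 2)) ?ge_min ?lexx //.
  by rewrite ltr_pdivrMr // ltr_pMr // ltr1n.
have hv : h * `|v| < r.
  apply: (@le_lt_trans _ _ (r / (2 * (`|v| + 1)) * `|v|)).
    by rewrite ler_wpM2r // ge_min lexx orbT.
  rewrite mulrAC ltr_pdivrMr ?mulr_gt0 // ltr_pM2l //; have := normr_ge0 v; lra.
have inb s : 0 <= s <= h -> `|x + s *: v - x| < r.
  move=> /andP[s0 sh]; rewrite addrAC subrr add0r normrZ.
  by apply: le_lt_trans hv; rewrite ler_wpM2r // ger0_norm.
have [c /andP[c0 ch]] := @mvt_dir R V f x v h h0
  (fun s hs => Ck_derivable (CkW hf) v (hr _ (inb s hs)).1).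
move=> E; have hc : 0 <= c <= h by rewrite !ltW.
have inc s : 0 <= s <= c -> 0 <= s <= h by case/andP=> *; lra.
have [c' /andP[c0' ch']] := @mvt_dir R V (fun y => 'D_v f y) x v c c0
  (fun s hs => Ck_derivable (Ck_D v hf) v (hr _ (inb s (inc s hs))).1).
rewrite d1 subr0 => E2; have hc' : 0 <= c' <= c by rewrite !ltW.
have := (hr _ (inb c' (inc c' hc'))).2; set d := 'D_v (fun y => 'D_v f y) (x + c' *: v) in E2 * => hd.
have dpos : 0 < d by move: hd; rewrite ler_norml => /andP[+ _]; lra.
have := he h he' h0; rewrite -subr_le0 E E2 leNgt !mulr_gt0 //.
Qed.

End Extremum.
End Composition.

(** * Gradient and Hessian of a function in a frame *)

Section Values.
Variables (R : realType) (n : nat).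
Local Notation B := (R * 'rV[R]_n)%type.
Local Notation P := (R * 'rV[R]_n * 'M[R]_n)%type.
Variables (O : osub B) (G : B -> 'M[R]_n).
Hypothesis hG : forall i j k, Ck k O (fun q => G q i j).
Hypothesis uG : forall q, O q -> G q \in unitmx.

Local Notation U := (frames O).
Local Notation A := (smfun U).
Local Notation pd := (@pdf R n O).
Local Notation z := (@zf R n O).
Local Notation Gam := (mGam hG uG).
Local Notation Gs p := (fun y => G (p.1.1, y)).
Local Notation D := (gD hG uG).
Local Notation Gi := (gGi hG uG).

Definition grad_sq (Gs : 'rV[R]_n -> 'M[R]_n) (f : 'rV[R]_n -> R) y :=
  qform (invmx (Gs y)) (\row_i partial i f y).
Definition hess_sq (Gs : 'rV[R]_n -> 'M[R]_n) (f : 'rV[R]_n -> R) y :=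
  \tr (invmx (Gs y) *m hessian Gs f y *m (invmx (Gs y))^T *m (hessian Gs f y)^T).

Let pder i : derivation (pd i). Proof. exact: smD_der. Qed.
Let pcomm i j F : pd i (pd j F) = pd j (pd i F). Proof. exact: smD_comm. Qed.

Lemma pulls_base F f : pulls F f -> fbase pd F.
Proof. by move=> h c k; exact: pulls_py h. Qed.

Lemma gD_value F f a p : pulls F f -> U p ->
  D a F p = \sum_k p.2 a k * partial k (fun y => f (p.1.1, y)) p.1.2.
Proof.
move=> h Up; rewrite /gD (fD_base _ _ _ (pulls_base h)) /fL smf_sum //.
by apply: eq_bigr => k _; rewrite smME // (pulls_px _ h Up) mxE zfE.
Qed.

Lemma contract3 (Ya Yb d : 'I_n -> R) (C : 'I_n -> 'I_n -> 'I_n -> R) :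
  \sum_i (\sum_k Ya k * (\sum_l Yb l * C i k l)) * d i =
  \sum_l (\sum_k Ya k * (\sum_i C i k l * d i)) * Yb l.
Proof.
transitivity (\sum_i \sum_k \sum_l Ya k * Yb l * C i k l * d i).
  apply: eq_bigr => i _; rewrite mulr_suml; apply: eq_bigr => k _.
  by rewrite mulr_sumr mulr_suml; apply: eq_bigr => l _; ring.
symmetry; transitivity (\sum_l \sum_k \sum_i Ya k * Yb l * C i k l * d i).
  apply: eq_bigr => l _; rewrite mulr_suml; apply: eq_bigr => k _.
  by rewrite mulr_sumr mulr_suml; apply: eq_bigr => i _; ring.
rewrite exchange_big; under eq_bigr do rewrite exchange_big.
by rewrite exchange_big.
Qed.

(** The vertical part of the horizontal field acts on the frame component [D b F] and supplies the
    Christoffel term of the Hessian. *)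
Lemma gDD_value F f a b p : pulls F f -> U p ->
  D a (D b F) p = (p.2 *m hessian (Gs p) (fun y => f (p.1.1, y)) p.1.2 *m p.2^T) a b.
Proof.
move=> h Up; rewrite {2}/gD (fD_base _ _ _ (pulls_base h)) /gD.
rewrite (fD_L _ pder (@geom_pd_z R n O)) smDDE // smNE // /fL !smf_sum //.
have e1 l : fD pd z Gam a (pd (iX l) F) p =
    \sum_k p.2 a k * partial k (partial l (fun y => f (p.1.1, y))) p.1.2.
  exact: (gD_value a (pulls_pxp l h) Up).
have e2 i : fGy z Gam a b i p =
    \sum_k p.2 a k * \sum_l p.2 b l * christoffel (Gs p) i k l p.1.2.
  rewrite /fGy /fL smf_sum //; apply: eq_bigr => k _; rewrite smME // mxE zfE //; congr (_ * _).
  rewrite smf_sum //; apply: eq_bigr => l _; rewrite smME // mxE zfE //; congr (_ * _).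
  exact: (pulls_Gam hG uG _ _ _ Up).
transitivity (\sum_l (\sum_k p.2 a k * partial k (partial l (fun y => f (p.1.1, y))) p.1.2) * p.2 b l
  - \sum_i (\sum_k p.2 a k * \sum_l p.2 b l * christoffel (Gs p) i k l p.1.2)
     * partial i (fun y => f (p.1.1, y)) p.1.2).
  congr (_ - _); apply: eq_bigr => l _; rewrite smME //.
    by rewrite e1 mxE zfE // mulrC.
  by rewrite e2 (pulls_px _ h Up).
rewrite contract3 -sumrB [RHS]mxE; apply: eq_bigr => l _; rewrite -mulrBl [in RHS]mxE [in X in _ = _ * X]mxE.
congr (_ * _); rewrite -sumrB; apply: eq_bigr => k _.
by rewrite [in RHS]mxE mulrBr.
Qed.

Lemma gGi_value a b p : U p -> Gi a b p = ((invmx p.2)^T *m invmx (G p.1) *m invmx p.2) a b.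
Proof.
move=> Up; rewrite /gGi /fGi sm_mulmx // [RHS]mxE; apply: eq_bigr => k _; congr (_ * _).
  rewrite sm_mulmx // [RHS]mxE; apply: eq_bigr => l _; congr (_ * _).
    by rewrite !mxE smkE.
  exact: (pulls_mgi hG uG _ _ Up).
by rewrite mxE smkE.
Qed.

Lemma quad_mx (M : 'M[R]_n) (x : 'I_n -> R) :
  \sum_a \sum_b M a b * (x a * x b) = ((\row_a x a) *m M *m (\row_a x a)^T) ord0 ord0.
Proof.
rewrite mxE exchange_big; apply: eq_bigr => b _; rewrite mxE mulr_suml.
by apply: eq_bigr => a _; rewrite !mxE; ring.
Qed.

Lemma quad_tr (M Z : 'M[R]_n) :
  \sum_(i : 'I_n * 'I_n) \sum_(j : 'I_n * 'I_n) M i.1 j.1 * M i.2 j.2 * (Z i.1 i.2 * Z j.1 j.2)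
  = \tr (M *m Z *m M^T *m Z^T).
Proof.
transitivity (\sum_a \sum_d \sum_c \sum_b M a c * M d b * (Z a d * Z c b)).
  rewrite [RHS]pair_bigA /=; apply: eq_bigr => -[a d] _ /=; rewrite [RHS]pair_bigA /=.
  by apply: eq_bigr => -[c b] _.
apply: eq_bigr => a _; rewrite [RHS]mxE; apply: eq_bigr => d _.
rewrite [X in _ = X * _]mxE [X in _ = _ * X]mxE mulr_suml exchange_big; apply: eq_bigr => b _.
rewrite [X in _ = X * _ * _]mxE [X in _ = _ * X * _]mxE !mulr_suml; apply: eq_bigr => c _; ring.
Qed.

Lemma gradsq_pulls F f : pulls F f ->
  pulls (gradsq D Gi F) (fun q => grad_sq (fun y => G (q.1, y)) (fun y => f (q.1, y)) q.2).
Proof.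
move=> h p Up; rewrite /gradsq smf_sum //.
transitivity (\sum_a \sum_b ((invmx p.2)^T *m invmx (G p.1) *m invmx p.2) a b * (D a F p * D b F p)).
  apply: eq_bigr => a _; rewrite smf_sum //; apply: eq_bigr => b _.
  by rewrite smME // smME // gGi_value.
rewrite quad_mx; set d := \row_a _.
have -> : d = (\row_i partial i (fun y => f (p.1.1, y)) p.1.2) *m p.2^T.
  apply/rowP => a; rewrite !mxE (gD_value a h Up); apply: eq_bigr => k _.
  by rewrite !mxE mulrC.
have uY := Up.2; rewrite /grad_sq /qform trmx_mul trmxK; set r := \row_i _.
have -> : G (p.1.1, p.1.2) = G p.1 by rewrite -surjective_pairing.
have VY : invmx p.2 *m p.2 = 1%:M by exact: mulVmx.
have YV : p.2^T *m (invmx p.2)^T = 1%:M by rewrite -trmx_mul VY trmx1.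
by rewrite -!mulmxA (mulmxA (invmx p.2)) VY mul1mx (mulmxA p.2^T) YV mul1mx.
Qed.

Lemma hesssq_pulls F f : pulls F f ->
  pulls (hesssq D Gi F) (fun q => hess_sq (fun y => G (q.1, y)) (fun y => f (q.1, y)) q.2).
Proof.
move=> h p Up; rewrite /hesssq smf_sum //.
pose M := (invmx p.2)^T *m invmx (G p.1) *m invmx p.2.
pose Hs := hessian (Gs p) (fun y => f (p.1.1, y)) p.1.2.
pose Z := p.2 *m Hs *m p.2^T.
transitivity (\sum_(i : 'I_n * 'I_n) \sum_(j : 'I_n * 'I_n) M i.1 j.1 * M i.2 j.2 * (Z i.1 i.2 * Z j.1 j.2)).
  apply: eq_bigr => i _; rewrite smf_sum //; apply: eq_bigr => j _.
  by rewrite /met2 !smME // !gGi_value // !(gDD_value _ _ h Up).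
rewrite quad_tr /hess_sq -/Hs.
have -> : G (p.1.1, p.1.2) = G p.1 by rewrite -surjective_pairing.
have uY := Up.2; have VY : invmx p.2 *m p.2 = 1%:M by exact: mulVmx.
have YV : p.2^T *m (invmx p.2)^T = 1%:M by rewrite -trmx_mul VY trmx1.
rewrite /M /Z !trmx_mul !trmxK.
rewrite !mulmxA -!(mulmxA _ (invmx p.2) p.2) !VY !mulmx1.
rewrite -!(mulmxA _ p.2^T (invmx p.2)^T) !YV !mulmx1.
by rewrite mxtrace_mulC !mulmxA YV mul1mx.
Qed.

(** [f] is the restriction of [F] to the section given by the identity frame. *)
Lemma pulls_slice_Ck (F : A) f k : pulls F f -> Ck k O f.
Proof.
move=> h; have Up q : O q -> U (q, 1%:M) by move=> Oq; split=> //=; exact: unitmx1.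
have c : continuous (fun q : B => (q, 1%:M : 'M[R]_n)).
  move=> q; have h1 : {for q, continuous (fun q : B => (q, 1%:M : 'M[R]_n))}.
    by apply: cont_pair; [exact: cvg_id|exact: cst_continuous].
  exact: h1.
have Ll (x w : B) (c' : R) : (c' *: w + x, 1%:M : 'M[R]_n) = c' *: (w, 0) + (x, 1%:M).
  by rewrite -[RHS]/(c' *: w + x, c' *: 0 + 1%:M) scaler0 add0r.
have := @Ck_affine _ _ _ _ (fun q : B => (q, 1%:M : 'M[R]_n)) (fun w => (w, 0)) c Ll k U F (smf_smooth F k).
move=> h1; apply: (@Ck_ext _ _ _ _ _ (F \o (fun q : B => (q, 1%:M : 'M[R]_n)))).
- exact: osub_open.
- by move=> q Oq /=; rewrite (h _ (Up q Oq)).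
- by apply: Ck_sub h1 => q; exact: Up.
Qed.

Lemma gDt_value F f p : pulls F f -> U p -> gDt hG uG F p = 'D_((1, 0) : B) f p.1.
Proof.
move=> h Up; rewrite /gDt (fDt_base _ _ _ (pulls_base h)) (pulls_pd _ h Up) //.
Qed.

Lemma gDt_is_derive F f p : pulls F f -> U p ->
  is_derive p.1.1 (1 : R) (fun s => f (s, p.1.2)) (gDt hG uG F p).
Proof.
move=> h Up; rewrite (gDt_value h Up).
rewrite -[fun s => _]/(f \o (fun s : R => (s, p.1.2))).
apply: (@is_derive_affine _ _ _ _ (fun s : R => (s, p.1.2)) (fun w => (w, 0) : B)).
  by move=> x w c; rewrite -[RHS]/(c *: w + x, c *: 0 + p.1.2) scaler0 add0r.
rewrite -surjective_pairing.
apply: derivableP; exact: (Ck_derivable (pulls_slice_Ck 1 h) _ Up.1).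
Qed.

(** * Derivatives at a maximum over earlier times *)

Section MaxPrinciple.
Variables (F : A) (f : B -> R) (p : P) (Up : U p).
Hypothesis hF : pulls F f.
Hypothesis orth : p.2 *m G p.1 *m p.2^T = 1%:M.
Hypothesis pmax : \forall r \near p.1, r.1 <= p.1.1 -> f r <= f p.1.

Let t := p.1.1.
Let y := p.1.2.
Let fs (x : 'rV[R]_n) := f (t, x).
Let Os : set 'rV[R]_n := [set x | O (t, x)].
Let pE : p.1 = (t, y).
Proof. exact: surjective_pairing. Qed.

Let cL : continuous (fun x : 'rV[R]_n => (t, x) : B).
Proof.
move=> x; have h1 : {for x, continuous (fun x : 'rV[R]_n => (t, x) : B)}.
  by apply: cont_pair; [exact: cst_continuous|exact: cvg_id].
exact: h1.
Qed.

Let oOs : open Os.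
Proof. by apply: open_comp => [x _|]; [exact: cL|exact: osub_open]. Qed.

Let Osy : Os y.
Proof. by rewrite /Os /= -pE; exact: Up.1. Qed.

Let Cfs k : Ck k Os fs.
Proof.
have Ll (x w : 'rV[R]_n) (c : R) : (t, c *: w + x) = c *: ((0, w) : B) + (t, x).
  by rewrite -[RHS]/(c *: 0 + t, c *: w + x) scaler0 add0r.
exact: (@Ck_affine _ _ _ _ (fun x => (t, x) : B) (fun w => (0, w) : B) cL Ll k O f (pulls_slice_Ck k hF)).
Qed.

Let smax : \forall x \near y, fs x <= fs y.
Proof.
have h : nbhs (t, y) [set r | r.1 <= t -> f r <= f (t, y)] by rewrite -pE.
by apply: filterS (nbhs_slice h) => x; apply.
Qed.

Let lmax (v : 'rV[R]_n) : \forall c \near (0 : R), fs (y + c *: v) <= fs y.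
Proof.
have c : {for (0 : R), continuous (fun c : R => y + c *: v)}.
  apply: cvgD; first exact: cvg_cst.
  by apply: cvgZ; [exact: cvg_id|exact: cvg_cst].
have h : nbhs (y + 0 *: v) [set x | fs x <= fs y] by rewrite scale0r addr0; exact: smax.
exact: (c _ h).
Qed.

Let dir0 (v : 'rV[R]_n) : 'D_v fs y = 0.
Proof.
have h0 w : 0 <= 'D_w fs y.
  apply: (left_max_derive oOs Osy (Cfs 1)).
  by apply: filterS (lmax (- w)) => c; rewrite scalerN => h _; exact: h.
apply/eqP; rewrite eq_le h0 andbT -oppr_ge0 -scaleN1r.
by rewrite -(derive_scale (-1) (Ck_derivable (Cfs 1) v Osy)).2; exact: h0.
Qed.

Lemma max_gD e : smev Up (gD hG uG e F) = 0.
Proof.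
rewrite /smev (gD_value e hF Up) big1 // => k _.
by rewrite /partial -/t -/y -/fs dir0 mulr0.
Qed.

Lemma max_gDt : 0 <= smev Up (gDt hG uG F).
Proof.
rewrite /smev (gDt_value hF Up).
apply: (left_max_derive (osub_open O) Up.1 (pulls_slice_Ck 1 hF)).
have c : {for (0 : R), continuous (fun c : R => p.1 - c *: ((1, 0) : B))}.
  apply: cvgB; first exact: cvg_cst.
  by apply: cvgZ; [exact: cvg_id|exact: cvg_cst].
have h : nbhs (p.1 - 0 *: ((1, 0) : B)) [set r | r.1 <= p.1.1 -> f r <= f p.1].
  by rewrite scale0r subr0; exact: pmax.
have h2 : nbhs (0 : R) [set s : R | (p.1 - s *: ((1, 0) : B)).1 <= p.1.1 ->
    f (p.1 - s *: ((1, 0) : B)) <= f p.1] by exact: (c _ h).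
apply: filterS h2 => s hs s0; apply: hs.
by rewrite -[leLHS]/(p.1.1 - s * 1) mulr1 gerBl ltW.
Qed.

(** In an orthonormal frame the Laplacian is the trace of the Hessian; at a critical point the
    Christoffel terms vanish, and pure second derivatives along the frame vectors remain. *)
Lemma max_lap : smev Up (frame_lap (gD hG uG) (gGi hG uG) F) <= 0.
Proof.
rewrite (ev_contract (gGi_orthonormal hG uG Up orth)) -oppr_ge0 -sumrN; apply: sumr_ge0 => e _.
rewrite oppr_ge0; suff: gD hG uG e (gD hG uG e F) p <= 0 by [].
rewrite (gDD_value e e hF Up) -/t -/y -/fs.
pose v : 'rV[R]_n := \row_k p.2 e k.
have co := coordinates_rV R n.
have D1 x : Os x -> 'D_v fs x = \sum_k v ord0 k * partial k fs x.
  by move=> Ox; exact: (C1_deriveE co v oOs (Cfs 1) Ox).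
have Cp k : Ck 1 Os (partial k fs) by exact: (Ck_D _ (Cfs 2)).
have := second_max_derive oOs Osy (Cfs 2) (dir0 v)
  (filterS (fun c (h : fs (y + c *: v) <= fs y) _ => h) (lmax v)).
have -> : 'D_v (fun x => 'D_v fs x) y = 'D_v (fun x => \sum_k v ord0 k * partial k fs x) y.
  apply: near_eq_derive; have : nbhs y Os by apply: open_nbhs_nbhs; split.
  by apply: filterS => x; exact: D1.
have -> : 'D_v (fun x => \sum_k v ord0 k * partial k fs x) y =
    \sum_l v ord0 l * \sum_k v ord0 k * partial l (partial k fs) y.
  have hk k : is_derive y v (fun x => v ord0 k * partial k fs x) (v ord0 k * 'D_v (partial k fs) y).
    apply: is_deriveZ; apply: derivableP; exact: (Ck_derivable (Cp k) v Osy).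
  have -> : (fun x => \sum_k v ord0 k * partial k fs x) = \sum_k (fun x => v ord0 k * partial k fs x).
    by apply/funext => x; rewrite fct_sumE.
  have hs : is_derive y v (\sum_k (fun x => v ord0 k * partial k fs x)) (\sum_k v ord0 k * 'D_v (partial k fs) y).
    elim/big_ind2: _ => [|x1 x2 y1 y2 h1 h2|k _]; [exact: is_derive_cst| |exact: hk].
    exact: is_deriveD.
  rewrite (@derive_val _ _ _ _ _ _ _ hs).
  have Ek k : 'D_v (partial k fs) y = \sum_l v ord0 l * partial l (partial k fs) y.
    exact: (C1_deriveE co v oOs (Cp k) Osy).
  transitivity (\sum_k \sum_l v ord0 k * (v ord0 l * partial l (partial k fs) y)).
    by apply: eq_bigr => k _; rewrite (Ek k) mulr_sumr.
  rewrite exchange_big; apply: eq_bigr => l _ /=; rewrite mulr_sumr; apply: eq_bigr => k _.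
  by rewrite mulrCA.
set H := hessian _ _ _.
have HE k l : H k l = partial k (partial l fs) y.
  rewrite /H mxE [X in _ - X]big1 ?subr0 // => m _.
  by rewrite [partial m fs y]dir0 mulr0.
suff -> : (p.2 *m H *m p.2^T) e e = \sum_l v ord0 l * \sum_k v ord0 k * partial l (partial k fs) y by exact.
rewrite mxE; transitivity (\sum_k \sum_l v ord0 l * (v ord0 k * partial l (partial k fs) y)).
  apply: eq_bigr => k _; rewrite mxE [X in _ * X]mxE mulr_suml; apply: eq_bigr => l _.
  by rewrite HE !mxE mulrAC mulrA.
rewrite exchange_big; apply: eq_bigr => l _; rewrite mulr_sumr; exact: erefl.
Qed.

End MaxPrinciple.
End Values.

Section LocalScalars.
Variables (R : realType) (n : nat).
Local Notation B := (R * 'rV[R]_n)%type.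
Variables (S : set 'rV[R]_n) (f : 'rV[R]_n -> R).
Hypothesis hf : forall k, Ck k S f.

Lemma Ck_snd k : Ck k [set q : B | S q.2] (fun q => f q.2).
Proof.
have c : continuous (@snd R 'rV[R]_n) by move=> q; exact: cvg_snd.
exact: (@Ck_affine _ _ _ _ (@snd R 'rV[R]_n) snd c (fun _ _ _ => erefl) k S f (hf k)).
Qed.

Lemma local_scalar_grad : local_scalar S (fun Gs y => grad_sq Gs f y).
Proof.
split; first by move=> G1 G2 y h; rewrite /grad_sq (nbhs_singleton h).
move=> W G hG uG sG WS q Wq.
have hW k : Ck k W (fun q : B => f q.2) by apply: Ck_sub (@Ck_snd k) => r; exact: WS.
apply: (@smooth_scalar_cont _ _ W (gradsq (gD hG uG) (gGi hG uG) (bfun hW)) _ _ _ Wq).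
exact: (gradsq_pulls hG uG (bfunE hW)).
Qed.

Lemma local_scalar_hess : local_scalar S (fun Gs y => hess_sq Gs f y).
Proof.
split.
  move=> G1 G2 y h; rewrite /hess_sq (nbhs_singleton h).
  have -> // : hessian G1 f y = hessian G2 f y.
  apply/matrixP => i j; rewrite !mxE; congr (_ - _); apply: eq_bigr => k _; congr (_ * _).
  exact: (nbhs_singleton (near_christoffel k i j h)).
move=> W G hG uG sG WS q Wq.
have hW k : Ck k W (fun q : B => f q.2) by apply: Ck_sub (@Ck_snd k) => r; exact: WS.
apply: (@smooth_scalar_cont _ _ W (hesssq (gD hG uG) (gGi hG uG) (bfun hW)) _ _ _ Wq).
exact: (hesssq_pulls hG uG (bfunE hW)).
Qed.

Lemma hessian_sym (Gs : 'rV[R]_n -> 'M[R]_n) y : open S -> S y ->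
  (forall y, S y -> (Gs y)^T = Gs y) -> (hessian Gs f y)^T = hessian Gs f y.
Proof.
move=> oS Sy sG; apply/matrixP => i j.
have nS : nbhs y S by apply: open_nbhs_nbhs; split; [exact: oS|exact: Sy].
have e1 : partial j (partial i f) y = partial i (partial j f) y.
  exact: (schwarz _ _ oS (hf 2) Sy).
have e3 l : partial l (fun y => Gs y j i) y = partial l (fun y => Gs y i j) y.
  by apply: near_eq_derive; apply: filterS nS => x /sG h; rewrite -[in LHS]h mxE.
have e2 k : christoffel Gs k j i y = christoffel Gs k i j y.
  rewrite /christoffel; congr (2^-1 * _); apply: eq_bigr => l _.
  rewrite e3 [X in X - _]addrC; exact: erefl.
rewrite [LHS]mxE [LHS]mxE [RHS]mxE e1; under eq_bigr do rewrite e2.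
exact: erefl.
Qed.

End LocalScalars.

(** Polarisation in the orthonormal frame [Y]: the bounds of the form at e_a + e_b and e_a - e_b
    bound every entry by c. *)
Lemma hess_sq_le (R : realType) (n : nat) (M H Y : 'M[R]_n) (c : R) : H^T = H ->
  Y *m M *m Y^T = 1%:M -> 
  (forall v, `|qform H v| <= c * qform M v) ->
  \tr (invmx M *m H *m (invmx M)^T *m H^T) <= n%:R ^+ 2 * c ^+ 2.
Proof.
move=> sH hY hb.
have iM : invmx M = Y^T *m Y.
  have YM : Y *m M *m Y^T = 1%:M := hY.
  have h2 : Y^T *m (Y *m M) = 1%:M by exact: mulmx1C.
  have uM : M \in unitmx.
    by have := unitmx1 R n; rewrite -h2 !unitmx_mul => /andP[_ /andP[]].
  by rewrite -[LHS]mul1mx -h2 -!mulmxA mulmxV // mulmx1.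
pose Z := Y *m H *m Y^T.
have sZ a b : Z a b = Z b a.
  have : Z^T = Z by rewrite /Z !trmx_mul trmxK sH mulmxA.
  by move=> h; rewrite -{1}h mxE.
have -> : \tr (invmx M *m H *m (invmx M)^T *m H^T) = \sum_(i : 'I_n * 'I_n) Z i.1 i.2 ^+ 2.
  rewrite iM trmx_mul trmxK -!mulmxA mxtrace_mulC -!mulmxA sH.
  rewrite [X in \tr X](_ : _ = Z *m Z^T); last by rewrite /Z !trmx_mul trmxK sH !mulmxA.
  rewrite /mxtrace; transitivity (\sum_a \sum_b Z a b ^+ 2); last by rewrite pair_bigA.
  by apply: eq_bigr => a _; rewrite mxE; apply: eq_bigr => b _; rewrite [X in _ * X]mxE.
have qE (K : 'M[R]_n) w : qform K (w *m Y) = qform (Y *m K *m Y^T) w.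
  by rewrite /qform trmx_mul !mulmxA.
pose w (s : R) (a b : 'I_n) : 'rV[R]_n := delta_mx ord0 a + s *: delta_mx ord0 b.
have qw (K : 'M[R]_n) s a b : qform K (w s a b) = K a a + s * (K a b + K b a) + s ^+ 2 * K b b.
  have ed (L : 'M[R]_n) c' d' : (delta_mx (ord0 : 'I_1) c' *m L *m (delta_mx (ord0 : 'I_1) d')^T) ord0 ord0 = L c' d'.
    by rewrite trmx_delta -rowE -colE !mxE.
  have eadd (X1 X2 : 'M[R]_1) : (X1 + X2) ord0 ord0 = X1 ord0 ord0 + X2 ord0 ord0 by rewrite mxE.
  have esc (X1 : 'M[R]_1) c' : (c' *: X1) ord0 ord0 = c' * X1 ord0 ord0 by rewrite mxE.
  rewrite /qform /w linearD linearZ /= mulmxDl -scalemxAl mulmxDr !mulmxDl.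
  by rewrite -?scalemxAl -?scalemxAr -?scalemxAl !(eadd, esc) !ed; ring.
have Zb a b : `|Z a b| <= c.
  have h1 := hb (w 1 a b *m Y); have h2 := hb (w (-1) a b *m Y).
  move: h1 h2; rewrite !qE hY -/Z !qw ![(1%:M : 'M[R]_n) _ _]mxE !eqxx (eq_sym b a) (sZ b a) sqrrN !expr1n !mul1r !mulN1r /= !mulr1n.
  rewrite !ler_norml => /andP[h1 h2] /andP[h3 h4].
  by apply/andP; split; lra.
have -> : n%:R ^+ 2 = #|{: 'I_n * 'I_n}|%:R :> R by rewrite card_prod card_ord natrM expr2.
apply: (le_trans (ler_norm _)); apply: ler_norm_sumc => i.
rewrite ger0_norm ?sqr_ge0 // -[Z _ _ ^+ 2]ger0_norm ?sqr_ge0 // normrX.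
have c0 : 0 <= c by apply: le_trans (Zb i.1 i.2).
by rewrite lerXn2r // nnegrE.
Qed.

(** The function e^(- c s) P(s) is nonincreasing. *)
Lemma exp_gronwall (R : realType) (P dP : R -> R) (c t : R) : 0 <= t ->
  {within `[0, t], continuous P} ->
  (forall s, 0 < s < t -> is_derive s 1 P (dP s) /\ dP s <= c * P s) ->
  P t <= expR (c * t) * P 0.
Proof.
move=> t0 cP hP; have hE s : is_derive s (1 : R) (fun s => expR (- c * s)) (- c * expR (- c * s)).
  have h1 : is_derive s (1 : R) (fun s => - c * s) (- c).
    by have := is_deriveZ (- c) (is_derive_id s (1 : R)); rewrite /GRing.scale /= mulr1; exact.
  by have := is_derive1_comp (is_derive_expR (- c * s)) h1; rewrite mulrC; exact.
have cE : continuous (fun s : R => expR (- c * s)).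
  by move=> s; apply/differentiable_continuous/derivable1_diffP; exact: (@ex_derive _ _ _ _ _ _ _ (hE s)).
have := @mono_off R (fun s => - (expR (- c * s) * P s))
  (fun s => - (expR (- c * s) * dP s + P s * (- c * expR (- c * s)))) [::] 0 t t0.
rewrite mulr0 expR0 mul1r lerN2 => h.
suff h' : expR (- c * t) * P t <= P 0.
  have e : P t = expR (c * t) * (expR (- c * t) * P t) by rewrite mulrA -expRD mulNr subrr expR0 mul1r.
  by rewrite e ler_pM2l ?expR_gt0.
apply: h.
  move=> s; apply: cvgN; apply: cvgM; last exact: cP.
  by apply: continuous_subspaceT.
move=> s s0 _; have [h1 h2] := hP s s0; split.
  by apply: is_deriveN; exact: is_deriveM.
have := expR_gt0 (- c * s); move: (expR _) h2 => E h2 E0; nra.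
Qed.

(* The forcing term m / sqrt s is unbounded but integrable at s = 0. *)
Lemma sqrt_gronwall (R : realType) (H dH v : R -> R) (a b m t : R) : 0 <= t -> 0 <= a -> 0 <= b ->
  {within `[0, t], continuous H} ->
  (forall s, 0 < s < t -> [/\ is_derive s 1 H (dH s), 0 <= H s,
     dH s <= 2 * a * v s * Num.sqrt (H s) + 2 * b * H s & 0 <= v s <= m / Num.sqrt s]) ->
  Num.sqrt (H t + 1) <= expR (b * t) * (Num.sqrt (H 0 + 1) + 2 * a * m * Num.sqrt t).
Proof.
move=> t0 a0 b0 cH hH.
(* The summand 1 keeps the square root differentiable where H vanishes. *)
pose f s := Num.sqrt (H s + 1).
have hE s : is_derive s (1 : R) (fun s => expR (- b * s)) (- b * expR (- b * s)).
  have h1 : is_derive s (1 : R) (fun s => - b * s) (- b).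
    by have := is_deriveZ (- b) (is_derive_id s (1 : R)); rewrite /GRing.scale /= mulr1; exact.
  by have := is_derive1_comp (is_derive_expR (- b * s)) h1; rewrite mulrC; exact.
have cE : continuous (fun s : R => expR (- b * s)).
  by move=> s; apply/differentiable_continuous/derivable1_diffP; exact: (@ex_derive _ _ _ _ _ _ _ (hE s)).
have cf : {within `[0, t], continuous f}.
  move=> s; apply: (@continuous_comp _ _ _ (fun s : subspace `[0, t] => H s + 1) Num.sqrt).
    by apply: cvgD; [exact: cH|exact: cvg_cst].
  exact: sqrt_continuous.
have := @mono_off R (fun s => 2 * a * m * Num.sqrt s - expR (- b * s) * f s)
  (fun s => 2 * a * m * (2 * Num.sqrt s)^-1 -
     (expR (- b * s) * ((2 * f s)^-1 * dH s) + f s * (- b * expR (- b * s)))) [::] 0 t t0.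
rewrite sqrtr0 !mulr0 expR0 mul1r sub0r => h.
suff h' : - f 0 <= 2 * a * m * Num.sqrt t - expR (- b * t) * f t.
  have e : f t = expR (b * t) * (expR (- b * t) * f t) by rewrite mulrA -expRD mulNr subrr expR0 mul1r.
  rewrite -/(f t) -/(f 0) e ler_pM2l ?expR_gt0 //; move: h'; move: (expR (- b * t) * f t) => E; lra.
apply: h.
  move=> s; apply: cvgB; last by apply: cvgM; [exact: continuous_subspaceT|exact: cf].
  apply: cvgM; first exact: cvg_cst.
  by apply: continuous_subspaceT => z; exact: sqrt_continuous.
move=> s s0t _; have [h1 h2 h3 /andP[v0 vm]] := hH s s0t; have s0 : 0 < s by case/andP: s0t.
have H1 : 0 < H s + 1 by rewrite ltr_wpDl.
have f1 : 1 <= f s by rewrite -[X in X <= _]sqrtr1 ler_wsqrtr // lerDr.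
have df : is_derive s (1 : R) f ((2 * f s)^-1 * dH s).
  have hp : is_derive s (1 : R) (fun s => H s + 1) (dH s).
    by have := is_deriveD h1 (is_derive_cst (1 : R) s (1 : R)); rewrite addr0; exact.
  have hs : is_derive ((fun s => H s + 1) s) (1 : R) Num.sqrt (2 * f s)^-1 by exact: is_derive1_sqrt.
  exact: (@is_derive1_comp R Num.sqrt (fun s => H s + 1) s _ _ hs hp).
split.
  apply: is_deriveB; last exact: is_deriveM.
  apply: is_deriveZ; exact: is_derive1_sqrt.
have fp : 0 < f s by exact: lt_le_trans ltr01 f1.
have Hf : H s <= f s ^+ 2 by rewrite /f (sqr_sqrtr (ltW H1)) lerDl.
have sHf : Num.sqrt (H s) <= f s by rewrite ler_wsqrtr // lerDl.
have sH0 : 0 <= Num.sqrt (H s) by exact: sqrtr_ge0.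
have key : (2 * f s)^-1 * dH s <= a * v s + b * f s.
  rewrite mulrC ler_pdivrMr ?mulr_gt0 //; apply: (le_trans h3).
  have g1 : a * v s * Num.sqrt (H s) <= a * v s * f s by rewrite ler_wpM2l // mulr_ge0.
  have g2 : b * H s <= b * f s ^+ 2 by rewrite ler_wpM2l.
  rewrite expr2 in g2; lra.
have E1 : expR (- b * s) <= 1 by rewrite -expR0 ler_expR mulNr oppr_le0 mulr_ge0 // ltW.
have E0 : 0 < expR (- b * s) by exact: expR_gt0.
have sq0 : 0 < Num.sqrt s by rewrite sqrtr_gt0.
have e1 : 2 * a * m * (2 * Num.sqrt s)^-1 = a * (m / Num.sqrt s).
  by field; rewrite gt_eqF.
rewrite e1; have g3 : a * v s <= a * (m / Num.sqrt s) by rewrite ler_wpM2l.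
have g4 : expR (- b * s) * (a * v s) <= a * v s by rewrite ler_piMl // mulr_ge0.
have g5 := ler_wpM2l (ltW E0) key.
move: g3 g4 g5; rewrite mulrDr; move: (expR _) => E; lra.
Qed.

(** * Growth of |d phi| and |Hess phi| at a fixed point of the manifold *)

Section Point.
Variables (R : realType) (n : nat) (M : smooth_manifold R n) (T : R) (g : R -> tensor2 M).
Hypothesis gf : ricci_flow T g.
Variables (i : atlas M) (f : 'rV[R]_n -> R).
Hypothesis hf : forall k, Ck k (coords i) f.
Local Notation B := (R * 'rV[R]_n)%type.
Local Notation W := (cylinder T i).
Local Notation N := (n%:R : R).

Definition fhG a b k := @flow_Ck R n M T g gf i a b k.
Definition fuG q := @flow_unit R n M T g gf i q.
Definition fsG q := @flow_sym R n M T g gf i q.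
Definition fdd := gD fhG fuG.
Definition fcalc := geom_calculus fhG fuG fsG (@flow_eq R n M T g gf i).

Lemma cyl_Ck k : Ck k W (fun q : B => f q.2).
Proof. by apply: Ck_sub (@Ck_snd _ _ _ _ hf k) => q []. Qed.

Definition phiE := bfun cyl_Ck.
Lemma phiE_pulls : pulls phiE (fun q => f q.2).
Proof. exact: bfunE. Qed.

Lemma base_E (F : smfun (frames W)) h : pulls F h -> forall d c, gE_ d c F = 0.
Proof. by move=> hF d c; exact: (fE_base _ _ _ (pulls_base hF)). Qed.

Lemma base_Dt (F : smfun (frames W)) h : pulls F h -> gDt fhG fuG F = pdf iT F.
Proof. by move=> hF; exact: (fDt_base _ _ _ (pulls_base hF)). Qed.

Lemma phiE_Dt : gDt fhG fuG phiE = 0.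
Proof.
rewrite (base_Dt phiE_pulls); apply: smfun_eq => p Up; rewrite sm0E //.
rewrite (pulls_pd _ phiE_pulls Up) -[fun q : B => f q.2]/(f \o snd).
have := @derive_affine R _ _ _ (@snd R 'rV[R]_n) snd (fun _ _ _ => erefl) f p.1 (fe R (@iT n)).1.
by rewrite /= => ->; exact: derive0.
Qed.

Section At.
Variables (t : R) (y : 'rV[R]_n).
Hypothesis tT : 0 < t < T.
Hypothesis cy : coords i y.

Lemma tT' : 0 <= t <= T. Proof. by case/andP: tT => *; rewrite !ltW. Qed.
Lemma at_cyl : W (t, y). Proof. by split. Qed.

Lemma at_frame : exists Y : 'M[R]_n, Y *m flow_mx g i (t, y) *m Y^T = 1%:M.
Proof.
have m := flow_metric gf tT'; exact: (orthonormal_frame (metric_sym m cy) (metric_pos m cy)).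
Qed.

Lemma grad_sq_derive : exists d, [/\ is_derive t 1 (fun s => grad_sq (g s i) f y) d,
  `|d| <= 2 * N ^+ 3 * Num.sqrt (rm_sq (g t i) y) * grad_sq (g t i) f y & 0 <= grad_sq (g t i) f y].
Proof.
have [Y hY] := at_frame; have Up := frame_unit at_cyl hY.
have pG := gradsq_pulls fhG fuG phiE_pulls.
exists (smev Up (gDt fhG fuG (gradsq fdd (gGi fhG fuG) phiE))).
have eG := gGi_orthonormal fhG fuG Up hY.
have vG : smev Up (gradsq fdd (gGi fhG fuG) phiE) = grad_sq (g t i) f y by exact: (pG _ Up).
have vR : smev Up (normRm (gGi fhG fuG) (gRm fhG fuG)) = rm_sq (g t i) y.
  exact: (normRm_value fhG fuG fsG Up).
split.
- have h := gDt_is_derive fhG fuG pG Up; exact: h.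
- rewrite -vR -vG; exact: (ev_Dt_gradsq_le fcalc (base_E phiE_pulls) phiE_Dt eG).
- by rewrite -vG; exact: (ev_gradsq_ge0 _ _ eG).
Qed.

Lemma hess_sq_derive : exists d, [/\ is_derive t 1 (fun s => hess_sq (g s i) f y) d,
  `|d| <= 6 * N ^+ 4 * (Num.sqrt (drm_sq (g t i) y) * Num.sqrt (grad_sq (g t i) f y)
      * Num.sqrt (hess_sq (g t i) f y)) + 4 * N ^+ 4 * Num.sqrt (rm_sq (g t i) y) * hess_sq (g t i) f y
  & 0 <= hess_sq (g t i) f y].
Proof.
have [Y hY] := at_frame; have Up := frame_unit at_cyl hY.
have pG := gradsq_pulls fhG fuG phiE_pulls; have pH := hesssq_pulls fhG fuG phiE_pulls.
exists (smev Up (gDt fhG fuG (hesssq fdd (gGi fhG fuG) phiE))).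
have eG := gGi_orthonormal fhG fuG Up hY.
have vG : smev Up (gradsq fdd (gGi fhG fuG) phiE) = grad_sq (g t i) f y by exact: (pG _ Up).
have vH : smev Up (hesssq fdd (gGi fhG fuG) phiE) = hess_sq (g t i) f y by exact: (pH _ Up).
have vR : smev Up (normRm (gGi fhG fuG) (gRm fhG fuG)) = rm_sq (g t i) y.
  exact: (normRm_value fhG fuG fsG Up).
have vD : smev Up (normDRm fdd (gGi fhG fuG) (gRm fhG fuG)) = drm_sq (g t i) y.
  exact: (normDRm_value fhG fuG Up).
split.
- have h := gDt_is_derive fhG fuG pH Up; exact: h.
- rewrite -vR -vG -vH -vD; exact: (ev_Dt_hesssq_le fcalc (base_E phiE_pulls) phiE_Dt eG).
- by rewrite -vH; exact: (ev_hesssq_ge0 _ _ eG).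
Qed.

Lemma rm_drm_ge0 : 0 <= rm_sq (g t i) y /\ 0 <= drm_sq (g t i) y.
Proof.
have [Y hY] := at_frame; have Up := frame_unit at_cyl hY.
have eG := gGi_orthonormal fhG fuG Up hY; split.
  by have := ev_normRm_ge0 (gRm fhG fuG) eG; rewrite -(normRm_value fhG fuG fsG Up).
by have := ev_normDRm_ge0 fdd (gRm fhG fuG) eG; rewrite -(normDRm_value fhG fuG Up).
Qed.

End At.

Lemma time_cont Q y t : local_scalar (coords i) Q -> coords i y -> 0 <= t <= T ->
  {within `[0, t], continuous (fun s => Q (g s i) y)}.
Proof.
move=> hQ cy /andP[t0 tT]; apply/subspace_continuousP => s; rewrite /= in_itv /= => /andP[s0 st].
have sT : 0 <= s <= T by rewrite s0 (le_trans st).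
move=> P hP; have h := local_scalar_cont gf hQ sT cy hP.
have h' : nbhs ((s, y) : B) [set q : B | (`[0, T]%classic `*` setT) q -> P (Q (g q.1 i) q.2)] by exact: h.
have c : {for s, continuous (fun s : R => (s, y) : B)}.
  by apply: cont_pair; [exact: cvg_id|exact: cst_continuous].
have h2 : nbhs s [set s | (`[0, T]%classic `*` setT) ((s, y) : B) -> P (Q (g s i) y)] by exact: (c _ h').
apply: filterS h2 => z hz; rewrite /= in_itv /= => /andP[z0 zt]; apply: hz.
by split=> //=; rewrite in_itv /= z0 (le_trans zt).
Qed.

Lemma grad_sq_bound y t k : coords i y -> 0 <= t < T ->
  (forall s, 0 <= s <= T -> Num.sqrt (rm_sq (g s i) y) <= k) ->
  grad_sq (g t i) f y <= expR (2 * N ^+ 3 * k * t) * grad_sq (g 0 i) f y.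
Proof.
move=> cy /andP[t0 tT] hk.
have hs s : 0 < s < t -> exists d, is_derive s 1 (fun s => grad_sq (g s i) f y) d /\
    d <= 2 * N ^+ 3 * k * grad_sq (g s i) f y.
  move=> /andP[s0 st]; have sT : 0 < s < T by rewrite s0 (lt_trans st).
  have sT' : 0 <= s <= T by rewrite ltW // ltW // (lt_trans st).
  have [d [h1 h2 h3]] := grad_sq_derive sT cy; exists d; split=> //.
  apply: (le_trans (ler_norm _)); apply: (le_trans h2); apply: ler_wpM2r => //.
  by apply: ler_wpM2l; [rewrite mulr_ge0 // exprn_ge0|exact: hk].
have /boolp.choice[dP hdP] : forall s, exists d, 0 < s < t ->
    is_derive s 1 (fun s => grad_sq (g s i) f y) d /\ d <= 2 * N ^+ 3 * k * grad_sq (g s i) f y.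
  move=> s; have [h|h] := boolP (0 < s < t); last by exists 0.
  by have [d hd] := hs s h; exists d.
apply: (@exp_gronwall R (fun s => grad_sq (g s i) f y) dP _ t t0) => //.
by apply: (time_cont (local_scalar_grad hf) cy); rewrite t0 ltW.
Qed.

(** An ordinary differential inequality in time at the fixed point y: only the values of |D Rm| at y
    before time t enter, which is what allows its use at the maximum in Shi's estimate. *)
Lemma hess_sq_bound y t k p m : coords i y -> 0 <= t < T -> 0 <= k -> 0 <= p ->
  (forall s, 0 <= s <= T -> Num.sqrt (rm_sq (g s i) y) <= k) ->
  (forall s, 0 < s < t -> Num.sqrt (grad_sq (g s i) f y) <= p) ->
  (forall s, 0 < s < t -> Num.sqrt (drm_sq (g s i) y) <= m / Num.sqrt s) ->
  Num.sqrt (hess_sq (g t i) f y + 1) <= expR (2 * N ^+ 4 * k * t) *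
    (Num.sqrt (hess_sq (g 0 i) f y + 1) + 2 * (3 * N ^+ 4 * p) * m * Num.sqrt t).
Proof.
move=> cy /andP[t0 tT] k0 p0 hk hp hv.
have N4 : 0 <= N ^+ 4 by rewrite exprn_ge0.
have hs s : 0 < s < t -> exists d, [/\ is_derive s 1 (fun s => hess_sq (g s i) f y) d,
    0 <= hess_sq (g s i) f y &
    d <= 2 * (3 * N ^+ 4 * p) * Num.sqrt (drm_sq (g s i) y) * Num.sqrt (hess_sq (g s i) f y)
      + 2 * (2 * N ^+ 4 * k) * hess_sq (g s i) f y].
  move=> st; have /andP[s0 s1] := st; have sT : 0 < s < T by rewrite s0 (lt_trans s1).
  have sT' : 0 <= s <= T by rewrite ltW // ltW // (lt_trans s1).
  have [d [h1 h2 h3]] := hess_sq_derive sT cy; exists d; split=> //.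
  apply: (le_trans (ler_norm _)); apply: (le_trans h2).
  have hP := hp s st; have hR := hk s sT'.
  have v0 := sqrtr_ge0 (drm_sq (g s i) y); have H0 := sqrtr_ge0 (hess_sq (g s i) f y).
  have g1 : Num.sqrt (drm_sq (g s i) y) * Num.sqrt (grad_sq (g s i) f y) * Num.sqrt (hess_sq (g s i) f y)
     <= Num.sqrt (drm_sq (g s i) y) * p * Num.sqrt (hess_sq (g s i) f y).
    by rewrite ler_wpM2r // ler_wpM2l.
  have g2 := ler_wpM2l N4 g1.
  have g3 : Num.sqrt (rm_sq (g s i) y) * hess_sq (g s i) f y <= k * hess_sq (g s i) f y by rewrite ler_wpM2r.
  have g4 := ler_wpM2l N4 g3.
  move: g2 g4; move: (Num.sqrt (drm_sq _ _)) (Num.sqrt (grad_sq _ _ _)) (Num.sqrt (hess_sq _ _ _)).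
  move: (Num.sqrt (rm_sq _ _)) (hess_sq (g s i) f y) (N ^+ 4) => a1 a2 a3 a4 a5 a6; lra.
have /boolp.choice[dH hdH] : forall s, exists d, 0 < s < t ->
    [/\ is_derive s 1 (fun s => hess_sq (g s i) f y) d, 0 <= hess_sq (g s i) f y &
    d <= 2 * (3 * N ^+ 4 * p) * Num.sqrt (drm_sq (g s i) y) * Num.sqrt (hess_sq (g s i) f y)
      + 2 * (2 * N ^+ 4 * k) * hess_sq (g s i) f y].
  move=> s; have [h|h] := boolP (0 < s < t); last by exists 0.
  by have [d hd] := hs s h; exists d.
apply: (@sqrt_gronwall R (fun s => hess_sq (g s i) f y) dH (fun s => Num.sqrt (drm_sq (g s i) y))
  (3 * N ^+ 4 * p) (2 * N ^+ 4 * k) m t t0).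
- by rewrite !mulr_ge0.
- by rewrite !mulr_ge0.
- by apply: (time_cont (local_scalar_hess hf) cy); rewrite t0 ltW.
move=> s st; have [h1 h2 h3] := hdH s st; split=> //.
by rewrite sqrtr_ge0 hv.
Qed.

End Point.

(** * The inequalities at a maximum, for the flow in a chart *)

Section Elements.
Variables (R : realType) (n : nat) (M : smooth_manifold R n) (T : R) (g : R -> tensor2 M).
Hypothesis gf : ricci_flow T g.
Variables (i : atlas M) (f : 'rV[R]_n -> R).
Hypothesis hf : forall k, Ck k (coords i) f.
Local Notation B := (R * 'rV[R]_n)%type.
Local Notation W := (cylinder T i).
Local Notation A := (smfun (frames W)).
Local Notation N := (n%:R : R).
Local Notation hG := (fhG gf i).
Local Notation uG := (@fuG _ _ _ _ _ gf i).
Local Notation D := (gD hG uG).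
Local Notation Dt := (gDt hG uG).
Local Notation Gi := (gGi hG uG).
Local Notation Rm := (gRm hG uG).
Local Notation Lap := (frame_lap D Gi).
Local Notation phiE := (phiE T hf).
Local Notation fc := (fcalc gf i).

Definition el_cst (c : R) : A := smcst (frames W) c.

Lemma vf_zero v (F : A) : (forall j, pdf j F = 0) -> vf (@pdf R n W) v F = 0.
Proof. by move=> h; rewrite /vf big1 // => j _; rewrite h mulr0. Qed.

Lemma el_cst_D c e : D e (el_cst c) = 0.
Proof. by apply: vf_zero => j; exact: smD_cst. Qed.
Lemma el_cst_Dt c : Dt (el_cst c) = 0.
Proof. by apply: vf_zero => j; exact: smD_cst. Qed.

Definition el_t : A := zf W iT.
Lemma el_t_D e : D e el_t = 0.
Proof. by rewrite /gD /fD /el_t (vf_z (@geom_pd_z R n W)). Qed.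
Lemma el_t_Dt : Dt el_t = 1.
Proof. by rewrite /gDt /fDt /el_t (vf_z (@geom_pd_z R n W)). Qed.

Definition NRe := normRm Gi Rm.
Definition NDe := normDRm D Gi Rm.

Lemma NRe_pulls : pulls NRe (fun q => rm_sq (g q.1 i) q.2).
Proof. by move=> p Up; exact: (normRm_value hG uG (@fsG _ _ _ _ _ gf i) Up). Qed.
Lemma NDe_pulls : pulls NDe (fun q => drm_sq (g q.1 i) q.2).
Proof. by move=> p Up; exact: (normDRm_value hG uG Up). Qed.

Lemma pullsM (F1 F2 : A) f1 f2 : pulls F1 f1 -> pulls F2 f2 -> pulls (F1 * F2) (fun q => f1 q * f2 q).
Proof. by move=> h1 h2 p Up; rewrite smME // h1 // h2. Qed.
Lemma pullsD (F1 F2 : A) f1 f2 : pulls F1 f1 -> pulls F2 f2 -> pulls (F1 + F2) (fun q => f1 q + f2 q).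
Proof. by move=> h1 h2 p Up; rewrite smDDE // h1 // h2. Qed.
Lemma pullsN (F1 : A) f1 : pulls F1 f1 -> pulls (- F1) (fun q => - f1 q).
Proof. by move=> h1 p Up; rewrite smNE // h1. Qed.
Lemma pulls_cst c : pulls (el_cst c) (fun _ => c).
Proof. by move=> p Up; exact: smcstE. Qed.
Lemma pulls_one : pulls (1 : A) (fun _ => 1).
Proof. by move=> p Up; exact: sm1E. Qed.
Lemma pulls_t : pulls el_t (fun q => q.1).
Proof. by move=> p Up; rewrite zfE. Qed.

Section AtMax.
Variables (t : R) (y : 'rV[R]_n).
Hypothesis tT : 0 < t < T.
Hypothesis cy : coords i y.
Variables (F : A) (h : B -> R).
Hypothesis hF : pulls F h.
Hypothesis hmax : \forall r \near ((t, y) : B), r.1 <= t -> h r <= h (t, y).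

(** The conditions under which the algebraic inequalities were stated, gathered at an orthonormal
    frame over the maximum point. *)
Lemma at_max : exists (p : R * 'rV[R]_n * 'M[R]_n) (Up : frames W p),
  [/\ p.1 = (t, y), forall a b, smev Up (Gi a b) = (a == b)%:R, 0 <= smev Up (Dt F),
      forall e, smev Up (D e F) = 0 & smev Up (Lap F) <= 0].
Proof.
have [Y hY] := at_frame gf tT cy; have Up := frame_unit (at_cyl tT cy) hY.
exists ((t, y), Y), Up; split=> //.
- exact: (gGi_orthonormal hG uG Up hY).
- exact: (max_gDt hG uG Up hF hmax).
- exact: (max_gD hG uG Up hF hmax).
- exact: (max_lap hG uG Up hF hY hmax).
Qed.

End AtMax.

Lemma shi_point t y k a0 c : 0 < t < T -> coords i y ->
  Num.sqrt (rm_sq (g t i) y) <= k -> 8 * N ^+ 20 * k ^+ 2 <= a0 -> 0 < a0 -> 0 <= c ->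
  0 <= 1 - c * f y <= 1 ->
  let h (q : B) := q.1 * ((1 - c * f q.2) * (1 - c * f q.2)) *
     ((a0 + rm_sq (g q.1 i) q.2) * drm_sq (g q.1 i) q.2) in
  let e := 1 - c * f y in let S := drm_sq (g t i) y in
  (\forall r \near ((t, y) : B), r.1 <= t -> h r <= h (t, y)) ->
  (t * e ^+ 2 * S) ^+ 2 <=
    (20 * N ^+ 6 * k ^+ 3 + (a0 + k ^+ 2) * (84 * N ^+ 7 * k)) * T * (t * e ^+ 2 * S)
    + h (t, y) * (1 + 2 * T * N * c * (e * Num.sqrt (hess_sq (g t i) f y))
                  + 8 * T * c ^+ 2 * grad_sq (g t i) f y).
Proof.
move=> tT cy hk ha a0p c0 hc h e S hmax.
pose q := el_t * ((1 - el_cst c * phiE) * (1 - el_cst c * phiE)) * ((el_cst a0 + NRe) * NDe).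
have pq : pulls q h.
  have pe : pulls (1 - el_cst c * phiE) (fun q => 1 - c * f q.2).
    apply: pullsD; first exact: pulls_one.
    by apply: pullsN; apply: pullsM; [exact: pulls_cst|exact: phiE_pulls].
  apply: pullsM; first by apply: pullsM; [exact: pulls_t|apply: pullsM].
  by apply: pullsM; [apply: pullsD; [exact: pulls_cst|exact: NRe_pulls]|exact: NDe_pulls].
have [p [Up [ep eG m1 m2 m3]]] := at_max tT cy pq hmax.
have vt : smev Up el_t = t by rewrite /smev (pulls_t Up) ep.
have vc : smev Up (el_cst c) = c by rewrite /smev (pulls_cst c Up).
have va : smev Up (el_cst a0) = a0 by rewrite /smev (pulls_cst a0 Up).
have vf : smev Up phiE = f y by rewrite /smev (phiE_pulls hf Up) ep.
have vR : smev Up NRe = rm_sq (g t i) y by rewrite /smev (NRe_pulls Up) ep.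
have vD : smev Up NDe = S by rewrite /smev (NDe_pulls Up) ep.
have vq : smev Up q = h (t, y) by rewrite /smev (pq _ Up) ep.
have vP : smev Up (gradsq D Gi phiE) = grad_sq (g t i) f y.
  by rewrite /smev (gradsq_pulls hG uG (phiE_pulls hf) Up) ep.
have vH : smev Up (hesssq D Gi phiE) = hess_sq (g t i) f y.
  by rewrite /smev (hesssq_pulls hG uG (phiE_pulls hf) Up) ep.
have tT2 : 0 <= t <= T by case/andP: tT => *; rewrite !ltW.
have uk : Num.sqrt (smev Up NRe) <= k by rewrite vR.
have hx : 8 * N ^+ 20 * k ^+ 2 <= smev Up (el_cst a0) by rewrite va.
have hx2 : 0 < smev Up (el_cst a0) by rewrite va.
have hx3 : 0 <= smev Up el_t <= T by rewrite vt.
have hx4 : 0 <= smev Up (el_cst c) by rewrite vc.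
have hx5 : 0 <= 1 - smev Up (el_cst c) * smev Up phiE <= 1 by rewrite vc vf.
have := @shi_max _ _ _ _ _ _ _ _ _ fc _ _ eG phiE k (phiE_Dt gf hf) uk el_t (el_cst c) (el_cst a0) T
  el_t_D el_t_Dt (el_cst_D c) (el_cst_Dt c) (el_cst_D a0) (el_cst_Dt a0) hx hx2 hx3 hx4 hx5 m1 m2 m3.
rewrite -/NRe -/NDe -/q.
change (GRing.RMorphism.sort _) with (smev Up).
by rewrite vt vc va vf vD vP vH vq.
Qed.

Lemma el_exp (l : R) : exists X : A, [/\ pulls X (fun q => expR (l * q.1)),
  forall e, D e X = 0 & Dt X = el_cst l * X].
Proof.
pose h (q : B) := l * q.1.
have hl (x w : B) (c : R) : h (c *: w + x) = c * h w + h x.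
  by rewrite /h -[(c *: w + x).1]/(c * w.1 + x.1); ring.
have hc : continuous h by move=> q; apply: cvgM; [exact: cvg_cst|exact: cvg_fst].
have hk k : Ck k W h by exact: (Ck_lin hc hl).
have hX k : Ck k W (fun q => expR (h q)) by apply: Ck_expR => //; exact: osub_open.
have pX : pulls (bfun hX) (fun q => expR (h q)) by exact: bfunE.
have pdX j : pdf j (bfun hX) = el_cst (h (fe R j).1) * bfun hX.
  apply: smfun_eq => p Up; rewrite (pulls_pd _ pX Up) smME // smcstE // (pX _ Up).
  have dh : derivable h p.1 (fe R j).1 by exact: (Ck_derivable (hk 1) _ Up.1).
  have hd := is_derive_comp_dir (is_derive_expR (h p.1)) dh.
  rewrite -[fun q : B => expR (h q)]/(expR \o h) (@derive_val _ _ _ _ _ _ _ hd).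
  by rewrite (derive_lin hl) mulrC.
exists (bfun hX); split; first exact: pX.
  move=> e; rewrite /gD (fD_base _ _ _ (pulls_base pX)) /fL big1 // => k _.
  by rewrite pdX /h /= mulr0 -[el_cst 0]/(0 : A) mul0r mulr0.
by rewrite (base_Dt gf pX) pdX /h /= mulr1.
Qed.

Hypothesis fpos : forall y, coords i y -> 0 < f y.

(** Division is not an operation of the ring [A]: the derivative of the power is expressed with an
    explicit inverse [kap] of the function, as [power_weight] expects. *)
Lemma el_power (b : R) : exists V kap : A, [/\ pulls V (fun q => f q.2 `^ b),
  pulls kap (fun q => (f q.2)^-1), kap * phiE = 1, Dt V = 0 &
  forall e, D e V = el_cst b * (V * (kap * D e phiE))].
Proof.
have f0 (q : B) : W q -> 0 < f q.2 by case=> _; exact: fpos.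
have hV k : Ck k W (fun q : B => f q.2 `^ b).
  by apply: Ck_powR => //; [exact: osub_open|move=> m; exact: (cyl_Ck T hf)].
have hkap k : Ck k W (fun q : B => (f q.2)^-1).
  apply: CkV; [exact: osub_open|by move=> q /f0 h; rewrite gt_eqF|exact: (cyl_Ck T hf)].
have pV : pulls (bfun hV) (fun q => f q.2 `^ b) by exact: bfunE.
have pk : pulls (bfun hkap) (fun q => (f q.2)^-1) by exact: bfunE.
have pdV j : pdf j (bfun hV) = el_cst b * (bfun hV * (bfun hkap * pdf j phiE)).
  apply: smfun_eq => p Up; have fp := f0 _ Up.1.
  rewrite (pulls_pd _ pV Up) smME // smcstE // smME // (pV _ Up) smME // (pk _ Up).
  rewrite (pulls_pd _ (phiE_pulls hf) Up).
  have dh : derivable (fun q : B => f q.2) p.1 (fe R j).1.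
    exact: (Ck_derivable (cyl_Ck T hf 1) _ Up.1).
  have hd := is_derive_comp_dir (is_derive1_powR b fp) dh.
  rewrite -[fun q : B => f q.2 `^ b]/((fun x : R => x `^ b) \o (fun q : B => f q.2)).
  rewrite (@derive_val _ _ _ _ _ _ _ hd) powRB; last by apply/implyP => _; rewrite gt_eqF.
  by rewrite powRr1 ?ltW // !mulrA.
exists (bfun hV), (bfun hkap); split=> //.
- apply: smfun_eq => p Up; rewrite smME // (pk _ Up) (phiE_pulls hf Up) sm1E //.
  by rewrite mulVf // gt_eqF // f0 //; exact: Up.1.
- rewrite (base_Dt gf pV) pdV -(base_Dt gf (phiE_pulls hf)) (phiE_Dt gf hf).
  by rewrite !mulr0.
- move=> e; rewrite /gD /fD /vf !mulr_sumr; apply: eq_bigr => j _.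
  by rewrite pdV; ring.
Qed.

Lemma Lap_zero X : (forall e, D e X = 0) -> Lap X = 0.
Proof.
move=> h; rewrite /frame_lap big1 // => e _; rewrite big1 // => k _.
by rewrite h (der0 (fc_D fc e)) mulr0.
Qed.

Lemma Lap_sub X Y : Lap (X - Y) = Lap X - Lap Y.
Proof.
rewrite /frame_lap -sumrB; apply: eq_bigr => e _; rewrite -sumrB; apply: eq_bigr => k _.
by rewrite (derB (fc_D fc k)) (derB (fc_D fc e)) mulrBr.
Qed.

(** The weighted curvature is a subsolution for the reaction rate [C1], and the rate
    [C1 + Q (a + 1)] makes the barrier a supersolution. If F were positive at the maximum, the
    factor with exponent - (C1 + 1) t would make the heat operator of [h] negative there, whereas at
    a maximum over earlier times it is nonnegative. *)
Lemma decay_point t y k a p hh eps : 0 < t < T -> coords i y ->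
  Num.sqrt (rm_sq (g t i) y) <= k -> 0 <= a -> 0 <= eps ->
  (f y)^-1 * Num.sqrt (grad_sq (g t i) f y) <= p ->
  (f y)^-1 * Num.sqrt (hess_sq (g t i) f y) <= hh ->
  let Q b := b * (b + 1) * p ^+ 2 + b * (N * hh) in
  let C1 := 20 * N ^+ 6 * k + Q a + 2 * N ^+ 10 * a ^+ 2 * p ^+ 2 in
  let F (q : B) := f q.2 `^ a * rm_sq (g q.1 i) q.2
     - eps * (expR ((C1 + Q (a + 1)) * q.1) * f q.2 `^ (a + 1)) in
  let h (q : B) := expR (- (C1 + 1) * q.1) * F q in
  (\forall r \near ((t, y) : B), r.1 <= t -> h r <= h (t, y)) -> F (t, y) <= 0.
Proof.
move=> tT cy hk a0 eps0 hp hhh Q C1 F h hmax; rewrite leNgt; apply/negP => F0.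
have [X [pX DX DtX]] := el_exp (- (C1 + 1)).
have [Y [pY DY DtY]] := el_exp (C1 + Q (a + 1)).
have [Wa [kap [pWa pk kF DtWa DWa]]] := el_power a.
have [Wb [kap' [pWb pk' kF' DtWb DWb]]] := el_power (a + 1).
pose Fe := Wa * NRe - el_cst eps * (Y * Wb).
have pF : pulls Fe F.
  apply: pullsD; first by apply: pullsM; [exact: pWa|exact: NRe_pulls].
  by apply: pullsN; apply: pullsM; [exact: pulls_cst|apply: pullsM].
have pq : pulls (X * Fe) h by apply: pullsM.
have [p0 [Up [ep eG m1 m2 m3]]] := at_max tT cy pq hmax.
have fy := fpos cy.
have vX : smev Up X = expR (- (C1 + 1) * t) by rewrite /smev (pX _ Up) ep.
have vY : smev Up Y = expR ((C1 + Q (a + 1)) * t) by rewrite /smev (pY _ Up) ep.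
have vWa : smev Up Wa = f y `^ a by rewrite /smev (pWa _ Up) ep.
have vWb : smev Up Wb = f y `^ (a + 1) by rewrite /smev (pWb _ Up) ep.
have vk : smev Up kap = (f y)^-1 by rewrite /smev (pk _ Up) ep.
have vk' : smev Up kap' = (f y)^-1 by rewrite /smev (pk' _ Up) ep.
have vF : smev Up Fe = F (t, y) by rewrite /smev (pF _ Up) ep.
have vR : smev Up NRe = rm_sq (g t i) y by rewrite /smev (NRe_pulls Up) ep.
have ve c : smev Up (el_cst c) = c by rewrite /smev (pulls_cst c Up).
have vP : smev Up (gradsq D Gi phiE) = grad_sq (g t i) f y.
  by rewrite /smev (gradsq_pulls hG uG (phiE_pulls hf) Up) ep.
have vH : smev Up (hesssq D Gi phiE) = hess_sq (g t i) f y.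
  by rewrite /smev (hesssq_pulls hG uG (phiE_pulls hf) Up) ep.
have uk : Num.sqrt (smev Up NRe) <= k by rewrite vR.
have fi : 0 <= (f y)^-1 by rewrite invr_ge0 ltW.
have ha1 : 0 <= smev Up Wa by rewrite vWa powR_ge0.
have ha2 : 0 <= smev Up (el_cst a) by rewrite ve.
have ha3 : 0 <= smev Up kap by rewrite vk.
have ha4 : smev Up kap * Num.sqrt (smev Up (gradsq D Gi phiE)) <= p by rewrite vk vP.
have ha5 : smev Up kap * Num.sqrt (smev Up (hesssq D Gi phiE)) <= hh by rewrite vk vH.
have hb1 : 0 <= smev Up Wb by rewrite vWb powR_ge0.
have hb2 : 0 <= smev Up (el_cst (a + 1)) by rewrite ve addr_ge0.
have hb3 : 0 <= smev Up kap' by rewrite vk'.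
have hb4 : smev Up kap' * Num.sqrt (smev Up (gradsq D Gi phiE)) <= p by rewrite vk' vP.
have hb5 : smev Up kap' * Num.sqrt (smev Up (hesssq D Gi phiE)) <= hh by rewrite vk' vH.
have [_ d1] := @decay_heat _ _ _ _ _ _ _ _ _ fc _ _ eG phiE k uk (el_cst a) Wa kap 0 p hh
  (el_cst_D a) kF DtWa DWa ha1 ha2 ha3 ha4 ha5.
have [d2 _] := @decay_heat _ _ _ _ _ _ _ _ _ fc _ _ eG phiE k uk (el_cst (a + 1)) Wb kap' 0 p hh
  (el_cst_D (a + 1)) kF' DtWb DWb hb1 hb2 hb3 hb4 hb5.
have {}d1 : smev Up (Dt (Wa * NRe) - Lap (Wa * NRe)) <= C1 * (f y `^ a * rm_sq (g t i) y).
  have : smev Up (Dt (Wa * NRe) - Lap (Wa * NRe)) <=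
    (20 * N ^+ 6 * k + (smev Up (el_cst a) * (smev Up (el_cst a) + 1) * p ^+ 2 + smev Up (el_cst a) * (N * hh))
     + 2 * N ^+ 10 * smev Up (el_cst a) ^+ 2 * p ^+ 2) * (smev Up Wa * smev Up NRe) by exact: d1.
  by rewrite ve vWa vR.
have {}d2 : `|smev Up (Lap Wb)| <= f y `^ (a + 1) * Q (a + 1).
  have : `|smev Up (Lap Wb)| <= smev Up Wb * (smev Up (el_cst (a + 1)) * (smev Up (el_cst (a + 1)) + 1) * p ^+ 2
     + smev Up (el_cst (a + 1)) * (N * hh)) by exact: d2.
  by rewrite ve vWb.
have hM x z : smev Up (Dt (x * z) - Lap (x * z)) = smev Up x * smev Up (Dt z - Lap z)
    + smev Up z * smev Up (Dt x - Lap x) - 2 * \sum_e smev Up (D e x) * smev Up (D e z).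
  exact: (ev_heatM fc eG).
have hM0 x z : (forall e, D e x = 0) -> smev Up (Dt (x * z) - Lap (x * z)) =
    smev Up x * smev Up (Dt z - Lap z) + smev Up z * smev Up (Dt x).
  move=> Dx; rewrite hM (Lap_zero Dx) subr0 big1 ?mulr0 ?subr0 // => e _.
  by rewrite Dx (rmorph0 (smev Up)) mul0r.
have evM x z : smev Up (x * z) = smev Up x * smev Up z by exact: (rmorphM (smev Up)).
have evB x z : smev Up (x - z) = smev Up x - smev Up z by exact: (rmorphB (smev Up)).
have hq : 0 <= smev Up (Dt (X * Fe) - Lap (X * Fe)) by rewrite evB subr_ge0 (le_trans m3).
have hF : smev Up (Dt Fe - Lap Fe) <= C1 * F (t, y).
  have -> : Dt Fe - Lap Fe = (Dt (Wa * NRe) - Lap (Wa * NRe)) -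
     (Dt (el_cst eps * (Y * Wb)) - Lap (el_cst eps * (Y * Wb))).
    by rewrite /Fe (derB (fc_Dt fc)) Lap_sub; ring.
  rewrite evB (hM0 _ _ (el_cst_D eps)) el_cst_Dt (rmorph0 (smev Up)) mulr0 addr0 ve.
  rewrite (hM0 _ _ DY) DtWb sub0r (rmorphN (smev Up)) /= DtY evM ve vY vWb.
  have Y0 := expR_gt0 ((C1 + Q (a + 1)) * t); have Wb0 := powR_ge0 (f y) (a + 1).
  have FE : F (t, y) = f y `^ a * rm_sq (g t i) y
     - eps * (expR ((C1 + Q (a + 1)) * t) * f y `^ (a + 1)) by [].
  have gen (E V Z q1 c1 s1 s2 : R) : s1 <= c1 * Z -> `|s2| <= V * q1 -> 0 < E -> 0 <= V ->
      s1 - eps * (E * - s2 + V * ((c1 + q1) * E)) <= c1 * (Z - eps * (E * V)).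
    move=> e1 e2 E0 V0; have e3 : s2 <= V * q1 by apply: le_trans e2; exact: ler_norm.
    have e4 : eps * E * s2 <= eps * E * (V * q1) by rewrite ler_wpM2l // mulr_ge0 // ltW.
    nra.
  by rewrite FE; exact: gen.
have := hq; rewrite (hM0 _ _ DX) DtX evM ve vX vF.
have X0 := expR_gt0 (- (C1 + 1) * t).
have gen (s1 E Z c1 : R) : s1 <= c1 * Z -> 0 < E -> 0 < Z -> 0 <= E * s1 + Z * (- (c1 + 1) * E) -> False.
  move=> h1 h2 h3 h4; have h5 : E * s1 <= E * (c1 * Z) by rewrite ler_wpM2l // ltW.
  have h6 : 0 < E * Z by rewrite mulr_gt0.
  lra.
exact: gen hF X0 F0.
Qed.

End Elements.

(** * Curvature decay *)

Ltac nonneg := repeat first [assumption | exact: sqrtr_ge0 | exact: expR_ge0 | exact: sqr_ge0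
  | exact: ler0n | exact: ler01 | apply: mulr_ge0 | apply: addr_ge0 | apply: exprn_ge0].

Lemma le_of_sqrt (R : realType) (a c : R) : Num.sqrt a <= c -> a <= c ^+ 2.
Proof.
move=> h; have [a0|a0] := leP 0 a; last by apply: (le_trans (ltW a0)); exact: sqr_ge0.
by rewrite -[a](sqr_sqrtr a0) lerXn2r // nnegrE ?sqrtr_ge0 // (le_trans (sqrtr_ge0 a)).
Qed.

Lemma le_sqrtP (R : realType) (a c : R) : 0 <= c -> a <= c ^+ 2 -> Num.sqrt a <= c.
Proof. by move=> c0 h; rewrite -[c]ger0_norm // -sqrtr_sqr ler_wsqrtr. Qed.

(** The inequality be sqrt M <= M / 2 + be^2 / 2; it closes the feedback in Shi's estimate. *)
Lemma self_bound (R : realType) (M al be : R) : 0 <= M -> M <= al + be * Num.sqrt M ->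
  M <= 2 * al + be ^+ 2.
Proof.
move=> M0 h; have := sqr_ge0 (Num.sqrt M - be); have := sqr_sqrtr M0.
move: (Num.sqrt M) h => s h e; rewrite sqrrB !expr2 in e *; nra.
Qed.

Lemma cvg_within_sub (T U : topologicalType) (A A' : set T) (f : T -> U) (x : T) (l : U) : A' `<=` A ->
  f @ within A (nbhs x) --> l -> f @ within A' (nbhs x) --> l.
Proof.
move=> s h P hP; have h' : nbhs x [set z | A z -> P (f z)] by exact: (h P hP).
suff: nbhs x [set z | A' z -> P (f z)] by [].
by apply: filterS h' => z hz /s; exact: hz.
Qed.

(** * Shi's estimate with phi as cut-off *)

Section Main.
Variables (R : realType) (n : nat) (X : smooth_manifold R n) (T : R) (g : R -> tensor2 X).
Variables (K : R) (phi : X -> R) (C c2 : R).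
Hypothesis T0 : 0 < T.
Hypothesis gf : ricci_flow T g.
Hypothesis K0 : 0 <= K.
Hypothesis hK : forall (t : R) (x : X), 0 <= t <= T -> Rm_norm (g t) x <= K.
Hypothesis sphi : smooth_fun phi.
Hypothesis C0 : 0 < C.
Hypothesis phiC : forall x, C^-1 <= phi x.
Hypothesis dphi : forall x, d_norm (g 0) phi x <= C.
Hypothesis c20 : 0 <= c2.
Hypothesis hess2 : forall x v,
  `|qform (hess_at (g 0) phi x) v| <= c2 * phi x * qform (metric_at (g 0) x) v.
Hypothesis cpt : forall r, compact [set x | phi x <= r].
Implicit Types (x z : X) (t s r : R).
Local Notation N := (n%:R : R).
Local Notation B := (R * 'rV[R]_n)%type.
Local Notation ch x := (chart (chart_at x) x).
Local Notation ph x := (phi \o param (chart_at x)).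
Local Notation gg t x := (g t (chart_at x)).

Lemma phi_gt0 x : 0 < phi x.
Proof. by apply: lt_le_trans (phiC x); rewrite invr_gt0. Qed.

Lemma Cphi x : 1 <= C * phi x.
Proof. by rewrite -ler_pdivrMl // mulr1. Qed.

Lemma phi_Ck i k : Ck k (coords i) (phi \o param i).
Proof. by apply: smooth_on_Ck; [exact: open_coords|exact: sphi]. Qed.

Lemma phi_cont x : {for x, continuous phi}.
Proof.
set i := chart_at x; have dx : dom i x by exact: dom_chart_at.
have c : {for x, continuous ((phi \o param i) \o chart i)}.
  apply: (@continuous_comp _ _ _ (chart i) (phi \o param i)); first exact: chart_continuous.
  exact: (Ck_cont (phi_Ck i 0) (coords_chart dx)).
move=> P hP; have hP' : nbhs (((phi \o param i) \o chart i) x) P by rewrite /= chartK.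
have hc : nbhs x [set z | P (phi (param i (chart i z)))] by exact: (c _ hP').
apply: filterS (filterI hc (near_dom dx)) => z [h1 h2].
by move: h1; rewrite /= chartK.
Qed.

Lemma z0T : 0 <= (0 : R) <= T. Proof. by rewrite lexx ltW. Qed.
Lemma cch x : coords (chart_at x) (ch x).
Proof. by apply: coords_chart; exact: dom_chart_at. Qed.
Lemma ph_ch x : ph x (ch x) = phi x.
Proof. by rewrite /= chartK //; exact: dom_chart_at. Qed.

Lemma NRge0 t x : 0 < t < T -> 0 <= NR (g t) x /\ 0 <= ND (g t) x.
Proof. by move=> tT; exact: (rm_drm_ge0 gf tT (cch x)). Qed.

Lemma NR_le t x : 0 <= t <= T -> NR (g t) x <= K ^+ 2.
Proof. by move=> tT; apply: le_of_sqrt; exact: (hK x tT). Qed.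

(** The bound of |d phi| along the flow; the exponent is half of that for |d phi|^2. *)
Definition pB := expR (N ^+ 3 * K * T) * C.
Lemma pB0 : 0 <= pB. Proof. by rewrite mulr_ge0 ?expR_ge0 // ltW. Qed.

Lemma grad_bound x t : 0 <= t < T -> Num.sqrt (grad_sq (gg t x) (ph x) (ch x)) <= pB.
Proof.
move=> /andP[t0 tT]; apply: le_sqrtP; first exact: pB0.
have t0T : 0 <= t < T by rewrite t0.
apply: (le_trans (grad_sq_bound gf (phi_Ck _) (cch x) t0T (fun s hs => hK x hs))).
rewrite /pB exprMn [expR _ ^+ 2]expr2 -expRD.
have h0 : grad_sq (gg 0 x) (ph x) (ch x) <= C ^+ 2 by apply: le_of_sqrt; exact: dphi.
apply: (@le_trans _ _ (expR (2 * N ^+ 3 * K * t) * C ^+ 2)).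
  by rewrite ler_wpM2l ?expR_ge0.
rewrite ler_wpM2r ?sqr_ge0 // ler_expR.
have : N ^+ 3 * K * t <= N ^+ 3 * K * T.
  by rewrite ler_wpM2l ?(ltW tT) // mulr_ge0 // exprn_ge0.
move: (N ^+ 3) => q; lra.
Qed.

(** The summand N c2 is for the initial Hessian; the summand C absorbs the 1 under the square root,
    because C phi >= 1. *)
Definition c4 := N * c2 + C.
Definition eB := expR (2 * N ^+ 4 * K * T).
Definition aB := 2 * (3 * N ^+ 4 * pB) * Num.sqrt T.
Lemma aB0 : 0 <= aB.
Proof.
apply: mulr_ge0; last exact: sqrtr_ge0.
apply: mulr_ge0 => //; apply: mulr_ge0; last exact: pB0.
by rewrite mulr_ge0 // exprn_ge0.
Qed.
Lemma c40 : 0 <= c4.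
Proof. by rewrite /c4 addr_ge0 ?mulr_ge0 // ltW. Qed.

Lemma hess0_bound x : Num.sqrt (hess_sq (gg 0 x) (ph x) (ch x) + 1) <= c4 * phi x.
Proof.
have m := flow_metric gf z0T; have cx := cch x.
have [Y hY] := orthonormal_frame (metric_sym m cx) (metric_pos m cx).
have hs : (hess_at (g 0) phi x)^T = hess_at (g 0) phi x.
  apply: (hessian_sym (phi_Ck _) (@open_coords _ _ X _) cx) => y.
  exact: (metric_sym m).
have h : hess_sq (gg 0 x) (ph x) (ch x) <= N ^+ 2 * (c2 * phi x) ^+ 2.
  exact: (hess_sq_le hs hY (hess2 x)).
have px := phi_gt0 x.
apply: le_sqrtP; first by rewrite mulr_ge0 ?c40 // ltW.
have h1 := Cphi x.
have h2 : 0 <= N * c2 * phi x by rewrite !mulr_ge0 // ltW.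
have -> : c4 * phi x = N * c2 * phi x + C * phi x by rewrite /c4 mulrDl.
move: h; rewrite (_ : N ^+ 2 * (c2 * phi x) ^+ 2 = (N * c2 * phi x) ^+ 2); last by ring.
move: (hess_sq _ _ _) (N * c2 * phi x) (C * phi x) h1 h2 => q a b h1 h2 h3; nra.
Qed.

Lemma hess_bound x t m : 0 <= t < T -> 0 <= m ->
  (forall s, 0 < s < t -> Num.sqrt (ND (g s) x) <= m / Num.sqrt s) ->
  Num.sqrt (hess_sq (gg t x) (ph x) (ch x)) <= eB * (c4 * phi x + aB * m).
Proof.
move=> tT m0 hv; have /andP[t0 t1] := tT.
have gb s : 0 < s < t -> Num.sqrt (grad_sq (gg s x) (ph x) (ch x)) <= pB.
  by move=> /andP[s0 st]; apply: grad_bound; rewrite ltW // (lt_trans st).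
have h := hess_sq_bound gf (phi_Ck _) (cch x) tT K0 pB0 (fun s hs => hK x hs) gb hv.
apply: (@le_trans _ _ (Num.sqrt (hess_sq (gg t x) (ph x) (ch x) + 1))).
  by rewrite ler_wsqrtr // lerDl.
apply: (le_trans h); apply: ler_pM.
- exact: expR_ge0.
- apply: addr_ge0; first exact: sqrtr_ge0.
  have pb := pB0; have N4 : 0 <= N ^+ 4 by rewrite exprn_ge0.
  nonneg.
- rewrite ler_expR ler_wpM2l ?(ltW t1) // !mulr_ge0 // exprn_ge0 //.
- apply: lerD; first exact: hess0_bound.
  have pb := pB0; have N4 : 0 <= N ^+ 4 by rewrite exprn_ge0.
  rewrite /aB [leRHS]mulrAC; apply: ler_wpM2l; first by nonneg.
  by rewrite ler_wsqrtr // ltW.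
Qed.

Lemma space_time_max (q : R -> X -> R) (T1 r : R) : 0 <= T1 -> T1 <= T ->
  (exists x, phi x <= r) ->
  (forall (t : R) (x : X), 0 <= t <= T ->
     q p.1 p.2 @[p --> within (`[0, T]%classic `*` setT) (nbhs ((t, x) : R * X))] --> q t x) ->
  exists t x, [/\ 0 <= t <= T1, phi x <= r &
    forall s z, 0 <= s <= T1 -> phi z <= r -> q s z <= q t x].
Proof.
move=> T10 T1T [x1 hx1] cq.
pose A : set (R * X) := `[0, T1]%classic `*` [set x | phi x <= r].
have cA : compact A by apply: compact_setX; [exact: segment_compact|exact: cpt].
have A0 : A !=set0 by exists (0, x1); split=> //=; rewrite in_itv /= lexx.
have cc : {within A, continuous (fun p : R * X => q p.1 p.2)}.
  apply/subspace_continuousP => -[t x] [/=]; rewrite in_itv /= => /andP[t0 t1] hx.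
  have tT : 0 <= t <= T by rewrite t0 (le_trans t1).
  apply: cvg_within_sub (cq t x tT) => -[s z] [/=]; rewrite in_itv /= => /andP[s0 s1] _.
  by split=> //; rewrite /= in_itv /= s0 (le_trans s1).
have [[t x]] := compact_EVT_max A0 cA cc; rewrite inE => -[/=]; rewrite in_itv /= => tT hx hmax.
exists t, x; split=> // s z sT hz; have := hmax (s, z); apply.
by rewrite inE; split=> //=; rewrite in_itv.
Qed.

Lemma cont_phi_st (t : R) (x : X) (A : set (R * X)) :
  phi p.2 @[p --> within A (nbhs ((t, x) : R * X))] --> phi x.
Proof.
apply: cvg_within_filter.
apply: (@continuous_comp _ _ _ (@snd R X) phi (t, x)); first exact: cvg_snd.
exact: phi_cont.
Qed.

Lemma cont_t_st (t : R) (x : X) (A : set (R * X)) :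
  p.1 @[p --> within A (nbhs ((t, x) : R * X))] --> t.
Proof. by apply: cvg_within_filter; exact: cvg_fst. Qed.

(** The strict inequalities phi x < r and 0 < t turn the maximum over the compact set into a local
    one in the chart at x, among points of no later time. *)
Lemma chart_max (q : R -> X -> R) (h : B -> R) (T1 r t : R) (x : X) : T1 <= T ->
  0 < t -> t <= T1 -> phi x < r ->
  (forall s z, 0 <= s <= T1 -> phi z <= r -> q s z <= q t x) ->
  (forall s y, 0 < s <= T -> coords (chart_at x) y ->
     h (s, y) = q s (param (chart_at x) y)) ->
  \forall p \near ((t, ch x) : B), p.1 <= t -> h p <= h (t, ch x).
Proof.
move=> T1T t0 tT hx hmax hh; set i := chart_at x in hh *.
have dx : dom i x by exact: dom_chart_at.
have n1 : \forall z \near x, phi z < r.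
  have : nbhs (phi x) [set s | s < r] by apply: lt_nbhsl.
  exact: (phi_cont (x := x)).
have n2 : nbhs (param i (chart i x)) [set z | phi z < r] by rewrite chartK.
have n3 := near_param (coords_chart dx) n2.
have n4 : nbhs ((t, chart i x) : B) [set p : B | coords i p.2 /\ phi (param i p.2) < r].
  exact: (@cvg_snd _ _ (nbhs t) (nbhs (chart i x)) _ _ n3).
have n5 : nbhs ((t, chart i x) : B) [set p : B | 0 < p.1].
  have : nbhs t [set s : R | 0 < s] by exact: lt_nbhsr.
  exact: (@cvg_fst _ _ (nbhs t) (nbhs (chart i x)) _ [set s : R | 0 < s]).
apply: filterS (filterI n4 n5) => -[s y] [/= [cy hy] s0] st.
have s1 : 0 < s <= T by rewrite s0 (le_trans st) // (le_trans tT).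
have t1 : 0 < t <= T by rewrite t0 (le_trans tT).
rewrite !hh //; last exact: coords_chart.
rewrite chartK //; apply: hmax; last exact: ltW.
by rewrite ltW // (le_trans st).
Qed.

(** The weight a0 of [heat_shi], increased by 1 so that it is at least 1 even for K = 0. *)
Definition A0 := 8 * N ^+ 20 * K ^+ 2 + 1.
Definition A1 := A0 + K ^+ 2.
Definition C3 := 20 * N ^+ 6 * K ^+ 3 + (A0 + K ^+ 2) * (84 * N ^+ 7 * K).
(** The maximum M will satisfy M <= shi_al + shi_be sqrt M; [M0] is the bound that [self_bound]
    derives from this. *)
Definition shi_al := A1 ^+ 2 * (C3 * T + 1 + 2 * T * N * eB * c4 + 8 * T * pB ^+ 2).
Definition shi_be := A1 ^+ 2 * (2 * T * N * eB * aB).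
Definition M0 := 2 * shi_al + shi_be ^+ 2.

Lemma A0ge1 : 1 <= A0.
Proof. by rewrite /A0 lerDr !mulr_ge0 ?exprn_ge0. Qed.

Lemma C3_ge0 : 0 <= C3.
Proof.
apply: addr_ge0; first by rewrite !mulr_ge0 // exprn_ge0.
apply: mulr_ge0; last by rewrite !mulr_ge0 // exprn_ge0.
by rewrite addr_ge0 ?sqr_ge0 // (le_trans ler01) // A0ge1.
Qed.

Lemma M0_ge0 : 0 <= M0.
Proof.
apply: addr_ge0; last exact: sqr_ge0.
apply: mulr_ge0 => //; apply: mulr_ge0; first exact: sqr_ge0.
have T1 := ltW T0; have h1 := C3_ge0; have h2 := c40; have h3 : 0 <= eB by exact: expR_ge0.
have h4 : 0 <= pB ^+ 2 by exact: sqr_ge0.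
have h5 : 0 <= N by [].
nonneg.
Qed.

Lemma shi_arith (t y S NRx M r sH P : R) : 0 < t <= T -> 0 < y <= 1 -> 0 <= S -> 0 <= NRx <= K ^+ 2 ->
  1 <= r -> 0 < M -> M = t * (y * y) * ((A0 + NRx) * S) ->
  0 <= sH -> y * sH <= eB * (c4 * r + aB * Num.sqrt M) -> P <= pB ^+ 2 ->
  (t * y ^+ 2 * S) ^+ 2 <= C3 * T * (t * y ^+ 2 * S)
    + M * (1 + 2 * T * N * r^-1 * (y * sH) + 8 * T * r^-1 ^+ 2 * P) ->
  M <= M0.
Proof.
move=> /andP[t0 tT] /andP[y0 y1] S0 /andP[n0 n1] r1 M1 ME sH0 hsH hP h.
have A01 := A0ge1; have A00 : 0 < A0 by exact: lt_le_trans ltr01 A01.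
have A10 : 0 < A1 by rewrite /A1 ltr_pwDl // sqr_ge0.
have N0 : 0 <= N by [].
have r0 : 0 < r by exact: lt_le_trans ltr01 r1.
have ri1 : r^-1 <= 1 by rewrite invf_le1.
have ri0 : 0 <= r^-1 by rewrite invr_ge0 ltW.
have eB0 : 0 < eB by exact: expR_gt0.
have sM0 := sqrtr_ge0 M.
have C30 := C3_ge0.
set s := t * y ^+ 2 * S in h.
have s0 : 0 <= s by rewrite /s !mulr_ge0 ?sqr_ge0 // ltW.
have Ms : M = s * (A0 + NRx) by rewrite ME /s; ring.
have sM : s <= M by rewrite Ms ler_peMr // (le_trans A01) // lerDl.
have MA : M <= A1 * s by rewrite Ms mulrC ler_wpM2r // /A1 lerD2l.
have M2 : M ^+ 2 <= A1 ^+ 2 * s ^+ 2.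
  have As : 0 <= A1 * s by rewrite mulr_ge0 // ltW.
  by rewrite -exprMn lerXn2r // nnegrE ltW.
have b1 : r^-1 * (y * sH) <= eB * (c4 + aB * Num.sqrt M).
  apply: (@le_trans _ _ (r^-1 * (eB * (c4 * r + aB * Num.sqrt M)))); first by rewrite ler_wpM2l.
  rewrite mulrCA ler_wpM2l ?(ltW eB0) // mulrDr mulrCA mulVf ?gt_eqF // mulr1 lerD2l.
  by rewrite ler_piMl // mulr_ge0 // aB0.
have b2 : r^-1 ^+ 2 * P <= pB ^+ 2.
  apply: (@le_trans _ _ (r^-1 ^+ 2 * pB ^+ 2)); first by rewrite ler_wpM2l ?sqr_ge0.
  by rewrite ler_piMl ?sqr_ge0 // exprn_ile1.
have TN : 0 <= 2 * T * N by rewrite !mulr_ge0 // ltW.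
have T8 : 0 <= 8 * T by rewrite mulr_ge0 // ltW.
have b3 := ler_wpM2l TN b1; have b4 := ler_wpM2l T8 b2.
have b5 : s ^+ 2 <= M * (C3 * T + 1 + 2 * T * N * (eB * (c4 + aB * Num.sqrt M)) + 8 * T * pB ^+ 2).
  apply: (le_trans h).
  have b6 : C3 * T * s <= C3 * T * M by rewrite ler_wpM2l // mulr_ge0 // ltW.
  have b7 : M * (2 * T * N * r^-1 * (y * sH) + 8 * T * r^-1 ^+ 2 * P) <=
     M * (2 * T * N * (eB * (c4 + aB * Num.sqrt M)) + 8 * T * pB ^+ 2).
    rewrite ler_wpM2l ?(ltW M1) //; apply: lerD; [by rewrite -mulrA|by rewrite -mulrA].
  move: b6 b7; rewrite !mulrDr; lra.
have b8 : M <= shi_al + shi_be * Num.sqrt M.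
  rewrite -(ler_pM2l M1) -expr2; apply: (le_trans M2).
  apply: (@le_trans _ _ (A1 ^+ 2 * (M * (C3 * T + 1 + 2 * T * N * (eB * (c4 + aB * Num.sqrt M)) + 8 * T * pB ^+ 2)))).
    by rewrite ler_wpM2l // sqr_ge0.
  by rewrite /shi_al /shi_be le_eqVlt; apply/orP; left; apply/eqP; ring.
by apply: self_bound => //; exact: ltW.
Qed.

Lemma shi t x : 0 < t < T -> t * ND (g t) x <= 4 * M0.
Proof.
move=> tT; have /andP[t0 t1] := tT.
(* With this radius the cut-off at x is at least 1/2; its square accounts for the factor 4. *)
pose r := 2 * phi x + 1; have px := phi_gt0 x.
have r1 : 1 <= r by rewrite /r lerDr mulr_ge0 // ltW.
have r0 : 0 < r by exact: lt_le_trans ltr01 r1.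
pose q (s : R) (z : X) := s * ((1 - r^-1 * phi z) * (1 - r^-1 * phi z)) * ((A0 + NR (g s) z) * ND (g s) z).
have cq (s : R) (z : X) : 0 <= s <= T ->
    q p.1 p.2 @[p --> within (`[0, T]%classic `*` setT) (nbhs ((s, z) : R * X))] --> q s z.
  move=> sT.
  have ce : (1 - r^-1 * phi p.2) @[p --> within (`[0, T]%classic `*` setT) (nbhs ((s, z) : R * X))]
      --> 1 - r^-1 * phi z.
    by apply: cvgB; [exact: cvg_cst|apply: cvgM; [exact: cvg_cst|exact: cont_phi_st]].
  apply: cvgM; first by apply: cvgM; [exact: cont_t_st|apply: cvgM].
  apply: cvgM; last exact: (@ND_cont _ _ _ _ _ gf s z sT).
  by apply: cvgD; [exact: cvg_cst|exact: (@NR_cont _ _ _ _ _ gf s z sT)].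
have ex : exists z, phi z <= r by exists x; rewrite /r; lra.
have [ts [xs [/andP[ts0 ts1] xsr hmax]]] := space_time_max (ltW t0) (ltW t1) ex cq.
have qx : t * ND (g t) x / 4 <= q t x.
  have [n0 d0] := NRge0 x tT.
  have e1 : 2^-1 <= 1 - r^-1 * phi x.
    have : r^-1 * phi x <= 2^-1.
      by rewrite mulrC ler_pdivrMr // /r; lra.
    lra.
  have e2 : 4^-1 <= (1 - r^-1 * phi x) * (1 - r^-1 * phi x) by move: (1 - _) e1 => w; nra.
  have a1 : 1 <= A0 + NR (g t) x by apply: (le_trans A0ge1); rewrite lerDl.
  rewrite /q; set w := (1 - _) * (1 - _) in e2 *; set a := A0 + _ in a1 *; set d := ND _ _ in d0 *.
  have h1 : d <= a * d by rewrite ler_peMl.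
  have h2 : 4^-1 * (t * d) <= w * (t * (a * d)).
    apply: ler_pM; [by rewrite invr_ge0|by rewrite mulr_ge0 // ltW|exact: e2|].
    by rewrite ler_wpM2l // ltW.
  by rewrite mulrC (_ : t * w * (a * d) = w * (t * (a * d))); last by ring.
have qm : q t x <= q ts xs by apply: hmax; [rewrite lexx ltW|rewrite /r; lra].
suff : q ts xs <= M0 by lra.
have A00 : 0 < A0 by exact: lt_le_trans ltr01 A0ge1.
have M00 := M0_ge0.
have [qp|] := ltP 0 (q ts xs); last by move=> h; exact: le_trans h M00.
have tsp : 0 < ts.
  by rewrite lt_neqAle ts0 andbT; apply/eqP => h; move: qp; rewrite /q -h !mul0r ltxx.
have tsT : 0 < ts < T by rewrite tsp (le_lt_trans ts1).
have xr : phi xs < r.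
  rewrite lt_neqAle xsr andbT; apply/eqP => h; move: qp.
  by rewrite /q h mulVf ?gt_eqF // subrr !mul0r mulr0 mul0r ltxx.
have [n0 d0] := NRge0 xs tsT.
pose y := 1 - r^-1 * phi xs.
have y0 : 0 < y by rewrite subr_gt0 mulrC ltr_pdivrMr // mul1r.
have y1 : y <= 1 by rewrite gerBl mulr_ge0 ?invr_ge0 ?(ltW r0) // ltW // phi_gt0.
have tsT' : 0 <= ts <= T by rewrite ts0 ltW // (le_lt_trans ts1).
pose hf (p : B) := p.1 * ((1 - r^-1 * ph xs p.2) * (1 - r^-1 * ph xs p.2)) *
     ((A0 + rm_sq (g p.1 (chart_at xs)) p.2) * drm_sq (g p.1 (chart_at xs)) p.2).
have hh s (w : 'rV[R]_n) : 0 < s <= T -> coords (chart_at xs) w ->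
    hf (s, w) = q s (param (chart_at xs) w).
  move=> /andP[s0 s1] cz; have sT : 0 <= s <= T by rewrite ltW.
  have m := flow_metric gf sT; have [d e] := paramK cz.
  by rewrite /q (NR_chart m d) (ND_chart m d) e.
have hfq : hf (ts, ch xs) = q ts xs.
  rewrite hh ?chartK //; [exact: dom_chart_at|by rewrite tsp; case/andP: tsT'|exact: cch].
have hloc := chart_max (ltW t1) tsp ts1 xr hmax hh.
have rk : Num.sqrt (rm_sq (gg ts xs) (ch xs)) <= K by exact: (hK xs tsT').
have hA : 8 * N ^+ 20 * K ^+ 2 <= A0 by rewrite /A0 lerDl.
have hy : 0 <= 1 - r^-1 * ph xs (ch xs) <= 1 by rewrite ph_ch (ltW y0).
have ri0 : 0 <= r^-1 by rewrite invr_ge0 ltW.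
have main := shi_point gf (phi_Ck _) tsT (cch xs) rk hA A00 ri0 hy hloc.
have {}main : (ts * y ^+ 2 * ND (g ts) xs) ^+ 2 <= C3 * T * (ts * y ^+ 2 * ND (g ts) xs)
    + q ts xs * (1 + 2 * T * N * r^-1 * (y * Num.sqrt (hess_sq (gg ts xs) (ph xs) (ch xs)))
       + 8 * T * r^-1 ^+ 2 * grad_sq (gg ts xs) (ph xs) (ch xs)).
  have ey : y = 1 - r^-1 * ph xs (ch xs) by rewrite ph_ch.
  rewrite -[q ts xs]hfq ey.
  exact: main.
set M := q ts xs in qp hmax main *.
have sM := sqrtr_ge0 M.
have tsT1 : 0 <= ts < T by case/andP: tsT => _ ->; rewrite ts0.
have m0 : 0 <= Num.sqrt M / y by rewrite divr_ge0 // ltW.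
(* The feedback: the cut-off [y] does not depend on time, so that maximality of M bounds |D Rm| at
   the same point at all earlier times. The factor 1 / y introduced here is cancelled by the factor
   y that accompanies the Hessian. *)
have hv s : 0 < s < ts -> Num.sqrt (ND (g s) xs) <= Num.sqrt M / y / Num.sqrt s.
  move=> /andP[s0 s1]; have sT : 0 < s < T by rewrite s0 (lt_trans s1) //; case/andP: tsT.
  have [n1 d1] := NRge0 xs sT.
  have hq : q s xs <= M by apply: hmax => //; rewrite ltW //= (le_trans (ltW s1)).
  apply: le_sqrtP; first by rewrite divr_ge0 ?sqrtr_ge0.
  rewrite !expr_div_n (sqr_sqrtr (ltW qp)) (sqr_sqrtr (ltW s0)).
  rewrite (ler_pdivlMr _ _ s0) (ler_pdivlMr _ _ (exprn_gt0 2 y0)); apply: le_trans hq.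
  rewrite /q -/y; have a1 : 1 <= A0 + NR (g s) xs by apply: (le_trans A0ge1); rewrite lerDl.
  have -> : ND (g s) xs * s * y ^+ 2 = s * (y * y) * ND (g s) xs by ring.
  rewrite ler_wpM2l ?mulr_ge0 ?(ltW s0) ?(ltW y0) // ler_peMl //.
have hb := hess_bound tsT1 m0 hv.
apply: (@shi_arith ts y (ND (g ts) xs) (NR (g ts) xs) M r _ _ _ _ d0 _ r1 qp _ (sqrtr_ge0 _) _ _ main).
- by rewrite tsp; case/andP: tsT'.
- by rewrite y0.
- by rewrite n0 NR_le.
- by [].
- apply: (@le_trans _ _ (y * (eB * (c4 * phi xs + aB * (Num.sqrt M / y))))).
    by rewrite ler_wpM2l // ltW.
  rewrite mulrCA ler_wpM2l ?expR_ge0 // mulrDr; apply: lerD.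
    rewrite mulrCA ler_wpM2l ?c40 //; apply: (@le_trans _ _ (phi xs)); last exact: ltW.
    by rewrite ler_piMl // ltW // phi_gt0.
  by rewrite mulrCA ler_wpM2l ?aB0 // mulrC divfK // gt_eqF.
- by apply: le_of_sqrt; exact: grad_bound.
Qed.

Definition c5 := eB * (c4 + aB * (2 * Num.sqrt M0) * C).

(** Shi's estimate is now available with a constant, and C phi >= 1 turns its contribution into a
    multiple of phi. *)
Lemma hess_decay t x : 0 < t < T -> Num.sqrt (hess_sq (gg t x) (ph x) (ch x)) <= c5 * phi x.
Proof.
move=> /andP[t0 t1]; have t0T : 0 <= t < T by rewrite ltW.
have m0 : 0 <= 2 * Num.sqrt M0 by rewrite mulr_ge0 // sqrtr_ge0.
have hv s : 0 < s < t -> Num.sqrt (ND (g s) x) <= 2 * Num.sqrt M0 / Num.sqrt s.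
  move=> /andP[s0 st]; have sT : 0 < s < T by rewrite s0 (lt_trans st).
  apply: le_sqrtP; first by rewrite divr_ge0 ?sqrtr_ge0.
  rewrite expr_div_n exprMn (sqr_sqrtr M0_ge0) (sqr_sqrtr (ltW s0)) ler_pdivlMr // mulrC.
  by rewrite (_ : 2 ^+ 2 = 4); [exact: shi|ring].
apply: (le_trans (hess_bound t0T m0 hv)); rewrite /c5 -[leRHS]mulrA; apply: ler_wpM2l; first exact: expR_ge0.
rewrite [leRHS]mulrDl lerD2l -[leRHS]mulrA; apply: ler_peMr; [by apply: mulr_ge0; [exact: aB0|exact: m0]|exact: Cphi].
Qed.

(** * The maximum principle for the weighted curvature *)

Section Decay.
Variables (a D0 : R).
Hypothesis a0 : 0 <= a.
Hypothesis D00 : 0 <= D0.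
Hypothesis init : forall x, phi x `^ a * NR (g 0) x <= D0.

Let p := C * pB.
Definition dQ b := b * (b + 1) * p ^+ 2 + b * (N * c5).
Definition dC1 := 20 * N ^+ 6 * K + dQ a + 2 * N ^+ 10 * a ^+ 2 * p ^+ 2.
Let lam := dC1 + 1.
Let mu := dC1 + dQ (a + 1).

Lemma decay_eps eps t x : 0 < eps -> 0 <= t < T ->
  expR (- lam * t) * (phi x `^ a * NR (g t) x - eps * (expR (mu * t) * phi x `^ (a + 1))) <= D0.
Proof.
move=> e0 /andP[t0 t1].
pose q s z := expR (- lam * s) * (phi z `^ a * NR (g s) z - eps * (expR (mu * s) * phi z `^ (a + 1))).
rewrite -/(q t x).
have cexp (c : R) : continuous (fun s : R => expR (c * s)).
  move=> s; apply: (@continuous_comp _ _ _ (fun s => c * s) expR); last exact: continuous_expR.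
  by apply: cvgM; [exact: cvg_cst|exact: cvg_id].
have cpow (b : R) x' : {for x', continuous (fun z => phi z `^ b)}.
  apply: (@continuous_comp _ _ _ phi (fun s : R => s `^ b)); first exact: phi_cont.
  apply/differentiable_continuous/derivable1_diffP.
  exact: (@ex_derive _ _ _ _ _ _ _ (is_derive1_powR b (phi_gt0 x'))).
have cq (s : R) (z : X) : 0 <= s <= T ->
    q p.1 p.2 @[p --> within (`[0, T]%classic `*` setT) (nbhs ((s, z) : R * X))] --> q s z.
  move=> sT; set FF := within _ _.
  have ce c : expR (c * p0.1) @[p0 --> FF] --> expR (c * s).
    apply: cvg_within_filter; apply: (@continuous_comp _ _ _ (@fst R X) (fun s => expR (c * s)) (s, z)).
      exact: cvg_fst.
    exact: cexp.
  have cp b : phi p0.2 `^ b @[p0 --> FF] --> phi z `^ b.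
    apply: cvg_within_filter; apply: (@continuous_comp _ _ _ (@snd R X) (fun z => phi z `^ b) (s, z)).
      exact: cvg_snd.
    exact: cpow.
  apply: cvgM; first exact: ce.
  apply: cvgB; first by apply: cvgM; [exact: cp|exact: (@NR_cont _ _ _ _ _ gf s z sT)].
  by apply: cvgM; [exact: cvg_cst|apply: cvgM; [exact: ce|exact: cp]].
(* Where phi >= K^2 / eps the barrier dominates the weighted curvature, so that a positive maximum
   lies strictly inside the sublevel set. *)
pose r := Num.max (phi x + 1) (K ^+ 2 / eps).
have rx : phi x < r by rewrite lt_max ltrDl ltr01.
have ex : exists z, phi z <= r by exists x; exact: ltW.
have mu0 : 0 <= mu.
  have c50 : 0 <= c5.
    have h1 := c40; have h2 := aB0; have h3 := ltW C0; rewrite /c5; apply: mulr_ge0; [exact: expR_ge0|nonneg].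
  have p0 : 0 <= p by apply: mulr_ge0; [exact: ltW|exact: pB0].
  have N0 : 0 <= N by [].
  have Q0 b : 0 <= b -> 0 <= dQ b.
    by move=> b0; rewrite /dQ; nonneg.
  have Qa := Q0 a a0; have Qb : 0 <= dQ (a + 1) by apply: Q0; nonneg.
  by rewrite /mu /dC1; nonneg.
have neg s z : 0 <= s <= T -> r <= phi z -> q s z <= 0.
  move=> sT hz; rewrite pmulr_rle0 ?expR_gt0 // subr_le0.
  have pz := phi_gt0 z.
  have h1 : phi z `^ (a + 1) = phi z * phi z `^ a.
    by rewrite powRD ?powRr1 ?ltW // 1?mulrC //; apply/implyP => _; rewrite gt_eqF.
  have h2 : NR (g s) z <= eps * phi z.
    apply: (le_trans (NR_le z sT)); rewrite mulrC -ler_pdivrMr //.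
    by apply: le_trans hz; rewrite le_max lexx orbT.
  have h3 : 1 <= expR (mu * s) by rewrite -expR0 ler_expR mulr_ge0 //; case/andP: sT.
  have w0 := powR_ge0 (phi z) a; rewrite h1.
  apply: (@le_trans _ _ (phi z `^ a * (eps * phi z))); first by rewrite ler_wpM2l.
  have -> : eps * (expR (mu * s) * (phi z * phi z `^ a)) = expR (mu * s) * (phi z `^ a * (eps * phi z)) by ring.
  by rewrite ler_peMl // !mulr_ge0 // ltW.
have [ts [xs [/andP[ts0 ts1] xsr hmax]]] := space_time_max t0 (ltW t1) ex cq.
have qm : q t x <= q ts xs by apply: hmax; [rewrite lexx t0|exact: ltW].
apply: (le_trans qm); rewrite leNgt; apply/negP => qD.
have qp : 0 < q ts xs by exact: le_lt_trans qD.
have tsT' : 0 <= ts <= T by rewrite ts0 ltW // (le_lt_trans ts1).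
have xr : phi xs < r by rewrite ltNge; apply/negP => /(neg _ _ tsT'); rewrite leNgt qp.
have tsp : 0 < ts.
  rewrite lt_neqAle ts0 andbT; apply/eqP => h; move: qD; rewrite /q -h !mulr0 expR0 !mul1r ltNge.
  have h1 : 0 <= eps * phi xs `^ (a + 1) by rewrite mulr_ge0 ?powR_ge0 // ltW.
  by rewrite (le_trans _ (init xs)) // gerBl.
have tsT : 0 < ts < T by rewrite tsp (le_lt_trans ts1).
pose hf (p0 : B) := expR (- lam * p0.1) * (ph xs p0.2 `^ a * rm_sq (g p0.1 (chart_at xs)) p0.2
     - eps * (expR (mu * p0.1) * ph xs p0.2 `^ (a + 1))).
have hh s (w : 'rV[R]_n) : 0 < s <= T -> coords (chart_at xs) w ->
    hf (s, w) = q s (param (chart_at xs) w).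
  move=> /andP[s0 s1] cz; have sT : 0 <= s <= T by rewrite ltW.
  have m := flow_metric gf sT; have [d e] := paramK cz.
  by rewrite /q (NR_chart m d) e.
have hloc := chart_max (ltW t1) tsp ts1 xr hmax hh.
have rk : Num.sqrt (rm_sq (gg ts xs) (ch xs)) <= K by exact: (hK xs tsT').
have pos y : coords (chart_at xs) y -> 0 < ph xs y by move=> _; exact: phi_gt0.
have tsT1 : 0 <= ts < T by case/andP: tsT => _ ->; rewrite ts0.
have kC : (phi xs)^-1 <= C by rewrite invf_ple ?posrE ?phi_gt0.
have b1 : (ph xs (ch xs))^-1 * Num.sqrt (grad_sq (gg ts xs) (ph xs) (ch xs)) <= p.
  rewrite ph_ch; apply: ler_pM; [by rewrite invr_ge0 ltW // phi_gt0|exact: sqrtr_ge0|exact: kC|exact: grad_bound].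
have b2 : (ph xs (ch xs))^-1 * Num.sqrt (hess_sq (gg ts xs) (ph xs) (ch xs)) <= c5.
  by rewrite ph_ch mulrC ler_pdivrMr ?phi_gt0 // hess_decay.
have := decay_point gf (phi_Ck _) pos tsT (cch xs) rk a0 (ltW e0) b1 b2 hloc.
rewrite /= leNgt => /negP; apply; move: qp; rewrite /q pmulr_rgt0 ?expR_gt0 //.
by rewrite chartK; [|exact: dom_chart_at].
Qed.

(** At a fixed point eps tends to 0. The final time, where the interior argument does not apply, is
    reached by continuity. *)
Lemma decay t x : 0 <= t <= T -> phi x `^ a * NR (g t) x <= expR (`|lam| * T) * D0.
Proof.
have main s : 0 <= s < T -> phi x `^ a * NR (g s) x <= expR (`|lam| * T) * D0.
  move=> sT; have /andP[s0 s1] := sT.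
  have E0 := expR_gt0 (mu * s); have V0 := powR_gt0 (a + 1) (phi_gt0 x).
  have h1 : expR (- lam * s) * (phi x `^ a * NR (g s) x) <= D0.
    apply/ler_addgt0Pr => e e0.
    pose w := expR (- lam * s) * (expR (mu * s) * phi x `^ (a + 1)).
    have w0 : 0 < w by rewrite !mulr_gt0 ?expR_gt0.
    have ew : 0 < e / w by rewrite divr_gt0.
    have := decay_eps x ew sT; rewrite mulrBr (mulrCA _ (e / w)) -/w divfK ?gt_eqF // lerBlDr.
    exact.
  have e1 : phi x `^ a * NR (g s) x = expR (lam * s) * (expR (- lam * s) * (phi x `^ a * NR (g s) x)).
    by rewrite mulrA -expRD mulNr subrr expR0 mul1r.
  rewrite e1; apply: (@le_trans _ _ (expR (lam * s) * D0)); first by rewrite ler_wpM2l ?expR_ge0.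
  rewrite ler_wpM2r // ler_expR; apply: (@le_trans _ _ (`|lam| * s)).
    by rewrite ler_wpM2r // ler_norm.
  by rewrite ler_wpM2l // ltW.
move=> /andP[t0]; rewrite le_eqVlt => /orP[/eqP->|t1]; last by apply: main; rewrite t0.
rewrite leNgt; apply/negP => hlt.
have TT : 0 <= T <= T by rewrite lexx ltW.
have c1 : (phi x `^ a * NR (g p.1) p.2) @[p --> within (`[0, T]%classic `*` setT) (nbhs ((T, x) : R * X))]
    --> phi x `^ a * NR (g T) x.
  by apply: cvgM; [exact: cvg_cst|exact: (@NR_cont _ _ _ _ _ gf T x TT)].
have n1 : nbhs (phi x `^ a * NR (g T) x) [set s | expR (`|lam| * T) * D0 < s] by exact: lt_nbhsr.
have n2 : nbhs ((T, x) : R * X) [set p : R * X | (`[0, T]%classic `*` setT) p ->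
    expR (`|lam| * T) * D0 < phi x `^ a * NR (g p.1) p.2] by exact: (c1 _ n1).
have c : {for T, continuous (fun s : R => (s, x) : R * X)}.
  by apply: cont_pair; [exact: cvg_id|exact: cst_continuous].
have n3 : nbhs T [set s : R | (`[0, T]%classic `*` setT) ((s, x) : R * X) ->
    expR (`|lam| * T) * D0 < phi x `^ a * NR (g s) x] by exact: (c _ n2).
have /nbhs_ballP[e e0 he] := n3.
pose s := Num.max 0 (T - e / 2).
have s0 : 0 <= s by rewrite le_max lexx.
have sT : s < T by rewrite gt_max T0 gtrBl divr_gt0.
have bs : ball T e s.
  rewrite -ball_normE /= gtr0_norm ?subr_gt0 //.
  by apply: left_ball => //; rewrite le_max lexx orbT.
have := he s bs; have sI : (`[0, T]%classic `*` setT) ((s, x) : R * X).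
  by split=> //; rewrite /= in_itv /= s0 ltW.
move=> /(_ sI); rewrite ltNge main //.
by rewrite s0.
Qed.

End Decay.
End Main.

(** * From decay in phi to decay in the distance *)

Lemma dist_ge0 (R : realType) (n : nat) (M : smooth_manifold R n) (g : tensor2 M) (x y : M) :
  riemannian_metric g -> 0 <= dist g x y.
Proof.
move=> hm; rewrite /dist; set S := (X in inf X).
have [->|/set0P S0] := eqVneq S set0; first by rewrite inf0.
apply: lb_le_inf S0 _ => _ [c [[cc [s hs]] _ _] <-].
by apply: (length_ge0 hm (s := s)).
Qed.

Lemma powR_sqr (R : realType) (w b : R) : w `^ (2 * b) = (w `^ b) ^+ 2.
Proof. by rewrite mulrC powRrM powR_mulrn // powR_ge0. Qed.

Lemma powR_le_mul (R : realType) (a c d b : R) : 0 <= b -> 0 <= a -> 0 <= c -> 0 <= d -> a <= c * d ->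
  a `^ b <= c `^ b * d `^ b.
Proof.
move=> b0 a0 c0 d0 h; rewrite -powRM //.
by apply: ge0_ler_powR => //; rewrite nnegrE // mulr_ge0.
Qed.

Lemma compact_bounded_above (R : realType) (U : topologicalType) (A : set U) (f : U -> R) :
  compact A -> (forall x, {for x, continuous f}) -> exists2 P : R, 0 <= P & forall x, A x -> f x <= P.
Proof.
move=> cA cf; have [->|/set0P A0] := eqVneq A set0; first by exists 0.
have cc : {within A, continuous f} by apply: continuous_subspaceT => x; exact: cf.
have [c _ hc] := compact_EVT_max A0 cA cc.
exists `|f c| => // x Ax; apply: le_trans (ler_norm _); apply: hc; exact: mem_set.
Qed.

Theorem propositionB10 (R : realType) (n : nat) (X : smooth_manifold R n)
    (T : R) (g : R -> tensor2 X) (x0 : X) (alpha : R)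
    (X_connected : connected [set: X])
    (T_gt0 : 0 < T)
    (g_flow : ricci_flow T g)
    (g_bounded : exists K : R,
       forall (t : R) (x : X), 0 <= t <= T -> Rm_norm (g t) x <= K)
    (g_complete : forall t : R, 0 <= t <= T -> complete_metric (g t))
    (alpha_gt0 : 0 < alpha)
    (Rm0_decay : exists (C : R) (K : set X), compact K /\
       forall x : X, ~ K x ->
         Rm_norm (g 0) x <= C * dist (g 0) x x0 `^ (- (2 * alpha)))
    (phi_hess : exists phi : X -> R, distance_like (g 0) x0 phi /\
       exists B0 : R, forall x v,
         B0 * qform (metric_at (g 0) x) v
           <= (phi x)^-1 * qform (hess_at (g 0) phi x) v) :
  exists (C : R) (K : set X), compact K /\
    forall (t : R) (x : X), 0 <= t <= T -> ~ K x ->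
      Rm_norm (g t) x <= C * dist (g 0) x x0 `^ (- (2 * alpha)).
Proof.
have [K hK] := g_bounded; have [A [K1 [cK1 hA]]] := Rm0_decay.
have [phi [[sphi [C C0 hC]] [B0 hB]]] := phi_hess.
have z0 : 0 <= (0 : R) <= T by rewrite lexx ltW.
have hm := flow_metric g_flow z0.
have d0 x : 0 <= dist (g 0) x x0 by exact: dist_ge0.
have K0 : 0 <= K by apply: le_trans (hK 0 x0 z0); exact: sqrtr_ge0.
have lo x : C^-1 * (dist (g 0) x x0 + 1) <= phi x by case: (hC x).
have up x : phi x <= C * (dist (g 0) x x0 + 1) by case: (hC x).
have dphi x : d_norm (g 0) phi x <= C by case: (hC x).
have Ci : 0 < C^-1 by rewrite invr_gt0.
have phiC x : C^-1 <= phi x.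
  by apply: le_trans (lo x); rewrite ler_peMr ?(ltW Ci) // lerDr.
have phi0 x : 0 < phi x by exact: lt_le_trans (phiC x).
have dC x : dist (g 0) x x0 <= C * phi x.
  by rewrite -ler_pdivrMl //; apply: le_trans (lo x); rewrite ler_wpM2l ?(ltW Ci) // lerDl.
have cphi x : {for x, continuous phi} by exact: phi_cont.
have cpt r : compact [set x | phi x <= r].
  apply: (@hopf_rinow _ _ _ _ hm x0 (C * r)) => //; first exact: g_complete.
    have -> : [set x | phi x <= r] = phi @^-1` [set y | y <= r] by [].
    by apply: preimage_closed => [x _|]; [exact: cphi|exact: closed_le].
  by move=> y hy; apply: (le_trans (dC y)); rewrite ler_pM2l.
have q0 x v : 0 <= qform (metric_at (g 0) x) v.
  have [->|v0] := eqVneq v 0; first by rewrite /qform !mul0mx mxE.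
  have [_ _ pos _] := hm; apply/ltW/pos => //; apply: coords_chart; exact: dom_chart_at.
(* C phi >= 1 turns the upper bound C g of the Hessian into C^2 phi g; the lower bound contributes
   |B0|. *)
pose c2 := C ^+ 2 + `|B0|.
have c20 : 0 <= c2 by rewrite addr_ge0 // sqr_ge0.
have hess2 x v : `|qform (hess_at (g 0) phi x) v| <= c2 * phi x * qform (metric_at (g 0) x) v.
  have [_ _ _ /(_ v) h1] := hC x; have := hB x v; rewrite [leRHS]mulrC ler_pdivlMr // => h2.
  have q := q0 x v; have p := phi0 x.
  have h3 : C <= C ^+ 2 * phi x by rewrite expr2 -mulrA ler_peMr ?(ltW C0) // -ler_pdivrMl // mulr1.
  have b1 := ler_norm B0; have b2 := ler_norm (- B0); rewrite normrN in b2.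
  have b3 := normr_ge0 B0; rewrite ler_norml /c2.
  move: (qform (metric_at _ _) v) (qform (hess_at _ _ _) v) (phi x) (`|B0|) h1 h2 q p h3 b1 b2 b3 => m h f b h1 h2 q p h3 b1 b2 b3.
  have e1 : C * m <= C ^+ 2 * f * m by rewrite ler_wpM2r.
  have e2 : - (b * (f * m)) <= B0 * (f * m).
    by rewrite -mulNr ler_wpM2r ?mulr_ge0 ?(ltW p) //; lra.
  have e3 : 0 <= b * (f * m) by rewrite !mulr_ge0 // ltW.
  have e4 : 0 <= C ^+ 2 * f * m by rewrite !mulr_ge0 ?sqr_ge0 // ltW.
  have e5 : (C ^+ 2 + b) * f * m = C ^+ 2 * f * m + b * (f * m) by ring.
  have e6 : B0 * m * f = B0 * (f * m) by ring.
  by rewrite e5; rewrite e6 in h2; apply/andP; split; lra.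
pose b := 2 * alpha; have b0 : 0 <= b by rewrite mulr_ge0 // ltW.
have [P P0 hP] := compact_bounded_above cK1 cphi.
(* One summand for each region: far out, where phi <= 2 C dist; the exceptional compact set, where
   phi <= P; and the set phi <= 2 C, where the distance may be at most 1. *)
pose D := `|A| * (2 * C) `^ b + K * P `^ b + K * (2 * C) `^ b.
have D1 : 0 <= `|A| * (2 * C) `^ b by rewrite mulr_ge0 ?powR_ge0.
have D2 : 0 <= K * P `^ b by rewrite mulr_ge0 ?powR_ge0.
have D3 : 0 <= K * (2 * C) `^ b by rewrite mulr_ge0 ?powR_ge0.
have DE : D = `|A| * (2 * C) `^ b + K * P `^ b + K * (2 * C) `^ b by [].
have bnd x s : 0 <= s -> phi x <= s -> Rm_norm (g 0) x * phi x `^ b <= K * s `^ b.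
  move=> s0 hs; apply: ler_pM; [exact: sqrtr_ge0|exact: powR_ge0|exact: hK|].
  by apply: ge0_ler_powR => //; rewrite nnegrE // ltW.
have CC0 : 0 <= 2 * C by rewrite mulr_ge0 // ltW.
have init1 x : Rm_norm (g 0) x * phi x `^ b <= D.
  have [kx|kx] := pselect (K1 x).
    by have := bnd x P P0 (hP _ kx); rewrite DE; lra.
  have [le|gt] := leP (phi x) (2 * C).
    by have := bnd x _ CC0 le; rewrite DE; lra.
  have d1 : 1 < dist (g 0) x x0.
    by have := lt_le_trans gt (up x); rewrite mulrC ltr_pM2l //; lra.
  have dp : 0 < dist (g 0) x x0 by exact: lt_trans ltr01 d1.
  have pd : phi x <= 2 * C * dist (g 0) x x0.
    by apply: (le_trans (up x)); rewrite [2 * C]mulrC -mulrA ler_pM2l //; lra.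
  have e := powR_le_mul b0 (ltW (phi0 x)) CC0 (d0 x) pd.
  have dbp := powR_gt0 b dp.
  have r1 : Rm_norm (g 0) x <= `|A| / dist (g 0) x x0 `^ b.
    apply: (le_trans (hA _ kx)); rewrite powRN -/b ler_wpM2r ?ler_norm //.
    by rewrite invr_ge0 ltW.
  have : Rm_norm (g 0) x * phi x `^ b <=
      `|A| / dist (g 0) x x0 `^ b * ((2 * C) `^ b * dist (g 0) x x0 `^ b).
    by apply: ler_pM => //; [exact: sqrtr_ge0|exact: powR_ge0].
  by rewrite [(2 * C) `^ b * _]mulrC mulrA divfK ?gt_eqF // DE; lra.
have D0 : 0 <= D by rewrite DE; lra.
have a0 : 0 <= 2 * b by rewrite mulr_ge0.
(* The square of [init1]: for |Rm|^2 the exponent is 2 b = 4 alpha. *)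
have init x : phi x `^ (2 * b) * NR (g 0) x <= D ^+ 2.
  have h : NR (g 0) x <= Rm_norm (g 0) x ^+ 2 by apply: le_of_sqrt; rewrite -Rm_normE.
  rewrite powR_sqr; apply: (@le_trans _ _ ((Rm_norm (g 0) x * phi x `^ b) ^+ 2)).
    by rewrite exprMn mulrC ler_wpM2r // sqr_ge0.
  by rewrite lerXn2r // nnegrE mulr_ge0 ?powR_ge0 //; exact: sqrtr_ge0.
have main := decay T_gt0 g_flow K0 hK sphi C0 phiC dphi c20 hess2 cpt a0 (sqr_ge0 D) init.
move: main; set E := (X in forall t x, _ -> _ <= X) => main.
have E0 : 0 <= E by rewrite /E mulr_ge0 ?expR_ge0 // sqr_ge0.
(* Off this compact set the distance to x0 is positive, so that its negative power is not the
   default value at 0. *)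
exists (Num.sqrt E * C `^ b), [set x | phi x <= C]; split; first exact: cpt.
move=> t x tT /negP; rewrite -ltNge => hx.
have dp : 0 < dist (g 0) x x0.
  by have := lt_le_trans hx (up x); rewrite -[X in X < _]mulr1 ltr_pM2l // ltrDr.
have wp := powR_gt0 b (phi0 x); have dbp := powR_gt0 b dp.
have e := powR_le_mul b0 (ltW dp) (ltW C0) (ltW (phi0 x)) (dC x).
apply: (@le_trans _ _ (Num.sqrt E / phi x `^ b)).
  rewrite Rm_normE; apply: le_sqrtP; first by rewrite divr_ge0 ?sqrtr_ge0 // ltW.
  rewrite expr_div_n sqr_sqrtr // -powR_sqr ler_pdivlMr ?powR_gt0 // mulrC.
  exact: main.
rewrite -mulrA ler_wpM2l ?sqrtr_ge0 // powRN -/b ler_pdivlMr // mulrC ler_pdivrMr //.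
Qed.
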